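(* (i) For every $p$ with $2<p\le 4$ there exists a threshold $\lambda^*$ with $0<\lambda^*<+\infty$ such that $S(\lambda,p)$ is attained for every real $\lambda<\lambda^*$ and is not attained for every $\lambda>\lambda^*$; moreover, for every $\lambda>\lambda^*$ one has $S(\lambda,p)=4\pi$. (ii) For every $p>4$, $S(\lambda,p)$ is attained for all $\lambda\in\mathbb{R}$.
   Context: For $\lambda\in\mathbb{R}$ and $p\ge 2$ define $$S(\lambda,p)=\sup\left\{\int_{\mathbb{R}^2}\left(e^{4\pi u^2}-1-\lambda|u|^p\right)dx \;:\; u\in H^1(\mathbb{R}^2),\ \int_{\mathbb{R}^2}\left(|\nabla u|^2+|u|^2\right)dx\le 1\right\}.$$ ''$S(\lambda,p)$ is attained'' means that there exists $u\in H^1(\mathbb{R}^2)$ with $\int_{\mathbb{R}^2}(|\nabla u|^2+|u|^2)\,dx\le 1$ and $\int_{\mathbb{R}^2}(e^{4\pi u^2}-1-\lambda|u|^p)\,dx=S(\lambda,p)$. Functions are real-valued. *)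

(* Defs.v *)
From HB Require Import structures.
From mathcomp Require Import all_boot all_order all_algebra.
From mathcomp Require Import all_classical all_reals all_analysis.

Set Implicit Arguments.
Unset Strict Implicit.
Unset Printing Implicit Defensive.

Import Order.TTheory GRing.Theory Num.Theory.
Import numFieldNormedType.Exports.

Local Open Scope classical_set_scope.
Local Open Scope ring_scope.

Notation plane R := (R * R)%type (only parsing).

(* This measure is not completed: measurable functions on the plane are Borel
   functions. Every Lebesgue measurable function is a.e. equal to a Borel one,
   so each class of L^2(R^2) has a representative. *)
Notation leb2 R :=
  (product_measure1 (@lebesgue_measure R) (@lebesgue_measure R)).

Section Sobolev.
Context {R : realType}.
Implicit Types (u phi : plane R -> R) (g : plane R -> plane R).

(* For [k > 0] the continuity of [f] itself is not repeated: it follows from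
   the existence and continuity of both partial derivatives. *)
Fixpoint Ck (k : nat) (f : plane R -> R) : Prop :=
  if k is k'.+1 then
    [/\ forall x, derivable f x (1, 0), forall x, derivable f x (0, 1),
        Ck k' ('D_(1, 0) f) & Ck k' ('D_(0, 1) f)]
  else continuous f.

Definition test_function phi : Prop :=
  (forall k, Ck k phi) /\ compact (closure [set x | phi x != 0]).

Definition weak_partial (v : plane R) u (h : plane R -> R) : Prop :=
  forall phi, test_function phi ->
    (\int[leb2 R]_x (u x * 'D_v phi x)%:E =
     - \int[leb2 R]_x (h x * phi x)%:E)%E.

(* [H1_grad u g]: [u] is in H^1(R^2) and [g] is a representative of its weak
   gradient. The weak gradient is unique up to a.e. equality, so the integral
   in [H1_norm_le1] does not depend on the choice of [g]. *)
Definition H1_grad u g : Prop :=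
  [/\ u \in Lfun (leb2 R) 2%:E,
      (fst \o g) \in Lfun (leb2 R) 2%:E, (snd \o g) \in Lfun (leb2 R) 2%:E,
      weak_partial (1, 0) u (fst \o g) & weak_partial (0, 1) u (snd \o g)].

Definition H1 : set (plane R -> R) := [set u | exists g, H1_grad u g].

Definition H1_norm_le1 u : Prop :=
  exists2 g, H1_grad u g &
    (\int[leb2 R]_x (((g x).1 ^+ 2 + (g x).2 ^+ 2) + u x ^+ 2)%:E <= 1)%E.

(* On [H1] the integrand is integrable for [2 <= p], hence the value is
   finite. *)
Definition TM_functional (lambda p : R) u : \bar R :=
  (\int[leb2 R]_x
     (expR (4 * pi * u x ^+ 2) - 1 - lambda * `|u x| `^ p)%:E)%E.

Definition TM_sup (lambda p : R) : \bar R :=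
  ereal_sup [set TM_functional lambda p u | u in H1 `&` H1_norm_le1].

Definition TM_attained (lambda p : R) : Prop :=
  exists u, [/\ H1 u, H1_norm_le1 u &
    TM_functional lambda p u = TM_sup lambda p].

End Sobolev.

(* Main.v *)
(* Let [X] be the decreasing rearrangement of [sqrt (4 pi) |u|] as a function of
   the area divided by [4 pi]. The Brunn-Minkowski inequality with discs, applied
   to the level sets of smooth approximations of [u], bounds the energy [E] of
   [X] by that of [u] (Polya-Szego), and conversely every such [X] is realised
   by a radial function in H^1. So the problem is to maximise
   [J X = \int (e^(X^2) - 1 - lambda X^p)] over decreasing [X] on the half-line
   with [E + \int X^2 <= 1].
   A maximising sequence has a pointwise limit. Either [e^(X^2)] is dominated
   near 0 by a fixed integrable function, or [X] concentrates at 0; in the second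
   case a discrete Carleson-Chang estimate gives [\int (e^(X^2) - 1) < 1]. Since
   vanishing sequences yield 1, the supremum is attained as soon as it exceeds 1.
   The profiles [a (1 + b s)^-2] give a value above 1 for small positive
   [lambda], and for every [lambda] when [p > 4]. If [p <= 4] and [lambda] is
   large then [J <= 1], because [e^(X^2) - 1 - X^2 <= e X^p] where [X <= 1].
   Beyond the threshold a maximiser would have [J = 1] for [lambda] and hence
   [J > 1] for a smaller parameter, unless [X = 0]. *)
Require Import Defs.
From HB Require Import structures.
From mathcomp Require Import all_boot all_order all_algebra.
From mathcomp Require Import all_classical all_reals all_analysis.
From mathcomp Require Import measurable_realfun ring lra.
Set Implicit Arguments.
Unset Strict Implicit.
Unset Printing Implicit Defensive.
Import Order.TTheory GRing.Theory Num.Theory.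
Import numFieldNormedType.Exports.
Local Open Scope classical_set_scope.
Local Open Scope ring_scope.

(** Concentration is decided by one inequality. Let [a] be the value of [t |-> X (expR (- t))] at a
    grid point [T >= 8] and let [delta] bound the energy left beyond [T]. The Carleson-Chang bound
    for the part [s <= expR (- T)] is [expR (1 + a^2 / (1 - delta) - T) / (1 - delta)], so its
    factor [e] has to be won back. The energy and the mass spent before [T] force
    [a^2 <= (T - 1 - 1/100) (1 - delta)]; the margin [1/100] comes from a finite recursion evaluated
    with rational bounds. Vanishing is met by the dilation [s |-> s / r], which keeps the energy and
    multiplies both the mass and the value by [r]: mass lost in a limit is put back in this way. The
    exponent 4 appears because a flat profile of height [a] and mass near 1 gains order [a^2] from
    the quartic term of the exponential and pays order [|lambda| a^(p - 2)]. The energy of a profile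
    is a bound on sums of squared increments over all uniform grids in [t]; it needs no derivative
    and survives pointwise limits. *)

Notation mfun T := (measurable_fun [set: T]).
Notation mline R := (measurableTypeR R).
Notation mplane R := (mline R * mline R)%type.

Lemma le_of_eq d (T : porderType d) (x y : T) : x = y -> (x <= y)%O.
Proof. by move->. Qed.

Lemma subset_le_measure d (T : measurableType d) (R : realType)
  (m : {measure set T -> \bar R}) (A B : set T) :
 measurable A -> measurable B -> A `<=` B -> (m A <= m B)%E.
Proof. by move=> mA mB AB; apply: le_measure; rewrite ?inE. Qed.

(** * Layer cake formula *)

Section layer_cake.
Context d (T : measurableType d) (R : realType).
Variable m : {sigma_finite_measure set T -> \bar R}.
Notation leb := (@lebesgue_measure R).
Local Open Scope ereal_scope.

Let graph_below (f : T -> \bar R) : set (T * R) :=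
 [set z | (0 <= z.2)%R /\ z.2%:E < f z.1].

Let measurable_graph_below (f : T -> \bar R) : mfun T f ->
 measurable (graph_below f).
Proof.
move=> mf; apply: measurableI.
 rewrite [X in measurable X](_ : _ = snd @^-1` `[0%R, +oo[%classic); last first.
  by apply/seteqP; split => z /=; rewrite in_itv/= andbT.
 by rewrite -[X in measurable X]setTI; exact: measurable_snd.
rewrite -[X in measurable X]setTI; apply: measurable_lte => //.
- by apply/measurable_EFinP; exact: measurable_snd.
- exact: measurableT_comp.
Qed.

Lemma measurable_superlevel (f : T -> \bar R) : mfun T f -> forall t : R,
 measurable [set x | t%:E < f x].
Proof.
move=> mf t; rewrite -[X in measurable X]setTI.
exact: measurable_lte.
Qed.

(** Tonelli for the indicator of the region below the graph: the sections over [x] have length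
    [f x], also when that is infinite, and the sections at height [t] are the superlevel sets. *)
Lemma layer_cake (f : T -> \bar R) : mfun T f -> (forall x, 0 <= f x) ->
 \int[m]_x f x = \int[leb]_(t in `[0%R, +oo[) m [set x | t%:E < f x].
Proof.
move=> mf f0; have mA := measurable_graph_below mf.
have := @indic_fubini_tonelli _ _ T (mline R) R m leb _ mA.
rewrite indic_fubini_tonelli_FE// indic_fubini_tonelli_GE// => FG.
transitivity (\int[m]_x (leb \o xsection (graph_below f)) x).
 apply: eq_integral => x _ /=.
 have -> : xsection (graph_below f) x = [set t | (0 <= t)%R /\ t%:E < f x].
  by apply/seteqP; split => t; rewrite /xsection/graph_below/= inE.
 have := f0 x; case: (f x) => [r|_|//].
 - rewrite lee_fin => r0.
  rewrite (_ : [set _ | _] = `[0%R, r[%classic); last first.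
   by apply/seteqP; split => t /=; rewrite in_itv/= lte_fin => /andP.
  rewrite lebesgue_measure_itv/= lte_fin; case: ltP => [_|rle].
   by rewrite oppr0 adde0.
  by congr (_%:E); apply/eqP; rewrite eq_le r0 rle.
 - rewrite (_ : [set _ | _] = `[0%R, +oo[%classic); last first.
   apply/seteqP; split => t /=; rewrite in_itv/= andbT; first by case.
   by move=> t0; split => //; rewrite ltry.
  by rewrite lebesgue_measure_itv/= ltry oppr0.
rewrite FG [RHS]integral_mkcond; apply: eq_integral => t _ /=.
rewrite patchE; case: ifPn => [|]; rewrite ?inE ?notin_setE/= in_itv/= andbT.
 move=> t0; congr (m _).
 by apply/seteqP; split => x; rewrite /ysection/graph_below/= inE //= => -[].
move=> t0; rewrite (_ : ysection _ _ = set0) ?measure0//.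
by apply/seteqP; split => x //; rewrite /ysection/graph_below/= inE /= => -[/t0].
Qed.

Lemma measurable_fun_superlevel (f : T -> \bar R) : mfun T f ->
 measurable_fun (`[0%R, +oo[ : set R) (fun t : R => m [set x | t%:E < f x]).
Proof.
move=> mf; have mA := measurable_graph_below mf.
have /= mG := @measurable_fun_ysection _ _ T (mline R) R m _ mA.
apply: (eq_measurable_fun (m \o ysection (graph_below f))); last first.
 by apply: measurable_funTS.
move=> t; rewrite inE/= in_itv/= andbT => t0; congr (m _).
by apply/seteqP; split => x; rewrite /ysection/graph_below/= inE //= => -[].
Qed.

End layer_cake.

(** * Brunn-Minkowski inequality on the line *)

Section brunn_minkowski_line.
Context {R : realType}.
Notation leb := (@lebesgue_measure R).
Local Open Scope ereal_scope.

(** By uniqueness of Lebesgue measure it suffices to compare both sides on half-open intervals. *)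
Lemma lebesgue_measure_shift (A : set R) (c : R) : measurable A ->
 leb [set x | A (x + c)%R] = leb A.
Proof.
move=> mA; have mc : measurable_fun setT (fun x : R => x - c)%R.
 by apply: measurable_funB.
pose nu := pushforward leb (fun x : R => x - c : mline R)%R.
have -> : [set x | A (x + c)%R] = (fun x => x + c)%R @^-1` A by [].
have mc' : measurable_fun setT (fun x : R => x + c)%R.
 by apply: measurable_funD.
apply/esym.
apply: (@lebesgue_measure_unique R
 (pushforward leb (fun x : mline R => x + c : mline R)%R)) => //.
move=> _ [[a b]] _ <-; rewrite /pushforward /=.
rewrite [X in _ = leb X](_ : _ = `](a - c)%R, (b - c)%R]%classic); last first.
 by apply/seteqP; split => x /=; rewrite !in_itv/= ltrBlDr lerBrDr.
rewrite !lebesgue_measure_itv/= !lte_fin ltrD2r.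
by case: ifP => // _; rewrite -!EFinB; congr (_%:E); lra.
Qed.

(* Split [A] at a point [a] of [A]; the left part moves left, the right part
  moves right, and the gap in between is filled by [a + ]-l, l[]. *)
Lemma brunn_minkowski_line (A K : set R) (l : R) :
 measurable A -> measurable K -> (0 < l)%R -> A !=set0 ->
 (forall x y, A x -> (`|y| < l)%R -> K (x + y)%R) ->
 leb A + (l *+ 2)%:E <= leb K.
Proof.
move=> mA mK l0 [a Aa] AK; apply/lee_subgt0Pr => e e0.
(* The hypothesis concerns [|y| < l] strictly, so the pieces are moved by some [r < l];
   [l - e / 2 <= r] keeps the total loss at most [e], and [l / 2] keeps [r] positive. *)
pose r := (Num.max (l / 2) (l - e / 2))%R.
have r0 : (0 < r)%R by rewrite lt_max divr_gt0.
have rl : (r < l)%R by rewrite gt_max; apply/andP; split; lra.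
have rle : (l - e / 2 <= r)%R by rewrite le_max lexx orbT.
pose A1 := A `&` `]-oo, a[; pose A2 := A `&` `[a, +oo[.
pose B1 := [set x | A1 (x + r)%R]; pose B2 := [set x | A2 (x - r)%R].
pose B0 := `[(a - r)%R, (a + r)%R[%classic : set R.
have mA1 : measurable A1 by apply: measurableI.
have mA2 : measurable A2 by apply: measurableI.
have mshift (S : set R) (c : R) : measurable S -> measurable [set x | S (x + c)%R].
 move=> mS; have mc' : measurable_fun setT (fun x : R => x + c)%R.
  by apply: measurable_funD.
 by have := mc' measurableT S mS; rewrite setTI.
have mB1 : measurable B1 by exact: mshift.
have mB2 : measurable B2 by exact: mshift.
have mB0 : measurable B0 by exact: measurable_itv.
have AE : leb A = leb A1 + leb A2.
 rewrite -measureU//; last first.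
  apply/seteqP; split => x //=; rewrite /A1 /A2 /= !in_itv/= andbT.
  by move=> [[_ h1] [_ h2]]; move: (lt_le_trans h1 h2); rewrite ltxx.
 congr (_ _); rewrite /A1 /A2 -setIUr -[LHS]setIT; congr (_ `&` _).
 by apply/seteqP; split => x //= _; rewrite !in_itv/= andbT; case: (ltP x a); auto.
have B1E : leb B1 = leb A1 by exact: lebesgue_measure_shift.
have B2E : leb B2 = leb A2 by exact: lebesgue_measure_shift.
have B0E : leb B0 = (r *+ 2)%:E.
 rewrite /B0 lebesgue_measure_itv/= lte_fin ifT; last lra.
 by rewrite -EFinB; congr (_%:E); rewrite mulr2n; lra.
have d1 : B1 `&` B0 = set0.
 apply/seteqP; split => x //=; rewrite /B1/A1/B0/= !in_itv/=.
 by move=> [[_ ?] /andP[? ?]]; lra.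
have d2 : (B1 `|` B0) `&` B2 = set0.
 apply/seteqP; split => x //=; rewrite /B1/A1/B0/B2/A2/= !in_itv/= andbT.
 by move=> [[[_ ?]|/andP[? ?]] [_ ?]]; lra.
have BK : B1 `|` B0 `|` B2 `<=` K.
 move=> x [[[Ax _]|]|[Ax _]].
 - by rewrite (_ : x = x + r + - r)%R; [apply: AK => //; rewrite normrN gtr0_norm|lra].
 - rewrite /B0/= in_itv/= => /andP[h1 h2].
  rewrite (_ : x = a + (x - a))%R; last lra.
  by apply: AK => //; rewrite ltr_norml; apply/andP; split; lra.
 - by rewrite (_ : x = x - r + r)%R; [apply: AK => //; rewrite gtr0_norm|lra].
have leBK : leb (B1 `|` B0 `|` B2) <= leb K.
 by apply: le_measure; rewrite ?inE//; do 2?apply: measurableU.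
apply: le_trans leBK.
have -> : leb (B1 `|` B0 `|` B2) = leb B1 + leb B0 + leb B2.
 rewrite measureU//; last exact: measurableU.
 by congr (_ + _); rewrite measureU.
rewrite B1E B0E B2E AE.
rewrite -!addeA; apply: leeD2l; rewrite [X in _ <= X]addeC; apply: leeD2l.
by rewrite -EFinB lee_fin !mulr2n; lra.
Qed.

End brunn_minkowski_line.

(** * Intervals and the fundamental theorem of calculus *)

Section interval_measure.
Context {R : realType}.
Notation leb := (@lebesgue_measure R).

Lemma leb_itvcc (a b : R) : a <= b -> leb `[a, b]%classic = (b - a)%:E.
Proof.
move=> ab; rewrite lebesgue_measure_itv/= lte_fin; case: ltP => [_|ba].
 by rewrite EFinB.
by congr (_%:E); apply/eqP; rewrite eq_sym subr_eq0 eq_le ba.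
Qed.

Lemma leb_itvcc_lty (a b : R) : (leb `[a, b]%classic < +oo)%E.
Proof.
by rewrite lebesgue_measure_itv/=; case: ifP => // _; rewrite -EFinB ltry.
Qed.

End interval_measure.

Lemma FTC2_is_derive (R : realType) (f F : R -> R) (a b : R) : a <= b ->
 (forall x, a <= x <= b -> is_derive x 1 F (f x)) ->
 (forall x, a <= x <= b -> {for x, continuous f}) ->
 (\int[lebesgue_measure]_(x in `[a, b]) (f x)%:E = (F b - F a)%:E)%E.
Proof.
rewrite le_eqVlt => /predU1P[<- _ _|ab dF cf].
 by rewrite set_itv1 integral_set1 subrr.
have cF x : a <= x <= b -> F z @[z --> x] --> F x.
 move=> /dF -[dFx _]; apply: differentiable_continuous.
 exact/derivable1_diffP.
rewrite (@continuous_FTC2 R f F)//.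
- apply: continuous_in_subspaceT => x; rewrite inE/= in_itv/=; exact: cf.
- split => [x||].
 + by rewrite in_itv/= => /andP[/ltW ax /ltW xb]; have [] := dF x; rewrite ?ax.
 + by apply: cvg_at_right_filter; apply: cF; rewrite lexx ltW.
 + by apply: cvg_at_left_filter; apply: cF; rewrite lexx ltW.
- move=> x; rewrite in_itv/= => /andP[/ltW ax /ltW xb].
 by rewrite derive1E; have [|_ ->] := dF x; rewrite ?ax.
Qed.

(** * Area of the quarter disc *)

Section quarter_disc.
Context {R : realType}.
Notation leb := (@lebesgue_measure R).

Let quarter (t : R) := Num.sqrt (1 - t ^+ 2).

Lemma continuous_quarter : continuous quarter.
Proof.
move=> x; apply: continuous_comp; last exact: sqrt_continuous.
by apply: continuousB; [exact: cvg_cst|exact: exprn_continuous].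
Qed.

(** The two terms of the antiderivative [(t * quarter t + asin t) / 2] are not differentiable at 1,
    so the upper bound stops at [sin th < 1]. *)
Lemma integral_quarter_sin (th : R) : 0 <= th < pi / 2 ->
 (\int[leb]_(t in `[0%R, sin th]) (quarter t)%:E =
  ((sin th * cos th + th) / 2)%:E)%E.
Proof.
move=> /andP[th0 thpi].
have pi0 := @pi_gt0 R.
have s0 : 0 <= sin th by apply: sin_ge0_pi; rewrite th0/=; lra.
have c0 : 0 < cos th by apply: cos_gt0_pihalf; apply/andP; split; lra.
have s1 : sin th < 1.
 have := cos2Dsin2 th; nra.
pose F (t : R) := (t * quarter t + asin t) / 2.
transitivity ((F (sin th) - F 0)%:E).
 apply: FTC2_is_derive => // x; last by move=> _; exact: continuous_quarter.
 move=> /andP[x0 xs].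
 have x1 : -1 < x < 1 by apply/andP; split; lra.
 have q0 : 0 < 1 - x ^+ 2 by nra.
 have dq : is_derive x 1 quarter ((2 * quarter x)^-1 * (- (2 * x))).
  have d1 : is_derive x 1 (fun t : R => 1 - t ^+ 2) (- (2 * x)).
   by apply: is_derive_eq; rewrite /GRing.scale/=; ring.
  have d2 := is_derive1_sqrt q0.
  exact: (@is_derive1_comp _ Num.sqrt (fun t => 1 - t ^+ 2) x _ _ d2 d1).
 have da := is_derive1_asin x1.
 have qx0 : 0 < quarter x by rewrite sqrtr_gt0.
 have qxE : quarter x ^+ 2 = 1 - x ^+ 2 by rewrite sqr_sqrtr// ltW.
 apply: is_derive_eq; rewrite -/(quarter x) /= /GRing.scale/=.
 transitivity ((quarter x ^+ 2 + (1 - x ^+ 2)) / (2 * quarter x)).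
  by field; rewrite lt0r_neq0.
 by rewrite -qxE; field; rewrite lt0r_neq0.
congr (_%:E); rewrite /F.
rewrite /quarter -cos2sin2 sqrtr_sqr gtr0_norm//.
rewrite sinK ?in_itv/=; last by apply/andP; split; lra.
rewrite mul0r add0r -[X in asin X](@sin0 R) sinK ?mul0r ?subr0//.
by rewrite in_itv/=; apply/andP; split; lra.
Qed.

(** On the missing interval from [sin th] to 1 the integrand lies between 0 and 1; letting [th] tend
    to [pi / 2] squeezes the value. *)
Lemma integral_quarter :
 (\int[leb]_(t in `[0%R, 1%R]) (quarter t)%:E = (pi / 4)%:E)%E.
Proof.
have pi0 := @pi_gt0 R.
have mq : measurable_fun setT (EFin \o quarter).
 by apply/measurable_EFinP; exact: continuous_measurable_fun continuous_quarter.
have q0 t : (0 <= (quarter t)%:E)%E by rewrite lee_fin sqrtr_ge0.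
have q1 t : quarter t <= 1.
 by rewrite /quarter -[leRHS]sqrtr1 ler_wsqrtr// gerBl sqr_ge0.
have bounds (th : R) : 0 <= th < pi / 2 ->
  (((sin th * cos th + th) / 2)%:E <=
   \int[leb]_(t in `[0%R, 1%R]) (quarter t)%:E <=
   ((sin th * cos th + th) / 2 + (1 - sin th))%:E)%E.
 move=> th0; have s1 := sin_le1 th.
 have s0 : 0 <= sin th by apply: sin_ge0_pi; move: th0 => /andP[-> ?]/=; lra.
 rewrite EFinD -integral_quarter_sin//; apply/andP; split.
  apply: ge0_subset_integral => //=; first exact: measurable_funTS.
  by apply: subset_itvl; rewrite bnd_simp.
 rewrite (@itv_bndbnd_setU _ _ _ (BRight (sin th)))/= ?bnd_simp//.
 rewrite ge0_integral_setU//=; last 2 first.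
  exact: measurable_funTS.
  apply/disj_set2P/seteqP; split => x //=; rewrite !in_itv/=.
  by move=> [/andP[_ h1] /andP[h2 _]]; move: (lt_le_trans h2 h1); rewrite ltxx.
 apply: leeD => //.
 apply: (@le_trans _ _ (\int[leb]_(t in `]sin th, 1%R]) (cst (1%E : \bar R) t))%E).
  apply: ge0_le_integral => //=; first exact: measurable_funTS.
  by move=> t _; rewrite lee_fin.
 rewrite integral_cst//= mul1e lebesgue_measure_itv/= lte_fin.
 by case: ifPn => [_|]; [rewrite EFinB | rewrite lee_fin; lra].
move: bounds; case: (\int[leb]_(t in _) _)%E => [r| |] bounds.
- congr (_%:E); apply/eqP; rewrite eq_le; apply/andP; split.
  apply: (@cvgr_to_ge _ (pi / 2)^'- _ _
   (fun th : R => (sin th * cos th + th) / 2 + (1 - sin th))).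
   apply: cvg_at_left_filter.
   rewrite [X in _ --> X](_ : _ = (sin (pi / 2) * cos (pi / 2) + pi / 2) / 2 +
     (1 - sin (pi / 2)) :> R); last by rewrite sin_pihalf cos_pihalf; lra.
   apply: cvgD; last by apply: cvgB; [exact: cvg_cst|exact: continuous_sin].
   apply: cvgMr_tmp; apply: cvgD; last exact: cvg_id.
   by apply: cvgM; [exact: continuous_sin|exact: continuous_cos].
  near=> th; have /bounds/andP[_] : 0 <= th < pi / 2; last by rewrite lee_fin.
  by apply/andP; split; near: th; [apply: nbhs_left_ge; lra|exact: nbhs_left_lt].
 apply: (@cvgr_to_le _ (pi / 2)^'- _ _
  (fun th : R => (sin th * cos th + th) / 2)).
  apply: cvg_at_left_filter.
  rewrite [X in _ --> X](_ : _ = (sin (pi / 2) * cos (pi / 2) + pi / 2) / 2 :> R);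
   last by rewrite sin_pihalf cos_pihalf; lra.
  apply: cvgMr_tmp; apply: cvgD; last exact: cvg_id.
  by apply: cvgM; [exact: continuous_sin|exact: continuous_cos].
 near=> th; have /bounds/andP[+ _] : 0 <= th < pi / 2; last by rewrite lee_fin.
 by apply/andP; split; near: th; [apply: nbhs_left_ge; lra|exact: nbhs_left_lt].
- by have /bounds/andP[] : 0 <= (0 : R) < pi / 2 by apply/andP; split; lra.
- by have /bounds/andP[] : 0 <= (0 : R) < pi / 2 by apply/andP; split; lra.
Unshelve. all: by end_near. Qed.

End quarter_disc.

(** * Brunn-Minkowski inequality with discs in the plane *)

Section brunn_minkowski_disc.
Context {R : realType}.
Notation leb := (@lebesgue_measure R).
Implicit Types (A K : set (R * R)) (h : R).
Local Open Scope ereal_scope.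

Definition disc_expands A K h := forall x y : R * R, A x ->
 (y.1 ^+ 2 + y.2 ^+ 2 < h ^+ 2)%R -> K (x.1 + y.1, x.2 + y.2)%R.

(* With [f], [k] the slice lengths of [A] and [K] and [F = sup f], the set
  [{k > t (F + 2h)}] contains [{f > t F} + ]-h sqrt (1 - t^2), h sqrt (1 - t^2)[],
  so the one-dimensional inequality can be integrated over [t] in [0, 1]. *)
Lemma brunn_minkowski_disc_bounded A K h (M a : R) :
 measurable A -> measurable K -> (0 < h)%R -> disc_expands A K h ->
 (forall x, leb (xsection A x) <= M%:E) -> leb2 R A = a%:E ->
 (a + 2 * h * Num.sqrt (pi * a))%:E <= leb2 R K.
Proof.
move=> mA mK h0 AK fM aE.
have pi0 := @pi_gt0 R.
have a0 : (0 <= a)%R by rewrite -lee_fin -aE.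
move: a0; rewrite le_eqVlt => /predU1P[<-|a0].
 by rewrite mulr0 sqrtr0 mulr0 addr0.
pose f x := leb (xsection A x).
have f0 x : 0 <= f x by [].
have ffin x : f x \is a fin_num.
 by rewrite ge0_fin_numE//; apply: (le_lt_trans (fM x)); rewrite ltry.
pose g x := fine (f x).
have fE x : f x = (g x)%:E by rewrite /g fineK.
pose F := sup (range g).
have hsg : has_sup (range g).
 split; first by exists (g 0%R); exists 0%R.
 by exists M => _ [x _ <-]; rewrite -lee_fin -fE fM.
have gF x : (g x <= F)%R by apply: sup_upper_bound => //; exists x.
have mf : mfun R f by exact: measurable_fun_xsection.
have aI : a%:E = \int[leb]_x f x by rewrite -aE.
have F0 : (0 < F)%R.
 rewrite ltNge; apply/negP => F0.
 have : a%:E = 0.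
  rewrite aI; apply: integral0_eq => x _; apply/eqP; rewrite eq_le f0 andbT.
  by rewrite fE lee_fin (le_trans (gF x)).
 by move=> /eqP; rewrite eqe gt_eqF.
pose k x := leb (xsection K x).
have k0 x : 0 <= k x by [].
have mk : mfun R k by exact: measurable_fun_xsection.
pose c := (F + 2 * h)%R.
have c0 : (0 < c)%R by rewrite addr_gt0// mulr_gt0.
pose f' x := (F^-1)%:E * f x; pose k' x := (c^-1)%:E * k x.
have mf' : mfun R f' by exact: measurable_funeM.
have mk' : mfun R k' by exact: measurable_funeM.
have f'0 x : 0 <= f' x by rewrite mule_ge0// lee_fin invr_ge0 ltW.
have k'0 x : 0 <= k' x by rewrite mule_ge0// lee_fin invr_ge0 ltW.
have level (t : R) : (0 < t < 1)%R ->
  leb [set x | t%:E < f' x] + (2 * h * Num.sqrt (1 - t ^+ 2))%:E <=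
  leb [set x | t%:E < k' x].
 move=> /andP[t0 t1]; pose s := Num.sqrt (1 - t ^+ 2).
 have s2 : (0 < 1 - t ^+ 2)%R by nra.
 have s0 : (0 < s)%R by rewrite sqrtr_gt0.
 have sE : (s ^+ 2 = 1 - t ^+ 2)%R by rewrite sqr_sqrtr// ltW.
 rewrite (_ : 2 * h * s = (h * s) *+ 2)%R; last by rewrite mulr2n; ring.
 apply: brunn_minkowski_line => //.
 - exact: measurable_superlevel.
 - exact: measurable_superlevel.
 - by rewrite mulr_gt0.
 - have [_ [x _ <-] tx] := @sup_adherent _ _ ((1 - t) * F)%R
   (mulr_gt0 (eqbRL (subr_gt0 _ _) t1) F0) hsg.
  exists x; rewrite /= /f' fE -EFinM lte_fin ltr_pdivlMl//.
  by apply: le_lt_trans tx; rewrite -/F; lra.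
 - move=> x y /=; rewrite /f' /k' fE -EFinM lte_fin ltr_pdivlMl// => tx yh.
  rewrite -(@lte_pmul2l _ c%:E)//.
  rewrite muleA -!EFinM divff ?gt_eqF// mul1e.
  have y2 : (y ^+ 2 < h ^+ 2 * s ^+ 2)%R.
   by rewrite -exprMn -real_normK ?num_real// ltrXn2r// ?nnegrE// ltW// mulr_gt0.
  pose l := Num.sqrt (h ^+ 2 - y ^+ 2).
  have l2 : (0 <= h ^+ 2 - y ^+ 2)%R by nra.
  have lE : (l ^+ 2 = h ^+ 2 - y ^+ 2)%R by rewrite sqr_sqrtr.
  have l0 : (0 <= l)%R by exact: sqrtr_ge0.
  have thl : (t * h < l)%R.
   rewrite ltNge; apply/negP => hl.
   have : (l * l <= (t * h) * (t * h))%R by apply: ler_pM.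
   by rewrite sE in y2; rewrite -expr2 lE; nra.
  have : f x + (l *+ 2)%:E <= k (x + y)%R.
   apply: brunn_minkowski_line.
   + exact: measurable_xsection.
   + exact: measurable_xsection.
   + by apply: le_lt_trans thl; rewrite mulr_ge0// ltW.
   + apply/set0P/negP => /eqP Ax0; move: tx.
    rewrite /g /f Ax0 measure0/=; apply/negP; rewrite -leNgt.
    by rewrite mulr_ge0// ltW.
   + move=> p q; rewrite /xsection/= !inE => Ap ql.
    apply: (AK (x, p) (y, q)) => //=.
    have : (q ^+ 2 < l ^+ 2)%R.
     by rewrite -(real_normK (num_real q)) ltrXn2r// ?nnegrE.
    by rewrite lE; lra.
  apply: lt_le_trans; rewrite fE -EFinD lte_fin /c mulr2n.
  rewrite (mulrC F t) in tx; nra.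
have mq : mfun R (fun t : R => Num.sqrt (1 - t ^+ 2))%R.
 exact: continuous_measurable_fun (@continuous_quarter R).
have K1 : a%:E * (F^-1)%:E + (2 * h * (pi / 4))%:E <= \int[leb]_x k' x.
 have a' : a%:E * (F^-1)%:E = \int[leb]_x f' x.
  by rewrite ge0_integralZl//= ?aI 1?muleC// lee_fin invr_ge0 ltW.
 have mlf := measurable_fun_superlevel leb mf'.
 have mlk := measurable_fun_superlevel leb mk'.
 have s1 : `[0%R, 1%R] `<=` (`[0%R, +oo[ : set R) by apply: subset_itvl.
 have -> : a%:E * (F^-1)%:E =
   \int[leb]_(t in `[0%R, 1%R]) leb [set x | t%:E < f' x].
  rewrite a' layer_cake// [LHS]integral_mkcond [RHS]integral_mkcond.
  apply: eq_integral => t _; rewrite !patchE.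
  case: ifPn => [|]; rewrite ?inE ?notin_setE/= in_itv/= andbT => t0.
   case: ifPn => //; rewrite notin_setE/= in_itv/= t0/= => /negP.
   rewrite -ltNge => t1; rewrite (_ : [set _ | _] = set0) ?measure0//.
   apply/seteqP; split => x//=; rewrite /f' fE -EFinM lte_fin.
   by rewrite ltr_pdivlMl// => tx; have := gF x; nra.
  by rewrite memNset//= in_itv/= => /andP[].
 have -> : (2 * h * (pi / 4))%:E =
   \int[leb]_(t in `[0%R, 1%R]) (2 * h * Num.sqrt (1 - t ^+ 2))%:E.
  under eq_integral do rewrite EFinM.
  rewrite ge0_integralZl//= ?integral_quarter//.
  - by exact/measurable_EFinP/measurable_funTS.
  - by rewrite lee_fin mulr_ge0// ltW.
 have s2 : `]0%R, 1%R[ `<=` (`[0%R, +oo[ : set R).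
  by move=> t /=; rewrite !in_itv/= => /andP[/ltW ->].
 have mL : measurable_fun (`]0%R, 1%R[ : set R) (fun t : R =>
   leb [set x | t%:E < f' x] + (2 * h * Num.sqrt (1 - t ^+ 2))%:E).
  apply: emeasurable_funD; first by apply: measurable_funS mlf.
  by apply/measurable_EFinP/measurable_funM => //; exact: measurable_funTS.
 rewrite layer_cake// -ge0_integralD//=.
 - rewrite integral_itv_bndoo//.
  apply: (@le_trans _ _ (\int[leb]_(t in `]0%R, 1%R[) leb [set x | t%:E < k' x])).
   apply: ge0_le_integral => //=.
   + by move=> t _; rewrite adde_ge0// lee_fin mulr_ge0 ?sqrtr_ge0// mulr_ge0// ltW.
   + by apply: measurable_funS mlk.
  exact: ge0_subset_integral.
 - by apply: measurable_funS mlf.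
 - by move=> t _; rewrite lee_fin mulr_ge0 ?sqrtr_ge0// mulr_ge0// ltW.
 - by apply/measurable_EFinP/measurable_funM => //; exact: measurable_funTS.
have -> : leb2 R K = c%:E * \int[leb]_x k' x.
 rewrite ge0_integralZl//= ?lee_fin ?invr_ge0 ?ltW//.
 by rewrite muleA -EFinM divff ?gt_eqF// mul1e.
apply: (@le_trans _ _ (c%:E * (a%:E * (F^-1)%:E + (2 * h * (pi / 4))%:E))); last first.
 by apply: lee_wpmul2l => //; rewrite lee_fin ltW.
rewrite -(EFinM a) -(EFinD (a / F)) -EFinM lee_fin.
set q := Num.sqrt _.
have qE : (q ^+ 2 = pi * a)%R by rewrite sqr_sqrtr// mulr_ge0// ltW.
have q0 : (0 <= q)%R by exact: sqrtr_ge0.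
(* Nothing is known of [F], but [2 a / F + pi F / 2 >= 2 q] by the arithmetic-geometric mean
   inequality. The square below is this inequality, and [pi * h ^+ 2] is left over. *)
rewrite -subr_ge0.
rewrite (_ : _ - _ = (h / (2 * F * pi)) * (2 * q - pi * F) ^+ 2 + pi * h ^+ 2)%R.
 have [? ? ?] : [/\ 0 <= pi :> R, 0 <= F & 0 <= h]%R by split; exact: ltW.
 by apply: addr_ge0; apply: mulr_ge0; rewrite ?sqr_ge0// divr_ge0 ?mulr_ge0.
have pi1 : (pi != 0 :> R)%R by rewrite gt_eqF.
have F1 : (F != 0)%R by rewrite gt_eqF.
have -> : a = (q ^+ 2 / pi)%R by rewrite qE mulrC mulKf.
rewrite /c; move: (pi : R) pi1 => P P1.
by field; rewrite P1 F1.
Qed.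

(** The strips [|x.2| <= n] exhaust [A] and make its vertical slices bounded, so the bounded case
    passes to the limit. The real number [m] gives a meaning to the root when [A] has infinite
    area. *)
Lemma brunn_minkowski_disc A K h (m : R) :
 measurable A -> measurable K -> (0 < h)%R -> disc_expands A K h ->
 (0 <= m)%R -> m%:E <= leb2 R A ->
 leb2 R A + (2 * h * Num.sqrt (pi * m))%:E <= leb2 R K.
Proof.
move=> mA mK h0 AK m0 mA0.
have pi0 := @pi_gt0 R.
have AsubK : A `<=` K.
 move=> x Ax; have := AK x (0, 0)%R Ax; rewrite /= !addr0 expr0n/= addr0.
 by case: x Ax => x1 x2 Ax; apply; rewrite exprn_gt0.
have leAK : leb2 R A <= leb2 R K by apply: le_measure; rewrite ?inE.
move: mA0 leAK; case aE : (leb2 R A) => [a| |] ma leAK; last 2 first.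
- by apply: le_trans leAK; exact: leey.
- by have : 0 <= leb2 R A by []; rewrite aE.
rewrite lee_fin in ma.
case kE : (leb2 R K) => [k| |]; last 2 first.
- exact: leey.
- by have : 0 <= leb2 R K by []; rewrite kE.
rewrite -EFinD lee_fin.
apply: (@le_trans _ _ (a + 2 * h * Num.sqrt (pi * a))%R).
 rewrite lerD2l ler_wpM2l//; first by rewrite mulr_ge0// ltW.
 by rewrite ler_wsqrtr// ler_wpM2l// ltW.
pose B n := A `&` [set z | z.2 \in `[- n%:R, n%:R]%R].
have mstrip n : measurable [set z : R * R | z.2 \in `[- n%:R, n%:R]%R].
 have := @measurable_snd _ _ R R measurableT _ (measurable_itv `[- n%:R, n%:R]%R).
 by rewrite setTI.
have mB n : measurable (B n) by apply: measurableI.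
have UB : \bigcup_n B n = A.
 apply/seteqP; split => [x [n _ []]//|x Ax].
 exists (Num.trunc `|x.2|).+1 => //; split => //=.
 by rewrite in_itv/= -ler_norml ltW// truncnS_gt.
have Bcvg : leb2 R (B n) @[n --> \oo] --> a%:E.
 rewrite -aE -UB; apply: nondecreasing_cvg_mu => //.
  exact: bigcupT_measurable.
 move=> n p np; apply/subsetPset => x [Ax]/=; rewrite !in_itv/= => /andP[h1 h2].
 split => //=; rewrite in_itv/=.
 have : (n%:R <= p%:R :> R)%R by rewrite ler_nat.
 by move=> ?; apply/andP; split; lra.
have Bfin n : leb2 R (B n) \is a fin_num.
 rewrite ge0_fin_numE//; apply: (@le_lt_trans _ _ a%:E); last by rewrite ltry.
 by rewrite -aE; apply: le_measure; rewrite ?inE; [exact: mB|exact: mA|move=> x []].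
pose b n := fine (leb2 R (B n)).
have bE n : leb2 R (B n) = (b n)%:E by rewrite fineK.
have bcvg : b n @[n --> \oo] --> a by exact: (fine_cvg Bcvg).
apply: (@cvgr_to_le _ \oo _ _ (fun n => b n + 2 * h * Num.sqrt (pi * b n))%R).
 apply: cvgD => //; apply: cvgMl_tmp.
 apply: (@continuous_cvg _ _ _ \oo _ (fun n => pi * b n)%R Num.sqrt).
  exact: sqrt_continuous.
 exact: cvgMl_tmp.
apply: nearW => n; rewrite -lee_fin -kE.
apply: (@brunn_minkowski_disc_bounded (B n) K h (n%:R *+ 2)) => //.
 by move=> x y [Ax _]; exact: AK.
move=> x; apply: (@le_trans _ _ (leb [set` `[- n%:R, n%:R]%R])).
 apply: subset_le_measure; [exact: (measurable_xsection x (mB n))|exact: measurable_itv|].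
 by move=> y; rewrite /xsection/= inE => -[].
rewrite lebesgue_measure_itv/= lte_fin; case: ifPn => [_|].
 by rewrite lee_fin mulr2n opprK.
by rewrite lee_fin mulrn_wge0.
Qed.

End brunn_minkowski_disc.

(** * Smooth functions on the line and plateaus *)

Section smooth_line.
Context {R : realType}.
Implicit Types f g : R -> R.

Fixpoint Ck_line (k : nat) f : Prop :=
 if k is k'.+1 then (forall x, derivable f x 1) /\ Ck_line k' ('D_1 f)
 else continuous f.

Definition smooth_line f := forall k, Ck_line k f.

Lemma is_derive_continuous f (x df : R) : is_derive x 1 f df -> {for x, continuous f}.
Proof.
by move=> [dfx _]; apply: differentiable_continuous; apply/derivable1_diffP.
Qed.

Lemma Ck_line_continuous k f : Ck_line k f -> continuous f.
Proof.
case: k => [//|k [df _] x].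
by apply: differentiable_continuous; apply/derivable1_diffP.
Qed.

Lemma Ck_lineW k f : Ck_line k.+1 f -> Ck_line k f.
Proof.
elim: k f => [|k IH] f; first exact: Ck_line_continuous.
by move=> [df Df]; split=> //; exact: IH.
Qed.

Lemma Ck_line_is_derive k f f' : (forall x : R, is_derive x 1 f (f' x)) ->
 Ck_line k f' -> Ck_line k.+1 f.
Proof.
move=> df cf'; split=> [x|]; first by have [] := df x.
by rewrite (_ : 'D_1 f = f') //; apply/funext => x; have [_ ->] := df x.
Qed.

Lemma Ck_line_derive k f (x : R) : Ck_line k.+1 f -> is_derive x 1 f ('D_1 f x).
Proof. by move=> [df _]; split. Qed.

Lemma Ck_lineD k f g : Ck_line k f -> Ck_line k g ->
 Ck_line k (fun x => f x + g x).
Proof.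
elim: k f g => [|k IH] f g cf cg.
 by move=> x; apply: cvgD; [exact: cf|exact: cg].
apply: (@Ck_line_is_derive _ _ (fun x => 'D_1 f x + 'D_1 g x)).
 by move=> x; exact: (is_deriveD (Ck_line_derive x cf) (Ck_line_derive x cg)).
by apply: IH; [have [] := cf|have [] := cg].
Qed.

Lemma Ck_lineM k f g : Ck_line k f -> Ck_line k g ->
 Ck_line k (fun x => f x * g x).
Proof.
elim: k f g => [|k IH] f g cf cg.
 by move=> x; apply: cvgM; [exact: cf|exact: cg].
apply: (@Ck_line_is_derive _ _ (fun x => f x * 'D_1 g x + g x * 'D_1 f x)).
 by move=> x; exact: (is_deriveM (Ck_line_derive x cf) (Ck_line_derive x cg)).
by apply: Ck_lineD; apply: IH; rewrite ?(proj2 cf) ?(proj2 cg)//;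
 [exact: Ck_lineW|have [] := cg|exact: Ck_lineW|have [] := cf].
Qed.

Lemma Ck_line_cst k (c : R) : Ck_line k (fun=> c).
Proof.
elim: k c => [|k IH] c; first by move=> x; exact: cvg_cst.
apply: (@Ck_line_is_derive _ _ (fun _ => 0)) => // x; exact: is_derive_cst.
Qed.

Lemma Ck_line_affine k f (a b : R) : Ck_line k f ->
 Ck_line k (fun x => f (a * x + b)).
Proof.
elim: k f => [|k IH] f cf.
 move=> x; apply: (@continuous_comp _ _ _ (fun x => a * x + b) f); last exact: cf.
 by apply: cvgD; [apply: cvgMl_tmp; exact: cvg_id|exact: cvg_cst].
apply: (@Ck_line_is_derive _ _ (fun x => 'D_1 f (a * x + b) * a)).
 move=> x; have da : is_derive x 1 (fun x : R => a * x + b) a.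
  by apply: is_derive_eq; rewrite /GRing.scale/=; ring.
 exact: (@is_derive1_comp _ f (fun x => a * x + b) x _ _
  (Ck_line_derive _ cf) da).
apply: (@Ck_lineM _ (fun x => 'D_1 f (a * x + b)) (fun=> a)); first exact: IH (proj2 cf).
exact: Ck_line_cst.
Qed.

Definition exp_inv_poly (p : {poly R}) (x : R) : R :=
 if 0 < x then p.[x^-1] * expR (- x^-1) else 0.

(** From [e^y >= y^(i + 1) / (i + 1)!] with [y = x^-1], one coefficient at a time. It settles
    differentiability at 0. *)
Lemma exp_inv_poly_le (p : {poly R}) : exists C, forall x,
 `|exp_inv_poly p x| <= C * `|x|.
Proof.
pose C := \sum_(i < size p) `|p`_i| * (i.+1)`!%:R.
exists C => x; rewrite /exp_inv_poly; case: ifPn => x0; last first.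
 by rewrite normr0 mulr_ge0// sumr_ge0// => i _; rewrite mulr_ge0.
have y0 : 0 < x^-1 by rewrite invr_gt0.
rewrite normrM (gtr0_norm (expR_gt0 _)) (gtr0_norm x0) horner_coef.
rewrite -ler_pdivlMr ?expR_gt0// -expRN opprK.
apply: (le_trans (ler_norm_sum _ _ _)).
rewrite -mulrA mulr_suml; apply: ler_sum => i _.
rewrite normrM -mulrA ler_wpM2l// normrX gtr0_norm//.
have := @expR_ge1Dxn R x^-1 i (ltW y0).
set e := expR _; set m := _`!%:R => H.
have m0 : 0 < m :> R by rewrite ltr0n fact_gt0.
have {}H : x^-1 ^+ i.+1 / m <= e by apply: le_trans H; rewrite lerDr.
rewrite ler_pdivrMr// exprS in H.
rewrite (_ : m * (x * e) = x * (e * m)); last by ring.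
by rewrite -[leLHS](mulVKf (lt0r_neq0 x0)) ler_wpM2l ?(ltW x0).
Qed.

Lemma is_derive_exp_inv_poly (p : {poly R}) (x : R) :
 is_derive x 1 (exp_inv_poly p) (exp_inv_poly ('X^2 * (p - p^`())) x).
Proof.
have [x0|x0|->] := ltgtP x 0.
- apply: (@near_eq_is_derive _ _ _ (cst 0)).
  near=> z; rewrite /exp_inv_poly ltNge ltW//.
  by near: z; exact: lt_nbhsl.
 by rewrite /exp_inv_poly ltNge (ltW x0)/=; exact: is_derive_cst.
- apply: (@near_eq_is_derive _ _ _ (fun z : R => p.[z^-1] * expR (- z^-1) : R)).
  near=> z; rewrite /exp_inv_poly (_ : 0 < z)//.
  by near: z; exact: lt_nbhsr.
 have xn : x != 0 by rewrite gt_eqF.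
 have d1 : is_derive x 1 (fun z : R => z^-1) (- x ^- 2).
  by have /= := @is_deriveV R id x 1 1 xn _; rewrite /GRing.scale/= mulr1; apply.
 have d2 : is_derive x 1 (fun z : R => - z^-1) (x ^- 2).
  by have := is_deriveN d1; rewrite opprK; apply.
 have d3 : is_derive x 1 (fun z : R => p.[z^-1]) (p^`().[x^-1] * (- x ^- 2)).
  apply: (@is_derive1_comp _ (horner p) (fun z => z^-1)).
 have d4 : is_derive x 1 (fun z : R => expR (- z^-1)) (expR (- x^-1) * x ^- 2).
  exact: (@is_derive1_comp _ expR (fun z => - z^-1)).
 have d5 := is_deriveM d3 d4.
 apply: (is_derive_eq d5); rewrite /exp_inv_poly x0 /GRing.scale/=.
 rewrite !hornerE/=; field; exact: xn.
(* At 0 the difference quotient of the function of [p] is the function of ['X * p], which is of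
   order [h]. *)
- have [C HC] := exp_inv_poly_le ('X * p).
 have -> : exp_inv_poly ('X^2 * (p - p^`())) 0 = 0 by rewrite /exp_inv_poly ltxx.
 have H : h^-1 *: ((exp_inv_poly p \o shift 0) (h *: (1 : R)) - exp_inv_poly p 0)
   @[h --> 0^'] --> (0 : R).
  have cC : (C * `|h| @[h --> (0 : R)^'] --> (0 : R)).
   rewrite -[X in _ --> X](mulr0 C); apply: cvgMl_tmp.
   apply: cvg_within_filter.
   by have := cvg_norm (@cvg_id _ (nbhs (0 : R))); rewrite normr0; apply.
  have cNC : (- (C * `|h|) @[h --> (0 : R)^'] --> (0 : R)).
   by rewrite -[X in _ --> X]oppr0; exact: cvgN.
  apply: (squeeze_cvgr _ cNC cC).
  near=> h; rewrite -ler_norml.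
  have hn0 : h != 0 by near: h; exact: nbhs_dnbhs_neq.
  apply: le_trans (HC h); rewrite /exp_inv_poly ltxx subr0 /GRing.scale/=.
  rewrite mulr1 addr0; case: ifPn => // h0; rewrite ?mulr0//.
  by rewrite hornerM hornerX mulrA.
 split; first by apply/cvg_ex; exists 0.
 exact/cvg_lim.
Unshelve. all: by end_near. Qed.

Lemma Ck_exp_inv_poly k (p : {poly R}) : Ck_line k (exp_inv_poly p).
Proof.
elim: k p => [|k IH] p; last first.
 exact: Ck_line_is_derive (is_derive_exp_inv_poly p) (IH _).
by move=> x; exact: is_derive_continuous (is_derive_exp_inv_poly p x).
Qed.

(** A smooth approximation from below of the indicator of []a, b[]: the factor [n.+1] sends
    [e^(- 1 / (n.+1 c))] to 1 for every [c > 0], while the support stays in [[a, b]]. *)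
Definition plateau (a b : R) (n : nat) (x : R) : R :=
 exp_inv_poly 1 (n.+1%:R * (x - a)) * exp_inv_poly 1 (n.+1%:R * (b - x)).

Lemma smooth_plateau a b n : smooth_line (plateau a b n).
Proof.
move=> k; apply: Ck_lineM.
 have := Ck_line_affine n.+1%:R (- n.+1%:R * a) (Ck_exp_inv_poly k 1).
 rewrite (_ : (fun x => _) = (fun x => exp_inv_poly 1 (n.+1%:R * (x - a))))//.
 by apply/funext => x; congr exp_inv_poly; ring.
have := Ck_line_affine (- n.+1%:R) (n.+1%:R * b) (Ck_exp_inv_poly k 1).
rewrite (_ : (fun x => _) = (fun x => exp_inv_poly 1 (n.+1%:R * (b - x))))//.
by apply/funext => x; congr exp_inv_poly; ring.
Qed.

Lemma exp_inv_poly1_ge0 x : 0 <= exp_inv_poly 1 x <= 1.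
Proof.
rewrite /exp_inv_poly hornerC; case: ifPn => [x0|]; last by rewrite lexx ler01.
by rewrite mul1r expR_ge0/= -expR0 ler_expR oppr_le0 invr_ge0 ltW.
Qed.

Lemma plateau_ge0 a b n x : 0 <= plateau a b n x.
Proof.
by rewrite mulr_ge0//; case/andP: (exp_inv_poly1_ge0 (n.+1%:R * (x - a)));
 case/andP: (exp_inv_poly1_ge0 (n.+1%:R * (b - x))).
Qed.

Lemma plateau_le1 a b n x : plateau a b n x <= 1.
Proof.
rewrite /plateau; case/andP: (exp_inv_poly1_ge0 (n.+1%:R * (x - a))) => ? ?.
by case/andP: (exp_inv_poly1_ge0 (n.+1%:R * (b - x))) => ? ?; rewrite mulr_ile1.
Qed.

Lemma plateau_neq0 a b n x : plateau a b n x != 0 -> a < x < b.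
Proof.
apply: contraNT; rewrite negb_and -!leNgt => /orP[h|h]; rewrite /plateau.
 by rewrite {1}/exp_inv_poly ltNge pmulr_rle0// subr_le0 h/= mul0r.
by rewrite {2}/exp_inv_poly ltNge pmulr_rle0// subr_le0 h/= mulr0.
Qed.

Lemma cvg_plateau a b x : plateau a b n x @[n --> \oo] --> (\1_(`]a, b[%classic) x : R).
Proof.
rewrite indicE; have [/=|/=] := boolP (x \in _); last first.
 rewrite notin_setE/= in_itv/= => xab.
 rewrite (_ : (fun n => _) = cst 0); first exact: cvg_cst.
 by apply/funext => n; apply/eqP; apply: contra_notT xab; exact: plateau_neq0.
rewrite inE/= in_itv/= => /andP[ax xb].
have key (c : R) : 0 < c -> exp_inv_poly 1 (n.+1%:R * c) @[n --> \oo] --> (1 : R).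
 move=> c0; rewrite (_ : (fun n => _) = (fun n : nat => expR (- (n.+1%:R^-1 * c^-1)))).
  rewrite -[X in _ --> X](@expR0 R).
  apply: (@continuous_cvg _ _ _ \oo _ (fun n : nat => - (n.+1%:R^-1 * c^-1)) expR).
   exact: continuous_expR.
  rewrite -oppr0; apply: cvgN; rewrite -[X in _ --> X](mul0r c^-1).
  by apply: cvgMr_tmp; exact: cvg_harmonic.
 apply/funext => n; rewrite /exp_inv_poly pmulr_rgt0// c0 hornerC mul1r.
 by rewrite invfM.
rewrite -[X in _ --> X](mulr1 1); apply: cvgM; apply: key; rewrite subr_gt0//.
Qed.

End smooth_line.

(** * Product test functions on the plane *)

Section tensor.
Context {R : realType}.
Implicit Types (f g : R -> R) (phi : R * R -> R).

Let quotient_fst phi z : (fun h : R => h^-1 *: ((phi \o shift z) (h *: (1, 0)) - phi z)) =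
 (fun h : R => h^-1 *: (((fun s => phi (s, z.2)) \o shift z.1) (h *: (1 : R)) -
   (fun s => phi (s, z.2)) z.1)).
Proof.
apply/funext => h; case: z => z1 z2 /=; congr (_ *: (phi _ - _)).
by congr (_, _); rewrite /= /GRing.scale/= ?mulr0 ?add0r.
Qed.

Let quotient_snd phi z : (fun h : R => h^-1 *: ((phi \o shift z) (h *: (0, 1)) - phi z)) =
 (fun h : R => h^-1 *: (((fun s => phi (z.1, s)) \o shift z.2) (h *: (1 : R)) -
   (fun s => phi (z.1, s)) z.2)).
Proof.
apply/funext => h; case: z => z1 z2 /=; congr (_ *: (phi _ - _)).
by congr (_, _); rewrite /= /GRing.scale/= ?mulr0 ?add0r.
Qed.

Lemma derivable_fst phi z :
 derivable phi z (1, 0) <-> derivable (fun s => phi (s, z.2)) z.1 1.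
Proof. by rewrite /derivable quotient_fst. Qed.

Lemma derivable_snd phi z :
 derivable phi z (0, 1) <-> derivable (fun s => phi (z.1, s)) z.2 1.
Proof. by rewrite /derivable quotient_snd. Qed.

Lemma derive_fst phi z : 'D_(1, 0) phi z = 'D_1 (fun s => phi (s, z.2)) z.1.
Proof. by rewrite /derive quotient_fst. Qed.

Lemma derive_snd phi z : 'D_(0, 1) phi z = 'D_1 (fun s => phi (z.1, s)) z.2.
Proof. by rewrite /derive quotient_snd. Qed.

Definition tensor f g (z : R * R) : R := f z.1 * g z.2.

Lemma derive_fst_tensor f g : (forall x, derivable f x 1) ->
 'D_(1, 0) (tensor f g) = tensor ('D_1 f) g.
Proof.
move=> df; apply/funext => z; rewrite derive_fst /tensor/=.
have d := @is_deriveM _ _ f (cst (g z.2)) z.1 1 _ _ (DeriveDef (df z.1) erefl)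
 (is_derive_cst _ _ _).
rewrite -/((f * cst (g z.2))) (derive_val (is_derive := d)).
by rewrite /GRing.scale/= mulr0 add0r mulrC.
Qed.

Lemma derive_snd_tensor f g : (forall x, derivable g x 1) ->
 'D_(0, 1) (tensor f g) = tensor f ('D_1 g).
Proof.
move=> dg; apply/funext => z; rewrite derive_snd /tensor/=.
have d := @is_deriveM _ _ (cst (f z.1)) g z.2 1 _ _ (is_derive_cst _ _ _)
 (DeriveDef (dg z.2) erefl).
rewrite -/((cst (f z.1) * g)) (derive_val (is_derive := d)).
by rewrite /GRing.scale/= mulr0 addr0.
Qed.

Lemma Ck_tensor k f g : smooth_line f -> smooth_line g -> Ck k (tensor f g).
Proof.
elim: k f g => [|k IH] f g sf sg.
 move=> z; apply: cvgM.
  apply: (@continuous_comp _ _ _ fst f); first exact: cvg_fst.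
  exact: (sf 0).
 apply: (@continuous_comp _ _ _ snd g); first exact: cvg_snd.
 exact: (sg 0).
have df x : derivable f x 1 by have [] := sf 1%N.
have dg x : derivable g x 1 by have [] := sg 1%N.
have sf' : smooth_line ('D_1 f) by move=> n; have [] := sf n.+1.
have sg' : smooth_line ('D_1 g) by move=> n; have [] := sg n.+1.
split.
- move=> z; apply/derivable_fst.
 exact: (@derivableM _ _ f (cst (g z.2)) z.1 1 (df _) (derivable_cst _ _ _)).
- move=> z; apply/derivable_snd.
 exact: (@derivableM _ _ (cst (f z.1)) g z.2 1 (derivable_cst _ _ _) (dg _)).
- by rewrite derive_fst_tensor//; exact: IH.
- by rewrite derive_snd_tensor//; exact: IH.
Qed.

Lemma test_function_tensor f g (a b c d : R) :
 smooth_line f -> smooth_line g ->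
 (forall x, f x != 0 -> a <= x <= b) -> (forall x, g x != 0 -> c <= x <= d) ->
 test_function (tensor f g).
Proof.
move=> sf sg supf supg; split=> [k|]; first exact: Ck_tensor.
have cab := @segment_compact R a b; have ccd := @segment_compact R c d.
apply: (@subclosed_compact _ _ (`[a, b]%classic `*` `[c, d]%classic)).
- exact: closed_closure.
- exact: compact_setX.
- have cl : closed (`[a, b]%classic `*` `[c, d]%classic).
  apply: compact_closed; last exact: compact_setX.
  exact: norm_hausdorff.
 rewrite closureE; apply: smallest_sub => // z /=.
 rewrite /tensor mulf_eq0 negb_or => /andP[/supf ? /supg ?].
 by split; rewrite /= in_itv.
Qed.

End tensor.

(** * Translation invariance of planar measure *)

Section translation.
Context {R : realType}.
Notation leb := (@lebesgue_measure R).
Notation P := (mplane R).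
Implicit Types (v : P) (t : R).

Definition tr v t x : P := (x.1 + t * v.1, x.2 + t * v.2).

Lemma trK v t : cancel (tr v t) (tr v (- t)).
Proof. by move=> [x1 x2]; rewrite /tr/=; congr (_, _); ring. Qed.

Lemma measurable_tr v t : mfun P (tr v t).
Proof.
by apply: measurable_fun_pair; apply: measurable_funD.
Qed.

(** A product measure is determined by rectangles, where the claim splits into two shifts of the
    line. *)
Lemma leb2_tr_preimage v t (A : set P) : measurable A ->
 leb2 R (tr v t @^-1` A) = leb2 R A.
Proof.
move=> mA; apply/esym.
have mt : mfun P (tr v t : P -> P) by exact: measurable_tr.
pose m' : {measure set P -> \bar R} :=
 pushforward (leb \x leb)%E (tr v t : P -> P).
apply: (@product_measure_unique _ _ _ _ _ leb leb (m' mt)) => //.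
move=> A1 A2 mA1 mA2; rewrite /pushforward/=.
have mshift (S : set R) (c : R) : measurable S -> measurable [set x | S (x + c)].
 move=> mS; have mc : measurable_fun setT (fun x : R => x + c).
  exact: measurable_funD.
 by have := mc measurableT S mS; rewrite setTI.
transitivity ((leb \x leb)%E
 ([set x | A1 (x + t * v.1)] `*` [set x | A2 (x + t * v.2)])); first by [].
rewrite product_measure1E; [|exact: mshift|exact: mshift].
by congr (_ * _)%E; exact: lebesgue_measure_shift.
Qed.

Lemma ge0_integral_tr v t (f : P -> \bar R) : mfun P f ->
 (forall x, 0 <= f x)%E ->
 (\int[leb2 R]_x f (tr v t x) = \int[leb2 R]_x f x)%E.
Proof.
move=> mf f0.
have := @ge0_integral_pushforward _ _ P P R (tr v t) (@measurable_tr v t)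
 (leb \x leb)%E setT f measurableT mf (fun x _ => f0 x).
rewrite preimage_setT => <-.
apply: eq_measure_integral => [|mt A mA _]; first exact: measurable_tr.
by have := leb2_tr_preimage v t mA; rewrite [X in X = _ -> _](_ : _ = pushforward (leb2 R) (tr v t) A).
Qed.

Lemma integrable_tr v t (f : P -> \bar R) :
 (leb2 R).-integrable [set: P] f ->
 (leb2 R).-integrable [set: P] (f \o tr v t).
Proof.
move=> /integrableP[mf fi]; apply/integrableP; split.
 by apply: measurableT_comp => //; exact: measurable_tr.
rewrite (ge0_integral_tr v t (f := fun x => `|f x|%E))//.
exact: measurableT_comp.
Qed.

Lemma integral_tr v t (f : P -> \bar R) :
 (leb2 R).-integrable [set: P] f ->
 (\int[leb2 R]_x f (tr v t x) = \int[leb2 R]_x f x)%E.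
Proof.
move=> fi; have mf := measurable_int _ fi.
have := @integral_pushforward _ _ P P R (tr v t) (@measurable_tr v t)
 (leb \x leb)%E setT f mf _ measurableT.
rewrite preimage_setT => <-; last exact: integrable_tr.
apply: eq_measure_integral => [|mt A mA _]; first exact: measurable_tr.
by have := leb2_tr_preimage v t mA; rewrite [X in X = _ -> _](_ : _ = pushforward (leb2 R) (tr v t) A).
Qed.

Lemma ge0_integral_reflect (f : R -> \bar R) (c : R) : mfun R f ->
 (forall x, 0 <= f x)%E ->
 (\int[leb]_s f (c - s)%R = \int[leb]_y f y)%E.
Proof.
move=> mf f0; pose r (s : R) : mline R := c - s.
have mr : mfun (mline R) r by exact: measurable_funB.
have := @ge0_integral_pushforward _ _ (mline R) (mline R) R r mr
 leb setT f measurableT mf (fun x _ => f0 x).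
rewrite preimage_setT => <-; apply: eq_measure_integral => A mA _.
apply/esym; apply: (@lebesgue_measure_unique R (pushforward leb r)) => // _ [[a b]] _ <-.
have E : r @^-1` `](a, b).1, (a, b).2]%classic = `[c - b, c - a[%classic.
 by apply/seteqP; split => s /=; rewrite /r !in_itv/= => /andP[? ?]; apply/andP; split; lra.
rewrite [RHS](_ : _ = leb `[c - b, c - a[%classic); last by rewrite -E.
rewrite !lebesgue_measure_itv/= !lte_fin ltrD2l ltrN2.
by case: ifPn => // _; rewrite -!EFinB; congr (_%:E); ring.
Qed.

End translation.

(** * Moving averages of smooth functions *)

Section smooth_average.
Context {R : realType}.
Notation leb := (@lebesgue_measure R).
Variables (f : R -> R) (a b : R).
Hypothesis (sf : smooth_line f) (f0 : forall x, 0 <= f x) (f1 : forall x, f x <= 1).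
Hypothesis (suppf : forall x, f x != 0 -> a < x < b).

Let mf : mfun R f.
Proof. exact: continuous_measurable_fun (sf 0). Qed.

Lemma integrable_line : leb.-integrable [set: R] (EFin \o f).
Proof.
have iab : leb.-integrable `[a, b] (cst (1%:E : \bar R)).
 apply/integrableP; split => //=; rewrite integral_cst// normr1 mul1e.
 exact: leb_itvcc_lty.
apply/integrableP; split; first exact/measurable_EFinP.
apply: (@le_lt_trans _ _ (\int[leb]_(x in `[a, b]) cst (1%:E : \bar R) x)%E).
 rewrite [leRHS]integral_mkcond; apply: ge0_le_integral => //=.
 - by apply/measurable_EFinP; exact: measurableT_comp.
 - by apply/(measurable_restrictT _ _).1.
 - move=> x _; rewrite ger0_norm// patchE; case: ifPn; rewrite ?lee_fin//.
  rewrite notin_setE/= in_itv/= => /negP xab.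
  case: (eqVneq (f x) 0) => [->//|/suppf /andP[/ltW ? /ltW ?]].
  by move: xab; rewrite negb_and -!ltNge => /orP[]; lra.
by rewrite integral_cst//= mul1e leb_itvcc_lty.
Qed.

(** Its derivative is the difference [f x - f (x - t)]. As a factor of a test function it therefore
    converts a weak derivative into a finite difference. *)
Definition line_average (t x : R) : R := \int[leb]_(s in `[0, t]) f (x - s).

Let B x := \int[leb]_(y in `]-oo, x]) f y.

Let line_averageE t x : 0 <= t -> line_average t x = B x - B (x - t).
Proof.
move=> t0; rewrite /B Rintegral_itvB//; last 2 first.
 by apply: integrableS integrable_line.
 by rewrite bnd_simp lerBlDr lerDl.
rewrite /line_average /Rintegral; congr fine.
rewrite (integral_itv_obnd_cbnd); last first.
 by exact/measurable_EFinP/measurable_funTS.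
rewrite [LHS]integral_mkcond [RHS]integral_mkcond.
rewrite -(ge0_integral_reflect (f := (fun y => (f y)%:E) \_ `[x - t, x]) x).
- apply: eq_integral => s _; rewrite !patchE.
 rewrite (_ : (s \in _) = (x - s \in `[x - t, x]%classic))//.
 apply/idP/idP; rewrite !inE/= !in_itv/= => /andP[? ?]; apply/andP; split; lra.
- by apply/(measurable_restrictT _ _).1 => //; exact/measurable_EFinP/measurable_funTS.
- by move=> y; apply: erestrict_ge0 => z _; rewrite lee_fin.
Qed.

Let is_derive_B (x : R) : is_derive x 1 B (f x).
Proof.
have := @continuous_FTC1 R f -oo%O x (x + 1).
rewrite ltrDl ltr01 => /(_ isT) /=.
case.
- by apply: integrableS integrable_line.
- by rewrite ltNyr.
- exact: (sf 0).
- by move=> dB; rewrite derive1E => DB; split.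
Qed.

Lemma is_derive_line_average t (x : R) : 0 <= t ->
 is_derive x 1 (line_average t) (f x - f (x - t)).
Proof.
move=> t0; rewrite (_ : line_average t = fun x => B x - B (x - t)); last first.
 by apply/funext => y; rewrite line_averageE.
have d1 : is_derive x 1 (fun y : R => y - t) 1.
 by apply: is_derive_eq; rewrite subr0.
have d2 := @is_derive1_comp _ B (fun y : R => y - t) x _ _ (is_derive_B (x - t)) d1.
apply: (is_derive_eq (is_deriveB (is_derive_B x) d2)).
by rewrite mulr1.
Qed.

Lemma smooth_line_average t : 0 <= t -> smooth_line (line_average t).
Proof.
move=> t0; suff H k : Ck_line k.+1 (line_average t) by move=> k; exact: Ck_lineW.
apply: (@Ck_line_is_derive _ _ _ (fun x => f x - f (x - t))).
 by move=> x; exact: is_derive_line_average.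
apply: Ck_lineD; first exact: sf.
rewrite (_ : (fun x => _) = (fun x => (fun=> -1) x * f (1 * x + (- t)))); last first.
 by apply/funext => x; rewrite mulN1r mul1r.
by apply: Ck_lineM; [exact: Ck_line_cst|apply: Ck_line_affine; exact: sf].
Qed.

Lemma line_average_ge0 t x : 0 <= line_average t x.
Proof. by apply: Rintegral_ge0. Qed.

Let integrable_avg t x : leb.-integrable `[0, t] (EFin \o (fun s => f (x - s))).
Proof.
apply: (@measurable_bounded_integrable _ _ _ leb (fun s => f (x - s))) => //.
- exact: leb_itvcc_lty.
- apply: measurable_funTS; apply: measurableT_comp => //; exact: measurable_funB.
- exists 1; split; first exact: num_real.
 by move=> M M1 s _ /=; rewrite ger0_norm// (le_trans (f1 _))// ltW.
Qed.

Lemma line_average_le t x : 0 <= t -> line_average t x <= t.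
Proof.
move=> t0; apply: (@le_trans _ _ (\int[leb]_(s in `[0, t]) cst (1 : R) s)).
 apply: le_Rintegral => //.
 apply: (@measurable_bounded_integrable _ _ _ leb (cst 1)) => //.
  exact: leb_itvcc_lty.
 by exists 1; split; [exact: num_real|move=> M M1 s _ /=; rewrite normr1 ltW].
by rewrite Rintegral_cst//= mul1r leb_itvcc//= subr0.
Qed.

Lemma line_average_neq0 t x : 0 <= t -> line_average t x != 0 -> a <= x <= b + t.
Proof.
move=> t0; apply: contraNT; rewrite negb_and -!ltNge => xab.
rewrite /line_average Rintegral_mkcond; apply/eqP.
rewrite /Rintegral integral0_eq// => s _; rewrite patchE; case: ifPn => //.
rewrite inE/= in_itv/= => /andP[s0 st]; congr (_%:E); apply/eqP.
apply: contraTT xab => /suppf /andP[h1 h2]; rewrite negb_or -!leNgt.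
by apply/andP; split; lra.
Qed.

End smooth_average.

(** * Weak derivatives tested against boxes *)

Section weak_partial_limit.
Context {R : realType}.
Notation leb := (@lebesgue_measure R).
Notation P := (mplane R).
Implicit Types (u h phi psi : P -> R) (v : P).

Lemma Lfun2_measurable u : u \in Lfun (leb2 R) 2%:E -> mfun P u.
Proof. by rewrite inE => /andP[]; rewrite inE. Qed.

(** Pointwise [|u psi| <= u^2 + M^2 1_Q], and both terms are integrable since [Q] has finite
    area. *)
Lemma Lfun2_integrable_bounded u psi (M : R) (Q : set P) :
 u \in Lfun (leb2 R) 2%:E -> mfun P psi ->
 measurable Q -> (leb2 R Q < +oo)%E ->
 (forall x, `|psi x| <= M * \1_Q x) ->
 (leb2 R).-integrable [set: P] (fun x => (u x * psi x)%:E).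
Proof.
move=> uL mpsi mQ Qoo bpsi.
have mu := Lfun2_measurable uL.
have u2 := Lfun2_integrable_sqr uL.
have iQ : (leb2 R).-integrable [set: P] (EFin \o \1_Q).
 apply/integrableP; split; first by apply/measurable_EFinP; exact: measurable_indic.
 rewrite (eq_integral (fun x => (\1_Q x)%:E)); last first.
  by move=> x _; rewrite /= ger0_norm.
 by rewrite integral_indic// setIT.
have i2 := integrableD measurableT u2 (integrableZl measurableT (M ^+ 2) iQ).
apply: le_integrable i2 => //.
 by apply/measurable_EFinP; exact: measurable_funM.
move=> x _ /=; rewrite lee_fin normrM.
rewrite [leRHS]ger0_norm; last first.
 by rewrite addr_ge0 ?sqr_ge0// mulr_ge0 ?sqr_ge0.
have h1 := bpsi x; have h2 : (\1_Q x : R) ^+ 2 = \1_Q x.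
 by rewrite indicE; case: (x \in Q); rewrite /= ?expr1n ?expr0n.
have amgm (r q : R) : r * q <= r ^+ 2 + q ^+ 2 by nra.
apply: (@le_trans _ _ (`|u x| * (M * \1_Q x))); first by rewrite ler_wpM2l.
by rewrite -h2 -exprMn -(real_normK (num_real (u x))) h2; exact: amgm.
Qed.

(** Dominated convergence on the fixed set [Q]. The limits [phi] and [psi] need not be continuous,
    which admits indicators of boxes. *)
Lemma weak_partial_limit v u h (phi_ : nat -> P -> R) phi psi (M : R) (Q : set P) :
 weak_partial v u h -> u \in Lfun (leb2 R) 2%:E -> h \in Lfun (leb2 R) 2%:E ->
 (forall n, test_function (phi_ n)) ->
 (forall n, mfun P (phi_ n)) ->
 (forall n, mfun P ('D_v (phi_ n))) ->
 measurable Q -> (leb2 R Q < +oo)%E ->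
 (forall n x, `|phi_ n x| <= M * \1_Q x) ->
 (forall n x, `|'D_v (phi_ n) x| <= M * \1_Q x) ->
 (forall x, phi_ n x @[n --> \oo] --> phi x) ->
 (forall x, 'D_v (phi_ n) x @[n --> \oo] --> psi x) ->
 (\int[leb2 R]_x (u x * psi x)%:E = - \int[leb2 R]_x (h x * phi x)%:E)%E.
Proof.
move=> wu uL hL tphi mphi mDphi mQ Qoo bphi bDphi cphi cpsi.
have mu := Lfun2_measurable uL; have mh := Lfun2_measurable hL.
have dom (w : P -> R) (chi_ : nat -> P -> R) (chi : P -> R) :
  w \in Lfun (leb2 R) 2%:E ->
  (forall n, mfun P (chi_ n)) ->
  (forall n x, `|chi_ n x| <= M * \1_Q x) ->
  (forall x, chi_ n x @[n --> \oo] --> chi x) ->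
  (\int[leb2 R]_x (w x * chi_ n x)%:E @[n --> \oo] -->
   \int[leb2 R]_x (w x * chi x)%:E)%E.
 move=> wL mchi bchi cchi; have mw := Lfun2_measurable wL.
 have MQ0 x : 0 <= M * \1_Q x by exact: le_trans (bchi 0%N x).
 have iw : (leb2 R).-integrable [set: P] (fun x => (w x * (M * \1_Q x))%:E).
  apply: (Lfun2_integrable_bounded wL _ mQ Qoo).
   by apply: measurable_funM => //; exact: measurable_indic.
  by move=> x; rewrite ger0_norm.
 apply: (@dominated_cvg _ _ _ _ setT measurableT
  (fun n x => (w x * chi_ n x)%:E) (fun x => (w x * chi x)%:E)
  (fun x => `|(w x * (M * \1_Q x))%:E|%E)) => //.
 - by move=> n; apply/measurable_EFinP; exact: measurable_funM.
 - move=> x _; apply: cvg_EFin; first exact: nearW.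
  by apply: cvgMl_tmp; exact: cchi.
 - exact: integrable_abse.
 - by move=> n x _ /=; rewrite lee_fin !(normrM (w x)) ler_wpM2l// (ger0_norm (MQ0 x)).
have c1 := dom u _ _ uL mDphi bDphi cpsi.
have c2 := dom h _ _ hL mphi bphi cphi.
rewrite -(cvg_lim _ c1)// -(cvg_lim _ (cvgeN c2))//.
rewrite (_ : (fun n => _) = (fun n => - \int[leb2 R]_x (h x * phi_ n x)%:E)%E)//.
by apply/funext => n; exact: wu.
Qed.

Definition coord_dir v := v = (1, 0) \/ v = (0, 1).

Definition box (a b c d : R) : set P := `]a, b[%classic `*` `]c, d[%classic.

Lemma measurable_box a b c d : measurable (box a b c d).
Proof. by apply: measurableX. Qed.

Lemma leb2_box a b c d : a <= b -> c <= d ->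
 leb2 R (box a b c d) = ((b - a) * (d - c))%:E.
Proof.
have oo (a' b' : R) : a' <= b' -> leb `]a', b'[%classic = (b' - a')%:E.
 move=> ab; rewrite lebesgue_measure_itv/= lte_fin; case: ltP => [_|ba].
  by rewrite EFinB.
 by congr (_%:E); apply/eqP; rewrite eq_sym subr_eq0 eq_le ba.
by move=> ab cd; rewrite /box product_measure1E//= !oo.
Qed.

(* [sweep v t B x] is the time spent in [B] by the segment from [x] to
  [x - t v]. *)
Definition sweep v (t : R) (B : set P) (x : P) : R :=
 \int[leb]_(s in `[0, t]) \1_B (tr v (- s) x).

Let indic_box a b c d (x : P) :
 \1_(box a b c d) x = \1_(`]a, b[%classic) x.1 * \1_(`]c, d[%classic) x.2 :> R.
Proof. by rewrite !indicE /box in_setX; case: (_ \in _); rewrite ?mul1r ?mul0r. Qed.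

Let cvg_average_plateau a b (t x : R) : 0 <= t ->
 line_average (plateau a b n) t x @[n --> \oo] -->
 \int[leb]_(s in `[0, t]) (\1_(`]a, b[%classic) (x - s) : R).
Proof.
move=> t0; rewrite /line_average /Rintegral.
have mx : mfun R (fun s : R => x - s) by exact: measurable_funB.
have tfin : (leb `[0%R, t]%classic < +oo)%E by exact: leb_itvcc_lty.
have i1 (g : R -> R) : mfun R g -> (forall s, 0 <= g s <= 1) ->
  (\int[leb]_(s in `[0%R, t]) (g (x - s))%:E)%E \is a fin_num.
 move=> mg g01; apply: integrable_fin_num => //.
 apply: (@measurable_bounded_integrable _ _ _ leb (fun s => g (x - s))) => //.
  by apply: measurable_funTS; exact: measurableT_comp.
 exists 1; split; first exact: num_real.
 move=> M M1 s _ /=; have /andP[g0 g1] := g01 (x - s).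
 by rewrite ger0_norm// (le_trans g1)// ltW.
apply: fine_cvg; rewrite fineK; last first.
 apply: i1; first exact: measurable_indic.
 by move=> s; rewrite indicE; case: (s \in _); rewrite /= lexx ler01.
apply: (@dominated_cvg _ _ _ leb `[0, t]%classic (measurable_itv _)
 (fun n s => (plateau a b n (x - s))%:E) _ (cst 1%E)) => //.
- move=> n; apply/measurable_EFinP/measurable_funTS/measurableT_comp => //.
 exact: continuous_measurable_fun (smooth_plateau a b n 0).
- by move=> s _; apply: cvg_EFin; [exact: nearW|exact: cvg_plateau].
- apply/integrableP; split => //=; rewrite integral_cst// normr1 mul1e.
 exact: leb_itvcc_lty.
- by move=> n s _ /=; rewrite lee_fin ger0_norm ?plateau_ge0// plateau_le1.
Qed.

(** The factor of the test function in the direction [v] is a moving average of plateaus: its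
    derivative tends to a difference of indicators, and the average itself to the time spent in the
    interval. *)
Lemma weak_partial_box v u h (a b c d t : R) : coord_dir v ->
 weak_partial v u h -> u \in Lfun (leb2 R) 2%:E -> h \in Lfun (leb2 R) 2%:E ->
 0 < t -> a <= b -> c <= d ->
 (\int[leb2 R]_x (u x * (\1_(box a b c d) x - \1_(box a b c d) (tr v (- t) x)))%:E =
  - \int[leb2 R]_x (h x * sweep v t (box a b c d) x)%:E)%E.
Proof.
move=> vE wu uL hL t0 ab cd; have t0' := ltW t0.
(* Contains the supports of all test functions below; the margin 1 absorbs their closed ends. *)
pose Q := box (a - 1) (b + t + 1) (c - 1) (d + t + 1).
have Qoo : (leb2 R Q < +oo)%E by rewrite leb2_box ?ltry//; lra.
have mB (a' b' : R) n : mfun R (plateau a' b' n).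
 exact: continuous_measurable_fun (smooth_plateau a' b' n 0).
pose c_ (a' b' : R) n := line_average (plateau a' b' n) t.
have bp a' b' n := @smooth_line_average R (plateau a' b' n) a' b' (smooth_plateau a' b' n)
 (plateau_ge0 a' b' n) (plateau_le1 a' b' n) (@plateau_neq0 _ a' b' n) t t0'.
have bd a' b' n x := @is_derive_line_average R (plateau a' b' n) a' b' (smooth_plateau a' b' n)
 (plateau_ge0 a' b' n) (plateau_le1 a' b' n) (@plateau_neq0 _ a' b' n) t x t0'.
have bs a' b' n x := @line_average_neq0 R (plateau a' b' n) a' b'
  (@plateau_neq0 _ a' b' n) t x t0'.
have bl a' b' n x := @line_average_le R (plateau a' b' n) (smooth_plateau a' b' n)
 (plateau_ge0 a' b' n) (plateau_le1 a' b' n) t x t0'.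
have bg a' b' n x := @line_average_ge0 R (plateau a' b' n) (plateau_ge0 a' b' n) t x.
have mc a' b' n : mfun R (c_ a' b' n).
 exact: continuous_measurable_fun (bp a' b' n 0).
have Dc a' b' n : 'D_1 (c_ a' b' n) = fun x => plateau a' b' n x - plateau a' b' n (x - t).
 by apply/funext => x; have [_ ->] := bd a' b' n x.
have dc a' b' n (x : R) : derivable (c_ a' b' n) x 1 by have [] := bd a' b' n x.
have mtensor (f g : R -> R) : mfun R f -> mfun R g ->
  mfun P (tensor f g).
 by move=> mf mg; apply: measurable_funM; apply: measurableT_comp.
have mDc a' b' n : mfun R ('D_1 (c_ a' b' n)).
 rewrite Dc; apply: measurable_funB => //; apply: measurableT_comp => //.
 exact: measurable_funB.
have neq0 (f : R -> R) (x lo hi : R) : (f x != 0 -> lo <= x <= hi) ->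
  ~~ (lo - 1 < x < hi + 1) -> f x = 0.
 move=> sf; apply: contraNeq => /sf /andP[h1 h2]; apply/andP; split; lra.
have cM a' b' n (x : R) : `|c_ a' b' n x| <= 1 + t.
 by rewrite ger0_norm; [have := bl a' b' n x; rewrite /c_; lra|exact: bg].
have bM (a' b' : R) n (x : R) : `|plateau a' b' n x| <= 1 by rewrite ger0_norm ?plateau_ge0// plateau_le1.
have DcE a' b' n (x : R) : 'D_1 (c_ a' b' n) x = plateau a' b' n x - plateau a' b' n (x - t).
 by have [_ ->] := bd a' b' n x.
have DcM a' b' n (x : R) : `|'D_1 (c_ a' b' n) x| <= 1.
 rewrite DcE ler_norml; have := plateau_ge0 a' b' n x; have := plateau_le1 a' b' n x.
 by have := plateau_ge0 a' b' n (x - t); have := plateau_le1 a' b' n (x - t); lra.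
have supp_c (a' b' : R) n (x : R) : ~~ (a' - 1 < x < b' + t + 1) -> c_ a' b' n x = 0.
 by apply: neq0 => /bs.
have supp_Dc (a' b' : R) n (x : R) : ~~ (a' - 1 < x < b' + t + 1) -> 'D_1 (c_ a' b' n) x = 0.
 move=> hx; rewrite DcE; have [->|/plateau_neq0 /andP[h1 h2]] := eqVneq (plateau a' b' n x) 0.
  have [->|/plateau_neq0 /andP[h1 h2]] := eqVneq (plateau a' b' n (x - t)) 0; first by rewrite subr0.
  by case/negP: hx; apply/andP; split; lra.
 by case/negP: hx; apply/andP; split; lra.
have supp_b (a' b' : R) n (x : R) : ~~ (a' - 1 < x < b' + t + 1) -> plateau a' b' n x = 0.
 by apply: contraNeq => /plateau_neq0 /andP[h1 h2]; apply/andP; split; lra.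
have bound (f g : R -> R) (F G : R) : 0 <= F <= 1 + t -> 0 <= G <= 1 + t ->
  (forall x, `|f x| <= F) -> (forall x, `|g x| <= G) ->
  (forall x, ~~ (a - 1 < x < b + t + 1) -> f x = 0) ->
  (forall x, ~~ (c - 1 < x < d + t + 1) -> g x = 0) ->
  forall x, `|tensor f g x| <= (1 + t) ^+ 2 * \1_Q x.
 move=> /andP[F0 F1] /andP[G0 G1] bf bgg sf sg x; rewrite /tensor /Q indic_box !indicE.
 have [xa|xa] := boolP (x.1 \in _); last first.
  by rewrite sf ?mul0r ?normr0 ?mulr0//; move: xa; rewrite notin_setE/= in_itv/= => /negP.
 have [xc|xc] := boolP (x.2 \in _); last first.
  by rewrite sg ?mulr0 ?normr0 ?mulr0//; move: xc; rewrite notin_setE/= in_itv/= => /negP.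
 by rewrite !mulr1 normrM expr2 ler_pM// ?(le_trans (bf _))// (le_trans (bgg _)).
have sweepE1 x : sweep (1, 0) t (box a b c d) x =
  \int[leb]_(s in `[0, t]) (\1_(`]a, b[%classic) (x.1 - s) : R) * \1_(`]c, d[%classic) x.2.
 rewrite /sweep -RintegralZr//.
  by apply: eq_Rintegral => s _; rewrite indic_box /tr/= mulr1 mulr0 addr0.
 apply: (@measurable_bounded_integrable _ _ _ leb (fun s => \1_(`]a, b[%classic) (x.1 - s))) => //.
 - exact: leb_itvcc_lty.
 - by apply: measurable_funTS; apply: measurableT_comp; [exact: measurable_indic|exact: measurable_funB].
 - exists 1; split; first exact: num_real.
  by move=> M M1 s _; rewrite /= indicE; case: (_ \in _); rewrite ?normr1 ?normr0 ltW// (lt_trans ltr01).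
have sweepE2 x : sweep (0, 1) t (box a b c d) x =
  \1_(`]a, b[%classic) x.1 * \int[leb]_(s in `[0, t]) (\1_(`]c, d[%classic) (x.2 - s) : R).
 rewrite /sweep -RintegralZl//.
  by apply: eq_Rintegral => s _; rewrite indic_box /tr/= mulr1 mulr0 addr0.
 apply: (@measurable_bounded_integrable _ _ _ leb (fun s => \1_(`]c, d[%classic) (x.2 - s))) => //.
 - exact: leb_itvcc_lty.
 - by apply: measurable_funTS; apply: measurableT_comp; [exact: measurable_indic|exact: measurable_funB].
 - exists 1; split; first exact: num_real.
  by move=> M M1 s _; rewrite /= indicE; case: (_ \in _); rewrite ?normr1 ?normr0 ltW// (lt_trans ltr01).
have t1 : 0 <= (1 : R) <= 1 + t by apply/andP; split; lra.
have t2 : 0 <= 1 + t <= 1 + t by apply/andP; split; lra.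
have D1E n x : 'D_(1, 0) (tensor (c_ a b n) (plateau c d n)) x =
  tensor ('D_1 (c_ a b n)) (plateau c d n) x.
 exact: (congr1 (fun f => f x) (@derive_fst_tensor R _ (plateau c d n) (dc a b n))).
have D2E n x : 'D_(0, 1) (tensor (plateau a b n) (c_ c d n)) x =
  tensor (plateau a b n) ('D_1 (c_ c d n)) x.
 exact: (congr1 (fun f => f x) (@derive_snd_tensor R (plateau a b n) _ (dc c d n))).
case: vE wu => -> wu.
- apply: (@weak_partial_limit (1, 0) u h (fun n => tensor (c_ a b n) (plateau c d n)) _ _
  ((1 + t) ^+ 2) Q) => //.
 + move=> n; apply: (@test_function_tensor _ _ _ a (b + t) c d).
  - exact: bp.
  - exact: smooth_plateau.
  - by move=> x; exact: bs.
  - by move=> x /plateau_neq0 /andP[/ltW-> /ltW->].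
 + by move=> n; exact: mtensor.
 + by move=> n; rewrite derive_fst_tensor//; exact: mtensor.
 + exact: measurable_box.
 + by move=> n; exact: (bound _ _ _ _ t2 t1 (cM a b n) (bM c d n)
   (supp_c a b n) (supp_b c d n)).
 + by move=> n x; rewrite D1E; exact: (bound _ _ _ _ t1 t1 (DcM a b n) (bM c d n)
   (supp_Dc a b n) (supp_b c d n)).
 + move=> x; rewrite sweepE1; apply: cvgM; first exact: cvg_average_plateau.
  exact: cvg_plateau.
 + move=> x; rewrite (_ : (fun n => _) = (fun n =>
    (plateau a b n x.1 - plateau a b n (x.1 - t)) * plateau c d n x.2)); last first.
   by apply/funext => n; rewrite D1E /tensor DcE.
  rewrite !indic_box /tr/= !mulr1 mulr0 addr0 -mulrBl.
  by apply: cvgM; [apply: cvgB; exact: cvg_plateau|exact: cvg_plateau].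
- apply: (@weak_partial_limit (0, 1) u h (fun n => tensor (plateau a b n) (c_ c d n)) _ _
  ((1 + t) ^+ 2) Q) => //.
 + move=> n; apply: (@test_function_tensor _ _ _ a b c (d + t)).
  - exact: smooth_plateau.
  - exact: bp.
  - by move=> x /plateau_neq0 /andP[/ltW-> /ltW->].
  - by move=> x; exact: bs.
 + by move=> n; exact: mtensor.
 + by move=> n; rewrite derive_snd_tensor//; exact: mtensor.
 + exact: measurable_box.
 + by move=> n; exact: (bound _ _ _ _ t1 t2 (bM a b n) (cM c d n)
   (supp_b a b n) (supp_c c d n)).
 + by move=> n x; rewrite D2E; exact: (bound _ _ _ _ t1 t1 (bM a b n) (DcM c d n)
   (supp_b a b n) (supp_Dc c d n)).
 + move=> x; rewrite sweepE2; apply: cvgM; first exact: cvg_plateau.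
  exact: cvg_average_plateau.
 + move=> x; rewrite (_ : (fun n => _) = (fun n =>
    plateau a b n x.1 * (plateau c d n x.2 - plateau c d n (x.2 - t)))); last first.
   by apply/funext => n; rewrite D2E /tensor DcE.
  rewrite !indic_box /tr/= !mulr1 mulr0 addr0 -mulrBr.
  by apply: cvgM; [exact: cvg_plateau|apply: cvgB; exact: cvg_plateau].
Qed.

End weak_partial_limit.

(** * Cauchy-Schwarz and auxiliary facts on integrals *)

Section integral_tools.
Context d (T : measurableType d) (R : realType).
Variable mu : {measure set T -> \bar R}.

(** Cauchy-Schwarz, from the nonnegativity of the integral of [(f - m)^2] with [m] the mean of [f].
    The right-hand side may be infinite. *)
Lemma sqr_Rintegral_le (S : set T) (f : T -> R) (k : R) : measurable S ->
 0 < k -> mu S = k%:E -> mu.-integrable S (EFin \o f) ->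
 (((\int[mu]_(x in S) f x) ^+ 2)%:E <= k%:E * \int[mu]_(x in S) (f x ^+ 2)%:E)%E.
Proof.
move=> mS k0 Sk fi; set I := \int[mu]_(x in S) f x.
have mf : measurable_fun S f by apply/measurable_EFinP; exact: measurable_int fi.
have I0 : (0 <= \int[mu]_(x in S) (f x ^+ 2)%:E)%E.
 by apply: integral_ge0 => x _; rewrite lee_fin sqr_ge0.
move: I0; case J2 : (\int[mu]_(x in S) (f x ^+ 2)%:E)%E => [J| |] // J0; last first.
 by rewrite gt0_muley ?leey// lte_fin.
have f2i : mu.-integrable S (fun x => (f x ^+ 2)%:E).
 apply/integrableP; split; first by apply/measurable_EFinP; exact: measurable_funX.
 under eq_integral do rewrite gee0_abs ?lee_fin ?sqr_ge0//.
 by rewrite J2 ltry.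
have ci (c : R) : mu.-integrable S (EFin \o cst c).
 apply: measurable_bounded_integrable => //; first by rewrite Sk ltry.
 by exists `|c|; split; [exact: num_real|move=> M cM x _ /=; exact: ltW].
pose m := I / k.
have : \int[mu]_(x in S) (2 * m * f x) <= \int[mu]_(x in S) (f x ^+ 2 + m ^+ 2).
 apply: le_Rintegral => //.
 - by have := integrableZl mS (2 * m) fi; apply: eq_integrable.
 - by have := integrableD mS f2i (ci (m ^+ 2)); apply: eq_integrable.
 - move=> x _; rewrite -subr_ge0 (_ : _ - _ = (f x - m) ^+ 2) ?sqr_ge0//.
  by ring.
rewrite RintegralZl// RintegralD// ?Rintegral_cst//; last exact: ci.
rewrite Sk/= -/I (_ : \int[mu]_(x in S) (f x ^+ 2) = J); last by rewrite /Rintegral J2.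
rewrite -EFinM lee_fin /m => H.
have : 0 <= k * (J + (I / k) ^+ 2 * k - 2 * (I / k) * I) by rewrite mulr_ge0 ?subr_ge0// ltW.
by rewrite (_ : k * _ = k * J - I ^+ 2) ?subr_ge0//; field; rewrite gt_eqF.
Qed.

End integral_tools.

Lemma ae_mono d (T : measurableType d) (R : realType)
  (mu : {measure set T -> \bar R}) (P Q : T -> Prop) :
 (forall x, P x -> Q x) -> {ae mu, forall x, P x} -> {ae mu, forall x, Q x}.
Proof. by move=> PQ; exact: filterS. Qed.

(** Partial integrals in Fubini's theorem are finite only almost everywhere; [fine] makes them
    real-valued without changing their integral. *)
Lemma integrable_fine d (T : measurableType d) (R : realType)
  (mu : {measure set T -> \bar R}) (D : set T) (f : T -> \bar R) :
 measurable D -> mu.-integrable D f ->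
 mu.-integrable D (fun x => (fine (f x))%:E) /\
 (\int[mu]_(x in D) (fine (f x))%:E = \int[mu]_(x in D) f x)%E.
Proof.
move=> mD fi; have mf := measurable_int _ fi.
have mff : measurable_fun D (fun x => (fine (f x))%:E).
 by apply/measurable_EFinP; apply: measurableT_comp.
split; last first.
 apply: ae_eq_integral => //.
 apply: filterS (integrable_ae mD fi) => x fx Dx; rewrite fineK//.
 exact: fx.
apply: le_integrable fi => // x Dx; case: (f x) => [r| |] //=.
 by rewrite normr0 leey.
by rewrite normr0 leey.
Qed.

(** * Functions whose integrals over quadrants vanish *)

Section ae_zero.
Context {R : realType}.
Notation leb := (@lebesgue_measure R).
Notation P := (mplane R).

(** [F x = 0] by continuity, and the difference quotients at [x] along rationals tending to [x] are
    all 0. *)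
Lemma derive_zero_on_rat (F : R -> R) (x l : R) : is_derive x 1 F l ->
 (forall q : rat, F (ratr q) = 0) -> l = 0.
Proof.
move=> dF F0; have cF := is_derive_continuous dF.
have rat_near (n : nat) : {q : rat | x < ratr q < x + n.+1%:R^-1}.
 apply: cid; have [|q] := @rat_in_itvoo R x (x + n.+1%:R^-1).
  by rewrite ltrDl invr_gt0.
 by rewrite in_itv/=; exists q.
pose r n : R := ratr (sval (rat_near n)).
have r1 n : x < r n < x + n.+1%:R^-1 by rewrite /r; case: (rat_near n).
have rx : r n @[n --> \oo] --> x.
 apply: (@squeeze_cvgr _ _ _ _ (cst x) (fun n => x + n.+1%:R^-1)).
 - by apply: nearW => n; have /andP[/ltW-> /ltW->] := r1 n.
 - exact: cvg_cst.
 - by rewrite -[X in _ --> X]addr0; apply: cvgD; [exact: cvg_cst|exact: cvg_harmonic].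
have Fx : F x = 0.
 apply: (@cvg_unique _ _ (F (r n) @[n --> \oo])); first exact: norm_hausdorff.
  exact: continuous_cvg.
 rewrite (_ : (fun n => _) = cst 0); first exact: cvg_cst.
 by apply/funext => n; exact: F0.
have [Fd FD] := dF.
have lim : h^-1 *: ((F \o shift x) (h *: (1 : R)) - F x) @[h --> 0^'] --> l.
 by rewrite -FD; exact: Fd.
apply: (@cvg_unique _ _ ((r n - x)^-1 *: ((F \o shift x) ((r n - x) *: (1 : R)) - F x) @[n --> \oo])).
- exact: norm_hausdorff.
- apply: (cvg_comp _ _ _ lim).
 move=> A /= [e /= e0 eA].
 have : \forall n \near \oo, `|x - r n| < e by move/cvgrPdist_lt : rx; exact.
 apply: filterS => n xr; apply: eA => /=; first by rewrite sub0r opprB.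
 by rewrite subr_eq0 gt_eqF//; have /andP[] := r1 n.
- rewrite (_ : (fun n => _) = cst 0); first exact: cvg_cst.
 apply/funext => n; rewrite /= Fx subr0 /GRing.scale/= mulr1 subrK.
 by rewrite /r F0 mulr0.
Qed.

(** The primitive of [f] vanishes at every rational, and by Lebesgue's theorem its derivative is [f]
    at almost every point. *)
Lemma ae_zero_line (f : R -> R) : leb.-integrable [set: R] (EFin \o f) ->
 (forall q : rat, \int[leb]_(x in `]-oo, (ratr q : R)[) f x = 0) ->
 {ae leb, forall x, f x = 0}.
Proof.
move=> fi f0.
have fiy (y : R) : leb.-integrable `]-oo, y] (EFin \o f) by exact: integrableS fi.
have locf : locally_integrable [set: R] f.
 by apply: open_integrable_locally => //; exact: openT.
have H := @FTC1 R f -oo%O fiy locf.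
move: H => /=; apply: (@ae_mono _ (mline R)) => x /(_ (ltNyr _)) [Fd FD].
rewrite derive1E in FD.
apply: (@derive_zero_on_rat _ x (f x)); first by split; [exact: Fd|exact: FD].
by move=> q /=; rewrite -Rintegral_itv_bndo_bndc ?f0//; exact: integrableS fi.
Qed.

(** The line case is used twice. For a fixed rational [q] it shows that the integral of [f (x, .)]
    below [q] vanishes for almost every [x]. The countably many [q] share one null set, off which
    the line case applies to the slice. *)
Lemma ae_zero_plane (f : P -> R) : (leb2 R).-integrable [set: P] (EFin \o f) ->
 (forall a c : R, (\int[leb2 R]_x
   (f x * (\1_(`]-oo, a[%classic) x.1 * \1_(`]-oo, c[%classic) x.2))%:E = 0)%E) ->
 {ae leb2 R, forall x, f x = 0}.
Proof.
move=> fi f0.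
have mf : mfun P f by apply/measurable_EFinP; exact: measurable_int fi.
have half_plane (q : rat) : {ae leb, forall x,
  \int[leb]_(y in `]-oo, (ratr q : R)[) f (x, y) = 0}.
 pose g (x : P) := f x * \1_(`]-oo, (ratr q : R)[%classic) x.2.
 have mind : mfun P (fun x : P => \1_(`]-oo, (ratr q : R)[%classic) x.2 : R).
  by apply: measurableT_comp => //; exact: measurable_indic.
 have gi : (leb2 R).-integrable [set: P] (EFin \o g).
  apply: le_integrable fi => //.
   by apply/measurable_EFinP; exact: measurable_funM.
  move=> x _ /=; rewrite lee_fin /g normrM indicE.
  by case: (_ \in _); rewrite ?normr1 ?normr0 ?mulr1 ?mulr0.
 have GE (x : R) : (\int[leb]_y (g (x, y))%:E = \int[leb]_(y in `]-oo, (ratr q : R)[) (f (x, y))%:E)%E.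
  by rewrite [RHS]integral_mkcond epatch_indic; apply: eq_integral => y _; rewrite EFinM.
 have [Gi GI] := integrable_fine measurableT (integrable_fubini_F gi).
 pose G (x : R) := fine (fubini_F leb (EFin \o g) x).
 have Gae := @ae_zero_line G Gi.
 have {}Gae : {ae leb, forall x, G x = 0}.
  apply: Gae => p; rewrite /Rintegral integral_mkcond.
  pose k (x : P) := g x * \1_(`]-oo, (ratr p : R)[%classic) x.1.
  have mind1 : mfun P (fun x : P => \1_(`]-oo, (ratr p : R)[%classic) x.1 : R).
   by apply: measurableT_comp => //; exact: measurable_indic.
  have ki : (leb2 R).-integrable [set: P] (EFin \o k).
   apply: le_integrable gi => //.
    by apply/measurable_EFinP; apply: measurable_funM => //; exact: measurable_funM.
   move=> x _ /=; rewrite lee_fin /k normrM [in X in _ * X]indicE.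
   by case: (_ \in _); rewrite ?normr1 ?normr0 ?mulr1 ?mulr0.
  have [_ KI] := integrable_fine measurableT (integrable_fubini_F ki).
  have := integral12_prod_meas1 ki; rewrite -KI.
  have -> : (\int[leb2 R]_x (EFin \o k) x = 0)%E.
   rewrite -[RHS](f0 (ratr p) (ratr q)); apply: eq_integral => x _ /=.
   by congr (_%:E); rewrite /k /g; ring.
  move=> K0; rewrite [X in fine X](_ : _ = 0%E)// -[RHS]K0.
  apply: eq_integral => x _; rewrite patchE /fubini_F /k/= indicE.
  case: ifPn => [_|_]; last first.
   by rewrite integral0_eq// => y _; rewrite mulr0.
  by congr (fine _)%:E; apply: eq_integral => y _; rewrite mulr1.
 move: Gae; apply: (@ae_mono _ (mline R)) => x; rewrite /G /fubini_F /Rintegral => <-.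
 by congr fine; rewrite GE.
have all_half : {ae leb, forall x, forall q : rat,
  \int[leb]_(y in `]-oo, (ratr q : R)[) f (x, y) = 0}.
 have := @ae_foralln _ _ _ leb (fun n x => if unpickle n is Some q then
  \int[leb]_(y in `]-oo, (ratr (q : rat) : R)[) f (x, y) = 0 else True).
 have H n : {ae leb, forall x, if unpickle n is Some q then
  \int[leb]_(y in `]-oo, (ratr (q : rat) : R)[) f (x, y) = 0 else True}.
  by case: (unpickle n) => [q|]; [exact: half_plane|exact: aeW].
 move=> /(_ H); apply: (@ae_mono _ (mline R)) => x xn q.
 by have := xn (pickle q); rewrite pickleK.
have slice : {ae leb, forall x, leb.-integrable [set: R] (fun y => (f (x, y))%:E)}.
 exact: (ae_integrable1 fi).
have zero_slice : {ae leb, forall x, (\int[leb]_y `|(f (x, y))%:E| = 0)%E}.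
 apply: filterS2 all_half slice => x xq xi.
 apply/ae_eq_integral_abs => //; first exact: measurable_int xi.
 move: (ae_zero_line xi xq); apply: (@ae_mono _ (mline R)) => y fy _.
 by rewrite fy.
have fabs : (\int[leb2 R]_x `|(f x)%:E| = 0)%E.
 rewrite (fubini_tonelli1 (fun x => `|(f x)%:E|%E))//; last first.
  by apply: measurableT_comp => //; exact/measurable_EFinP.
 rewrite [RHS](_ : _ = \int[leb]_(x in [set: R]) cst 0 x)%E; last by rewrite integral0.
 apply: ae_eq_integral => //.
  apply: measurable_fun_fubini_tonelli_F => //.
  by apply: measurableT_comp => //; exact/measurable_EFinP.
 by apply: filterS zero_slice => x.
have /ae_eq_integral_abs := fabs; move=> /(_ measurableT).
rewrite /ae_eq; move=> H.
have {}H := H (measurable_int _ fi).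
by apply: filterS H => x /(_ I) [].
Qed.

End ae_zero.

Section area.
Context {R : realType}.
Notation P := (mplane R).

(* The library attaches to [product_measure1] only the sigma-finiteness of
  products of subprobabilities; this alias carries the one of [leb2]. *)
Definition area : set P -> \bar R := leb2 R.

HB.instance Definition _ := Measure.on area.

Let area_sigma_finite : sigma_finite [set: P] area.
Proof.
exists (fun n => box (- n%:R) n%:R (- n%:R) (n%:R : R)).
 apply/esym; rewrite -subTset => x _.
 pose M := `|x.1| + `|x.2|.
 have [n nM] : exists n : nat, M < n%:R.
  by exists (Num.bound M); rewrite archi_boundP ?addr_ge0.
 exists n => //; rewrite /box /= !in_itv/= -!ltr_norml.
 by rewrite !(le_lt_trans _ nM)// /M ?lerDl ?lerDr.
move=> n; split; first exact: measurable_box.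
have n0 : - n%:R <= (n%:R : R) by rewrite -subr_ge0 opprK addr_ge0.
by rewrite /area leb2_box// ltry.
Qed.

HB.instance Definition _ := Measure_isSigmaFinite.Build _ _ _ area area_sigma_finite.

End area.

(** * L^2 modulus of continuity under translations *)

Section translation_estimate.
Context {R : realType}.
Notation leb := (@lebesgue_measure R).
Notation P := (mplane R).
Implicit Types (u h : P -> R) (v : P).

Lemma measurable_tr2 v : measurable_fun [set: P * mline R]
 (fun z : P * mline R => tr v z.2 z.1).
Proof.
apply: measurable_fun_pair; apply: measurable_funD.
- by apply: measurableT_comp => //; exact: measurableT_comp.
- by apply: measurable_funM.
- by apply: measurableT_comp => //; exact: measurableT_comp.
- by apply: measurable_funM.
Qed.

Lemma integrable_strip (F : P * mline R -> R) (c t : R) : 0 < t ->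
 measurable_fun [set: P * mline R] F ->
 (forall s, \int[leb2 R]_x `|(F (x, s))%:E| <= (c * \1_(`[0, t]%classic) s)%:E)%E ->
 (@area R \x leb)%E.-integrable [set: P * mline R] (EFin \o F).
Proof.
move=> t0 mF Fc; have mF' : measurable_fun setT (EFin \o F) by exact/measurable_EFinP.
have [_] := @integrable21ltyP _ _ P (mline R) R (@area R) leb _ mF'; apply.
apply: (@le_lt_trans _ _ (\int[leb]_s (c * \1_(`[0%R, t]%classic) s)%:E)%E).
 apply: ge0_le_integral => //.
 - by move=> s _; exact: integral_ge0.
 - apply: (@measurable_fun_fubini_tonelli_G _ _ P (mline R) R (@area R) (fun z => `|(F z)%:E|%E)) => //.
  exact: measurableT_comp.
 - by apply/measurable_EFinP; apply: measurable_funM => //; exact: measurable_indic.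
 - by move=> s _; exact: Fc.
have c0 : 0 <= c.
 have := Fc 0; rewrite indicE mem_set/= ?in_itv/= ?lexx ?(ltW t0)// mulr1.
 by rewrite -lee_fin; apply: le_trans; exact: integral_ge0.
under eq_integral do rewrite EFinM.
rewrite ge0_integralZl//; last first.
 by apply/measurable_EFinP; exact: measurable_indic.
by rewrite integral_indic// setIT lte_mul_pinfty// ?lee_fin// leb_itvcc_lty.
Qed.

Variables (v : P) (u h : P -> R) (t : R).
Hypotheses (cv : coord_dir v) (wu : weak_partial v u h) (t0 : 0 < t).
Hypotheses (uL : u \in Lfun (leb2 R) 2%:E) (hL : h \in Lfun (leb2 R) 2%:E).

Let mu := Lfun2_measurable uL.
Let mh := Lfun2_measurable hL.
Let mI : mfun (mline R) (\1_(`[0, t]%classic) : R -> R).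
Proof. exact: measurable_indic. Qed.

Section on_box.
Variables (a b c d : R).
Hypotheses (ab : a <= b) (cd : c <= d).
Let B := box a b c d.
Let mB : measurable B. Proof. exact: measurable_box. Qed.
Let m1B : mfun P (\1_B : P -> R). Proof. exact: measurable_indic. Qed.

Let hB s : (leb2 R).-integrable [set: P] (fun x => (h x * \1_B (tr v (- s) x))%:E).
Proof.
have mtB : mfun P (fun x : P => \1_B (tr v (- s) x) : R).
 by apply: measurableT_comp => //; exact: measurable_tr.
apply: (@Lfun2_integrable_bounded _ h _ 1 (tr v (- s) @^-1` B) hL mtB).
- by rewrite -[X in measurable X]setTI; exact: measurable_tr.
- by rewrite leb2_tr_preimage// leb2_box// ltry.
- by move=> x; rewrite mul1r ger0_norm.
Qed.

Let hBs s : (\int[leb2 R]_x `|(h (tr v s x) * \1_B x)%:E| = \int[leb2 R]_x `|(h x * \1_B (tr v (- s) x))%:E|)%E.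
Proof.
rewrite -(ge0_integral_tr v s (f := fun x => `|(h x * \1_B (tr v (- s) x))%:E|%E))//.
 by apply: eq_integral => x _; rewrite trK.
by apply: measurableT_comp => //; exact: measurable_int (hB s).
Qed.

Let hBc : exists c, forall s, (\int[leb2 R]_x `|(h x * \1_B (tr v (- s) x))%:E| <= c%:E)%E.
Proof.
exists (fine (\int[leb2 R]_x (h x ^+ 2)%:E) + (b - a) * (d - c))%R => s.
have h2 := Lfun2_integrable_sqr hL.
rewrite EFinD fineK; last exact: integrable_fin_num h2.
rewrite -leb2_box// -(leb2_tr_preimage v (- s) mB).
have mtB : measurable (tr v (- s) @^-1` B).
 by rewrite -[X in measurable X]setTI; exact: measurable_tr.
have := integral_indic (leb2 R) measurableT mtB; rewrite setIT => <-.
rewrite -ge0_integralD//; last 3 first.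
- by move=> x _; rewrite lee_fin sqr_ge0.
- exact: measurable_int h2.
- by apply/measurable_EFinP; exact: measurable_indic.
apply: ge0_le_integral => //.
- by apply: measurableT_comp => //; exact: measurable_int (hB s).
- apply: emeasurable_funD; first exact: measurable_int h2.
 by apply/measurable_EFinP; exact: measurable_indic.
move=> x _; rewrite -EFinD lee_fin (_ : \1_(tr v (- s) @^-1` B) x = \1_B (tr v (- s) x) :> R)//.
rewrite normrM indicE; case: (_ \in _) => /=; last by rewrite normr0 mulr0 addr0 sqr_ge0.
by rewrite normr1 mulr1 -(real_normK (num_real (h x))); move: `|h x| (normr_ge0 (h x)) => y y0; nra.
Qed.

Let F (z : P * mline R) := h (tr v z.2 z.1) * \1_B z.1 * \1_(`[0, t]%classic) z.2.
Let G (z : P * mline R) := h z.1 * \1_B (tr v (- z.2) z.1) * \1_(`[0, t]%classic) z.2.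

Let FG_bound (H : P * mline R -> R) (k : P -> R -> R) :
 (forall x s, H (x, s) = k x s * \1_(`[0, t]%classic) s) ->
 (forall s, (\int[leb2 R]_x `|(k x s)%:E| = \int[leb2 R]_x `|(h x * \1_B (tr v (- s) x))%:E|)%E) ->
 measurable_fun [set: P * mline R] H ->
 (@area R \x leb)%E.-integrable [set: P * mline R] (EFin \o H).
Proof.
move=> Hk kE mH; have [C hC] := hBc; apply: (@integrable_strip _ C t) => // s.
under eq_integral do rewrite Hk.
rewrite indicE; case: (_ \in _) => /=.
 by rewrite mulr1; under eq_integral do rewrite mulr1; rewrite kE.
by rewrite mulr0; under eq_integral do rewrite mulr0 normr0; rewrite integral0.
Qed.

Let iF : (@area R \x leb)%E.-integrable [set: P * mline R] (EFin \o F).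
Proof.
apply: (@FG_bound F (fun x s => h (tr v s x) * \1_B x)) => //.
apply: measurable_funM; last exact: measurableT_comp.
apply: measurable_funM; last exact: measurableT_comp.
by apply: measurableT_comp => //; exact: measurable_tr2.
Qed.

Let iG : (@area R \x leb)%E.-integrable [set: P * mline R] (EFin \o G).
Proof.
apply: (@FG_bound G (fun x s => h x * \1_B (tr v (- s) x))) => //.
apply: measurable_funM; last exact: measurableT_comp.
apply: measurable_funM; first exact: measurableT_comp.
apply: measurableT_comp => //.
have mneg : measurable_fun [set: P * mline R]
  (fun z : P * mline R => (z.1, - z.2) : P * mline R).
 by apply: measurable_fun_pair => //; exact: measurableT_comp.
exact: (measurableT_comp (measurable_tr2 v) mneg).
Qed.

Let k (x : P) : R := \int[leb]_(s in `[0, t]) h (tr v s x).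

(** Exchange the integrals over the plane and over [[0, t]], then translate by [s v]: integrating
    [h] along segments that start in the box is dual to the time spent in the box. *)
Lemma line_integral_box :
 (leb2 R).-integrable [set: P] (fun x => (k x * \1_B x)%:E) /\
 (\int[leb2 R]_x (k x * \1_B x)%:E = \int[leb2 R]_x (h x * sweep v t B x)%:E)%E.
Proof.
have [iFf FE] := integrable_fine measurableT (integrable_fubini_F iF).
have [iGf GE] := integrable_fine measurableT (integrable_fubini_F iG).
have kE x : fine (fubini_F leb (EFin \o F) x) = k x * \1_B x.
 rewrite /fubini_F /k /Rintegral /F /=; rewrite [in RHS]integral_mkcond epatch_indic.
 rewrite [in RHS]indicE; case: (boolP (x \in B)) => xB /=; rewrite ?mulr1 ?mulr0.
  by congr fine; apply: eq_integral => s _; rewrite indicE xB mulr1 EFinM.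
 by rewrite integral0_eq// => s _; rewrite indicE (negbTE xB) mulr0 mul0r.
have sE x : fine (fubini_F leb (EFin \o G) x) = h x * sweep v t B x.
 rewrite /fubini_F /sweep -RintegralZl//; last first.
  apply: (@measurable_bounded_integrable _ _ _ leb (fun s => \1_B (tr v (- s) x))) => //.
  - exact: leb_itvcc_lty.
  - apply: measurable_funTS; apply: measurableT_comp => //.
   by apply: measurable_fun_pair => //=; apply: measurable_funD => //; apply: measurable_funM => //; exact: measurableT_comp.
  - exists 1; split; first exact: num_real.
   by move=> M M1 s _; rewrite /= indicE; case: (_ \in _); rewrite ?normr1 ?normr0 ltW// (lt_trans ltr01).
 rewrite /Rintegral [in RHS]integral_mkcond epatch_indic; congr fine.
split; first by apply: eq_integrable iFf => // x _; rewrite kE.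
rewrite -(eq_integral _ _ (fun x _ => congr1 EFin (kE x))) FE.
rewrite -(eq_integral _ _ (fun x _ => congr1 EFin (sE x))) GE.
rewrite (integral12_prod_meas1 iF) (integral12_prod_meas1 iG).
rewrite -(integral21_prod_meas1 iF) -(integral21_prod_meas1 iG).
apply: eq_integral => s _; rewrite /fubini_G /F /G /=.
have := integral_tr v s (hB s).
rewrite indicE; case: (_ \in _) => /= H.
 under eq_integral do rewrite mulr1.
 under [RHS]eq_integral do rewrite mulr1.
 by rewrite -H; apply: eq_integral => x _; rewrite trK.
under eq_integral do rewrite mulr0.
by under [RHS]eq_integral do rewrite mulr0.
Qed.

Lemma line_integrable_ae : {ae leb2 R, forall x, B x ->
 leb.-integrable `[0, t] (fun s => (h (tr v s x))%:E)}.
Proof.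
move: (ae_integrable1 iF); apply: ae_mono => x xi Bx.
have xi' : leb.-integrable `[0%R, t] (fun s => (F (x, s))%:E) by exact: integrableS xi.
apply: eq_integrable xi' => // s; rewrite inE/= => st.
by rewrite /F/= !indicE !mem_set//= !mulr1.
Qed.

Lemma translate_box : (leb2 R).-integrable [set: P] (fun x => ((u (tr v t x) - u x) * \1_B x)%:E) /\
 (\int[leb2 R]_x ((u (tr v t x) - u x) * \1_B x)%:E =
  \int[leb2 R]_x (h x * sweep v t B x)%:E)%E.
Proof.
have H := weak_partial_box cv wu uL hL t0 ab cd.
have mtB : mfun P (fun x : P => \1_B (tr v (- t) x) : R).
 by apply: measurableT_comp => //; exact: measurable_tr.
have i1 : (leb2 R).-integrable [set: P] (fun x => (u x * \1_B (tr v (- t) x))%:E).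
 apply: (@Lfun2_integrable_bounded _ u _ 1 (tr v (- t) @^-1` B) uL mtB).
 - by rewrite -[X in measurable X]setTI; exact: measurable_tr.
 - by rewrite leb2_tr_preimage// leb2_box// ltry.
 - by move=> x; rewrite mul1r ger0_norm.
have i2 : (leb2 R).-integrable [set: P] (fun x => (u x * \1_B x)%:E).
 apply: (@Lfun2_integrable_bounded _ u _ 1 B uL m1B mB); first by rewrite leb2_box// ltry.
 by move=> x; rewrite mul1r ger0_norm.
have i3 : (leb2 R).-integrable [set: P] (fun x => (u (tr v t x) * \1_B x)%:E).
 by apply: eq_integrable (integrable_tr v t i1) => // x _; rewrite /= trK.
have E3 : (\int[leb2 R]_x (u (tr v t x) * \1_B x)%:E = \int[leb2 R]_x (u x * \1_B (tr v (- t) x))%:E)%E.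
 by rewrite -(integral_tr v t i1); apply: eq_integral => x _; rewrite trK.
have -> : (fun x => ((u (tr v t x) - u x) * \1_B x)%:E) =
 (fun x => (u (tr v t x) * \1_B x)%:E - (u x * \1_B x)%:E)%E.
 by apply/funext => x; rewrite mulrBl EFinB.
split; first exact: integrableB.
have E4 : (\int[leb2 R]_x (u x * (\1_B x - \1_B (tr v (- t) x)))%:E =
  \int[leb2 R]_x (u x * \1_B x)%:E - \int[leb2 R]_x (u x * \1_B (tr v (- t) x))%:E)%E.
 by rewrite -integralB//; apply: eq_integral => x _; rewrite mulrBr EFinB.
rewrite integralB// E3; move: H; rewrite -/B E4 => /(congr1 oppe); rewrite oppeK => <-.
have flip (x y : \bar R) : x \is a fin_num -> y \is a fin_num -> (x - y = - (y - x))%E.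
 by move=> xf yf; rewrite fin_num_oppeB// addeC.
by apply: flip; apply: integrable_fin_num.
Qed.

End on_box.

(** The increment of [u] from [x] to [x + t v] and the integral of [h] along that segment have the
    same integral over every box, hence agree almost everywhere. Cauchy-Schwarz on [[0, t]] gives
    the bound. *)
Lemma translate_ae : {ae leb2 R, forall x,
 (((u (tr v t x) - u x) ^+ 2)%:E <= t%:E * \int[leb]_(s in `[0%R, t]) (h (tr v s x) ^+ 2)%:E)%E}.
Proof.
pose k (x : P) : R := \int[leb]_(s in `[0, t]) h (tr v s x).
pose Q (n : nat) := box (- n%:R) n%:R (- n%:R) (n%:R : R).
have Qn n : {ae leb2 R, forall x, Q n x ->
  (((u (tr v t x) - u x) ^+ 2)%:E <= t%:E * \int[leb]_(s in `[0%R, t]) (h (tr v s x) ^+ 2)%:E)%E}.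
 have n0 : - n%:R <= (n%:R : R) by rewrite -subr_ge0 opprK addr_ge0.
 pose f (x : P) := (u (tr v t x) - u x - k x) * \1_(Q n) x.
 have fB (a b c d : R) : a <= b -> c <= d ->
   (leb2 R).-integrable [set: P] (fun x => ((u (tr v t x) - u x - k x) * \1_(box a b c d) x)%:E) /\
   (\int[leb2 R]_x ((u (tr v t x) - u x - k x) * \1_(box a b c d) x)%:E = 0)%E.
  move=> ab cd; have [i1 e1] := translate_box ab cd; have [i2 e2] := line_integral_box ab cd.
  have -> : (fun x => ((u (tr v t x) - u x - k x) * \1_(box a b c d) x)%:E) =
   (fun x => ((u (tr v t x) - u x) * \1_(box a b c d) x)%:E - (k x * \1_(box a b c d) x)%:E)%E.
   by apply/funext => x; rewrite mulrBl EFinB.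
  split; first exact: integrableB.
  by rewrite integralB// e1 e2 subee// -e1; exact: integrable_fin_num.
 have f0 : {ae leb2 R, forall x, f x = 0}.
  apply: ae_zero_plane; first exact: (fB _ _ _ _ n0 n0).1.
  (* [cut] moves the corner of a quadrant into [[- n, n]], so that the quadrant meets [Q n] in a
     box, possibly an empty one. *)
  move=> a c; pose cut (a : R) := Num.max (- n%:R) (Num.min a n%:R).
  have cn (a' : R) : - n%:R <= cut a' by rewrite /cut le_max lexx.
  rewrite -(fB _ _ _ _ (cn a) (cn c)).2; apply: eq_integral => x _; congr (_%:E).
  rewrite /f -mulrA; congr (_ * _).
  rewrite !indicE -!natrM !mulnb; congr (nat_of_bool _)%:R.
  apply/idP/idP.
   move=> /andP[/set_mem [/=]]; rewrite !in_itv/= => /andP[h1 h2] /andP[h3 h4].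
   move=> /andP[/set_mem/= + /set_mem/=]; rewrite !in_itv/= => h5 h6.
   by apply/mem_set; split; rewrite /= in_itv/= /cut !lt_max !lt_min ?h1 ?h2 ?h3 ?h4 ?h5 ?h6 !orbT.
  move=> /set_mem [/=]; rewrite !in_itv/= /cut !lt_max !lt_min => /andP[h1 h2] /andP[h3 h4].
  move: h2 h4; rewrite !(ltNge _ (- n%:R)) (ltW h1) (ltW h3)/= => /andP[h5 h6] /andP[h7 h8].
  apply/andP; split; first by apply/mem_set; split; rewrite /= in_itv/= ?h1 ?h3 ?h6 ?h8.
  by apply/andP; split; apply/mem_set; rewrite /= in_itv/=.
 have := line_integrable_ae n0 n0; move: f0; apply: filterS2 => x fx0 xi Qx.
 have := xi Qx => {}xi.
 have -> : u (tr v t x) - u x = k x.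
  apply/eqP; rewrite -subr_eq0; move: fx0; rewrite /f indicE mem_set// mulr1 => ->.
  by [].
 apply: sqr_Rintegral_le => //.
 by rewrite /= leb_itvcc ?subr0// ltW.
have := @ae_foralln _ _ _ (leb2 R) _ Qn; apply: ae_mono => x Hx.
pose M := `|x.1| + `|x.2|.
have [n nM] : exists n : nat, M < n%:R.
 by exists (Num.bound M); rewrite archi_boundP ?addr_ge0.
apply: (Hx n); rewrite /Q /box /= !in_itv/= -!ltr_norml.
by rewrite !(le_lt_trans _ nM)// /M ?lerDl ?lerDr.
Qed.

(** Integrate the pointwise bound and exchange the integrals: all translates of [h ^+ 2] have the
    same integral, so [[0, t]] contributes the second factor [t]. *)
Lemma translate_L2 : (\int[leb2 R]_x ((u (tr v t x) - u x) ^+ 2)%:E <=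
 (t ^+ 2)%:E * \int[leb2 R]_x (h x ^+ 2)%:E)%E.
Proof.
pose H (z : P * mline R) := ((h (tr v z.2 z.1) ^+ 2)%:E * (\1_(`[0, t]%classic) z.2)%:E)%E.
have mH : measurable_fun [set: P * mline R] H.
 apply: emeasurable_funM; last by apply/measurable_EFinP; exact: measurableT_comp.
 apply/measurable_EFinP; apply: measurable_funX.
 by apply: measurableT_comp => //; exact: measurable_tr2.
have H0 z : (0 <= H z)%E by rewrite /H mule_ge0// lee_fin ?sqr_ge0.
have HE x : (\int[leb]_(s in `[0%R, t]) (h (tr v s x) ^+ 2)%:E = \int[leb]_s H (x, s))%E.
 by rewrite integral_mkcond epatch_indic.
apply: (@le_trans _ _ (\int[leb2 R]_x (t%:E * \int[leb]_s H (x, s)))%E).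
 apply: ae_ge0_le_integral => //.
 - by move=> x _; rewrite lee_fin sqr_ge0.
 - apply/measurable_EFinP; apply: measurable_funX; apply: measurable_funB => //.
  by apply: measurableT_comp => //; exact: measurable_tr.
 - by move=> x _; rewrite mule_ge0 ?lee_fin ?(ltW t0)//; exact: integral_ge0.
 - apply: measurable_funeM; exact: (@measurable_fun_fubini_tonelli_F _ _ P (mline R) R leb H mH).
 - by move: translate_ae; apply: ae_mono => x + _; rewrite HE.
rewrite ge0_integralZl//; last 3 first.
- exact: (@measurable_fun_fubini_tonelli_F _ _ P (mline R) R leb H mH).
- by move=> x _; exact: integral_ge0.
- by rewrite lee_fin ltW.
rewrite (@fubini_tonelli _ _ P (mline R) R (@area R) leb H)//.
have -> : (\int[leb]_s \int[leb2 R]_x H (x, s) = \int[leb]_s ((\int[leb2 R]_x (h x ^+ 2)%:E) * (\1_(`[0%R, t]%classic) s)%:E))%E.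
 apply: eq_integral => s _; rewrite /H/= ge0_integralZr//; last 2 first.
 - apply/measurable_EFinP; apply: measurable_funX; apply: measurableT_comp => //; exact: measurable_tr.
 - by move=> x _; rewrite lee_fin sqr_ge0.
 by rewrite (ge0_integral_tr v s (f := fun x => (h x ^+ 2)%:E))//;
  [apply/measurable_EFinP; exact: measurable_funX|move=> x; rewrite lee_fin sqr_ge0].
rewrite ge0_integralZl//; last 2 first.
- by apply/measurable_EFinP.
- by apply: integral_ge0 => x _; rewrite lee_fin sqr_ge0.
have T : leb `[0%R, t]%classic = t%:E by rewrite leb_itvcc ?subr0 ?ltW.
rewrite integral_indic// setIT [X in (_ * (_ * X))%E](_ : _ = t%:E)//.
by rewrite muleCA -EFinM muleC -expr2.
Qed.

End translation_estimate.

(** * Averages over small squares *)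

Section box_average.
Context {R : realType}.
Notation leb := (@lebesgue_measure R).
Notation P := (mplane R).
Implicit Types (u h : P -> R) (v : P).

(** Cauchy-Schwarz as a weighted Young inequality. The weight [k] will be a power of the step,
    chosen so that both terms have the same order. *)
Lemma abs_integral_mul_le (h psi : P -> R) (k H K : R) : 0 < k ->
 mfun P h -> mfun P psi ->
 (\int[leb2 R]_x (h x ^+ 2)%:E <= H%:E)%E ->
 (\int[leb2 R]_x (psi x ^+ 2)%:E <= K%:E)%E ->
 `|\int[leb2 R]_x (h x * psi x)| <= k / 2 * H + K / (2 * k).
Proof.
move=> k0 mh mpsi hH psiK.
have mhp : mfun P (fun x => h x * psi x) by exact: measurable_funM.
have sqm (f : P -> R) : mfun P f -> mfun P (fun x => (f x ^+ 2)%:E).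
 by move=> mf; apply/measurable_EFinP; exact: measurable_funX.
have le1 : (\int[leb2 R]_x `|(h x * psi x)%:E| <= (k / 2 * H + K / (2 * k))%:E)%E.
 apply: (@le_trans _ _ (\int[leb2 R]_x ((k / 2)%:E * (h x ^+ 2)%:E + ((2 * k)^-1)%:E * (psi x ^+ 2)%:E))%E).
  apply: ge0_le_integral => //.
  - by apply: measurableT_comp => //; exact/measurable_EFinP.
  - by apply: emeasurable_funD; apply: measurable_funeM; exact: sqm.
  - move=> x _; rewrite -!EFinM -EFinD lee_fin normrM.
   rewrite -(real_normK (num_real (h x))) -(real_normK (num_real (psi x))).
   move: `|h x| `|psi x| => a b.
   have : 0 <= (k * a - b) ^+ 2 / (2 * k) by rewrite divr_ge0 ?sqr_ge0// mulr_ge0// ltW.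
   rewrite (_ : _ / _ = k / 2 * a ^+ 2 + (2 * k)^-1 * b ^+ 2 - a * b) ?subr_ge0//.
   by field; rewrite gt_eqF.
 have k2 : 0 <= k / 2 by rewrite divr_ge0// ltW.
 have k3 : 0 <= (2 * k)^-1 by rewrite invr_ge0 mulr_ge0// ltW.
 rewrite ge0_integralD//; last 4 first.
 - by move=> x _; rewrite -EFinM lee_fin mulr_ge0 ?sqr_ge0.
 - by apply: measurable_funeM; exact: sqm.
 - by move=> x _; rewrite -EFinM lee_fin mulr_ge0 ?sqr_ge0.
 - by apply: measurable_funeM; exact: sqm.
 rewrite !ge0_integralZl//; last 4 first.
 - exact: sqm.
 - by move=> x _; rewrite lee_fin sqr_ge0.
 - exact: sqm.
 - by move=> x _; rewrite lee_fin sqr_ge0.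
 rewrite EFinD; apply: leeD.
  by rewrite [X in (_ <= X)%E]EFinM lee_wpmul2l// lee_fin.
 by rewrite (mulrC K) [X in (_ <= X)%E]EFinM lee_wpmul2l// lee_fin.
have ihp : (leb2 R).-integrable [set: P] (EFin \o (fun x => h x * psi x)).
 apply/integrableP; split; first exact/measurable_EFinP.
 exact: le_lt_trans le1 (ltry _).
apply: le_trans (le_normr_Rintegral measurableT ihp) _.
rewrite /Rintegral -lee_fin fineK//; apply: integrable_fin_num => //.
exact: integrable_abse ihp.
Qed.

Lemma measurable_marginal (S : set P) (w : P * P -> R) : measurable S ->
 measurable_fun [set: P * P] w ->
 mfun P (fun x => \int[leb2 R]_(y in S) w (x, y)).
Proof.
move=> mS mw; pose W z := ((w z)%:E * (\1_S z.2)%:E)%E.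
have -> : (fun x => \int[leb2 R]_(y in S) w (x, y)) = fun x => fine (\int[leb2 R]_y W (x, y))%E.
 by apply/funext => x; rewrite /Rintegral integral_mkcond epatch_indic.
have mW : measurable_fun [set: P * P] W.
 apply: emeasurable_funM; apply/measurable_EFinP => //.
 by apply: measurableT_comp => //; exact: measurable_indic.
apply: measurableT_comp => //.
rewrite (_ : (fun x => _) = (fun x => \int[leb2 R]_y (W^\+ (x, y)) - \int[leb2 R]_y (W^\- (x, y)))%E); last first.
 apply/funext => x; rewrite integralE; congr (_ - _)%E; apply: eq_integral => y _.
  by rewrite !funeposE.
 by rewrite !funenegE.
apply: emeasurable_funB.
 apply: (@measurable_fun_fubini_tonelli_F _ _ P P R (@area R)) => //.
 exact: measurable_funepos.
apply: (@measurable_fun_fubini_tonelli_F _ _ P P R (@area R)) => //.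
exact: measurable_funeneg.
Qed.

Section mean.
Variables (S : set P) (k c : R) (w : P * P -> R).
Hypotheses (mS : measurable S) (k0 : 0 < k) (Sk : leb2 R S = k%:E).
Hypotheses (mw : measurable_fun [set: P * P] w).
Hypothesis iw : forall x, (leb2 R).-integrable S (fun y => (w (x, y))%:E).
Hypothesis wc : forall y, S y -> (\int[leb2 R]_x (w (x, y) ^+ 2)%:E <= c%:E)%E.

(** Jensen's inequality for the mean over [S], followed by Tonelli. *)
Lemma mean_L2 :
 (\int[leb2 R]_x ((k^-1 * \int[leb2 R]_(y in S) w (x, y)) ^+ 2)%:E <= c%:E)%E.
Proof.
pose H (z : P * P) := ((w z ^+ 2)%:E * (\1_S z.2)%:E)%E.
have mH : measurable_fun [set: P * P] H.
 apply: emeasurable_funM; apply/measurable_EFinP; first exact: measurable_funX.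
 by apply: measurableT_comp => //; exact: measurable_indic.
have H0 z : (0 <= H z)%E by rewrite /H mule_ge0// lee_fin ?sqr_ge0.
have mHF := @measurable_fun_fubini_tonelli_F _ _ P P R (@area R) H mH.
have HE x : (\int[leb2 R]_(y in S) (w (x, y) ^+ 2)%:E = \int[leb2 R]_y H (x, y))%E.
 by rewrite integral_mkcond epatch_indic.
have k1 : 0 <= k^-1 by rewrite invr_ge0 ltW.
apply: (@le_trans _ _ (\int[leb2 R]_x ((k^-1)%:E * \int[leb2 R]_y H (x, y)))%E).
 apply: ge0_le_integral => //.
 - by move=> x _; rewrite lee_fin sqr_ge0.
 - apply/measurable_EFinP; apply: measurable_funX; apply: measurable_funM => //.
  exact: measurable_marginal.
 - by apply: measurable_funeM; exact: mHF.
 - move=> x _; rewrite exprMn EFinM -HE.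
  have J := sqr_Rintegral_le mS k0 Sk (iw x).
  apply: (@le_trans _ _ ((k^-1 ^+ 2)%:E * (k%:E * \int[leb2 R]_(y in S) (w (x, y) ^+ 2)%:E))%E).
   by rewrite lee_wpmul2l// lee_fin sqr_ge0.
  by rewrite muleA -EFinM expr2 mulfVK ?gt_eqF.
rewrite ge0_integralZl//; last 2 first.
- exact: mHF.
- by move=> x _; exact: integral_ge0.
rewrite [X in (_ * X)%E](@fubini_tonelli _ _ P P R (@area R) (@area R) H)//.
apply: (@le_trans _ _ ((k^-1)%:E * \int[leb2 R]_y (c%:E * (\1_S y)%:E))%E).
 rewrite lee_wpmul2l ?lee_fin//; apply: ge0_le_integral => //.
 - by move=> y _; exact: integral_ge0.
 - exact: (@measurable_fun_fubini_tonelli_G _ _ P P R (@area R) H mH).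
 - by apply: measurable_funeM; apply/measurable_EFinP; exact: measurable_indic.
 - move=> y _; rewrite /H/=.
  have [yS|yS] := pselect (S y).
   rewrite indicE mem_set//= mule1; under eq_integral do rewrite mule1.
   exact: wc.
  by rewrite indicE memNset//= mule0; under eq_integral do rewrite mule0; rewrite integral0.
have Sne : S !=set0.
 apply/set0P; apply: contraTN k0 => /eqP S0; move: Sk; rewrite S0 measure0 => -[<-].
 by rewrite ltxx.
have c0 : 0 <= c.
 case: Sne => y Sy; rewrite -lee_fin; apply: le_trans (wc Sy).
 by apply: integral_ge0 => x _; rewrite lee_fin sqr_ge0.
rewrite ge0_integralZl//; last first.
 by apply/measurable_EFinP; exact: measurable_indic.
rewrite integral_indic// setIT [X in (_ * (_ * X))%E](_ : _ = k%:E)//.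
by rewrite -!EFinM lee_fin mulrCA mulVf ?mulr1// gt_eqF.
Qed.

End mean.

Variable e : R.
Hypothesis e0 : 0 < e.

Definition cell : set P := box 0 e 0 e.

Let mcell : measurable cell. Proof. exact: measurable_box. Qed.
Let cellE : leb2 R cell = (e ^+ 2)%:E.
Proof. by rewrite /cell leb2_box ?(ltW e0)// subr0. Qed.
Let e2 : 0 < e ^+ 2. Proof. exact: exprn_gt0. Qed.

(** Mean of [u] over the square [x + ]0, e[^2], in place of a mollification. For [u] in H^1 its
    increments follow the averaged gradient up to the power [3 / 2] of the step, which is all the
    regularity that is needed. *)
Definition avg u (x : P) : R := (e ^+ 2)^-1 * \int[leb2 R]_(y in cell) u (tr x 1 y).

Let mtr1 : measurable_fun [set: P * P] (fun z : P * P => tr z.1 1 z.2).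
Proof.
apply: measurable_fun_pair; apply: measurable_funD.
- by apply: measurableT_comp => //; exact: measurableT_comp.
- by apply: measurable_funM => //; apply: measurableT_comp => //; exact: measurableT_comp.
- by apply: measurableT_comp => //; exact: measurableT_comp.
- by apply: measurable_funM => //; apply: measurableT_comp => //; exact: measurableT_comp.
Qed.

Let icell u x : u \in Lfun (leb2 R) 2%:E ->
 (leb2 R).-integrable cell (fun y => (u (tr x 1 y))%:E).
Proof.
move=> uL; rewrite integrable_mkcond// epatch_indic.
have mtB : mfun P (fun y : P => \1_cell (tr x (- 1) y) : R).
 by apply: measurableT_comp; [exact: measurable_indic|exact: measurable_tr].
have mS : measurable (tr x (- 1) @^-1` cell) by rewrite -[X in measurable X]setTI; exact: measurable_tr.
have H := @Lfun2_integrable_bounded _ u _ 1 (tr x (- 1) @^-1` cell) uL mtB mS.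
rewrite leb2_tr_preimage// cellE ltry in H.
have bd (y : P) : `|\1_cell (tr x (- 1) y) : R| <= 1 * \1_(tr x (- 1) @^-1` cell) y.
 by rewrite mul1r ger0_norm.
have := integrable_tr x 1 (H isT bd).
by apply: eq_integrable => // y _; rewrite /= trK EFinM.
Qed.

Lemma measurable_avg u : mfun P u -> mfun P (avg u).
Proof.
move=> mu; rewrite /avg; apply: measurable_funM => //.
by apply: (measurable_marginal (w := fun z => u (tr z.1 1 z.2))) => //; exact: measurableT_comp.
Qed.

Lemma avg_L2 u : u \in Lfun (leb2 R) 2%:E ->
 (\int[leb2 R]_x (avg u x ^+ 2)%:E <= \int[leb2 R]_x (u x ^+ 2)%:E)%E.
Proof.
move=> uL; have mu := Lfun2_measurable uL.
have u2 := integrable_fin_num measurableT (Lfun2_integrable_sqr uL).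
rewrite -(fineK u2).
apply: (@mean_L2 cell (e ^+ 2) _ (fun z => u (tr z.1 1 z.2))) => //.
- exact: measurableT_comp.
- by move=> x; exact: icell.
move=> y _; rewrite fineK// -(ge0_integral_tr y 1 (f := fun x => (u x ^+ 2)%:E)); last 2 first.
- by apply/measurable_EFinP; exact: measurable_funX.
- by move=> x; rewrite lee_fin sqr_ge0.
rewrite (_ : (fun x => _) = (fun x => (u (tr y 1 x) ^+ 2)%:E)) ?lexx//.
by apply/funext => x; rewrite /tr/= !mul1r (addrC x.1) (addrC x.2).
Qed.

(** A translation by a vector of the cell is a move along the first axis followed by one along the
    second. Each costs at most [e ^+ 2 * H] in squared norm, and the square of a sum of two terms
    costs a factor 2. *)
Lemma avg_sub_L2 u h1 h2 (H : R) : u \in Lfun (leb2 R) 2%:E ->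
 h1 \in Lfun (leb2 R) 2%:E -> h2 \in Lfun (leb2 R) 2%:E ->
 weak_partial (1, 0) u h1 -> weak_partial (0, 1) u h2 ->
 (\int[leb2 R]_x (h1 x ^+ 2)%:E <= H%:E)%E ->
 (\int[leb2 R]_x (h2 x ^+ 2)%:E <= H%:E)%E ->
 (\int[leb2 R]_x ((avg u x - u x) ^+ 2)%:E <= (4 * e ^+ 2 * H)%:E)%E.
Proof.
move=> uL h1L h2L w1 w2 h1H h2H; have mu := Lfun2_measurable uL.
have H0 : 0 <= H.
 by rewrite -lee_fin; apply: le_trans h1H; apply: integral_ge0 => x _; rewrite lee_fin sqr_ge0.
pose w (z : P * P) := u (tr z.1 1 z.2) - u z.1.
have mw : measurable_fun [set: P * P] w.
 by apply: measurable_funB; exact: measurableT_comp.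
have icst (r : R) : (leb2 R).-integrable cell (EFin \o cst r).
 apply: measurable_bounded_integrable => //; first by rewrite [X in (X < _)%E](_ : _ = (e ^+ 2)%:E)// ltry.
 by exists `|r|; split; [exact: num_real|move=> M cM z _ /=; exact: ltW].
have E x : avg u x - u x = (e ^+ 2)^-1 * \int[leb2 R]_(y in cell) w (x, y).
 rewrite /w RintegralB; [|exact: mcell|exact: icell|exact: (icst (u x))].
 rewrite [X in _ * (_ - X)](_ : _ = \int[leb2 R]_(y in cell) cst (u x) y)//.
 rewrite Rintegral_cst// [X in fine X](_ : _ = (e ^+ 2)%:E)// /= mulrBr /avg; congr (_ - _).
 by rewrite mulrCA mulVf ?mulr1// gt_eqF.
under eq_integral do rewrite E.
apply: (@mean_L2 cell (e ^+ 2) _ w) => //.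
 by move=> x; apply: (integrableB mcell (icell x uL) (icst (u x))).
move=> y [/=]; rewrite !in_itv/= => /andP[y1 y1e] /andP[y2 y2e].
have mtr2 v t : mfun P (fun x : P => u (tr v t x)).
 by apply: measurableT_comp => //; exact: measurable_tr.
pose D2 x := u (tr (0, 1) y.2 x) - u x; pose D1 x := u (tr (1, 0) y.1 x) - u x.
have mD1 : mfun P D1 by exact: measurable_funB.
have mD2 : mfun P D2 by exact: measurable_funB.
have sq (f : P -> R) : mfun P f -> mfun P (fun x => (f x ^+ 2)%:E).
 by move=> mf; apply/measurable_EFinP; exact: measurable_funX.
have mD2' : mfun P (fun x => (D2 (tr (1, 0) y.1 x) ^+ 2)%:E).
 by apply: (measurableT_comp (sq _ mD2)); exact: measurable_tr.
apply: (@le_trans _ _ (\int[leb2 R]_x (2%:E * (D2 (tr (1%R, 0%R) y.1 x) ^+ 2)%:E + 2%:E * (D1 x ^+ 2)%:E))%E).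
 apply: ge0_le_integral => //.
 - by move=> x _; rewrite lee_fin sqr_ge0.
 - by apply: sq; apply: measurable_funB => //; apply: measurableT_comp => //; exact: (measurableT_comp mtr1).
 - by apply: emeasurable_funD; apply: measurable_funeM => //; exact: sq.
 - move=> x _; rewrite -!EFinM -EFinD lee_fin /w /D1 /D2 /=.
  have -> : tr x 1 y = tr (0, 1) y.2 (tr (1, 0) y.1 x).
   by rewrite /tr/=; congr (_, _); ring.
  set a := u (tr (0, 1) _ _); set b := u (tr (1, 0) _ _); rewrite -subr_ge0.
  rewrite (_ : _ - _ = ((a - b) - (b - u x)) ^+ 2) ?sqr_ge0//; ring.
have sq0 (f : P -> R) x : [set: P] x -> (0 <= (f x ^+ 2)%:E)%E by rewrite lee_fin sqr_ge0.
rewrite ge0_integralD//; last 4 first.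
- by move=> x _; rewrite -EFinM lee_fin mulr_ge0 ?sqr_ge0.
- exact: measurable_funeM.
- by move=> x _; rewrite -EFinM lee_fin mulr_ge0 ?sqr_ge0.
- by apply: measurable_funeM; exact: sq.
rewrite !ge0_integralZl//; try exact: sq; try exact: mD2'; try by move=> x _; rewrite lee_fin sqr_ge0.
rewrite (ge0_integral_tr (1, 0) y.1 (f := fun x => (D2 x ^+ 2)%:E)); last 2 first.
- exact: sq.
- by move=> x; rewrite lee_fin sqr_ge0.
have c1 : coord_dir ((1, 0) : P) by left.
have c2 : coord_dir ((0, 1) : P) by right.
have b2 := translate_L2 c2 w2 y2 uL h2L; have b1 := translate_L2 c1 w1 y1 uL h1L.
have sc (y' : R) (I J : \bar R) : 0 < y' -> y' < e -> (J <= H%:E)%E -> (I <= (y' ^+ 2)%:E * J)%E ->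
  (2%:E * I <= (2 * e ^+ 2 * H)%:E)%E.
 move=> y0 ye JH /le_trans; move=> /(_ ((e ^+ 2)%:E * H%:E)%E) IH.
 rewrite -mulrA EFinM lee_wpmul2l ?lee_fin// EFinM; apply: IH.
 apply: (@le_trans _ _ ((y' ^+ 2)%:E * H%:E)%E).
  by rewrite lee_wpmul2l// lee_fin sqr_ge0.
 by rewrite -!EFinM lee_fin ler_wpM2r// lerXn2r ?nnegrE ?ltW// (lt_trans y0).
rewrite (_ : 4 * e ^+ 2 * H = 2 * e ^+ 2 * H + 2 * e ^+ 2 * H); last by ring.
by rewrite [X in (_ <= X)%E]EFinD; apply: leeD; [apply: (sc _ _ _ y2 y2e h2H b2)|apply: (sc _ _ _ y1 y1e h1H b1)].
Qed.

Let cellx (x : P) := box x.1 (x.1 + e) x.2 (x.2 + e).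

Let cellxE x y : \1_(cellx x) y = \1_cell (tr x (- 1) y) :> R.
Proof.
rewrite !indicE; congr (nat_of_bool _)%:R; apply/idP/idP => /set_mem [] /=; rewrite !in_itv/= => /andP[h1 h2] /andP[h3 h4];
 apply/mem_set; split; rewrite /= in_itv/=; apply/andP; split; lra.
Qed.

Lemma avgE u x : u \in Lfun (leb2 R) 2%:E ->
 avg u x = (e ^+ 2)^-1 * \int[leb2 R]_y (u y * \1_(cellx x) y).
Proof.
move=> uL; rewrite /avg; congr (_ * _); rewrite /Rintegral integral_mkcond epatch_indic; congr fine.
have mtB : mfun P (fun y : P => \1_cell (tr x (- 1) y) : R).
 by apply: measurableT_comp; [exact: measurable_indic|exact: measurable_tr].
have mS : measurable (tr x (- 1) @^-1` cell) by rewrite -[X in measurable X]setTI; exact: measurable_tr.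
have H := @Lfun2_integrable_bounded _ u _ 1 (tr x (- 1) @^-1` cell) uL mtB mS.
rewrite leb2_tr_preimage// cellE ltry in H.
have bd (y : P) : `|\1_cell (tr x (- 1) y) : R| <= 1 * \1_(tr x (- 1) @^-1` cell) y.
 by rewrite mul1r ger0_norm.
rewrite (eq_integral _ _ (fun y _ => congr1 (fun z => (u y * z)%:E) (cellxE x y))).
by rewrite -(integral_tr x 1 (H isT bd)); apply: eq_integral => y _; rewrite /= trK EFinM.
Qed.

Let cell_int u x : u \in Lfun (leb2 R) 2%:E ->
 (leb2 R).-integrable [set: P] (EFin \o (fun y => u y * \1_(cellx x) y)).
Proof.
move=> uL; apply: (@Lfun2_integrable_bounded _ u _ 1 (cellx x) uL).
- by apply: measurable_indic; exact: measurable_box.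
- exact: measurable_box.
- by rewrite leb2_box ?lerDl ?(ltW e0)// ltry.
- by move=> y; rewrite mul1r ger0_norm.
Qed.

Let cell_tr v t x y : \1_(cellx (tr v t x)) y = \1_(cellx x) (tr v (- t) y) :> R.
Proof.
rewrite !indicE; congr (nat_of_bool _)%:R; apply/idP/idP => /set_mem [] /=; rewrite !in_itv/= => /andP[h1 h2] /andP[h3 h4];
 apply/mem_set; split; rewrite /= in_itv/=; apply/andP; split; lra.
Qed.

Let m1cell x : mfun P (\1_(cellx x) : P -> R).
Proof. by apply: measurable_indic; exact: measurable_box. Qed.

(** The integral is the area of the symmetric difference of a square and its translate: two strips
    of area [e * s] if [s < e], and at most [2 * e ^+ 2] otherwise. *)
Let cell_diff v s x : coord_dir v -> 0 <= s ->
 (\int[leb2 R]_y ((\1_(cellx (tr v s x)) y - \1_(cellx x) y) ^+ 2)%:E <= (2 * e * s)%:E)%E.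
Proof.
move=> cv s0; set A := cellx _; set B := cellx x.
have mA : measurable A by exact: measurable_box.
have mB : measurable B by exact: measurable_box.
have AE : leb2 R A = (e ^+ 2)%:E.
 by rewrite /A /cellx leb2_box ?lerDl ?(ltW e0)//; congr (_%:E); ring.
have BE : leb2 R B = (e ^+ 2)%:E.
 by rewrite /B /cellx leb2_box ?lerDl ?(ltW e0)//; congr (_%:E); ring.
have iI (C : set P) : measurable C -> (\int[leb2 R]_y (\1_C y : R)%:E = leb2 R C)%E.
 by move=> mC; rewrite integral_indic// setIT.
have [es|se] := leP e s.
 apply: (@le_trans _ _ (\int[leb2 R]_y ((\1_A y : R)%:E + (\1_B y : R)%:E))%E).
  apply: ge0_le_integral => //.
  - by move=> y _; rewrite lee_fin sqr_ge0.
  - by apply/measurable_EFinP; apply: measurable_funX; exact: measurable_funB.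
  - by apply: emeasurable_funD; exact/measurable_EFinP.
  - move=> y _; rewrite -EFinD lee_fin !indicE.
   by case: (_ \in _); case: (_ \in _); rewrite /= ?subrr ?subr0 ?sub0r ?sqrrN ?expr1n ?expr0n ?addr0 ?add0r ?addr_ge0.
 rewrite ge0_integralD//; try exact/measurable_EFinP.
 rewrite !iI// AE BE -EFinD lee_fin (_ : _ + _ = 2 * e * e); last by ring.
 by rewrite ler_wpM2l// mulr_ge0// ltW.
have [C [mC CE CAB]] : exists C : set P, [/\ measurable C, leb2 R C = (e * (e - s))%:E &
  forall y, \1_C y = \1_A y * \1_B y :> R].
 case: cv => vE.
  exists (box (x.1 + s) (x.1 + e) x.2 (x.2 + e)); split; first exact: measurable_box.
   by rewrite leb2_box; [congr (_%:E); ring|lra|lra].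
  move=> y; rewrite /A /B vE !indicE -natrM mulnb; congr (nat_of_bool _)%:R; apply/idP/idP.
   move=> /set_mem [] /=; rewrite !in_itv/= => /andP[h1 h2] /andP[h3 h4].
   by apply/andP; split; apply/mem_set; split; rewrite /= in_itv/=; apply/andP; split; lra.
  move=> /andP[/set_mem [] /=]; rewrite !in_itv/= => /andP[h1 h2] /andP[h3 h4] /set_mem [] /=.
  rewrite !in_itv/= => /andP[h5 h6] /andP[h7 h8].
  by apply/mem_set; split; rewrite /= in_itv/=; apply/andP; split; lra.
 exists (box x.1 (x.1 + e) (x.2 + s) (x.2 + e)); split; first exact: measurable_box.
  by rewrite leb2_box; [congr (_%:E); ring|lra|lra].
 move=> y; rewrite /A /B vE !indicE -natrM mulnb; congr (nat_of_bool _)%:R; apply/idP/idP.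
  move=> /set_mem [] /=; rewrite !in_itv/= => /andP[h1 h2] /andP[h3 h4].
  by apply/andP; split; apply/mem_set; split; rewrite /= in_itv/=; apply/andP; split; lra.
 move=> /andP[/set_mem [] /=]; rewrite !in_itv/= => /andP[h1 h2] /andP[h3 h4] /set_mem [] /=.
 rewrite !in_itv/= => /andP[h5 h6] /andP[h7 h8].
 by apply/mem_set; split; rewrite /= in_itv/=; apply/andP; split; lra.
have mc : mfun P (fun y => ((\1_A y - \1_B y) ^+ 2)%:E : \bar R).
 by apply/measurable_EFinP; apply: measurable_funX; exact: measurable_funB.
have mC1 : mfun P (fun y => 2%:E * (\1_C y : R)%:E : \bar R)%E.
 by apply: measurable_funeM; apply/measurable_EFinP; exact: measurable_indic.
(* Integrated form of [(1_A - 1_B)^2 + 2 1_C = 1_A + 1_B] with [C] the intersection, which spares a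
   description of the two strips. *)
have S : (\int[leb2 R]_y ((\1_A y - \1_B y) ^+ 2)%:E + (2 * (e * (e - s)))%:E = (2 * e ^+ 2)%:E)%E.
 rewrite (_ : (2 * (e * (e - s)))%:E = \int[leb2 R]_y (2%:E * (\1_C y : R)%:E))%E; last first.
  rewrite ge0_integralZl//; last by apply/measurable_EFinP; exact: measurable_indic.
  by rewrite iI// CE EFinM.
 rewrite -ge0_integralD//; last by move=> y _; rewrite lee_fin sqr_ge0.
 rewrite (_ : (2 * e ^+ 2)%:E = \int[leb2 R]_y ((\1_A y : R)%:E + (\1_B y : R)%:E))%E; last first.
  rewrite ge0_integralD//; try exact/measurable_EFinP.
  by rewrite !iI// AE BE -EFinD; congr (_%:E); ring.
 apply: eq_integral => y _; rewrite -EFinM -!EFinD CAB !indicE; congr (_%:E).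
 by case: (_ \in _); case: (_ \in _) => /=; ring.
have : (\int[leb2 R]_y ((\1_A y - \1_B y) ^+ 2)%:E)%E \is a fin_num.
 by rewrite ge0_fin_numE; [rewrite (@le_lt_trans _ _ (2 * e ^+ 2)%:E) ?ltry// -S leeDl// lee_fin mulr_ge0// mulr_ge0 ?subr_ge0 ?ltW|apply: integral_ge0 => y _; rewrite lee_fin sqr_ge0].
move: S; case: (\int[leb2 R]_y _)%E => //= r; rewrite -EFinD => -[rE] _.
by rewrite lee_fin -(lerD2r (2 * (e * (e - s)))) rE (_ : 2 * e * s + _ = 2 * e ^+ 2)//; ring.
Qed.

(** The difference of the averages pairs [h] with a difference of indicators of squared norm at most
    [2 * e * s]; the weight [sqrt s] balances the two terms of Young's inequality. *)
Lemma avg_holder v h (H s : R) x : coord_dir v -> h \in Lfun (leb2 R) 2%:E ->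
 (\int[leb2 R]_x (h x ^+ 2)%:E <= H%:E)%E -> 0 <= s ->
 `|avg h (tr v s x) - avg h x| <= (H / 2 + e) / e ^+ 2 * Num.sqrt s.
Proof.
move=> cv hL hH; rewrite le_eqVlt => /predU1P[<-|s0].
 by rewrite sqrtr0 mulr0 /tr !mul0r !addr0 -surjective_pairing subrr normr0.
have sg := sqrtr_gt0 s; rewrite s0 in sg.
rewrite !avgE// -mulrBr normrM ger0_norm ?invr_ge0 ?(ltW e2)// mulrC (mulrAC _ _ (Num.sqrt s)) ler_wpM2r ?invr_ge0 ?(ltW e2)//.
rewrite -RintegralB//; [|exact: cell_int|exact: cell_int].
rewrite (_ : \int[_]_(y in _) _ = \int[leb2 R]_y (h y * (\1_(cellx (tr v s x)) y - \1_(cellx x) y))); last first.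
 by apply: eq_Rintegral => y _; rewrite mulrBr.
have := @abs_integral_mul_le h (fun y => \1_(cellx (tr v s x)) y - \1_(cellx x) y) (Num.sqrt s) H (2 * e * s) sg
 (Lfun2_measurable hL) _ hH (cell_diff x cv (ltW s0)).
have m : mfun P (fun y => \1_(cellx (tr v s x)) y - \1_(cellx x) y : R).
 by apply: measurable_funB; exact: m1cell.
move=> /(_ m) /le_trans; apply.
have -> : 2 * e * s / (2 * Num.sqrt s) = e * Num.sqrt s.
 by rewrite -[in LHS](sqr_sqrtr (ltW s0)) sqrtr_sqr ger0_norm ?sqrtr_ge0//; field; rewrite gt_eqF.
by rewrite mulrDl lerD2r [leLHS]mulrC mulrA mulrAC.
Qed.

Let cell_sweep v s t x y : coord_dir v -> 0 <= s <= t -> cellx x (tr v (- s) y) ->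
 box x.1 (x.1 + e + t) x.2 (x.2 + e + t) y.
Proof.
rewrite /cellx /box /tr /= !in_itv/=; clear => -[->|->] /=; rewrite ?mulr0 ?mulr1 ?addr0;
 move=> /andP[s0 st] [/andP[h1 h2] /andP[h3 h4]];
 split; apply/andP; split; lra.
Qed.

(** The increment of [avg u] pairs [h] with the time spent in the square, the linear term pairs it
    with [t] times the indicator of the square. The squared norm of the difference of these weights
    is at most [2 * e * t ^+ 3]. *)
Lemma avg_taylor v u h (H t : R) x : coord_dir v -> weak_partial v u h ->
 u \in Lfun (leb2 R) 2%:E -> h \in Lfun (leb2 R) 2%:E ->
 (\int[leb2 R]_x (h x ^+ 2)%:E <= H%:E)%E -> 0 < t ->
 `|avg u (tr v t x) - avg u x - t * avg h x| <= (H / 2 + e) / e ^+ 2 * (t * Num.sqrt t).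
Proof.
move=> cv wu uL hL hH t0; have t0' := ltW t0.
have sg := sqrtr_gt0 t; rewrite t0 in sg.
have mh := Lfun2_measurable hL.
pose B := cellx x.
have xe1 : x.1 <= x.1 + e by rewrite lerDl ltW.
have xe2 : x.2 <= x.2 + e by rewrite lerDl ltW.
have [i1 e1] := translate_box cv wu t0 uL hL xe1 xe2.
have i1' : (leb2 R).-integrable cell (EFin \o (fun y => u (tr (tr v t x) 1 y))) by exact: icell.
have shiftE : avg u (tr v t x) - avg u x = (e ^+ 2)^-1 * \int[leb2 R]_y (h y * sweep v t B y).
 rewrite /Rintegral -e1 -[fine _]/(\int[leb2 R]_y ((u (tr v t y) - u y) * \1_B y)) !avgE// -mulrBr.
 congr (_ * _).
 have E3 : \int[leb2 R]_y (u y * \1_(cellx (tr v t x)) y) = \int[leb2 R]_y (u (tr v t y) * \1_B y).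
  rewrite /Rintegral -(integral_tr v t (cell_int (tr v t x) uL)); congr fine.
  by apply: eq_integral => y _; rewrite /= cell_tr trK.
 rewrite E3 -RintegralB//; last exact: cell_int.
  by apply: eq_Rintegral => y _; rewrite mulrBl.
 have := integrable_tr v t (cell_int (tr v t x) uL).
 by apply: eq_integrable => // y _; rewrite /= cell_tr trK.
have mtrs : measurable_fun [set: P * mline R] (fun z : P * mline R => \1_B (tr v (- z.2) z.1) : R).
 have mneg : measurable_fun [set: P * mline R]
  (fun z : P * mline R => (z.1, - z.2) : P * mline R).
  by apply: measurable_fun_pair => //; exact: measurableT_comp.
 by apply: (measurableT_comp (m1cell x)); exact: (measurableT_comp (measurable_tr2 v) mneg).
have i1B y : leb.-integrable `[0, t] (EFin \o (fun s => \1_B (tr v (- s) y) : R)).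
 apply: (@measurable_bounded_integrable _ _ _ leb (fun s => \1_B (tr v (- s) y))) => //.
 - exact: leb_itvcc_lty.
 - apply: measurable_funTS; apply: (measurableT_comp (m1cell x)).
  by apply: measurable_fun_pair => //=; apply: measurable_funD => //; apply: measurable_funM => //; exact: measurableT_comp.
 - exists 1; split; first exact: num_real.
  by move=> M M1 s _; rewrite /= indicE; case: (_ \in _); rewrite ?normr1 ?normr0 ltW// (lt_trans ltr01).
have icst (r : R) : leb.-integrable `[0, t] (EFin \o cst r).
 apply: measurable_bounded_integrable => //; first exact: leb_itvcc_lty.
 by exists `|r|; split; [exact: num_real|move=> M cM y _ /=; exact: ltW].
have lebt : leb `[0%R, t]%classic = t%:E by rewrite leb_itvcc ?subr0.
have sweepB y : sweep v t B y - t * \1_B y = \int[leb]_(s in `[0, t]) (\1_B (tr v (- s) y) - \1_B y).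
 rewrite RintegralB//; last exact: icst.
 by rewrite Rintegral_cst//= lebt /= mulrC.
have msweep : mfun P (sweep v t B).
 rewrite (_ : sweep v t B = fun y => fine (\int[leb]_s ((\1_B (tr v (- s) y) : R)%:E * (\1_(`[0%R, t]%classic) s)%:E))%E); last first.
  by apply/funext => y; rewrite /sweep /Rintegral integral_mkcond epatch_indic.
 apply: measurableT_comp => //.
 apply: (@measurable_fun_fubini_tonelli_F _ _ P (mline R) R leb
  (fun z => ((\1_B (tr v (- z.2) z.1) : R)%:E * (\1_(`[0%R, t]%classic) z.2)%:E)%E)).
  apply: emeasurable_funM; apply/measurable_EFinP => //.
  by apply: measurableT_comp => //; exact: measurable_indic.
 by move=> z; rewrite -EFinM lee_fin mulr_ge0.
have mpsi : mfun P (fun y => sweep v t B y - t * \1_B y).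
 by apply: measurable_funB => //; apply: measurable_funM => //; exact: m1cell.
have supp s y : 0 <= s <= t -> \1_B (tr v (- s) y) <= \1_(box x.1 (x.1 + e + t) x.2 (x.2 + e + t)) y :> R.
 move=> /andP[s0 st]; rewrite !indicE; have [yB|] := boolP (tr v (- s) y \in B); last by [].
 by rewrite mem_set//; move: yB => /set_mem; apply: (cell_sweep cv); rewrite s0.
have sweep_bd y : `|sweep v t B y| <= t * \1_(box x.1 (x.1 + e + t) x.2 (x.2 + e + t)) y.
 rewrite ger0_norm; last by apply: Rintegral_ge0.
 apply: (@le_trans _ _ (\int[leb]_(s in `[0, t]) cst (\1_(box x.1 (x.1 + e + t) x.2 (x.2 + e + t)) y : R) s)).
  by apply: le_Rintegral => // s; rewrite /= in_itv/=; exact: supp.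
 by rewrite Rintegral_cst//= lebt /= mulrC.
have isw : (leb2 R).-integrable [set: P] (EFin \o (fun y => h y * sweep v t B y)).
 apply: (@Lfun2_integrable_bounded _ h _ t (box x.1 (x.1 + e + t) x.2 (x.2 + e + t)) hL) => //.
  exact: measurable_box.
 by rewrite leb2_box ?ltry//; lra.
have iB := cell_int x hL.
have iBt : (leb2 R).-integrable [set: P] (EFin \o (fun y => t * (h y * \1_B y))).
 by apply: eq_integrable (integrableZl measurableT t iB).
rewrite shiftE avgE// mulrCA -mulrBr normrM ger0_norm ?invr_ge0 ?(ltW e2)//.
rewrite mulrC (mulrAC _ _ (t * Num.sqrt t)) ler_wpM2r ?invr_ge0 ?(ltW e2)//.
rewrite -RintegralZl// -RintegralB//.
rewrite (_ : \int[_]_(y in _) _ = \int[leb2 R]_y (h y * (sweep v t B y - t * \1_B y))); last first.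
 by apply: eq_Rintegral => y _; rewrite mulrBr mulrCA.
have tt0 : 0 < t * Num.sqrt t by rewrite mulr_gt0.
have psiK : (\int[leb2 R]_y ((sweep v t B y - t * \1_B y) ^+ 2)%:E <= (2 * e * t ^+ 3)%:E)%E.
 pose G (z : P * mline R) : \bar R :=
  (((\1_B (tr v (- z.2) z.1) - \1_B z.1) ^+ 2)%:E * (\1_(`[0%R, t]%classic) z.2)%:E)%E.
 have mG : measurable_fun [set: P * mline R] G.
  apply: emeasurable_funM; apply/measurable_EFinP; last first.
   by apply: measurableT_comp => //; exact: measurable_indic.
  apply: measurable_funX; apply: measurable_funB => //.
  by apply: (measurableT_comp (m1cell x)).
 have G0 z : (0 <= G z)%E by rewrite /G mule_ge0// lee_fin ?sqr_ge0.
 have mGF := @measurable_fun_fubini_tonelli_F _ _ P (mline R) R leb G mG G0.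
 apply: (@le_trans _ _ (\int[leb2 R]_y (t%:E * \int[leb]_s G (y, s)))%E).
  apply: ge0_le_integral => //.
  - by move=> y _; rewrite lee_fin sqr_ge0.
  - by apply/measurable_EFinP; exact: measurable_funX.
  - by apply: measurable_funeM; exact: mGF.
  - move=> y _; rewrite sweepB.
   have -> : (\int[leb]_s G (y, s) = \int[leb]_(s in `[0%R, t]) ((\1_B (tr v (- s) y) - \1_B y) ^+ 2)%:E)%E.
    by rewrite [RHS]integral_mkcond epatch_indic.
   apply: sqr_Rintegral_le => //.
   by apply: (integrableB _ (i1B y) (icst (\1_B y))).
 rewrite ge0_integralZl//; last by move=> y _; exact: integral_ge0.
 rewrite [X in (_ * X)%E](@fubini_tonelli _ _ P (mline R) R (@area R) leb G)//.
 apply: (@le_trans _ _ (t%:E * \int[leb]_s ((2 * e * t)%:E * (\1_(`[0%R, t]%classic) s)%:E))%E).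
  rewrite lee_wpmul2l ?lee_fin//; apply: ge0_le_integral => //.
  - by move=> s _; exact: integral_ge0.
  - exact: (@measurable_fun_fubini_tonelli_G _ _ P (mline R) R (@area R) G mG).
  - by apply: measurable_funeM; apply/measurable_EFinP; exact: measurable_indic.
  - move=> s _; rewrite /G/=; have [st|st] := pselect (`[0%R, t]%classic s).
    rewrite indicE mem_set//= mule1; under eq_integral do rewrite mule1.
    move: st; rewrite /= in_itv/= => /andP[s0 st].
    apply: (@le_trans _ _ (2 * e * s)%:E); last by rewrite lee_fin ler_wpM2l// mulr_ge0// ltW.
    apply: le_trans (cell_diff x cv s0); apply: ge0_le_integral => //.
    + by move=> y _; rewrite lee_fin sqr_ge0.
    + apply/measurable_EFinP; apply: measurable_funX; apply: measurable_funB; last exact: m1cell.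
     by apply: (measurableT_comp (m1cell x)); exact: measurable_tr.
    + by apply/measurable_EFinP; apply: measurable_funX; apply: measurable_funB; exact: m1cell.
    + by move=> y _; rewrite cell_tr.
   by rewrite indicE memNset//= mule0; under eq_integral do rewrite mule0; rewrite integral0.
 rewrite ge0_integralZl//; last 2 first.
 - by apply/measurable_EFinP; exact: measurable_indic.
 - by rewrite lee_fin !mulr_ge0// ltW.
 rewrite integral_indic// setIT [X in (_ * (_ * X))%E](_ : _ = t%:E)// -!EFinM lee_fin.
 by rewrite (_ : t * _ = 2 * e * t ^+ 3)//; ring.
have := abs_integral_mul_le tt0 mh mpsi hH psiK.
move=> /le_trans; apply.
have -> : 2 * e * t ^+ 3 / (2 * (t * Num.sqrt t)) = e * (t * Num.sqrt t).
 move: (sqr_sqrtr t0') sg; move: (Num.sqrt t) => r rE r0; rewrite -rE; field.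
 by rewrite gt_eqF.
by rewrite mulrDl lerD2r [leLHS]mulrC mulrA mulrAC.
Qed.

Lemma avg_bound h (H : R) x : h \in Lfun (leb2 R) 2%:E ->
 (\int[leb2 R]_x (h x ^+ 2)%:E <= H%:E)%E ->
 `|avg h x| <= (H / 2 + e ^+ 2 / 2) / e ^+ 2.
Proof.
move=> hL hH; rewrite avgE// normrM ger0_norm ?invr_ge0 ?(ltW e2)// mulrC.
rewrite ler_wpM2r ?invr_ge0 ?(ltW e2)//.
have psiK : (\int[leb2 R]_y (\1_(cellx x) y ^+ 2 : R)%:E <= (e ^+ 2)%:E)%E.
 rewrite (eq_integral (fun y => (\1_(cellx x) y : R)%:E)); last first.
  by move=> y _; rewrite indicE; case: (_ \in _); rewrite /= ?expr1n ?expr0n.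
 rewrite integral_indic//; last exact: measurable_box.
 have cE : leb2 R (cellx x) = (e ^+ 2)%:E.
  by rewrite /cellx leb2_box ?lerDl ?(ltW e0)//; congr (_%:E); ring.
 by rewrite setIT [X in (X <= _)%E](_ : _ = (e ^+ 2)%:E).
have := abs_integral_mul_le ltr01 (Lfun2_measurable hL) (m1cell x) hH psiK.
by move=> /le_trans; apply; rewrite mulr1 lerD2r (mulrC H) div1r.
Qed.

Lemma avg_holder_signed v h (H s : R) x : coord_dir v -> h \in Lfun (leb2 R) 2%:E ->
 (\int[leb2 R]_x (h x ^+ 2)%:E <= H%:E)%E ->
 `|avg h (tr v s x) - avg h x| <= (H / 2 + e) / e ^+ 2 * Num.sqrt `|s|.
Proof.
move=> cv hL hH; have [s0|s0] := leP 0 s.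
 by rewrite (ger0_norm s0); exact: avg_holder.
rewrite -{2}(trK v s x) distrC (ltr0_norm s0).
by apply: avg_holder => //; rewrite oppr_ge0 ltW.
Qed.

(** For negative [t] the expansion is taken at the other end of the segment. Passing from the slope
    there to the slope at [x] costs one Holder estimate, hence the factor 2. *)
Lemma avg_taylor_signed v u h (H t : R) x : coord_dir v -> weak_partial v u h ->
 u \in Lfun (leb2 R) 2%:E -> h \in Lfun (leb2 R) 2%:E ->
 (\int[leb2 R]_x (h x ^+ 2)%:E <= H%:E)%E ->
 `|avg u (tr v t x) - avg u x - t * avg h x| <=
  2 * ((H / 2 + e) / e ^+ 2 * (`|t| * Num.sqrt `|t|)).
Proof.
move=> cv wu uL hL hH; have [t0|t0|t0] := ltgtP 0 t.
- have := avg_taylor x cv wu uL hL hH t0; rewrite (gtr0_norm t0) => J; apply: le_trans J _.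
 rewrite ler_peMl ?ler1n// !mulr_ge0 ?sqrtr_ge0 ?invr_ge0 ?(ltW e2)// ?(ltW t0)//.
 rewrite addr_ge0 ?(ltW e0)// divr_ge0// -lee_fin (le_trans _ hH)//.
 by apply: integral_ge0 => y _; rewrite lee_fin sqr_ge0.
- have t0' : 0 < - t by rewrite oppr_gt0.
 have J1 := avg_taylor (tr v t x) cv wu uL hL hH t0'; rewrite trK in J1.
 have := avg_holder_signed t x cv hL hH; rewrite (ltr0_norm t0) => J2.
 have {}J2 := ler_wpM2l (ltW t0') J2.
 rewrite -{1}(gtr0_norm t0') -normrM in J2.
 rewrite mulr2n mulrDl mul1r -normrN.
 have -> : - (avg u (tr v t x) - avg u x - t * avg h x) =
  (avg u x - avg u (tr v t x) - - t * avg h (tr v t x)) + - t * (avg h (tr v t x) - avg h x) by ring.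
 apply: le_trans (ler_normD _ _) _; apply: lerD => //.
 by apply: le_trans J2 _; rewrite mulrCA.
- by rewrite -t0 normr0 !mul0r !mulr0 subr0 /tr !mul0r !addr0 -surjective_pairing subrr normr0.
Qed.

End box_average.

(** * Regular approximation of an H^1 function *)

Section smooth_approx.
Context {R : realType}.
Notation P := (mplane R).

Lemma sqr_sum_le (a b y1 y2 r : R) : 0 <= r -> y1 ^+ 2 + y2 ^+ 2 <= r ^+ 2 ->
 `|y1 * a + y2 * b| <= r * Num.sqrt (a ^+ 2 + b ^+ 2).
Proof.
move=> r0 yr; have s0 : 0 <= a ^+ 2 + b ^+ 2 by rewrite addr_ge0 ?sqr_ge0.
rewrite -[leRHS]ger0_norm ?mulr_ge0 ?sqrtr_ge0// -ler_sqr ?nnegrE// !real_normK ?num_real//.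
rewrite exprMn sqr_sqrtr//; apply: (@le_trans _ _ ((y1 ^+ 2 + y2 ^+ 2) * (a ^+ 2 + b ^+ 2))).
 rewrite -subr_ge0 (_ : _ - _ = (y1 * b - y2 * a) ^+ 2) ?sqr_ge0//; ring.
by rewrite ler_wpM2r.
Qed.

(** [U] is an average of [u] and [G] the length of the averaged gradient. The last clause is a first
    order bound on a whole disc of radius [r], the form in which superlevel sets can be thickened by
    discs. *)
Lemma smooth_approx (u : plane R -> R) (g : plane R -> plane R) (delta : R) :
 H1_grad u g -> 0 < delta -> exists (U G : P -> R) (C L : R),
 [/\ 0 <= C, mfun P U, mfun P G &
   forall x, 0 <= G x <= L] /\
 [/\ (\int[leb2 R]_x (U x ^+ 2)%:E <= \int[leb2 R]_x (u x ^+ 2)%:E)%E,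
   (\int[leb2 R]_x (G x ^+ 2)%:E <= \int[leb2 R]_x ((g x).1 ^+ 2 + (g x).2 ^+ 2)%:E)%E,
   (\int[leb2 R]_x ((U x - u x) ^+ 2)%:E <= delta%:E)%E &
   forall (x : P) y1 y2 r, 0 <= r <= 1 -> y1 ^+ 2 + y2 ^+ 2 <= r ^+ 2 ->
    `|U (x.1 + y1, x.2 + y2) - U x| <= r * (G x + C * Num.sqrt r)].
Proof.
move=> [uL g1L g2L w1 w2] d0.
have i1 := Lfun2_integrable_sqr g1L; have i2 := Lfun2_integrable_sqr g2L.
have f1 := integrable_fin_num measurableT i1; have f2 := integrable_fin_num measurableT i2.
have p1 : (0 <= \int[leb2 R]_x ((fst \o g) x ^+ 2)%:E)%E by apply: integral_ge0 => x _; rewrite lee_fin sqr_ge0.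
have p2 : (0 <= \int[leb2 R]_x ((snd \o g) x ^+ 2)%:E)%E by apply: integral_ge0 => x _; rewrite lee_fin sqr_ge0.
pose H := fine (\int[leb2 R]_x ((fst \o g) x ^+ 2)%:E)%E + fine (\int[leb2 R]_x ((snd \o g) x ^+ 2)%:E)%E.
have g1H : (\int[leb2 R]_x ((fst \o g) x ^+ 2)%:E <= H%:E)%E.
 by rewrite /H EFinD !fineK// leeDl.
have g2H : (\int[leb2 R]_x ((snd \o g) x ^+ 2)%:E <= H%:E)%E.
 by rewrite /H EFinD !fineK// leeDr.
have H0 : 0 <= H by rewrite addr_ge0// fine_ge0.
(* This makes [e <= 1] and [4 * e ^+ 2 * H <= delta], also when [H = 0]. *)
pose e := delta / (4 * (H + 1) + delta).
have den0 : 0 < 4 * (H + 1) + delta by rewrite addr_gt0// mulr_gt0// ltr_wpDl.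
have e0 : 0 < e by rewrite divr_gt0.
have e1 : e <= 1 by rewrite /e ler_pdivrMr// mul1r lerDr mulr_ge0// addr_ge0.
have eH : 4 * e ^+ 2 * H <= delta.
 have : e * (4 * (H + 1) + delta) = delta by rewrite /e mulfVK// gt_eqF.
 have : 0 <= e * (1 - e) * H.
  by apply: mulr_ge0 => //; apply: mulr_ge0; [exact: ltW|rewrite subr_ge0].
 have : 0 <= e * delta by rewrite mulr_ge0// ltW.
 rewrite expr2; nra.
pose K := (H / 2 + e) / e ^+ 2.
have K0 : 0 <= K by rewrite divr_ge0 ?sqr_ge0// addr_ge0 ?divr_ge0// ltW.
pose a := avg e (fst \o g); pose b := avg e (snd \o g).
have ma : mfun P a by apply: measurable_avg => //; exact: Lfun2_measurable g1L.
have mb : mfun P b by apply: measurable_avg => //; exact: Lfun2_measurable g2L.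
pose M := (H / 2 + e ^+ 2 / 2) / e ^+ 2.
(* The constant 5: two expansions cost [2 * K] each, and the second one starts at the intermediate
   point [z], where the averaged partial derivative differs from that at [x] by a Holder term
   [K]. *)
exists (avg e u), (fun x => Num.sqrt (a x ^+ 2 + b x ^+ 2)), (5 * K), (M + M); split; split.
- by rewrite mulr_ge0.
- by apply: measurable_avg => //; exact: Lfun2_measurable uL.
- apply: (measurableT_comp (continuous_measurable_fun (@sqrt_continuous R))).
 by apply: measurable_funD; exact: measurable_funX.
- move=> x; rewrite sqrtr_ge0/=.
 have Ma : `|a x| <= M by apply: avg_bound.
 have Mb : `|b x| <= M by apply: avg_bound.
 apply: (@le_trans _ _ (`|a x| + `|b x|)); last exact: lerD.
 rewrite -[leRHS]ger0_norm ?addr_ge0// -sqrtr_sqr ler_wsqrtr// sqrrD !real_normK ?num_real//.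
 by rewrite -subr_ge0 (_ : _ - _ = `|a x| * `|b x| *+ 2) ?mulrn_wge0 ?mulr_ge0//; ring.
- exact: avg_L2.
- apply: (@le_trans _ _ (\int[leb2 R]_x ((a x ^+ 2)%:E + (b x ^+ 2)%:E))%E).
  apply: le_of_eq; apply: eq_integral => x _.
  by rewrite sqr_sqrtr ?addr_ge0 ?sqr_ge0.
 have mX (f : P -> R) : mfun P f -> mfun P (fun x => (f x ^+ 2)%:E).
  by move=> mf; apply/measurable_EFinP; exact: measurable_funX.
 have X0 (f : P -> R) x : [set: P] x -> (0 <= (f x ^+ 2)%:E)%E by rewrite lee_fin sqr_ge0.
 rewrite ge0_integralD//; [|exact: X0|exact: mX|exact: X0|exact: mX].
 rewrite [X in (_ <= X)%E](_ : _ =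
  \int[leb2 R]_x (((fst \o g) x ^+ 2)%:E + ((snd \o g) x ^+ 2)%:E))%E//.
 have mg1 := Lfun2_measurable g1L; have mg2 := Lfun2_measurable g2L.
 rewrite [leRHS]ge0_integralD//; [|exact: X0|exact: mX|exact: X0|exact: mX].
 by apply: leeD; exact: avg_L2.
- by apply: le_trans (avg_sub_L2 e0 uL g1L g2L w1 w2 g1H g2H) _; rewrite lee_fin.
- move=> x y1 y2 r /andP[r0 r1] yr.
 have y1r : `|y1| <= r.
  rewrite -[leRHS]ger0_norm// -ler_sqr ?nnegrE// !real_normK ?num_real//; apply: le_trans yr.
  by rewrite lerDl sqr_ge0.
 have y2r : `|y2| <= r.
  rewrite -[leRHS]ger0_norm// -ler_sqr ?nnegrE// !real_normK ?num_real//; apply: le_trans yr.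
  by rewrite lerDr sqr_ge0.
 pose z := tr (1, 0) y1 x.
 have -> : (x.1 + y1, x.2 + y2) = tr (0, 1) y2 z by rewrite /tr/=; congr (_, _); ring.
 have c1 : coord_dir ((1, 0) : P) by left.
 have c2 : coord_dir ((0, 1) : P) by right.
 have t1 := avg_taylor_signed e0 y1 x c1 w1 uL g1L g1H.
 have t2 := avg_taylor_signed e0 y2 z c2 w2 uL g2L g2H.
 have t3 := avg_holder_signed e0 y1 x c1 g2L g2H.
 rewrite -/a -/b -/z -/K in t1 t2 t3.
 have {}t3 := ler_wpM2l (normr_ge0 y2) t3; rewrite -normrM in t3.
 have := sqr_sum_le (a x) (b x) r0 yr; set GG := r * Num.sqrt (_ + _) => t4.
 have sr (y : R) : `|y| <= r -> K * (`|y| * Num.sqrt `|y|) <= K * (r * Num.sqrt r).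
  by move=> yr'; rewrite ler_wpM2l// ler_pM ?sqrtr_ge0// ler_wsqrtr.
 have s1 := sr _ y1r; have s2 := sr _ y2r.
 have s3 : `|y2| * (K * Num.sqrt `|y1|) <= K * (r * Num.sqrt r).
  by rewrite mulrCA ler_wpM2l// ler_pM ?sqrtr_ge0// ler_wsqrtr.
 have -> : avg e u (tr (0, 1) y2 z) - avg e u x =
   (avg e u (tr (0, 1) y2 z) - avg e u z - y2 * b z) + (avg e u z - avg e u x - y1 * a x)
   + y2 * (b z - b x) + (y1 * a x + y2 * b x) by ring.
 apply: le_trans (ler_normD _ _) _; apply: (@le_trans _ _ (5 * (K * (r * Num.sqrt r)) + GG)).
  apply: lerD => //; apply: le_trans (ler_normD _ _) _.
  apply: (@le_trans _ _ (2 * (K * (r * Num.sqrt r)) + 2 * (K * (r * Num.sqrt r)) + K * (r * Num.sqrt r))); last first.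
   by apply: le_of_eq; ring.
  apply: lerD; last exact: le_trans t3 s3.
  apply: le_trans (ler_normD _ _) _; apply: lerD.
   by apply: le_trans t2 _; rewrite ler_wpM2l.
  by apply: le_trans t1 _; rewrite ler_wpM2l.
 by rewrite /GG mulrDr addrC lerD2l; apply: le_of_eq; ring.
Qed.

End smooth_approx.

(** * Gradient bounds on level bands from the isoperimetric inequality *)

Section real_tools.
Context {R : realType}.
Notation leb := (@lebesgue_measure R).

Lemma integral_add_step (f g : R -> \bar R) (c d : R) : 0 <= c -> 0 < d ->
 measurable_fun (`[0%R, +oo[ : set R) f -> measurable_fun (`[0%R, +oo[ : set R) g ->
 (forall t, (0 <= t)%R -> (0 <= f t)%E) ->
 (forall t, (0 <= t)%R -> f t + (c * \1_(`[0%R, d[%classic) t)%:E <= g t)%E ->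
 (\int[leb]_(t in `[0%R, +oo[) f t + (c * d)%:E <= \int[leb]_(t in `[0%R, +oo[) g t)%E.
Proof.
move=> c0 d0 mf mg f0 fg.
have mind : measurable_fun (`[0%R, +oo[ : set R) (fun t => (c * \1_(`[0%R, d[%classic) t)%:E : \bar R).
 by apply/measurable_EFinP; apply: measurable_funM => //; exact: measurable_indic.
apply: (@le_trans _ _ (\int[leb]_(t in `[0%R, +oo[)
  (f t + (c * \1_(`[0%R, d[%classic) t)%:E))%E).
 rewrite ge0_integralD//; last 2 first.
 - by move=> t /=; rewrite in_itv/= andbT; exact: f0.
 - by move=> t _; rewrite lee_fin mulr_ge0.
 apply: leeD => //.
 under eq_integral do rewrite EFinM.
 rewrite ge0_integralZl//; last by apply/measurable_EFinP; exact: measurable_indic.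
 rewrite integral_indic// (_ : _ `&` _ = `[0%R, d[%classic); last first.
  by apply/seteqP; split => t /=; rewrite !in_itv/= andbT; [case|move=> /andP[-> ->]].
 rewrite [X in (_ * X)%E](_ : _ = d%:E) -?EFinM//.
 by rewrite /= lebesgue_measure_itv/= lte_fin d0 oppr0 addr0.
apply: ge0_le_integral => //.
- by move=> t /=; rewrite in_itv/= andbT => t0; rewrite adde_ge0 ?f0// lee_fin mulr_ge0.
- by apply: emeasurable_funD.
by move=> t /=; rewrite in_itv/= andbT; exact: fg.
Qed.

Lemma clip_le (v e d : R) : 0 < d -> 0 <= e ->
 Num.min (Num.max (v + e) 0) d <= Num.min (Num.max v 0) d + e.
Proof.
move=> d0 e0; case: (leP (v + e) 0) => ?; case: (leP v 0) => ?;
 repeat match goal with |- context [Order.min ?a ?b] => case: (leP a b) => ? end; lra.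
Qed.

End real_tools.

Section coarea.
Context {R : realType}.
Notation leb := (@lebesgue_measure R).
Notation P := (mplane R).
Variables (V G : P -> R) (C L : R).
Hypotheses (mV : mfun P V) (mG : mfun P G).
Hypotheses (C0 : 0 <= C) (GL : forall x, 0 <= G x <= L).
Hypothesis regular : forall (x : P) y1 y2 r, 0 <= r <= 1 -> y1 ^+ 2 + y2 ^+ 2 <= r ^+ 2 ->
 V (x.1 + y1, x.2 + y2) <= V x + r * (G x + C * Num.sqrt r).

Let over (f : P -> R) (c : R) : set P := [set x | c < f x].
Let atleast (f : P -> R) (c : R) : set P := [set x | c <= f x].
Let below (f : P -> R) (c : R) : set P := [set x | f x < c].

Lemma measurable_over (f : P -> R) c : mfun P f -> measurable [set x | c < f x].
Proof.
move=> mf; have := measurable_superlevel (f := EFin \o f) _ c.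
rewrite (_ : [set x | _] = [set x : P | c < f x]); first by apply; exact/measurable_EFinP.
by apply/seteqP; split => x /=; rewrite lte_fin.
Qed.

Lemma measurable_under (f : P -> R) c : mfun P f -> measurable [set x | f x < c].
Proof.
move=> mf; rewrite (_ : [set x | _] = [set x : P | - c < - f x]).
 by apply: measurable_over; exact: measurableT_comp.
by apply/seteqP; split => x /=; rewrite ltrN2.
Qed.

Lemma measurable_atleast (f : P -> R) c : mfun P f -> measurable [set x | c <= f x].
Proof.
move=> mf; rewrite (_ : [set x | _] = ~` [set x : P | f x < c]).
 by apply: measurableC; exact: measurable_under.
by apply/seteqP; split => x /=; rewrite leNgt => /negP.
Qed.

(** Majorant of [V] on the disc of radius [h <= 1] about [x]. Superlevel sets of [V] thickened by
    [h] lie in those of [Phi h], while [Phi h - V] is of order [h * G]: this replaces the coarea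
    formula. *)
Let Phi h x := V x + h * (G x + C * Num.sqrt h).

Let mPhi h : mfun P (Phi h).
Proof. by apply: measurable_funD => //; apply: measurable_funM => //; exact: measurable_funD. Qed.

Let expands h c : 0 < h <= 1 -> disc_expands (over V c) (over (Phi h) c) h.
Proof.
move=> /andP[h0 h1] x y /= Vx /ltW yh; apply: lt_le_trans Vx _.
have := @regular (x.1 + y.1, x.2 + y.2) (- y.1) (- y.2) h; rewrite /= !addrK -surjective_pairing.
by apply; rewrite ?(ltW h0)// !sqrrN.
Qed.

Section band.
Variables (tau d s' : R).
Hypotheses (d0 : 0 < d) (s'0 : 0 <= s').
Hypothesis Vfin : (leb2 R (over V tau) < +oo)%E.
Hypothesis s'le : (s'%:E <= leb2 R (atleast V (tau + d)))%E.

Let cut (f : P -> R) x := Num.min (Num.max (f x - tau) 0) d.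

Let cut_ge0 f x : 0 <= cut f x.
Proof. by rewrite /cut le_min le_max lexx orbT ltW. Qed.

Let mcut (f : P -> R) : mfun P f -> mfun P (cut f).
Proof.
move=> mf; apply: measurable_minr => //; apply: measurable_maxr => //.
exact: measurable_funB.
Qed.

Let over_cut f t : 0 <= t ->
 [set x | (t%:E < (cut f x)%:E)%E] = if t < d then over f (tau + t) else set0.
Proof.
move=> t0; apply/seteqP; split => x /=; rewrite lte_fin /cut lt_min lt_max (ltNge t 0) t0 orbF.
 by move=> /andP[h1 ->] /=; move: h1; rewrite ltrBrDl.
by case: ifP => //= td; rewrite ltrBrDl => ->.
Qed.

(** Layer cake over the levels [tau + t] with [0 <= t < d]: the superlevel sets of [V] have area at
    least [s'] there, so the passage to [Phi h] adds at least [2 h sqrt (pi s')] to each area. *)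
Let gain h : 0 < h <= 1 ->
 (\int[leb2 R]_x (cut V x)%:E + (2 * h * Num.sqrt (pi * s') * d)%:E <= \int[leb2 R]_x (cut (Phi h) x)%:E)%E.
Proof.
move=> h01; have h0 : 0 < h by case/andP: h01.
pose c0 := 2 * h * Num.sqrt (pi * s').
have c00 : 0 <= c0 by rewrite /c0 !mulr_ge0 ?sqrtr_ge0// ltW.
have cE f : mfun P f -> (\int[leb2 R]_x (cut f x)%:E =
  \int[leb]_(t in `[0%R, +oo[) leb2 R [set x | (t%:E < (cut f x)%:E)%E])%E.
 move=> mf; apply: (layer_cake (@area R) (f := EFin \o cut f)).
  by apply/measurable_EFinP; exact: mcut.
 by move=> x; rewrite /= lee_fin.
have msup f : mfun P f ->
  measurable_fun (`[0%R, +oo[ : set R) (fun t : R => leb2 R [set x | (t%:E < (cut f x)%:E)%E]).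
 move=> mf; apply: (measurable_fun_superlevel (@area R) (f := EFin \o cut f)).
  by apply/measurable_EFinP; exact: mcut.
rewrite cE// (cE (Phi h))//; apply: integral_add_step => //; [exact: msup|exact: msup|].
move=> t t0; rewrite !over_cut//.
case: ifPn => td; last first.
 rewrite !measure0 add0e indicE memNset ?mulr0//= in_itv/= t0; exact/negP.
rewrite indicE mem_set ?mulr1/=; last by rewrite in_itv/= t0.
apply: brunn_minkowski_disc => //.
- exact: measurable_over.
- exact: measurable_over.
- exact: expands.
apply: le_trans s'le _; apply: subset_le_measure.
- exact: measurable_atleast.
- exact: measurable_over.
by move=> x /=; apply: lt_le_trans; rewrite ltrD2l.
Qed.

(** Only points of the band notice the growth from [V] to [Phi h]: elsewhere the two cut values are
    both 0 or both [d]. Dividing the gain by [h] leaves a lower bound for the integral of the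
    gradient. *)
Let band_h h : 0 < h <= 1 ->
 ((2 * Num.sqrt (pi * s') * d)%:E <=
  \int[leb2 R]_(x in over (Phi h) tau `&` below V (tau + d)) (G x + C * Num.sqrt h)%:E)%E.
Proof.
move=> h01; have h0 : 0 < h by case/andP: h01.
set B := _ `&` _; have mB : measurable B.
 by apply: measurableI; [exact: measurable_over|exact: measurable_under].
have e0 x : 0 <= G x + C * Num.sqrt h.
 by rewrite addr_ge0 ?mulr_ge0 ?sqrtr_ge0//; case/andP: (GL x).
have mGC : mfun P (fun x => (G x + C * Num.sqrt h)%:E).
 by apply/measurable_EFinP; exact: measurable_funD.
have cutle : (\int[leb2 R]_x (cut (Phi h) x)%:E <= \int[leb2 R]_x (cut V x)%:E +
  h%:E * \int[leb2 R]_(x in B) (G x + C * Num.sqrt h)%:E)%E.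
 rewrite [X in (_ + _ * X)%E]integral_mkcond epatch_indic -ge0_integralZl//; last 3 first.
 - by apply: emeasurable_funM => //; apply/measurable_EFinP; exact: measurable_indic.
 - by move=> x _; rewrite -EFinM lee_fin mulr_ge0.
 - by rewrite lee_fin ltW.
 rewrite -ge0_integralD//; last 4 first.
 - by move=> x _; rewrite lee_fin.
 - by apply/measurable_EFinP; exact: mcut.
 - by move=> x _; rewrite -!EFinM lee_fin !mulr_ge0// ltW.
 - by apply: measurable_funeM; apply: emeasurable_funM => //; apply/measurable_EFinP; exact: measurable_indic.
 apply: ge0_le_integral => //.
 - by move=> x _; rewrite lee_fin.
 - by apply/measurable_EFinP; exact: mcut.
 - apply: emeasurable_funD; first by apply/measurable_EFinP; exact: mcut.
  by apply: measurable_funeM; apply: emeasurable_funM => //; apply/measurable_EFinP; exact: measurable_indic.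
 move=> x _; rewrite -!EFinM -EFinD lee_fin.
 have he : 0 <= h * (G x + C * Num.sqrt h) by rewrite mulr_ge0// ltW.
 have PhiE : Phi h x = V x + h * (G x + C * Num.sqrt h) by [].
 have [xB|xB] := pselect (B x).
  rewrite indicE mem_set// mulr1; move: he PhiE; set e := h * _ => he PhiE.
  by rewrite /cut PhiE addrAC; exact: clip_le.
 rewrite indicE memNset// mulr0 mulr0 addr0; move: he PhiE; set e := h * _ => he PhiE.
 have : Phi h x <= tau \/ tau + d <= V x.
  have [?|h1] := leP (Phi h x) tau; first by left.
  by right; rewrite leNgt; apply/negP => h2; apply: xB.
 rewrite /cut PhiE => -[] ?; case: (leP (V x + e - tau) 0) => ?; case: (leP (V x - tau) 0) => ?;
  repeat match goal with |- context [Order.min ?a ?b] => case: (leP a b) => ? end; lra.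
have cutfin : (\int[leb2 R]_x (cut V x)%:E)%E \is a fin_num.
 rewrite ge0_fin_numE; last by apply: integral_ge0 => x _; rewrite lee_fin.
 apply: (@le_lt_trans _ _ (\int[leb2 R]_x (d%:E * (\1_(over V tau) x)%:E))%E).
  apply: ge0_le_integral => //.
  - by move=> x _; rewrite lee_fin.
  - by apply/measurable_EFinP; exact: mcut.
  - by apply: measurable_funeM; apply/measurable_EFinP; apply: measurable_indic; exact: measurable_over.
  move=> x _; rewrite -EFinM lee_fin /cut indicE.
  have [xV|xV] := pselect (over V tau x).
   by rewrite mem_set// mulr1 ge_min lexx orbT.
  rewrite memNset// mulr0; move: xV; rewrite /over/= => /negP; rewrite -leNgt => xV.
  by rewrite ge_min ge_max lexx andbT subr_le0 xV.
 rewrite ge0_integralZl//; last 2 first.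
 - by apply/measurable_EFinP; apply: measurable_indic; exact: measurable_over.
 - by rewrite lee_fin ltW.
 rewrite integral_indic//; last exact: measurable_over.
 by rewrite setIT lte_mul_pinfty// lee_fin ltW.
have := le_trans (gain h01) cutle; rewrite leeD2lE//.
rewrite (_ : 2 * h * _ * d = h * (2 * Num.sqrt (pi * s') * d)); last by ring.
by rewrite [X in (X <= _)%E]EFinM lee_pmul2l// lte_fin.
Qed.

(** Let [h] tend to 0. The band of [Phi h] moves with [h], but it lies in the fixed wider band once
    [h * (L + C) <= eta], and the error [C sqrt h] is integrated over a set of finite area. *)
Lemma band_gradient_eta (eta : R) : 0 < eta -> (leb2 R (over V (tau - eta)) < +oo)%E ->
 ((2 * Num.sqrt (pi * s') * d)%:E <=
  \int[leb2 R]_(x in over V (tau - eta) `&` below V (tau + d)) (G x)%:E)%E.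
Proof.
move=> eta0 fin; set B := _ `&` _; have mB : measurable B.
 by apply: measurableI; [exact: measurable_over|exact: measurable_under].
have L0 : 0 <= L by have /andP[h1 h2] := GL (0, 0); exact: le_trans h2.
have mO : measurable (over V (tau - eta)) by exact: measurable_over.
pose m := fine (leb2 R (over V (tau - eta))).
have mE : leb2 R (over V (tau - eta)) = m%:E by rewrite /m fineK// ge0_fin_numE.
have m0 : 0 <= m by exact: fine_ge0.
have I0 : (0 <= \int[leb2 R]_(x in B) (G x)%:E)%E.
 by apply: integral_ge0 => x _; rewrite lee_fin; case/andP: (GL x).
have main h : 0 < h <= 1 -> h * (L + C) <= eta ->
  ((2 * Num.sqrt (pi * s') * d)%:E <= \int[leb2 R]_(x in B) (G x)%:E + (C * Num.sqrt h * m)%:E)%E.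
 move=> h01 heta; have /andP[h0 h1] := h01; apply: le_trans (band_h h01) _.
 have sub : over (Phi h) tau `&` below V (tau + d) `<=` B.
  move=> x [/= Px Vx]; split => //; rewrite /over/=; move: Px; rewrite /over/= /Phi.
  have : h * (G x + C * Num.sqrt h) <= eta.
   apply: le_trans heta; rewrite ler_wpM2l ?(ltW h0)//; apply: lerD; first by case/andP: (GL x).
   by rewrite ler_piMr// -[leRHS]sqrtr1 ler_wsqrtr.
  lra.
 have mGC : measurable_fun B (fun x => (G x + C * Num.sqrt h)%:E).
  by apply/measurable_EFinP/measurable_funTS; exact: measurable_funD.
 have CS : 0 <= C * Num.sqrt h by rewrite mulr_ge0 ?sqrtr_ge0.
 apply: (@le_trans _ _ (\int[leb2 R]_(x in B) (G x + C * Num.sqrt h)%:E)%E).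
  apply: ge0_subset_integral => //.
   by apply: measurableI; [exact: measurable_over|exact: measurable_under].
  by move=> x _; rewrite lee_fin addr_ge0//; case/andP: (GL x).
 under eq_integral do rewrite EFinD.
 rewrite ge0_integralD//; last 2 first.
 - by move=> x _; rewrite lee_fin; case/andP: (GL x).
 - by apply/measurable_EFinP/measurable_funTS.
 apply: leeD => //; rewrite integral_cst// [X in (_ <= X)%E]EFinM lee_wpmul2l ?lee_fin// -mE.
 by apply: subset_le_measure => // x [].
move: main I0; case: (\int[leb2 R]_(x in B) _)%E => [I| |] // main I0; last by rewrite leey.
rewrite lee_fin; apply/ler_addgt0Pr => e e0.
pose q := e / (C * m + 1).
have den : 0 < C * m + 1 by rewrite ltr_wpDl// mulr_ge0.
have q0 : 0 < q by rewrite divr_gt0.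
have LC : 0 < L + C + 1 by rewrite ltr_wpDl// addr_ge0.
(* The three entries ensure [h <= 1], [h * (L + C) <= eta] and [C * sqrt h * m <= e]. *)
pose h := Num.min 1 (Num.min (eta / (L + C + 1)) (q ^+ 2)).
have h0 : 0 < h by rewrite /h !lt_min ltr01 divr_gt0//= exprn_gt0.
have := main h; rewrite h0 -EFinD lee_fin; move=> H.
have {}H : 2 * Num.sqrt (pi * s') * d <= I + C * Num.sqrt h * m.
 apply: H; first by rewrite /h ge_min lexx.
 apply: (@le_trans _ _ (eta / (L + C + 1) * (L + C))).
  by rewrite ler_wpM2r ?addr_ge0// /h !ge_min lexx orbT.
 rewrite mulrAC ler_pdivrMr// ler_wpM2l ?ltW//; lra.
apply: le_trans H _; rewrite lerD2l.
have hq : Num.sqrt h <= q.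
 rewrite -[leRHS](ger0_norm (ltW q0)) -sqrtr_sqr ler_wsqrtr// /h !ge_min lexx !orbT//.
apply: (@le_trans _ _ (C * q * m)).
 by rewrite ler_wpM2r// ler_wpM2l.
rewrite (_ : C * q * m = e * (C * m) / (C * m + 1)); last by rewrite /q; ring.
by rewrite ler_pdivrMr// ler_wpM2l ?(ltW e0)// lerDl.
Qed.

End band.

(** The widening by [eta] is undone by starting from [tau + eta], which lowers the height of the
    band by [eta] only. *)
Lemma band_gradient (tau tau' s' : R) : tau < tau' -> 0 <= s' ->
 (leb2 R (over V tau) < +oo)%E -> (s'%:E <= leb2 R (atleast V tau'))%E ->
 ((2 * Num.sqrt (pi * s') * (tau' - tau))%:E <=
  \int[leb2 R]_(x in over V tau `&` below V tau') (G x)%:E)%E.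
Proof.
move=> tt s'0 fin s'le.
have main eta : 0 < eta < tau' - tau -> ((2 * Num.sqrt (pi * s') * (tau' - tau - eta))%:E <=
  \int[leb2 R]_(x in over V tau `&` below V tau') (G x)%:E)%E.
 move=> /andP[e0 ed]; have d0 : 0 < tau' - tau - eta by rewrite subr_gt0.
 have := @band_gradient_eta (tau + eta) (tau' - tau - eta) s' d0 s'0.
 rewrite (_ : tau + eta + (tau' - tau - eta) = tau'); last by ring.
 have fin' : (leb2 R (over V (tau + eta)) < +oo)%E.
  apply: le_lt_trans fin; apply: subset_le_measure; [exact: measurable_over|exact: measurable_over|].
  by move=> x /=; apply: lt_trans; rewrite ltrDl.
 by move=> /(_ fin' s'le eta e0); rewrite addrK; apply.
have I0 : (0 <= \int[leb2 R]_(x in over V tau `&` below V tau') (G x)%:E)%E.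
 by apply: integral_ge0 => x _; rewrite lee_fin; case/andP: (GL x).
move: main I0; case: (\int[leb2 R]_(x in _) _)%E => [I| |] // main I0; last by rewrite leey.
rewrite lee_fin; apply/ler_addgt0Pr => e e0.
pose c := 2 * Num.sqrt (pi * s').
have c0 : 0 <= c by rewrite mulr_ge0 ?sqrtr_ge0.
pose eta := Num.min ((tau' - tau) / 2) (e / (c + 1)).
have c1 : 0 < c + 1 by rewrite ltr_wpDl.
have dt : 0 < tau' - tau by rewrite subr_gt0.
have eta0 : 0 < eta by rewrite /eta lt_min !divr_gt0.
have := main eta; rewrite eta0 lee_fin -/c => H.
have {}H : c * (tau' - tau - eta) <= I.
 apply: H; apply: (@le_lt_trans _ _ ((tau' - tau) / 2)); first by rewrite /eta ge_min lexx.
 lra.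
have : c * eta <= e.
 apply: (@le_trans _ _ (c * (e / (c + 1)))); first by rewrite ler_wpM2l// /eta ge_min lexx orbT.
 by rewrite mulrA ler_pdivrMr// mulrC ler_wpM2l ?(ltW e0)// lerDl.
move: H; rewrite mulrBr; lra.
Qed.

(** The band has area at most [s - s'], so Cauchy-Schwarz turns the gradient bound into an energy
    bound; [k] is the optimal constant in [(G - k)^2 >= 0]. *)
Lemma band_energy (tau tau' s s' : R) : tau < tau' -> 0 <= s' < s ->
 (leb2 R (over V tau) <= s%:E)%E -> (s'%:E <= leb2 R (atleast V tau'))%E ->
 ((4 * pi * s' * (tau' - tau) ^+ 2 / (s - s'))%:E <=
  \int[leb2 R]_(x in over V tau `&` below V tau') (G x ^+ 2)%:E)%E.
Proof.
move=> tt /andP[s'0 s's] sle s'le; set B := _ `&` _.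
have fin : (leb2 R (over V tau) < +oo)%E by exact: le_lt_trans sle (ltry _).
have mB : measurable B by apply: measurableI; [exact: measurable_over|exact: measurable_under].
have BS : (leb2 R B <= (s - s')%:E)%E.
 have : (leb2 R B + leb2 R (atleast V tau') <= s%:E)%E.
  apply: le_trans sle; rewrite -measureU//; last 2 first.
  - exact: measurable_atleast.
  - by apply/seteqP; split => x //= [[_ h1]]; rewrite /atleast/= leNgt => /negP; apply.
  apply: subset_le_measure; [by apply: measurableU => //; exact: measurable_atleast|exact: measurable_over|].
  by move=> x /= [[//]|]; rewrite /atleast/over/=; exact: lt_le_trans.
 move=> H; have := leeD2l (leb2 R B) s'le => /le_trans /(_ H).
 have : (0 <= leb2 R B)%E by [].
 case: (leb2 R B) => //= r _; rewrite -EFinD !lee_fin; lra.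
have := band_gradient tt s'0 fin s'le; rewrite -/B.
set q := Num.sqrt (pi * s'); have q2 : q ^+ 2 = pi * s' by rewrite sqr_sqrtr// mulr_ge0// pi_ge0.
have q0 : 0 <= q by exact: sqrtr_ge0.
set d := tau' - tau; have d0 : 0 < d by rewrite subr_gt0.
have ss : 0 < s - s' by rewrite subr_gt0.
pose k := 2 * q * d / (s - s').
have k0 : 0 <= k by rewrite divr_ge0 ?(ltW ss)// !mulr_ge0// ltW.
have mGB : measurable_fun B (fun x => (G x)%:E) by apply/measurable_EFinP/measurable_funTS.
have mG2 : measurable_fun B (fun x => (G x ^+ 2)%:E).
 by apply/measurable_EFinP/measurable_funTS; exact: measurable_funX.
move=> H1.
have H2 : ((2 * k)%:E * \int[leb2 R]_(x in B) (G x)%:E <=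
  \int[leb2 R]_(x in B) (G x ^+ 2)%:E + (k ^+ 2 * (s - s'))%:E)%E.
 rewrite -ge0_integralZl//; last 2 first.
 - by move=> x _; rewrite lee_fin; case/andP: (GL x).
 - by rewrite lee_fin mulr_ge0.
 apply: (@le_trans _ _ (\int[leb2 R]_(x in B) ((G x ^+ 2)%:E + (k ^+ 2)%:E))%E).
  apply: ge0_le_integral => //.
  - move=> x _; rewrite -EFinM lee_fin; apply: mulr_ge0; last by case/andP: (GL x).
   exact: mulr_ge0.
  - exact: measurable_funeM.
  - exact: emeasurable_funD.
  - move=> x _; rewrite -EFinM -EFinD lee_fin -subr_ge0.
   by rewrite (_ : _ - _ = (G x - k) ^+ 2) ?sqr_ge0//; ring.
 rewrite ge0_integralD//; last 2 first.
 - by move=> x _; rewrite lee_fin sqr_ge0.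
 - by move=> x _; rewrite lee_fin sqr_ge0.
 by apply: leeD => //; rewrite integral_cst// [X in (_ <= X)%E]EFinM lee_wpmul2l// lee_fin sqr_ge0.
have : (0 <= \int[leb2 R]_(x in B) (G x ^+ 2)%:E)%E.
 by apply: integral_ge0 => x _; rewrite lee_fin sqr_ge0.
move: H2; case: (\int[leb2 R]_(x in B) (G x ^+ 2)%:E)%E => [I| |] // H2 _; last by rewrite leey.
have k20 : (0 <= (2 * k)%:E)%E by rewrite lee_fin mulr_ge0.
have := le_trans (lee_wpmul2l k20 H1) H2; rewrite -EFinM -EFinD !lee_fin => H3.
have -> : 4 * pi * s' * d ^+ 2 / (s - s') = 2 * k * (2 * q * d) - k ^+ 2 * (s - s').
 rewrite -[4 * pi * s']mulrA -q2 /k; field; exact: lt0r_neq0.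
by rewrite lerBlDr.
Qed.

End coarea.

(** * Sums of squared increments and chains of levels *)

Section block_sums.
Context {R : realType}.

Lemma sqr_sum_le_sum (a : nat -> R) (k : nat) :
 (\sum_(j < k) a j) ^+ 2 <= k%:R * \sum_(j < k) a j ^+ 2.
Proof.
case: k => [|k]; first by rewrite !big_ord0 expr0n mul0r.
set S := \sum_(j < _) a j; set Q := \sum_(j < _) _; pose K : R := k.+1%:R.
have K0 : 0 < K by [].
have : 0 <= \sum_(j < k.+1) (a j - S / K) ^+ 2 by apply: sumr_ge0 => j _; exact: sqr_ge0.
have -> : \sum_(j < k.+1) (a j - S / K) ^+ 2 = Q - 2 * (S / K) * S + K * (S / K) ^+ 2.
 rewrite (eq_bigr (fun j : 'I_k.+1 => a j ^+ 2 - 2 * (S / K) * a j + (S / K) ^+ 2)); last by move=> j _; ring.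
 rewrite big_split sumrB/= -mulr_sumr; congr (_ + _).
 by rewrite sumr_const card_ord -mulr_natl.
move=> H; have : 0 <= K * (Q - 2 * (S / K) * S + K * (S / K) ^+ 2) by rewrite mulr_ge0// ltW.
rewrite (_ : K * _ = K * Q - S ^+ 2) ?subr_ge0//; field; exact: lt0r_neq0.
Qed.

(** Cauchy-Schwarz in each block of [K] increments: energy bounds on a fine grid imply those on a
    coarse grid. *)
Lemma block_sum (f : nat -> R) (K N : nat) :
 \sum_(i < N) (f (i.+1 * K)%N - f (i * K)%N) ^+ 2 <=
 K%:R * \sum_(j < N * K) (f j.+1 - f j) ^+ 2.
Proof.
elim: N => [|n IH]; first by rewrite mul0n !big_ord0 mulr0.
rewrite big_ord_recr/= mulSnr big_split_ord/= mulrDr; apply: lerD => //.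
have -> : f (n * K + K)%N - f (n * K)%N = \sum_(j < K) (f (n * K + j).+1 - f (n * K + j)%N).
 rewrite -(big_mkord xpredT (fun j => f (n * K + j).+1 - f (n * K + j)%N)).
 rewrite (eq_bigr (fun j => f (n * K + j.+1)%N - f (n * K + j)%N)); last by move=> j _; rewrite addnS.
 by rewrite (@telescope_sumr _ 0 K (fun j => f (n * K + j)%N))// addn0.
exact: (sqr_sum_le_sum (fun j => f (n * K + j).+1 - f (n * K + j)%N)).
Qed.

End block_sums.

Section level_chain.
Context {R : realType}.
Notation P := (mplane R).
Variables (V G : P -> R) (C L : R).
Hypotheses (mV : mfun P V) (mG : mfun P G).
Hypotheses (C0 : 0 <= C) (GL : forall x, 0 <= G x <= L).
Hypothesis regular : forall (x : P) y1 y2 r, 0 <= r <= 1 -> y1 ^+ 2 + y2 ^+ 2 <= r ^+ 2 ->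
 V (x.1 + y1, x.2 + y2) <= V x + r * (G x + C * Num.sqrt r).

(** The bands between [lo i] and [hi i] are disjoint, so their energies add up. A band may be empty,
    whence the maximum with 0 and conditions required only for [lo i < hi i]. *)
Lemma level_chain (lo hi s s' : nat -> R) (N : nat) :
 (forall i, lo i <= lo i.+1) -> (forall i, hi i <= lo i.+1) ->
 (forall i, (i < N)%N -> lo i < hi i -> [/\ 0 <= s' i < s i,
   (leb2 R [set x | (lo i < V x)%R] <= (s i)%:E)%E &
   ((s' i)%:E <= leb2 R [set x | (hi i <= V x)%R])%E]) ->
 ((\sum_(i < N) 4 * pi * s' i * (Num.max 0 (hi i - lo i)) ^+ 2 / (s i - s' i))%:E <=
  \int[leb2 R]_x (G x ^+ 2)%:E)%E.
Proof.
move=> lo_mono hilo cond.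
have mG2 D : measurable_fun D (fun x => (G x ^+ 2)%:E).
 by apply/measurable_EFinP/measurable_funTS; exact: measurable_funX.
have mb c : measurable [set x | V x < c] by exact: measurable_under.
have mo c : measurable [set x | c < V x] by exact: measurable_over.
suff H n : (n <= N)%N -> ((\sum_(i < n) 4 * pi * s' i * (Num.max 0 (hi i - lo i)) ^+ 2 / (s i - s' i))%:E <=
  \int[leb2 R]_(x in [set x | (V x < lo n)%R]) (G x ^+ 2)%:E)%E.
 apply: le_trans (H N (leqnn _)) _; apply: ge0_subset_integral => //.
 by move=> x _; rewrite lee_fin sqr_ge0.
elim: n => [_|n IH nN].
 by rewrite big_ord0; apply: integral_ge0 => x _; rewrite lee_fin sqr_ge0.
have {}IH := IH (ltnW nN); rewrite big_ord_recr/=.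
have sub : [set x | V x < lo n] `<=` [set x | V x < lo n.+1].
 by move=> x /= /lt_le_trans; apply.
have [lh|hl] := ltP (lo n) (hi n); last first.
 rewrite (max_l _) ?subr_le0// expr0n/= mulr0 mul0r addr0.
 apply: le_trans IH _; apply: ge0_subset_integral => // x _; rewrite lee_fin sqr_ge0//.
rewrite (max_r _) ?subr_ge0 ?(ltW lh)//.
have [ss c1 c2] := cond n nN lh.
have := band_energy mV mG C0 GL regular lh ss c1 c2 => B.
rewrite EFinD; apply: le_trans (leeD IH B) _.
rewrite -ge0_integral_setU//; last 3 first.
- exact: measurableI.
- by move=> x _; rewrite lee_fin sqr_ge0.
- apply/disj_set2P/seteqP; split => x //= [h1 [h2 _]].
 by move: h1; rewrite ltNge (ltW h2).
apply: ge0_subset_integral => //.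
- by apply: measurableU => //; exact: measurableI.
- by move=> x _; rewrite lee_fin sqr_ge0.
- by move=> x /= [/sub//|[_ /lt_le_trans]]; apply.
Qed.

End level_chain.

(** * Decreasing rearrangement and discrete Polya-Szego inequality *)

Section distribution.
Context {R : realType}.
Notation leb := (@lebesgue_measure R).
Notation P := (mplane R).

Lemma chebyshev_sqr (f : P -> R) (M eta : R) : mfun P f -> 0 < eta ->
 (\int[leb2 R]_x (f x ^+ 2)%:E <= M%:E)%E ->
 (leb2 R [set x | (eta < `|f x|)%R] <= (M / eta ^+ 2)%:E)%E.
Proof.
move=> mf e0 fM.
have mA : measurable [set x | (eta < `|f x|)%R].
 by apply: (measurable_over (f := fun x => `|f x|)); exact: measurableT_comp.
have e2 : 0 < eta ^+ 2 by rewrite exprn_gt0.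
have H : ((eta ^+ 2)%:E * leb2 R [set x | (eta < `|f x|)%R] <= M%:E)%E.
 apply: le_trans fM.
 have := integral_indic (leb2 R) measurableT mA; rewrite setIT => <-; rewrite -ge0_integralZl//; last 2 first.
 - by apply/measurable_EFinP; exact: measurable_indic.
 - by rewrite lee_fin ltW.
 apply: ge0_le_integral => //.
 - by move=> x _; rewrite -EFinM lee_fin mulr_ge0// ltW.
 - by apply: measurable_funeM; apply/measurable_EFinP; exact: measurable_indic.
 - by apply/measurable_EFinP; exact: measurable_funX.
 move=> x _; rewrite -EFinM lee_fin indicE; case: (boolP (x \in _)) => [/set_mem/= xA|_]; last first.
  by rewrite mulr0 sqr_ge0.
 by rewrite mulr1 -[leRHS]real_normK ?num_real// lerXn2r ?nnegrE// ltW.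
by rewrite -(@lee_pmul2l _ (eta ^+ 2)%:E)// ?lte_fin// -EFinM mulrCA mulfV ?mulr1// gt_eqF.
Qed.

Variable u : P -> R.
Hypothesis mu : mfun P u.
Variable M : R.
Hypothesis uM : (\int[leb2 R]_x (u x ^+ 2)%:E <= M%:E)%E.

Definition dist_fun (tau : R) : \bar R := leb2 R [set x | tau < `|u x|].

Let mabs : mfun P (fun x => `|u x|).
Proof. exact: measurableT_comp. Qed.

Lemma dist_fun_le (t1 t2 : R) : t1 <= t2 -> (dist_fun t2 <= dist_fun t1)%E.
Proof.
move=> t12; apply: subset_le_measure; [exact: measurable_over|exact: measurable_over|].
by move=> x /=; exact: le_lt_trans.
Qed.

Lemma dist_fun_right (tau s : R) : (s%:E < dist_fun tau)%E ->
 exists2 tau', tau < tau' & (s%:E < dist_fun tau')%E.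
Proof.
move=> st; apply: contrapT => H.
have Hn (n : nat) : (dist_fun (tau + n.+1%:R^-1) <= s%:E)%E.
 by rewrite leNgt; apply/negP => h; apply: H; exists (tau + n.+1%:R^-1); rewrite ?ltrDl ?invr_gt0.
pose A (n : nat) : set P := [set x | tau + n.+1%:R^-1 < `|u x|].
have mA n : measurable (A n) by exact: measurable_over.
have AU : \bigcup_n A n = [set x | tau < `|u x|].
 apply/seteqP; split => x.
  by move=> [n _]; rewrite /A/=; apply: le_lt_trans; rewrite lerDl invr_ge0.
 move=> /= tx; have : \forall n \near \oo, tau + n.+1%:R^-1 < `|u x|.
  have : (tau + n.+1%:R^-1) @[n --> \oo] --> tau + 0.
   by apply: cvgD; [exact: cvg_cst|exact: cvg_harmonic].
  by rewrite addr0 => /cvgr_lt; apply.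
 by case=> n _ /(_ n (leqnn n)) h; exists n.
have := @nondecreasing_cvg_mu _ _ _ (leb2 R) A mA.
rewrite AU => /(_ (measurable_over tau mabs)) cv.
have nd : nondecreasing_seq A.
 move=> m n mn; apply/subsetPset => x; rewrite /A/=; apply: le_lt_trans.
 by rewrite lerD2l lef_pV2 ?posrE// ler_nat.
have : (leb2 R [set x | (tau < `|u x|)%R] <= s%:E)%E.
 by apply: (cvge_to_le (cv nd)); exact: nearW.
by rewrite leNgt => /negP; apply.
Qed.

(** Generalised inverse of [dist_fun]. When [u] is nonzero on an area at most [s], the set is empty
    and [sup] returns 0, which is the right value. *)
Definition level (s : R) : R := sup [set tau | 0 <= tau /\ (s%:E < dist_fun tau)%E].

(** Right continuity of [dist_fun] gives an equivalence of strict inequalities; Chebyshev's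
    inequality bounds the set, so that the supremum is a genuine one. *)
Lemma level_gt (s tau : R) : 0 < s -> 0 <= tau ->
 (tau < level s) = (s%:E < dist_fun tau)%E.
Proof.
move=> s0 tau0; set S := [set tau | 0 <= tau /\ (s%:E < dist_fun tau)%E].
have M0 : 0 <= M.
 by rewrite -lee_fin; apply: le_trans uM; apply: integral_ge0 => x _; rewrite lee_fin sqr_ge0.
have ubS : has_ubound S.
 exists (1 + M / s) => t [t0 st]; rewrite leNgt; apply/negP => tM.
 have Ms : 0 <= M / s by rewrite divr_ge0// ltW.
 have t1 : 0 < t by apply: lt_trans tM; rewrite ltr_pwDl.
 have := lt_le_trans st (chebyshev_sqr mu t1 uM); rewrite lte_fin ltNge => /negP; apply.
 rewrite ler_pdivrMr ?exprn_gt0//.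
 have : M = s * (M / s) by rewrite mulrCA mulfV ?mulr1// gt_eqF.
 move: Ms tM; set q := M / s => Ms tM ->; rewrite ler_wpM2l ?ltW// expr2.
 by nra.
apply/idP/idP => [lt|st].
 have Sne : S !=set0.
  apply/set0P/negP => /eqP S0; move: lt; rewrite /level -/S S0 sup0 ltNge tau0//.
 have [t [t0 st] tt] := sup_gt Sne lt.
 by apply: lt_le_trans st _; apply: dist_fun_le; exact: ltW.
have [t' tt st'] := dist_fun_right st.
apply: (lt_le_trans tt); apply: ub_le_sup => //; split => //.
by rewrite (le_trans tau0)// (ltW tt).
Qed.

Lemma level_ge0 (s : R) : 0 < s -> 0 <= level s.
Proof.
move=> s0; set S := [set tau | 0 <= tau /\ (s%:E < dist_fun tau)%E].
have [Sne|/set0P/negP/negPn/eqP S0] := pselect (S !=set0); last by rewrite /level -/S S0 sup0.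
rewrite leNgt; apply/negP => l0; case: Sne => t [t0 st].
by have := level_gt s0 t0; rewrite st => tl; have := lt_trans (le_lt_trans t0 (tl : t < _)) l0; rewrite ltxx.
Qed.

Lemma level_le (s1 s2 : R) : 0 < s1 -> s1 <= s2 -> level s2 <= level s1.
Proof.
move=> s10 s12; have s20 := lt_le_trans s10 s12.
rewrite leNgt level_gt ?level_ge0//; apply/negP => h.
have : (s1%:E < dist_fun (level s1))%E by apply: le_lt_trans h; rewrite lee_fin.
by rewrite -level_gt ?level_ge0// ltxx.
Qed.

(** Polya-Szego along finitely many levels. A regular [U] differs from [u] by more than [e / 2] only
    on an area at most [e], so the chain for [|U|] uses levels and areas shifted by [e]; then [e]
    tends to 0. *)
Lemma level_energy (g : plane R -> plane R) (E : R) (s : nat -> R) (N : nat) :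
 H1_grad u g -> (\int[leb2 R]_x ((g x).1 ^+ 2 + (g x).2 ^+ 2)%:E <= E%:E)%E ->
 (forall i, 0 < s i.+1 < s i) ->
 \sum_(i < N) 4 * pi * s i.+1 * (level (s i.+1) - level (s i)) ^+ 2 / (s i - s i.+1) <= E.
Proof.
move=> ug gE sd.
have sp i : 0 < s i by case: i => [|i]; [have /andP[h1 h2] := sd 0%N; exact: lt_trans h2|case/andP: (sd i)].
have sle m n : (m <= n)%N -> s n <= s m.
 move=> /subnK <-; elim: (n - m)%N => // k IH; apply: le_trans IH.
 by rewrite addSn ltW//; case/andP: (sd (k + m)%N).
pose v i := level (s i).
have vm i : v i <= v i.+1 by apply: level_le => //; rewrite ltW//; case/andP: (sd i).
have v0 i : 0 <= v i by exact: level_ge0.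
have main e : 0 < e <= s N ->
  \sum_(i < N) 4 * pi * (s i.+1 - e) * ((v i.+1 - v i) ^+ 2 - 4 * (v i.+1 - v i) * e) /
   (s i - s i.+1 + 2 * e) <= E.
 move=> /andP[e0 eN].
 have h0 : 0 < e / 2 by rewrite divr_gt0.
 have d0 : 0 < e * (e / 2) ^+ 2 by rewrite mulr_gt0// exprn_gt0.
 have [U [G [C [L [[C0 mU mG GL] [_ Gg Uu reg]]]]]] := smooth_approx ug d0.
 have bad : (leb2 R [set x | (e / 2 < `|U x - u x|)%R] <= e%:E)%E.
  apply: le_trans (chebyshev_sqr _ h0 Uu) _; first exact: measurable_funB.
  by rewrite lee_fin mulfK// gt_eqF// exprn_gt0.
 pose V x := `|U x|.
 have mV : mfun P V by exact: measurableT_comp.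
 have regV (x : P) y1 y2 r : 0 <= r <= 1 -> y1 ^+ 2 + y2 ^+ 2 <= r ^+ 2 ->
   V (x.1 + y1, x.2 + y2) <= V x + r * (G x + C * Num.sqrt r).
  move=> r1 yr; have := reg x y1 y2 r r1 yr => h.
  by rewrite -lerBlDl; apply: le_trans h; exact: lerB_dist.
 have mbad : measurable [set x | e / 2 < `|U x - u x|].
  by apply: (measurable_over (f := fun x => `|U x - u x|)); apply: measurableT_comp => //; exact: measurable_funB.
 have := @level_chain R V G C L mV mG C0 GL regV (fun i => v i + e) (fun i => v i.+1 - e)
  (fun i => s i + e) (fun i => s i.+1 - e) N.
 have lo_mono i : v i + e <= v i.+1 + e by rewrite lerD2r.
 have hilo i : v i.+1 - e <= v i.+1 + e by lra.
 move=> /(_ lo_mono hilo) H.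
 have {}H : ((\sum_(i < N) 4 * pi * (s i.+1 - e) * Num.max 0 (v i.+1 - e - (v i + e)) ^+ 2 /
   (s i + e - (s i.+1 - e)))%:E <= E%:E)%E.
  apply: le_trans (le_trans (H _) Gg) gE => i iN lohi; split.
  - rewrite subr_ge0 (le_trans eN) ?sle//=.
   have /andP[_ h] := sd i; lra.
  - apply: (@le_trans _ _ (dist_fun (v i + e / 2) + leb2 R [set x | (e / 2 < `|U x - u x|)%R])%E).
    apply: (@le_trans _ _ (leb2 R ([set x | v i + e / 2 < `|u x|] `|` [set x | e / 2 < `|U x - u x|]))).
     apply: subset_le_measure; [exact: measurable_over|by apply: measurableU => //; exact: measurable_over|].
     move=> x /= Vx; have [h|h] := ltP (e / 2) `|U x - u x|; [by right|left].
     have := ler_normD (U x - u x) (u x); rewrite subrK -/(V x); lra.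
    apply: measureU2 => //; exact: measurable_over.
   rewrite EFinD; apply: leeD => //; rewrite leNgt; apply/negP.
   by rewrite -level_gt// ?addr_ge0// ?(ltW h0)// -/(v i) gtrDl ltNge (ltW h0).
  - have hh : 0 <= v i.+1 - e / 2 by have := v0 i; lra.
   have vs : ((s i.+1)%:E < dist_fun (v i.+1 - e / 2))%E.
    by rewrite -level_gt// -/(v i.+1) ltrBlDr ltrDl.
   have : (dist_fun (v i.+1 - e / 2) <= leb2 R [set x | (v i.+1 - e <= V x)%R] + leb2 R [set x | (e / 2 < `|U x - u x|)%R])%E.
    apply: (@le_trans _ _ (leb2 R ([set x | v i.+1 - e <= V x] `|` [set x | e / 2 < `|U x - u x|]))).
     apply: subset_le_measure; [exact: measurable_over|by apply: measurableU => //; exact: measurable_atleast|].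
     move=> x /= Vx; have [h|h] := ltP (e / 2) `|U x - u x|; [by right|left].
     have := ler_normD (u x - U x) (U x); rewrite subrK -/(V x) distrC; lra.
    apply: measureU2 => //; exact: measurable_atleast.
   move=> /(lt_le_trans vs) /ltW /le_trans => /(_ (leb2 R [set x | (v i.+1 - e <= V x)%R] + e%:E)%E).
   by rewrite EFinB leeBlDr//; apply; exact: leeD.
 move: H; rewrite lee_fin; apply: le_trans; apply: ler_sum => i _.
 have -> : s i + e - (s i.+1 - e) = s i - s i.+1 + 2 * e by ring.
 have den : 0 < s i - s i.+1 + 2 * e by have /andP[_ h] := sd i; lra.
 rewrite ler_wpM2r ?invr_ge0 ?(ltW den)// ler_wpM2l//.
  rewrite !mulr_ge0 ?pi_ge0// subr_ge0 (le_trans eN)// sle//; exact: ltn_ord.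
 have := vm i; move: (v i) (v i.+1) => a b ab.
 case: (leP 0 (b - e - (a + e))) => h; first by nra.
 rewrite expr0n/=; nra.
have lim : \sum_(i < N) 4 * pi * (s i.+1 - s N * n.+1%:R^-1) * ((v i.+1 - v i) ^+ 2 - 4 * (v i.+1 - v i) * (s N * n.+1%:R^-1)) /
   (s i - s i.+1 + 2 * (s N * n.+1%:R^-1)) @[n --> \oo] -->
 \sum_(i < N) 4 * pi * (s i.+1 - s N * 0) * ((v i.+1 - v i) ^+ 2 - 4 * (v i.+1 - v i) * (s N * 0)) /
   (s i - s i.+1 + 2 * (s N * 0)).
 have ce : s N * n.+1%:R^-1 @[n --> \oo] --> s N * 0.
  by apply: cvgMl_tmp; exact: cvg_harmonic.
 apply: cvg_big => [|i _]; first exact: add_continuous.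
 apply: cvgM; last first.
  apply: cvgV; first by rewrite !mulr0 addr0 subr_eq0 gt_eqF//; case/andP: (sd i).
  by apply: cvgD; [exact: cvg_cst|exact: cvgMl_tmp].
 apply: cvgM.
  by apply: cvgMl_tmp; apply: cvgB => //; exact: cvg_cst.
 by apply: cvgB; [exact: cvg_cst|exact: cvgMl_tmp].
have := @cvgr_to_le _ _ _ _ _ _ E lim.
have -> : \sum_(i < N) 4 * pi * (s i.+1 - s N * 0) * ((v i.+1 - v i) ^+ 2 - 4 * (v i.+1 - v i) * (s N * 0)) /
   (s i - s i.+1 + 2 * (s N * 0)) = \sum_(i < N) 4 * pi * s i.+1 * (level (s i.+1) - level (s i)) ^+ 2 / (s i - s i.+1).
 by apply: eq_bigr => i _; rewrite !mulr0 !subr0 addr0.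
apply; apply: nearW => n; apply: main.
by rewrite mulr_gt0//= ler_piMr ?(ltW (sp N))// invf_le1// ler1n.
Qed.

Let r4 : 0 < Num.sqrt (4 * pi) :> R.
Proof. by rewrite sqrtr_gt0 mulr_gt0// pi_gt0. Qed.

Let pi4 : 0 < 4 * pi :> R. Proof. by rewrite mulr_gt0// pi_gt0. Qed.

(* Decreasing rearrangement of [sqrt (4 pi) |u|] as a function of the area
  divided by [4 pi]. *)
Definition profile (sg : R) : R :=
 if 0 < sg then Num.sqrt (4 * pi) * level (4 * pi * sg) else 0.

Lemma profile_gt (sg c : R) : 0 < sg -> 0 <= c ->
 (c < profile sg) = ((4 * pi * sg)%:E < dist_fun (c / Num.sqrt (4 * pi)))%E.
Proof.
move=> sg0 c0; rewrite /profile sg0 -level_gt ?(mulr_gt0 pi4)// ?divr_ge0 ?(ltW r4)//.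
by rewrite ltr_pdivrMr// mulrC.
Qed.

Lemma profile_ge0 sg : 0 <= profile sg.
Proof.
rewrite /profile; case: ifPn => // s0; rewrite mulr_ge0 ?(ltW r4)//.
by apply: level_ge0; exact: mulr_gt0.
Qed.

Lemma profile_le s1 s2 : 0 < s1 -> s1 <= s2 -> profile s2 <= profile s1.
Proof.
move=> s10 s12; rewrite /profile s10 (lt_le_trans s10 s12) ler_wpM2l ?(ltW r4)//.
by apply: level_le; [exact: mulr_gt0|rewrite ler_wpM2l// ltW].
Qed.

Lemma profile_over c : 0 <= c ->
 ((4 * pi)%:E * leb [set sg | (c < profile sg)%R] = dist_fun (c / Num.sqrt (4 * pi)))%E.
Proof.
move=> c0.
have -> : [set sg | c < profile sg] =
  [set sg | 0 < sg /\ ((4 * pi * sg)%:E < dist_fun (c / Num.sqrt (4 * pi)))%E].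
 apply/seteqP; split => sg /=.
  have [s0|s0] := ltP 0 sg; first by rewrite profile_gt.
  by rewrite /profile (ltNge 0 sg) s0/= ltNge c0.
 by move=> [s0 h]; rewrite profile_gt.
have : (0 <= dist_fun (c / Num.sqrt (4 * pi)))%E by rewrite /dist_fun.
case: (dist_fun _) => [m| |//] m0.
- rewrite (_ : [set sg | _] = `]0%R, m / (4 * pi)[%classic); last first.
  apply/seteqP; split => sg /=; rewrite in_itv/= lte_fin ltr_pdivlMr// mulrC.
   by move=> [-> ->].
  by move=> /andP.
 rewrite lebesgue_measure_itv/= lte_fin; case: ltP => mm.
  by rewrite -EFinB -EFinM subr0 mulrC mulfVK// gt_eqF.
 rewrite mule0; congr (_%:E); apply/eqP; rewrite eq_le -lee_fin m0/=.
 by move: mm; rewrite ler_pdivrMr// mul0r.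
- rewrite (_ : [set sg | _] = `]0%R, +oo[%classic); last first.
  by apply/seteqP; split => sg /=; rewrite in_itv/= andbT; [case|move=> h; rewrite ltry].
 by rewrite lebesgue_measure_itv/= ltry oppr0 gt0_muley// lte_fin.
Qed.

Lemma measurable_profile : mfun R profile.
Proof.
apply: (measurability (RGenOInfty.G (R := R))); first exact: RGenOInfty.measurableE.
move=> _ [_ [c ->] <-]; rewrite setTI.
rewrite (_ : _ @^-1` _ = [set sg | c < profile sg]); last first.
 by apply/seteqP; split => sg /=; rewrite in_itv/= andbT.
have [c0|c0] := ltP c 0.
 rewrite (_ : [set sg | _] = setT)//; apply/seteqP; split => // sg _ /=.
 exact: lt_le_trans (profile_ge0 sg).
rewrite (_ : [set sg | c < profile sg] = [set sg | 0 < sg] `&`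
  [set sg | ((4 * pi * sg)%:E < dist_fun (c / Num.sqrt (4 * pi)))%E]); last first.
 apply/seteqP; split => sg /=.
  have [s0|s0] := ltP 0 sg; first by rewrite profile_gt.
  by rewrite /profile (ltNge 0 sg) s0/= ltNge c0.
 by move=> [s0 h]; rewrite profile_gt.
apply: measurableI.
 rewrite (_ : [set sg | _] = `]0, +oo[%classic)//.
 by apply/seteqP; split => sg /=; rewrite in_itv/= andbT.
rewrite -[X in measurable X]setTI; apply: measurable_lte => //.
by apply/measurable_EFinP; exact: measurable_funM.
Qed.

(** Layer cake on both sides: within the half-line the superlevel sets of [F] are the intervals []t,
    +oo[], so only the distribution function of [u] enters. *)
Lemma equimeasurable (F : R -> R) : mfun R F -> F 0 = 0 ->
 (forall y, 0 <= y -> 0 <= F y) ->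
 (forall c, 0 <= c -> exists2 t, 0 <= t & forall y, 0 <= y -> (c < F y) = (t < y)) ->
 (\int[leb2 R]_x (F (Num.sqrt (4 * pi) * `|u x|))%:E =
  (4 * pi)%:E * \int[leb]_(sg in `]0%R, +oo[) (F (profile sg))%:E)%E.
Proof.
move=> mF F0 Fge Fsup.
have -> : (\int[leb]_(sg in `]0%R, +oo[) (F (profile sg))%:E = \int[leb]_sg (F (profile sg))%:E)%E.
 rewrite integral_mkcond; apply: eq_integral => sg _; rewrite patchE.
 case: ifPn => //; rewrite notin_setE/= in_itv/= andbT => /negP/negbTE h.
 by rewrite /profile h F0.
have mFu : mfun P (fun x => (F (Num.sqrt (4 * pi) * `|u x|))%:E).
 by apply/measurable_EFinP; apply: measurableT_comp => //; exact: measurable_funM.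
have mFX : mfun R (fun sg => (F (profile sg))%:E).
 by apply/measurable_EFinP; apply: measurableT_comp => //; exact: measurable_profile.
rewrite (layer_cake (@area R) mFu); last first.
 by move=> x; rewrite lee_fin Fge// mulr_ge0 ?(ltW r4).
have X0 sg : (0 <= (F (profile sg))%:E)%E by rewrite lee_fin Fge// profile_ge0.
rewrite (layer_cake (@lebesgue_measure R) mFX X0) -ge0_integralZl//; last 2 first.
- exact: (measurable_fun_superlevel (@lebesgue_measure R) mFX).
- by rewrite lee_fin ltW.
apply: eq_integral => c; rewrite inE/= in_itv/= andbT => c0.
have [t t0 ct] := Fsup c c0.
rewrite (_ : [set x | (c%:E < (F (profile x))%:E)%E] = [set sg | t < profile sg]); last first.
 by apply/seteqP; split => sg /=; rewrite lte_fin ct// profile_ge0.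
rewrite (profile_over t0) /dist_fun /area; congr (leb2 R _).
apply/seteqP; split => x /=; rewrite lte_fin ct ?mulr_ge0 ?(ltW r4)// ltr_pdivrMr//.
 by rewrite mulrC.
by rewrite mulrC.
Qed.

(** For areas in geometric progression of ratio [expR (- D')], the level energy is the sum of
    squared increments divided by [expR D' - 1]. Splitting [D] into [k.+1] steps and regrouping them
    in blocks replaces [expR D - 1] by [k.+1 * (expR (D / k.+1) - 1)], which tends to [D]. *)
Lemma profile_energy (g : plane R -> plane R) (E t D : R) (N : nat) :
 H1_grad u g -> (\int[leb2 R]_x ((g x).1 ^+ 2 + (g x).2 ^+ 2)%:E <= E%:E)%E -> 0 < D ->
 \sum_(i < N) (profile (expR (- (t + i.+1%:R * D))) - profile (expR (- (t + i%:R * D)))) ^+ 2 <= D * E.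
Proof.
move=> ug gE D0.
have coarse t' D' n : 0 < D' ->
  \sum_(i < n) (profile (expR (- (t' + i.+1%:R * D'))) - profile (expR (- (t' + i%:R * D')))) ^+ 2 <= (expR D' - 1) * E.
 move=> D'0; pose s (i : nat) := 4 * pi * expR (- (t' + i%:R * D')).
 have eD : 1 < expR D' by rewrite expR_gt1.
 have sS i : s i = expR D' * s i.+1.
  by rewrite /s mulrCA -expRD; congr (_ * expR _); rewrite -natr1; ring.
 have s0 i : 0 < s i by rewrite mulr_gt0// expR_gt0.
 have sd i : 0 < s i.+1 < s i by rewrite s0/= [ltRHS]sS ltr_pMl.
 have := @level_energy g E s n ug gE sd.
 have eq : \sum_(i < n) 4 * pi * s i.+1 * (level (s i.+1) - level (s i)) ^+ 2 / (s i - s i.+1) =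
  (expR D' - 1)^-1 * \sum_(i < n) (profile (expR (- (t' + i.+1%:R * D'))) - profile (expR (- (t' + i%:R * D')))) ^+ 2.
  rewrite mulr_sumr; apply: eq_bigr => i _.
  have -> : profile (expR (- (t' + i.+1%:R * D'))) - profile (expR (- (t' + i%:R * D'))) =
    Num.sqrt (4 * pi) * (level (s i.+1) - level (s i)) by rewrite /profile !expR_gt0 mulrBr.
  rewrite [in RHS]exprMn sqr_sqrtr ?(ltW pi4)//.
  rewrite [in s i - _]sS; have := s0 i.+1; move: (s i.+1) => z z0.
  rewrite (_ : expR D' * z - z = z * (expR D' - 1)); last by ring.
  move: (level _ - level _) => y; move: (pi : R) => q; field.
  by rewrite !gt_eqF//= subr_gt0.
 by rewrite eq mulrC ler_pdivrMr ?subr_gt0// mulrC.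
have E0 : 0 <= E.
 by rewrite -lee_fin; apply: le_trans gE; apply: integral_ge0 => x _; rewrite lee_fin addr_ge0 ?sqr_ge0.
set S := \sum_(i < N) _.
have S0 : 0 <= S by apply: sumr_ge0 => i _; exact: sqr_ge0.
have fine_ (k : nat) : S <= k.+1%:R * (expR (D / k.+1%:R) - 1) * E.
 pose f (j : nat) := profile (expR (- (t + j%:R * (D / k.+1%:R)))).
 have fE i : profile (expR (- (t + i%:R * D))) = f (i * k.+1)%N.
  by rewrite /f natrM -mulrA (mulrCA k.+1%:R) mulfV ?mulr1// pnatr_eq0.
 have Dk : 0 < D / k.+1%:R by rewrite divr_gt0.
 rewrite -mulrA; apply: le_trans (ler_wpM2l (ler0n _ _) (coarse t (D / k.+1%:R) (N * k.+1)%N Dk)).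
 apply: le_trans (block_sum f k.+1 N).
 by rewrite /S; apply: le_of_eq; apply: eq_bigr => i _; rewrite !fE.
have lim : S * (1 - D * n.+1%:R^-1) @[n --> \oo] --> S * (1 - D * 0).
 apply: cvgMl_tmp; apply: cvgB; first exact: cvg_cst.
 by apply: cvgMl_tmp; exact: cvg_harmonic.
rewrite mulr0 subr0 mulr1 in lim.
apply: (@cvgr_to_le _ _ _ _ _ _ (D * E) lim).
apply: nearW => k; have k0 : 0 < k.+1%:R :> R by [].
have [h|h] := leP 1 (D * k.+1%:R^-1).
 apply: (@le_trans _ _ 0); last by rewrite mulr_ge0// ltW.
 by rewrite mulr_ge0_le0// subr_le0.
have hp : 0 < 1 - D / k.+1%:R by rewrite subr_gt0.
apply: le_trans (ler_wpM2r (ltW hp) (fine_ k)) _.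
rewrite mulrAC ler_wpM2r//.
have := expR_ge1Dx (- (D / k.+1%:R)); rewrite expRN.
have := expR_gt0 (D / k.+1%:R); set x := D / k.+1%:R in hp *; move: (expR x) => e e0.
have xE : k.+1%:R * x = D by rewrite /x mulrCA mulfV ?mulr1// gt_eqF.
move=> /(ler_wpM2l (ltW e0)); rewrite mulfV ?gt_eqF// => ex.
rewrite -xE -mulrA ler_wpM2l ?(ltW k0)// mulrBl; lra.
Qed.

End distribution.

(** * Discrete Carleson-Chang inequality *)

Section gibbs.
Context {R : realType}.
Implicit Types (a b D x : R) (z : nat -> R).

(** Concave primitive of [- ln], whose tangent inequality is [h_step]. The two sums that it
    telescopes contribute [h 1 - h 0 = 1] each; with the [- 1] of the logarithm bound they make the
    constant 1 of the result. *)
Let h a := a - a * ln a.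

Let ln_le a : 0 < a -> ln a <= a - 1.
Proof. move=> a0; have := @le_ln1Dx R (a - 1); rewrite (addrC 1) subrK; apply.
by rewrite ltrBrDr addNr. Qed.

Let h_step a b : 0 < a -> 0 <= b -> - (a - b) * ln a <= h a - h b.
Proof.
move=> a0; rewrite le_eqVlt => /predU1P[<-|b0].
 rewrite /h !mul0r subr0 subr0; lra.
have := ln_le (divr_gt0 a0 b0); rewrite ln_div// => /(ler_wpM2l (ltW b0)).
rewrite (_ : b * (a / b - 1) = a - b); last by field; rewrite gt_eqF.
rewrite /h; move: (ln a) (ln b) => la lb; lra.
Qed.

(* Discrete Carleson-Chang inequality. With the Gibbs weights [rho i] and their
  tails [T i], Abel summation and [ln x <= x - 1] at
  [x = D * T i * (1 - T i.+1) / rho i] make every error term telescope. *)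
Lemma discrete_carleson_chang z D N : 0 < D -> z 0%N = 0 ->
 \sum_(i < N) D * expR (2 * z i.+1 - i%:R * D) <=
 expR ((\sum_(i < N) (z i.+1 - z i) ^+ 2) / D + 1 + 2 * D).
Proof.
move=> D0 z0; case: N => [|n]; first by rewrite big_ord0 expR_ge0.
set N := n.+1; pose p i := D * expR (2 * z i.+1 - i%:R * D).
have p0 i : 0 < p i by rewrite mulr_gt0 ?expR_gt0.
set Z := \sum_(i < N) _; have Z0 : 0 < Z.
 by rewrite /Z big_ord_recl; apply: ltr_pwDl; [exact: (p0 0%N)|apply: sumr_ge0 => i _; exact/ltW/(p0 i.+1)].
pose rho i := p i / Z.
have rho0 i : 0 < rho i by rewrite divr_gt0.
pose T i := 1 - \sum_(j < i) rho j.
have TS i : T i - T i.+1 = rho i by rewrite /T big_ord_recr/=; ring.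
have T0 : T 0%N = 1 by rewrite /T big_ord0 subr0.
have TN : T N = 0 by rewrite /T -mulr_suml mulfV ?subrr// gt_eqF.
have Tge i : (i <= N)%N -> 0 <= T i.
 move=> iN; rewrite -TN; elim: (N - i)%N {-2}i (subnKC iN) => [|k IH] j.
  by rewrite addn0 => ->.
 rewrite addnS -addSn => /IH; have := TS j; have := rho0 j; lra.
have Tgt i : (i < N)%N -> 0 < T i.
 by move=> iN; have := Tge i.+1 iN; have := TS i; have := rho0 i; lra.
have Tlt i : T i.+1 < 1.
 elim: i => [|i IH]; first by have := TS 0%N; have := rho0 0%N; lra.
 by have := TS i.+1; have := rho0 i.+1; lra.
have Tle i : T i <= 1 by case: i => [|i]; [rewrite T0|exact/ltW/Tlt].
pose Phi i := 2 * T i * z i - D * i%:R * T i + h (T i) - h (1 - T i).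
pose dPhi i := Phi i - Phi i.+1.
have step (i : nat) : (i < N)%N -> rho i * ln Z <=
  (z i.+1 - z i) ^+ 2 / D + (2 * D - 1) * rho i + dPhi i.
 rewrite /dPhi => iN; have t0 := Tgt i iN; have t1 := Tge i.+1 iN; have t2 := Tlt i; have t3 := Tle i.
 have r0 := rho0 i; have TSi := TS i.
 have c0 : 0 < 1 - T i.+1 by rewrite subr_gt0.
 have lnr : ln (rho i) = ln D + (2 * z i.+1 - i%:R * D) - ln Z.
  by rewrite /rho ln_div ?posrE// /p lnM ?posrE ?expR_gt0// expRK.
 have : ln (D * (T i * (1 - T i.+1)) / rho i) <= D * (T i * (1 - T i.+1)) / rho i - 1.
  by apply: ln_le; rewrite divr_gt0// !mulr_gt0.
 have m0 : 0 < T i * (1 - T i.+1) by rewrite mulr_gt0.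
 have -> : ln (D * (T i * (1 - T i.+1)) / rho i) =
   ln D + (ln (T i) + ln (1 - T i.+1)) - ln (rho i).
  rewrite ln_div ?posrE//; last exact: mulr_gt0.
  by rewrite lnM ?posrE// lnM ?posrE.
 rewrite lnr => /(ler_wpM2l (ltW r0)).
 have -> : rho i * (D * (T i * (1 - T i.+1)) / rho i - 1) = D * (T i * (1 - T i.+1)) - rho i.
  by field; rewrite gt_eqF.
 have h1 := h_step t0 t1.
 have h2 : - rho i * ln (1 - T i.+1) <= h (1 - T i.+1) - h (1 - T i).
  have := @h_step (1 - T i.+1) (1 - T i) c0; rewrite subr_ge0 => /(_ t3).
  by rewrite (_ : 1 - T i.+1 - (1 - T i) = rho i)// -TSi; ring.
 (* Young's inequality brings in the energy of [z]. Its cost [D * T i ^+ 2], together with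
    [D * T i * (1 - T i.+1)] and the Abel summation of [i * D], leaves [D * rho i * (1 + T i)], at
    most [2 * D * rho i]. *)
 have h3 : 2 * T i * (z i.+1 - z i) <= (z i.+1 - z i) ^+ 2 / D + D * T i ^+ 2.
  rewrite -subr_ge0 (_ : _ - _ = (z i.+1 - z i - D * T i) ^+ 2 / D); first by rewrite divr_ge0 ?sqr_ge0// ltW.
  by field; rewrite gt_eqF.
 have h4 : 0 <= D * rho i * (1 - T i).
  by apply: mulr_ge0; [apply: mulr_ge0; exact: ltW|rewrite subr_ge0].
 rewrite TSi in h1; have nE : i.+1%:R = i%:R + 1 :> R by rewrite natr1.
 rewrite /Phi nE; move: h1 h2 h3 h4.
 rewrite -TSi.
 move: (h (T i)) (h (T i.+1)) (h (1 - T i)) (h (1 - T i.+1)) => e1 e2 e3 e4.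
 move: (ln D) (ln Z) (ln (T i)) (ln (1 - T i.+1)) => lD lZ l1 l2.
 move: ((z i.+1 - z i) ^+ 2 / D) => K.
 by move: (z i) (z i.+1) (T i) (T i.+1) (i%:R : R); clear => a b s t k; lra.
have : ln Z <= (\sum_(i < N) (z i.+1 - z i) ^+ 2) / D + 1 + 2 * D.
 have S1 : \sum_(i < N) rho i = 1 by have := TN; rewrite /T => /eqP; rewrite subr_eq0 => /eqP.
 rewrite -[leLHS]mul1r -S1 mulr_suml; apply: le_trans (ler_sum _ (fun (i : 'I_N) _ => step i (ltn_ord i))) _.
 rewrite 2!big_split/= -mulr_suml -mulr_sumr S1.
 rewrite /dPhi -(big_mkord xpredT (fun i => Phi i - Phi i.+1)).
 rewrite (eq_bigr (fun i => - (Phi i.+1 - Phi i))); last by move=> i _; rewrite [RHS]opprB.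
 rewrite sumrN telescope_sumr// /Phi T0 TN z0 subrr subr0 /h ln1; lra.
by rewrite -ler_expR lnK.
Qed.

End gibbs.

(** * Least cost of reaching a given height, with numerical bounds *)

Section outer.
Context {R : realType}.
Implicit Types (x y w : R).

(* [w i] is the reciprocal of the minimum of
  [\sum_(j < i) ((x j.+1 - x j) ^+ 2 / D + x j ^+ 2 * d j)] subject to [x i = 1]. *)
Fixpoint outer_rec (D : R) (d : nat -> R) (i : nat) : R :=
 match i with
 | 0 => 0
 | 1 => (d 0%N)^-1 + D
 | j.+1 => outer_rec D d j / (1 + d j * outer_rec D d j) + D
 end.

Let outer_recS D d i :
 outer_rec D d i.+2 = outer_rec D d i.+1 / (1 + d i.+1 * outer_rec D d i.+1) + D.
Proof. by []. Qed.

Lemma outer_rec_gt0 D d i : 0 < D -> (forall i, 0 < d i) -> 0 < outer_rec D d i.+1.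
Proof.
move=> D0 d0; elim: i => [|i IH]; first by rewrite addr_gt0 ?invr_gt0.
rewrite outer_recS addr_gt0// divr_gt0//.
by rewrite addr_gt0// mulr_gt0.
Qed.

Let quadratic a D w : 0 < a -> 0 < D -> a * w ^+ 2 >= 0 -> forall x y,
 y ^+ 2 / (a^-1 + D) <= (y - x) ^+ 2 / D + x ^+ 2 * a.
Proof.
move=> a0 D0 _ x y; have aD : 0 < 1 + a * D by rewrite addr_gt0// mulr_gt0.
rewrite -subr_ge0 (_ : _ - _ = ((1 + a * D) * x - y) ^+ 2 / (D * (1 + a * D))).
 by rewrite divr_ge0 ?sqr_ge0// ltW// mulr_gt0.
field; rewrite !gt_eqF//= ?mulr_gt0// ?addr_gt0 ?invr_gt0//.
Qed.

(** Dynamic programming: a quadratic cost [x^2 / w], increased by one mass term and one increment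
    and minimised over the intermediate value, is again quadratic, with the next [w] of the
    recursion. *)
Lemma outer_rec_le D d (x : nat -> R) n : 0 < D -> (forall i, 0 < d i) ->
 x n.+1 ^+ 2 / outer_rec D d n.+1 <=
 (\sum_(i < n.+1) (x i.+1 - x i) ^+ 2) / D + \sum_(i < n.+1) x i ^+ 2 * d i.
Proof.
move=> D0 d0; elim: n => [|n IH].
 by rewrite !big_ord1; apply: (@quadratic _ _ 0); rewrite ?expr0n/= ?mulr0.
rewrite big_ord_recr/= mulrDl [in X in _ <= _ + X]big_ord_recr/= addrACA.
have w0 := outer_rec_gt0 n D0 d0.
move: IH w0; set w := outer_rec D d n.+1 => IH w0.
have a0 : 0 < w^-1 + d n.+1 by rewrite addr_gt0 ?invr_gt0.
have := quadratic a0 D0 (mulr_ge0 (ltW a0) (sqr_ge0 0)) (x n.+1) (x n.+2).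
have -> : (w^-1 + d n.+1)^-1 + D = outer_rec D d n.+2.
 rewrite outer_recS -/w; congr (_ + _); field.
 by rewrite !gt_eqF// ?addr_gt0 ?mulr_gt0.
have -> : x n.+1 ^+ 2 * (w^-1 + d n.+1) = x n.+1 ^+ 2 / w + x n.+1 ^+ 2 * d n.+1 by rewrite mulrDr.
move=> H; apply: le_trans H _; rewrite addrC -addrA [leRHS]addrC -[leRHS]addrA.
move: IH; set s1 := (\sum_(i < n.+1) _) / D; set s2 := \sum_(i < n.+1) _.
by lra.
Qed.

Lemma outer_rec_mono D d i : 0 < D -> (forall i, 0 < d i) ->
 outer_rec D d i.+2 <= outer_rec D d i.+1 + D.
Proof.
move=> D0 d0; rewrite outer_recS lerD2r; have w0 := outer_rec_gt0 i D0 d0.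
rewrite ler_pdivrMr ?addr_gt0 ?mulr_gt0// ler_peMr ?(ltW w0)// lerDl ltW//.
exact: mulr_gt0.
Qed.

End outer.

Section outer_numeric.
Context {R : realType}.

(** Mesh of step [1 / 5] in [t = - ln s]. It starts at [- 8 / 5], so the mass beyond
    [s = expR (8 / 5)] is given up, and it reaches 8 at index 48. *)
Definition grid (i : nat) : R := (i%:R - 8) / 5.
Definition cellwidth (i : nat) : R := expR (- grid i) - expR (- grid i.+1).

Let ratio : R := expR (- 5^-1).

Let gridS i : grid i.+1 = grid i + 5^-1.
Proof. by rewrite /grid -natr1; field. Qed.

Let sqr_lo (x y a : R) : 0 <= a -> a <= x -> y <= a ^+ 2 -> y <= x ^+ 2.
Proof. by move=> a0 ax ya; apply: le_trans ya _; rewrite lerXn2r ?nnegrE// (le_trans a0). Qed.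

(** As [320 = 5 * 2 ^ 6], start from [expR (- 1 / 320) >= 1 - 1 / 320] and square six times,
    rounding down to six decimals on the way. *)
Let ratio_lo : 1023 / 1250 <= ratio.
Proof.
have e0 : 319 / 320 <= expR (- 320^-1) :> R by apply: le_trans (expR_ge1Dx _); lra.
have -> : ratio = (((((expR (- 320^-1) ^+ 2) ^+ 2) ^+ 2) ^+ 2) ^+ 2) ^+ 2.
 by rewrite -!exprM -expRM_natl /ratio; congr expR; field.
apply: (@sqr_lo _ _ (904 / 1000 + 673 / (1000 * 1000))); [lra| |lra].
apply: (@sqr_lo _ _ (951 / 1000 + 143 / (1000 * 1000))); [lra| |lra].
apply: (@sqr_lo _ _ (975 / 1000 + 266 / (1000 * 1000))); [lra| |lra].
apply: (@sqr_lo _ _ (987 / 1000 + 556 / (1000 * 1000))); [lra| |lra].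
apply: (@sqr_lo _ _ (993 / 1000 + 759 / (1000 * 1000))); [lra| |lra].
by apply: (@sqr_lo _ _ (319 / 320)); [lra| |lra].
Qed.

Let ratioV_lo : (1220 / 1000 + 97 / (100 * 1000)) <= expR 5^-1 :> R.
Proof.
have e0 : 321 / 320 <= expR 320^-1 :> R by apply: le_trans (expR_ge1Dx _); lra.
have -> : expR 5^-1 = (((((expR 320^-1 ^+ 2) ^+ 2) ^+ 2) ^+ 2) ^+ 2) ^+ 2 :> R.
 by rewrite -!exprM -expRM_natl; congr expR; field.
apply: (@sqr_lo _ _ (1104 / 1000 + 979 / (1000 * 1000))); [lra| |lra].
apply: (@sqr_lo _ _ (1051 / 1000 + 180 / (1000 * 1000))); [lra| |lra].
apply: (@sqr_lo _ _ (1025 / 1000 + 271 / (1000 * 1000))); [lra| |lra].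
apply: (@sqr_lo _ _ (1012 / 1000 + 557 / (1000 * 1000))); [lra| |lra].
apply: (@sqr_lo _ _ (1006 / 1000 + 259 / (1000 * 1000))); [lra| |lra].
by apply: (@sqr_lo _ _ (321 / 320)); [lra| |lra].
Qed.

Let ratio_hi : ratio <= 8191 / (100 * 100).
Proof.
have : ratio * expR 5^-1 = 1 by rewrite /ratio -expRD addNr expR0.
have := ratioV_lo; have : 0 < ratio := expR_gt0 _.
move: ratio (expR 5^-1) => r e r0 e0 re.
have : r * (1220 / 1000 + 97 / (100 * 1000)) <= 1 by rewrite -[leRHS]re ler_wpM2l// (ltW r0).
lra.
Qed.

Let expR_gridS i : expR (- grid i.+1) = expR (- grid i) * ratio.
Proof. by rewrite gridS opprD expRD. Qed.

Lemma cellwidth_gt0 i : 0 < cellwidth i.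
Proof. by rewrite subr_gt0 ltr_expR ltrN2 gridS ltrDl. Qed.

Let cellwidth_lo i (s : R) : 0 <= s -> s <= expR (- grid i) -> 1809 / (100 * 100) * s <= cellwidth i.
Proof.
move=> s0 se; rewrite /cellwidth expR_gridS; have := ratio_hi; move: ratio (expR _) se => r e se rh.
have : 0 <= e * (8191 / (100 * 100) - r) by rewrite mulr_ge0 ?subr_ge0// (le_trans s0).
lra.
Qed.

Let w := outer_rec 5^-1 cellwidth.

(** Two rounded decimals: a lower bound for [expR (- grid i)] in [k] thousandths and [l] millionths,
    and an upper bound for [w i] in [m] hundredths and [n] ten-thousandths. *)
Let certified i (k l m n : R) :=
 [/\ 0 < k / 1000 + l / (1000 * 1000), 0 < m / 100 + n / (100 * 100),
   k / 1000 + l / (1000 * 1000) <= expR (- grid i) & w i <= m / 100 + n / (100 * 100)].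

(** The next [w] increases with [w] and decreases with the cell width, and the latter is at least
    [1 - 8191 / 10000] times [expR (- grid i.+1)]. So one step of the table is a polynomial
    inequality between rationals. *)
Let certifiedS i k l m n k' l' m' n' : certified i.+1 k l m n ->
 0 < k' / 1000 + l' / (1000 * 1000) -> 5^-1 < m' / 100 + n' / (100 * 100) ->
 k' / 1000 + l' / (1000 * 1000) <= (k / 1000 + l / (1000 * 1000)) * (1023 / 1250) ->
 m / 100 + n / (100 * 100) <= (m' / 100 + n' / (100 * 100) - 5^-1) *
  (1 + 1809 / (100 * 100) * (k / 1000 + l / (1000 * 1000)) * (m / 100 + n / (100 * 100))) ->
 certified i.+2 k' l' m' n'.
Proof.
rewrite /certified; move: (k / 1000 + _) (m / 100 + _) (k' / 1000 + _) (m' / 100 + _) => a b a' b'.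
move=> [a0 b0 ea wb] a'0 b'0 aa bb; split=> //; first by apply: lt_trans b'0; rewrite invr_gt0.
 rewrite expR_gridS; have := ratio_lo; have e0 : 0 <= expR (- grid i.+1) := expR_ge0 _.
 move: ratio (expR _) ea e0 => r e ea e0 rl.
 have : 0 <= e * (r - 1023 / 1250) by rewrite mulr_ge0 ?subr_ge0.
 lra.
have dl := cellwidth_lo (ltW a0) ea.
have d0 := cellwidth_gt0 i.+1; have w0 : 0 < w i.+1 by apply: outer_rec_gt0 => //; exact: cellwidth_gt0.
rewrite (_ : w i.+2 = w i.+1 / (1 + cellwidth i.+1 * w i.+1) + 5^-1)//.
have c0 : 0 < b' - 5^-1 by rewrite subr_gt0.
rewrite -lerBrDr ler_pdivrMr; last by rewrite addr_gt0// mulr_gt0.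
move: (cellwidth i.+1) (w i.+1) (b' - 5^-1) d0 w0 dl wb bb c0 => d v c d0 v0 dl vb.
move: (1809 / (100 * 100) * a) dl => q dl H c0.
have h1 : 0 <= c * v * b * (d - q).
 by apply: mulr_ge0; [apply: mulr_ge0; [apply: mulr_ge0|]; exact: ltW|rewrite subr_ge0].
have h2 : 0 <= c * (b - v) by apply: mulr_ge0; [exact: ltW|rewrite subr_ge0].
have h3 := ler_wpM2r (ltW v0) H.
by rewrite -(ler_pM2l b0); lra.
Qed.

Local Tactic Notation "advance" hyp(p) uconstr(i) uconstr(k) uconstr(l) uconstr(m) uconstr(n) :=
 let H := fresh in assert (H : certified i k l m n) by (apply: (certifiedS p); lra); clear p; rename H into p.

(** The Carleson-Chang bound carries a factor [e]; to beat it, [w] must lie below [grid] by more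
    than 1. The table gives [6.9859 <= 8 - 1.01] at index 48, and from there on [w] grows no faster
    than the grid. *)
Lemma outer_rec_grid n : w (48 + n)%N <= grid (48 + n) - (1 + 100^-1).
Proof.
elim: n => [|n IH]; last first.
 rewrite addnS gridS (_ : (48 + n)%N = (47 + n).+1)// in IH *.
 have := outer_rec_mono (47 + n) (_ : 0 < 5^-1 :> R) cellwidth_gt0; rewrite -/w => /(_ _) H.
 apply: le_trans (H _) _ => //; move: IH; lra.
rewrite addn0.
have e8 : 492 / 100 <= expR (- grid 0).
 have -> : expR (- grid 0) = (((expR 5^-1) ^+ 2) ^+ 2) ^+ 2.
  by rewrite -!exprM -expRM_natl /grid; congr expR; field.
 apply: (@sqr_lo _ _ (2222 / 1000)); [lra| |lra].
 apply: (@sqr_lo _ _ (1490 / 1000 + 767 / (1000 * 1000))); [lra| |lra].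
 by apply: (@sqr_lo _ _ (1220 / 1000 + 97 / (100 * 1000))); [lra|exact: ratioV_lo|lra].
have p : certified 1 4026 528 132 36.
 rewrite /certified; split; [lra|lra| |].
  rewrite expR_gridS; have := ratio_lo; move: ratio (expR _) e8 => r e e8 rl.
  have : 0 <= (e - 492 / 100) * (r - 1023 / 1250) by rewrite mulr_ge0 ?subr_ge0.
  lra.
 rewrite /w/= -lerBrDr; have := cellwidth_lo (_ : 0 <= 492 / 100) e8 => H.
 rewrite -[leLHS]div1r ler_pdivrMr ?cellwidth_gt0//.
 have {}H : 1809 / (100 * 100) * (492 / 100) <= cellwidth 0 by apply: H; lra.
 lra.
advance p 2%N 3295 310 87 39.
advance p 3%N 2696 881 77 46.
advance p 4%N 2207 127 76 22.
advance p 5%N 1806 312 78 44.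
advance p 6%N 1478 285 82 44.
advance p 7%N 1209 828 87 55.
advance p 8%N 990 123 93 48.
advance p 9%N 810 316 100 8.
advance p 10%N 663 162 107 28.
advance p 11%N 542 731 115 5.
advance p 12%N 444 171 123 38.
advance p 13%N 363 509 132 26.
advance p 14%N 297 495 141 68.
advance p 15%N 243 469 151 65.
advance p 16%N 199 255 162 16.
advance p 17%N 163 70 173 21.
advance p 18%N 133 456 184 79.
advance p 19%N 109 220 196 90.
advance p 20%N 89 385 209 53.
advance p 21%N 73 152 222 67.
advance p 22%N 59 867 236 30.
advance p 23%N 48 995 250 41.
advance p 24%N 40 97 264 98.
advance p 25%N 32 815 279 99.
advance p 26%N 26 855 295 42.
advance p 27%N 21 978 311 25.
advance p 28%N 17 986 327 45.
advance p 29%N 14 719 344 0.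
advance p 30%N 12 46 360 88.
advance p 31%N 9 858 378 7.
advance p 32%N 8 67 395 54.
advance p 33%N 6 602 413 27.
advance p 34%N 5 403 431 25.
advance p 35%N 4 421 449 44.
advance p 36%N 3 618 467 84.
advance p 37%N 2 960 486 42.
advance p 38%N 2 422 505 16.
advance p 39%N 1 982 524 5.
advance p 40%N 1 622 543 7.
advance p 41%N 1 327 562 21.
advance p 42%N 1 86 581 46.
advance p 43%N 0 888 600 80.
advance p 44%N 0 726 620 23.
advance p 45%N 0 594 639 73.
advance p 46%N 0 486 659 30.
advance p 47%N 0 397 678 92.
advance p 48%N 0 324 698 59.
have [_ _ _] := p; rewrite /grid; lra.
Qed.

End outer_numeric.

(** * Step functions, improper integrals and model integrands *)

Section line_integrals.
Context {R : realType}.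
Notation leb := (@lebesgue_measure R).
Implicit Types (f : R -> R) (a b c : R).

Lemma leb_itvoc a b : a <= b -> leb `]a, b]%classic = (b - a)%:E.
Proof.
move=> ab; rewrite lebesgue_measure_itv/= lte_fin; case: ltP => [_|ba]; first by rewrite EFinB.
by congr (_%:E); apply/eqP; rewrite eq_sym subr_eq0 eq_le ba.
Qed.

Lemma step_integral_le f (s c : nat -> R) N : mfun R f ->
 (forall x, 0 <= f x) -> (forall i, s i.+1 <= s i) ->
 (forall i x, (i < N)%N -> s i.+1 < x <= s i -> f x <= c i) ->
 (\int[leb]_(x in `]s N, s 0%N]) (f x)%:E <= (\sum_(i < N) c i * (s i - s i.+1))%:E)%E.
Proof.
move=> mf f0 sd fc; have mfD D : measurable_fun D (fun x => (f x)%:E).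
 by exact/measurable_EFinP/measurable_funTS.
have sle n : s n <= s 0%N by elim: n => // n; apply: le_trans.
elim: N fc => [|n IH] fc.
 by rewrite big_ord0 set_itv_ge ?integral_set0// bnd_simp/= ltxx.
rewrite (_ : `]s n.+1, s 0%N]%classic = `]s n.+1, s n]%classic `|` `]s n, s 0%N]%classic); last first.
 by rewrite -itv_bndbnd_setU// bnd_simp.
rewrite ge0_integral_setU//; last 3 first.
- exact: mfD.
- by move=> x _; rewrite lee_fin.
- apply/disj_set2P/seteqP; split => x //= []; rewrite !in_itv/= => /andP[_ h1] /andP[h2 _].
 by move: h2; rewrite ltNge h1.
rewrite big_ord_recr/= EFinD [X in (X <= _)%E]addeC; apply: leeD.
 by apply: IH => i x /ltnW; exact: fc.
have -> : (c n * (s n - s n.+1))%:E = (\int[leb]_(x in `]s n.+1, s n]) cst (c n)%:E x)%E.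
 by rewrite integral_cst// [X in (_ * X)%E](leb_itvoc (sd n)).
apply: ge0_le_integral => //; try exact: mfD; try by move=> x _; rewrite lee_fin.
by move=> x /=; rewrite in_itv/= => h; rewrite lee_fin fc.
Qed.

Lemma step_integral_ge f (s c : nat -> R) N : mfun R f ->
 (forall x, 0 <= f x) -> (forall i, s i.+1 <= s i) -> (forall i, 0 <= c i) ->
 (forall i x, (i < N)%N -> s i.+1 < x <= s i -> c i <= f x) ->
 ((\sum_(i < N) c i * (s i - s i.+1))%:E <= \int[leb]_(x in `]s N, s 0%N]) (f x)%:E)%E.
Proof.
move=> mf f0 sd c0 fc; have mfD D : measurable_fun D (fun x => (f x)%:E).
 by exact/measurable_EFinP/measurable_funTS.
have sle n : s n <= s 0%N by elim: n => // n; apply: le_trans.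
elim: N fc => [|n IH] fc.
 by rewrite big_ord0; apply: integral_ge0 => x _; rewrite lee_fin.
rewrite (_ : `]s n.+1, s 0%N]%classic = `]s n.+1, s n]%classic `|` `]s n, s 0%N]%classic); last first.
 by rewrite -itv_bndbnd_setU// bnd_simp.
rewrite ge0_integral_setU//; last 3 first.
- exact: mfD.
- by move=> x _; rewrite lee_fin.
- apply/disj_set2P/seteqP; split => x //= []; rewrite !in_itv/= => /andP[_ h1] /andP[h2 _].
 by move: h2; rewrite ltNge h1.
rewrite big_ord_recr/= EFinD [X in (_ <= X)%E]addeC; apply: leeD.
 by apply: IH => i x /ltnW; exact: fc.
have -> : (c n * (s n - s n.+1))%:E = (\int[leb]_(x in `]s n.+1, s n]) cst (c n)%:E x)%E.
 by rewrite integral_cst// [X in (_ * X)%E](leb_itvoc (sd n)).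
apply: ge0_le_integral => //; try exact: mfD; try by move=> x _; rewrite lee_fin.
by move=> x /=; rewrite in_itv/= => h; rewrite lee_fin fc.
Qed.

Lemma improper_integral0 f (s : nat -> R) b (C : R) : mfun R f ->
 (forall x, 0 <= f x) -> (forall n, 0 <= s n) -> (forall n, s n.+1 <= s n) ->
 (forall x, 0 < x -> exists n, s n < x) ->
 (forall n, \int[leb]_(x in `]s n, b]) (f x)%:E <= C%:E)%E ->
 (\int[leb]_(x in `]0%R, b]) (f x)%:E <= C%:E)%E.
Proof.
move=> mf f0 s0 sd s_to0 fC; have mfD D : measurable_fun D (fun x => (f x)%:E).
 by exact/measurable_EFinP/measurable_funTS.
have sle m n : (m <= n)%N -> s n <= s m.
 by move=> /subnK <-; elim: (n - m)%N => // k IH; rewrite addSn; apply: le_trans IH.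
have nd : {homo (fun n => `]s n, b]%classic) : n m / (n <= m)%N >-> (n <= m)%O}.
 move=> m n mn; apply/subsetPset => x /=; rewrite !in_itv/= => /andP[h ->].
 by rewrite (le_lt_trans (sle _ _ mn)).
have U : \bigcup_n `]s n, b]%classic = `]0%R, b]%classic.
 apply/seteqP; split => x /=.
  by move=> [n _] /=; rewrite !in_itv/= => /andP[h ->]; rewrite (le_lt_trans (s0 n)).
 rewrite in_itv/= => /andP[x0 xb]; have [n sx] := s_to0 x x0.
 by exists n => //=; rewrite in_itv/= sx.
have := @ge0_nondecreasing_set_cvg_integral _ (mline R) R (fun n => `]s n, b]%classic) (fun x => (f x)%:E) leb nd.
rewrite U => H; apply: (cvge_to_le (H _ _ _)) => //.
- by move=> n; exact: mfD.
- by move=> n x _; rewrite lee_fin.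
- exact: nearW.
Qed.

Lemma improper_integraly f (s : nat -> R) a (C : R) : mfun R f ->
 (forall x, 0 <= f x) -> (forall n, s n <= s n.+1) -> (forall x, exists n, x <= s n) ->
 (forall n, \int[leb]_(x in `[a, s n]) (f x)%:E <= C%:E)%E ->
 (\int[leb]_(x in `[a, +oo[) (f x)%:E <= C%:E)%E.
Proof.
move=> mf f0 sd s_oo fC; have mfD D : measurable_fun D (fun x => (f x)%:E).
 by exact/measurable_EFinP/measurable_funTS.
have sle m n : (m <= n)%N -> s m <= s n.
 by move=> /subnK <-; elim: (n - m)%N => // k IH; rewrite addSn; apply: le_trans (sd _).
have nd : {homo (fun n => `[a, s n]%classic) : n m / (n <= m)%N >-> (n <= m)%O}.
 move=> m n mn; apply/subsetPset => x /=; rewrite !in_itv/= => /andP[-> h].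
 by rewrite (le_trans h)// sle.
have U : \bigcup_n `[a, s n]%classic = `[a, +oo[%classic.
 apply/seteqP; split => x /=.
  by move=> [n _] /=; rewrite !in_itv/= => /andP[-> _].
 rewrite in_itv/= andbT => ax; have [n xs] := s_oo x.
 by exists n => //=; rewrite in_itv/= ax.
have := @ge0_nondecreasing_set_cvg_integral _ (mline R) R (fun n => `[a, s n]%classic) (fun x => (f x)%:E) leb nd.
rewrite U => H; apply: (cvge_to_le (H _ _ _)) => //.
- by move=> n; exact: mfD.
- by move=> n x _; rewrite lee_fin.
- exact: nearW.
Qed.

(** [x ^ (c - 1)] for positive [x], indexed by the exponent of its primitive [x ^ c / c]. Writing it
    with [expR] and [ln] makes measurability immediate. *)
Definition power_fun (c x : R) : R := if 0 < x then expR ((c - 1) * ln x) else 0.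

Lemma measurable_if_pos (f : R -> R) : mfun R f ->
 mfun R (fun x => if 0 < x then f x else 0).
Proof.
move=> mf; apply: measurable_fun_ifT => //.
exact: (measurable_fun_ltr (f := cst 0) (g := id)).
Qed.

Lemma measurable_power_fun c : mfun R (power_fun c).
Proof.
apply: measurable_if_pos; apply: measurableT_comp => //.
by apply: measurable_funM => //; exact: measurable_ln.
Qed.

Let continuous_power c (x : R) : 0 < x -> {for x, continuous (fun y => expR ((c - 1) * ln y))}.
Proof.
move=> x0; apply: (@continuous_comp _ _ _ (fun y => (c - 1) * ln y) expR); last exact: continuous_expR.
by apply: cvgMl_tmp; exact: continuous_ln.
Qed.

Let integral_power c a b : c != 0 -> 0 < a -> a <= b ->
 (\int[leb]_(x in `[a, b]) (power_fun c x)%:E = (expR (c * ln b) / c - expR (c * ln a) / c)%:E)%E.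
Proof.
move=> c0 a0 ab.
have := @FTC2_is_derive R (fun x => expR ((c - 1) * ln x)) (fun x => expR (c * ln x) / c) a b ab.
have -> : (\int[leb]_(x in `[a, b]) (expR ((c - 1) * ln x))%:E = \int[leb]_(x in `[a, b]) (power_fun c x)%:E)%E.
 apply: eq_integral => x; rewrite inE/= in_itv/= => /andP[ax _].
 by rewrite /power_fun (lt_le_trans a0).
apply.
- move=> x /andP[ax xb]; have x0 := lt_le_trans a0 ax.
 have d1 : is_derive x 1 (fun y => c * ln y) (c * x^-1).
  by have d := is_derive1_ln x0; apply: is_derive_eq; rewrite /GRing.scale/= ?mulr0 ?addr0.
 have d2 := @is_derive1_comp R expR (fun y => c * ln y) x _ _ (is_derive_expR _) d1.
 have d3 : is_derive x 1 (fun y => c^-1 * expR (c * ln y)) (c^-1 * (expR (c * ln x) * (c * x^-1))).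
  by apply: is_derive_eq; rewrite /GRing.scale/= ?mulr0 ?addr0.
 rewrite (_ : (fun x => _) = (fun y => c^-1 * expR (c * ln y))); last by apply/funext => y; rewrite mulrC.
 apply: is_derive_eq; rewrite /GRing.scale/= mulrBl mul1r expRD expRN lnK// ?posrE//.
 by field; rewrite c0 gt_eqF.
- by move=> x /andP[ax _]; apply: continuous_power; exact: lt_le_trans ax.
Qed.

Let inv_seq (n : nat) : R := n.+1%:R^-1.

Let inv_seq_gt0 n : 0 < inv_seq n. Proof. by rewrite invr_gt0. Qed.

Let inv_seqS n : inv_seq n.+1 <= inv_seq n.
Proof. by rewrite lef_pV2 ?posrE// ler_nat. Qed.

Let inv_seq_lt (x : R) : 0 < x -> exists n, inv_seq n < x.
Proof.
move=> x0; exists (Num.bound x^-1); rewrite invf_plt ?posrE//.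
by rewrite (@lt_trans _ _ (Num.bound x^-1)%:R)// ?ltr_nat// archi_boundP// invr_ge0 ltW.
Qed.

Lemma power_fun_ge0 c x : 0 <= power_fun c x.
Proof. by rewrite /power_fun; case: ifP => // _; exact: expR_ge0. Qed.

Lemma integral_power0 c b : 0 < c -> 0 < b ->
 (\int[leb]_(x in `]0%R, b]) (power_fun c x)%:E <= (expR (c * ln b) / c)%:E)%E.
Proof.
move=> c0 b0; apply: (@improper_integral0 _ inv_seq) => //.
- exact: measurable_power_fun.
- exact: power_fun_ge0.
- by move=> n; rewrite ltW.
have bE : 0 <= expR (c * ln b) / c by rewrite divr_ge0 ?expR_ge0// ltW.
move=> n; have [h|h] := leP (inv_seq n) b; last first.
 by rewrite set_itv_ge ?integral_set0 ?lee_fin// bnd_simp/= -leNgt ltW.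
apply: (@le_trans _ _ (\int[leb]_(x in `[inv_seq n, b]) (power_fun c x)%:E)%E).
 apply: ge0_subset_integral => //.
 - by apply/measurable_EFinP/measurable_funTS; exact: measurable_power_fun.
 - by move=> x _; rewrite lee_fin power_fun_ge0.
 - by move=> x /=; rewrite !in_itv/= => /andP[/ltW-> ->].
by rewrite integral_power ?gt_eqF// lee_fin gerBl divr_ge0 ?expR_ge0// (ltW c0).
Qed.

Lemma integral_powery c a : 0 < c -> 0 < a ->
 (\int[leb]_(x in `[a, +oo[) (power_fun (- c) x)%:E <= (expR (- c * ln a) / c)%:E)%E.
Proof.
move=> c0 a0; apply: (@improper_integraly _ (fun n => a + n%:R)) => //.
- exact: measurable_power_fun.
- exact: power_fun_ge0.
- by move=> n; rewrite lerD2l ler_nat.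
- move=> x; exists (Num.bound x); have [x0|x0] := leP 0 x.
  by apply: ler_wpDl; rewrite ltW// archi_boundP.
 by rewrite (le_trans (ltW x0))// addr_ge0// ltW.
move=> n; rewrite integral_power ?oppr_eq0 ?gt_eqF ?lerDl// lee_fin.
by rewrite !invrN !mulrN opprK addrC gerBl divr_ge0 ?expR_ge0// ltW.
Qed.

(* [1 / (x * ln x ^+ 2)] on [0 < x < 1]. *)
Definition log_fun (x : R) : R :=
 if 0 < x then if x < 1 then expR (- ln x - 2 * ln (- ln x)) else 0 else 0.

Lemma log_funE x : 0 < x < 1 -> log_fun x = (x * ln x ^+ 2)^-1.
Proof.
move=> /andP[x0 x1]; have l0 : 0 < - ln x by rewrite oppr_gt0 ln_lt0// x0.
rewrite /log_fun x0 x1 expRB expRN lnK ?posrE// expRM_natl lnK ?posrE//.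
have n0 : ln x != 0 by rewrite -oppr_eq0 gt_eqF.
by rewrite sqrrN; field; rewrite n0 gt_eqF.
Qed.

Lemma measurable_log_fun : mfun R log_fun.
Proof.
apply: measurable_if_pos; apply: measurable_fun_ifT => //.
 exact: (measurable_fun_ltr (f := id) (g := cst 1)).
apply: measurableT_comp => //; apply: measurable_funB.
 by apply: measurableT_comp => //; exact: measurable_ln.
apply: measurable_funM => //; apply: (measurableT_comp (@measurable_ln R)).
by apply: measurableT_comp => //; exact: measurable_ln.
Qed.

Lemma log_fun_ge0 x : 0 <= log_fun x.
Proof. by rewrite /log_fun; case: ifP => // _; case: ifP => // _; exact: expR_ge0. Qed.

Lemma integral_log_fun b : 0 < b < 1 ->
 (\int[leb]_(x in `]0%R, b]) (log_fun x)%:E <= ((- ln b)^-1)%:E)%E.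
Proof.
move=> /andP[b0 b1]; have lb : 0 < - ln b by rewrite oppr_gt0 ln_lt0// b0.
apply: (@improper_integral0 _ inv_seq) => //.
- exact: measurable_log_fun.
- exact: log_fun_ge0.
- by move=> n; rewrite ltW.
move=> n; have [h|h] := leP (inv_seq n) b; last first.
 by rewrite set_itv_ge ?integral_set0 ?lee_fin ?invr_ge0 ?(ltW lb)// bnd_simp/= -leNgt ltW.
have a0 := inv_seq_gt0 n; move: (inv_seq n) h a0 => a ab a0.
have neg x : a <= x -> x <= b -> ln x < 0.
 by move=> ax xb; rewrite ln_lt0// (lt_le_trans a0)//= (le_lt_trans xb).
apply: (@le_trans _ _ (\int[leb]_(x in `[a, b]) (log_fun x)%:E)%E).
 apply: ge0_subset_integral => //.
 - by apply/measurable_EFinP/measurable_funTS; exact: measurable_log_fun.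
 - by move=> x _; rewrite lee_fin log_fun_ge0.
 - by move=> x /=; rewrite !in_itv/= => /andP[/ltW-> ->].
have := @FTC2_is_derive R (fun x => (x * ln x ^+ 2)^-1) (fun x => - (ln x)^-1) a b ab.
have -> : (\int[leb]_(x in `[a, b]) ((x * ln x ^+ 2)^-1)%:E = \int[leb]_(x in `[a, b]) (log_fun x)%:E)%E.
 apply: eq_integral => x; rewrite inE/= in_itv/= => /andP[ax xb].
 by rewrite log_funE// (lt_le_trans a0)//=; move: b1; apply: le_lt_trans.
move=> H; apply: (@le_trans _ _ (- (ln b)^-1 - - (ln a)^-1)%:E); last first.
 by rewrite lee_fin invrN opprK -[leRHS]addr0 lerD2l invr_le0 ltW// neg.
apply: le_of_eq; apply: H.
- move=> x /andP[ax xb]; have x0 := lt_le_trans a0 ax.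
 have l0 : ln x != 0 by rewrite lt_eqF// neg.
 have d := is_derive1_ln x0.
 have d2 : is_derive x 1 (fun y => (ln y)^-1) (- (ln x ^- 2) *: x^-1) by exact: is_deriveV.
 apply: is_derive_eq; rewrite /GRing.scale/=; field.
 by rewrite l0 gt_eqF.
- move=> x /andP[ax xb]; have x0 := lt_le_trans a0 ax.
 have l0 : ln x != 0 by rewrite lt_eqF// neg.
 apply: cvgV; first by rewrite mulf_neq0 ?expf_neq0// gt_eqF.
 by apply: cvgM; [exact: cvg_id|apply: cvgM; exact: continuous_ln].
Qed.

End line_integrals.

(** * Admissible profiles: inner and outer estimates *)

Section admissible_profiles.
Context {R : realType}.
Notation leb := (@lebesgue_measure R).

(* [X] stands for a profile, i.e. a decreasing rearrangement as a function of
  the normalised area; [E] bounds its Dirichlet energy, which is the energy of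
  [t |-> X (expR (- t))]. *)
Definition admissible (X : R -> R) (E B : R) : Prop :=
 [/\ mfun R X, forall s, 0 <= X s,
   forall s1 s2, 0 < s1 -> s1 <= s2 -> X s2 <= X s1,
   forall t D N, 0 < D -> \sum_(i < N)
    (X (expR (- (t + i.+1%:R * D))) - X (expR (- (t + i%:R * D)))) ^+ 2 <= D * E &
   [/\ 0 <= E, (\int[leb]_(s in `]0%R, +oo[) (X s ^+ 2)%:E = B%:E)%E & E + B <= 1]].

Variables (X : R -> R) (E B : R).
Hypothesis adm : admissible X E B.

Let mX : mfun R X. Proof. by case: adm. Qed.
Let X0 s : 0 <= X s. Proof. by case: adm. Qed.
Let Xle s1 s2 : 0 < s1 -> s1 <= s2 -> X s2 <= X s1. Proof. by case: adm => _ _ + _ _; apply. Qed.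
Let energy t D N : 0 < D -> \sum_(i < N)
  (X (expR (- (t + i.+1%:R * D))) - X (expR (- (t + i%:R * D)))) ^+ 2 <= D * E.
Proof. by case: adm => _ _ _ + _; apply. Qed.
Let E0 : 0 <= E. Proof. by case: adm => _ _ _ _ []. Qed.
Let XB : (\int[leb]_(s in `]0%R, +oo[) (X s ^+ 2)%:E = B%:E)%E.
Proof. by case: adm => _ _ _ _ []. Qed.
Let EB : E + B <= 1. Proof. by case: adm => _ _ _ _ []. Qed.

Let psi t := X (expR (- t)).

Lemma psi_mono t t' : t <= t' -> psi t <= psi t'.
Proof. by move=> tt; apply: Xle; rewrite ?expR_gt0// ler_expR lerN2. Qed.

Lemma psi_holder t t' : t <= t' -> (psi t' - psi t) ^+ 2 <= (t' - t) * E.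
Proof.
rewrite le_eqVlt => /predU1P[->|tt]; first by rewrite !subrr expr0n mul0r.
have := @energy t (t' - t) 1; rewrite subr_gt0 => /(_ tt).
rewrite big_ord1 mul0r addr0 mul1r (addrC t) subrK; exact.
Qed.

Let mX2 D : measurable_fun D (fun s => (X s ^+ 2)%:E).
Proof. by apply/measurable_EFinP/measurable_funTS; exact: measurable_funX. Qed.

Lemma admissible_B_ge0 : 0 <= B.
Proof. by rewrite -lee_fin -XB; apply: integral_ge0 => s _; rewrite lee_fin sqr_ge0. Qed.

(** A decreasing [X] is at least [X s] on []0, s]]. *)
Lemma admissible_sqr_le s : 0 < s -> X s ^+ 2 * s <= B.
Proof.
move=> s0; rewrite -lee_fin -XB.
apply: (@le_trans _ _ (\int[leb]_(x in `]0%R, s]) cst (X s ^+ 2)%:E x)%E).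
 by rewrite integral_cst// [X in (_ * X)%E](leb_itvoc (ltW s0)) subr0 EFinM.
apply: (@le_trans _ _ (\int[leb]_(x in `]0%R, s]) (X x ^+ 2)%:E)%E).
 apply: ge0_le_integral => //; try exact: mX2; try by move=> x _; rewrite lee_fin sqr_ge0.
 move=> x /=; rewrite in_itv/= => /andP[x0 xs].
 by rewrite lee_fin lerXn2r ?nnegrE// Xle.
apply: ge0_subset_integral => //; try exact: mX2; try by move=> x _; rewrite lee_fin sqr_ge0.
by move=> x /=; rewrite !in_itv/= andbT => /andP[].
Qed.

Lemma admissible_E_le1 : E <= 1.
Proof. by apply: le_trans EB; rewrite lerDl admissible_B_ge0. Qed.

Lemma admissible_B_le1 : B <= 1.
Proof. by apply: le_trans EB; rewrite lerDr. Qed.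

Lemma psi_le t : 0 <= t -> psi t <= 1 + Num.sqrt t.
Proof.
move=> t0; have h0 : psi 0 <= 1.
 have := admissible_sqr_le (ltr01 : 0 < 1 :> R); rewrite mulr1 => h.
 have := le_trans h admissible_B_le1; rewrite /psi oppr0 expR0 => h'.
 by rewrite -(ler_pXn2r (_ : (0 < 2)%N)) ?nnegrE// expr1n.
have := psi_holder t0; rewrite subr0 => h.
have h2 : (psi t - psi 0) ^+ 2 <= t by apply: le_trans h _; rewrite ler_piMr// admissible_E_le1.
have : psi t - psi 0 <= Num.sqrt t.
 have := ler_wsqrtr h2; rewrite sqrtr_sqr ger0_norm// subr_ge0; exact: psi_mono.
lra.
Qed.

Let mexpX D : measurable_fun D (fun s => (expR (X s ^+ 2))%:E).
Proof.
apply/measurable_EFinP/measurable_funTS; apply: measurableT_comp => //; exact: measurable_funX.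
Qed.

Section inner.
Variables (T delta : R).
Hypothesis d1 : 0 <= delta < 1.
Let step (K : nat) : R := 5^-1 / K.+1%:R.
Hypothesis inner_energy : forall K N,
 \sum_(i < N) (psi (T + i.+1%:R * step K) - psi (T + i%:R * step K)) ^+ 2 <= step K * delta.

Let a := psi T.
Let C := expR (- T) * (expR (1 + a ^+ 2 / (1 - delta)) / (1 - delta)).

Let step_gt0 K : 0 < step K. Proof. by rewrite divr_gt0// invr_gt0. Qed.

(** With [y = psi - a] the energy bound gives [y^2 <= (t - T) delta], so [psi^2 - (t - T) <= a^2 + 2
    a y - (1 - delta) (t - T)]. The exponent is now linear in [y], and the discrete Carleson-Chang
    inequality applies to [a y] with step [(1 - delta) h]. *)
Let inner_step K N : (\int[leb]_(s in `]expR (- (T + N%:R * step K)), expR (- T)]) (expR (X s ^+ 2))%:E <=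
 (C * expR (3 * step K))%:E)%E.
Proof.
have /andP[d0 d1'] := d1; set h := step K; have h0 : 0 < h by exact: step_gt0.
have dd : 0 < 1 - delta by rewrite subr_gt0.
pose y i := psi (T + i%:R * h) - a.
have y00 : y 0%N = 0 by rewrite /y mul0r addr0 subrr.
have ysqr (i : nat) : y i ^+ 2 <= i%:R * h * delta.
 have -> : y i = \sum_(j < i) (y j.+1 - y j).
  by rewrite -(big_mkord xpredT (fun j => y j.+1 - y j)) telescope_sumr// y00 subr0.
 apply: le_trans (sqr_sum_le_sum (fun j => y j.+1 - y j) i) _.
 rewrite -mulrA ler_wpM2l//; apply: le_trans (inner_energy K i); rewrite le_eqVlt.
 by apply/orP; left; apply/eqP; apply: eq_bigr => j _; rewrite /y; congr (_ ^+ 2); ring.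
pose s i := expR (- (T + i%:R * h)).
have sd i : s i.+1 <= s i by rewrite ler_expR lerN2 lerD2l ler_wpM2r ?(ltW h0)// ler_nat.
have s00 : s 0%N = expR (- T) by rewrite /s mul0r addr0.
rewrite -s00.
apply: (@le_trans _ _ (\sum_(i < N) expR (psi (T + i.+1%:R * h) ^+ 2) * (s i - s i.+1))%:E).
 apply: (@step_integral_le R (fun x => expR (X x ^+ 2)) s (fun i => expR (psi (T + i.+1%:R * h) ^+ 2)) N) => //.
 - by apply: measurableT_comp => //; exact: measurable_funX.
 - move=> i x _ /andP[sx _]; rewrite ler_expR lerXn2r ?nnegrE//; first exact: X0.
  by apply: Xle; [exact: expR_gt0|exact: ltW].
pose z i := a * y i.
have a0 : 0 <= a by exact: X0.
pose h' := (1 - delta) * h; have h'0 : 0 < h' by rewrite mulr_gt0.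
have := @discrete_carleson_chang R z h' N h'0; rewrite /z y00 mulr0 => /(_ erefl) G.
rewrite lee_fin.
apply: (@le_trans _ _ (expR (- T) * expR (a ^+ 2) * expR h / (1 - delta) *
  \sum_(i < N) h' * expR (2 * (a * y i.+1) - i%:R * h'))).
 rewrite mulr_sumr; apply: ler_sum => i _.
 have si : s i - s i.+1 <= s i * h.
  have -> : s i.+1 = s i * expR (- h) by rewrite /s -expRD -natr1; congr expR; ring.
  have := expR_ge1Dx (- h); have := expR_gt0 (- (T + i%:R * h)); rewrite -/(s i) => p q.
  by have := ler_wpM2l (ltW p) q; lra.
 apply: (@le_trans _ _ (expR (psi (T + i.+1%:R * h) ^+ 2) * (s i * h))).
  by rewrite ler_wpM2l ?expR_ge0.
 have -> : expR (- T) * expR (a ^+ 2) * expR h / (1 - delta) * (h' * expR (2 * (a * y i.+1) - i%:R * h'))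
   = h * expR (- T + a ^+ 2 + h + (2 * (a * y i.+1) - i%:R * h')).
  by rewrite !expRD /h'; field; rewrite gt_eqF.
 rewrite mulrA -expRD mulrC ler_wpM2l ?(ltW h0)// ler_expR.
 have -> : psi (T + i.+1%:R * h) = a + y i.+1 by rewrite /y; ring.
 have := ysqr i.+1; rewrite -natr1 /h' => yi.
 have : h * delta <= h by rewrite ler_piMr ?(ltW h0)// ltW.
 move: yi; move: (y i.+1) => Y; lra.
apply: (@le_trans _ _ (expR (- T) * expR (a ^+ 2) * expR h / (1 - delta) * expR (a ^+ 2 * delta / (1 - delta) + 1 + 2 * h))).
 rewrite ler_wpM2l//; first by rewrite !mulr_ge0 ?expR_ge0// invr_ge0 ltW.
 apply: le_trans G _; rewrite ler_expR lerD//; last first.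
  by rewrite ler_pM2l// /h' ler_piMl ?(ltW h0)// gerBl.
 rewrite lerD2r.
 have -> : \sum_(i < N) (a * y i.+1 - a * y i) ^+ 2 = a ^+ 2 * \sum_(i < N) (psi (T + i.+1%:R * h) - psi (T + i%:R * h)) ^+ 2.
  by rewrite mulr_sumr; apply: eq_bigr => i _; rewrite /y; ring.
 rewrite /h' ler_pdivrMr ?mulr_gt0//.
 have -> : a ^+ 2 * delta / (1 - delta) * ((1 - delta) * h) = a ^+ 2 * (h * delta) by field; rewrite gt_eqF.
 by rewrite ler_wpM2l ?sqr_ge0//; exact: inner_energy.
rewrite /C; apply: le_of_eq.
have -> : expR (- T) * expR (a ^+ 2) * expR h / (1 - delta) * expR (a ^+ 2 * delta / (1 - delta) + 1 + 2 * h) =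
 (expR (- T) / (1 - delta)) * expR (a ^+ 2 + h + (a ^+ 2 * delta / (1 - delta) + 1 + 2 * h)).
 by rewrite !expRD; ring.
have -> : expR (- T) * (expR (1 + a ^+ 2 / (1 - delta)) / (1 - delta)) * expR (3 * h) =
 (expR (- T) / (1 - delta)) * expR (1 + a ^+ 2 / (1 - delta) + 3 * h).
 by rewrite [in RHS]expRD; ring.
by congr (_ * expR _); field; rewrite gt_eqF.
Qed.

(** The estimate holds for every mesh [step K]; letting the mesh tend to 0 removes the factor
    [expR (3 * step K)]. *)
Lemma inner_bound : (\int[leb]_(s in `]0%R, expR (- T)]) (expR (X s ^+ 2))%:E <= C%:E)%E.
Proof.
have C0 : 0 <= C.
 have /andP[d0 d1'] := d1.
 by rewrite mulr_ge0 ?expR_ge0// divr_ge0 ?expR_ge0// subr_ge0 ltW.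
have IK K : (\int[leb]_(s in `]0%R, expR (- T)]) (expR (X s ^+ 2))%:E <= (C * expR (3 * step K))%:E)%E.
 apply: (@improper_integral0 R (fun x => expR (X x ^+ 2)) (fun n => expR (- (T + n%:R * step K)))) => //.
 - by apply: measurableT_comp => //; exact: measurable_funX.
 - by move=> n; rewrite ler_expR lerN2 lerD2l ler_wpM2r ?(ltW (step_gt0 K))// ler_nat.
 - move=> x x0; exists (Num.bound ((`|T| + `|ln x|) / step K)).
  rewrite -[ltRHS]lnK ?posrE// ltr_expR ltrNl.
  have : (`|T| + `|ln x|) / step K < (Num.bound ((`|T| + `|ln x|) / step K))%:R.
   by rewrite archi_boundP// divr_ge0 ?addr_ge0// ltW.
  rewrite ltr_pdivrMr//; have := ler_norm (- T); have := ler_norm (- ln x); rewrite !normrN; lra.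
have : (0 <= \int[leb]_(s in `]0%R, expR (- T)]) (expR (X s ^+ 2))%:E)%E.
 by apply: integral_ge0 => s _; rewrite lee_fin expR_ge0.
move: IK; case: (\int[leb]_(s in _) _)%E => [r| |] // IK; last by have := IK 0%N.
rewrite !lee_fin => r0.
have lim : r * (1 - 3 * 5^-1 * n.+1%:R^-1) @[n --> \oo] --> r * (1 - 3 * 5^-1 * 0).
 apply: cvgMl_tmp; apply: cvgB; first exact: cvg_cst.
 by apply: cvgMl_tmp; exact: cvg_harmonic.
rewrite mulr0 subr0 mulr1 in lim.
apply: (@cvgr_to_le _ _ _ _ _ _ C lim); apply: nearW => K.
have := IK K; rewrite lee_fin => rC.
apply: (@le_trans _ _ (r * expR (- (3 * step K)))).
 rewrite ler_wpM2l//; apply: le_trans (expR_ge1Dx _).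
 by rewrite /step mulrA.
by rewrite expRN ler_pdivrMr ?expR_gt0.
Qed.

End inner.

(** If [a ^+ 2 / (1 - delta) <= T - kappa], the constant of [inner_bound] is at most
    [expR (1 - kappa) / (1 - delta)]. The excess of [kappa] over 1 makes this less than 1 for small
    [delta]. *)
Let kappa : R := 1 + 100^-1.

(** [delta] is [E - O], what remains of the energy after the discrete energy [O] of the cells up to
    the grid point. The recursion bounds [psi ^+ 2] by [w * (O + B)], and [O + B <= 1 - delta]. *)
Lemma outer_bound n : exists2 delta : R,
 [/\ 0 <= delta, delta <= E, delta + B <= 1 & psi (grid (48 + n)) ^+ 2 <= (grid (48 + n) - kappa) * (1 - delta)] &
 forall K N, \sum_(i < N) (psi (grid (48 + n) + i.+1%:R * (5^-1 / K.+1%:R)) -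
   psi (grid (48 + n) + i%:R * (5^-1 / K.+1%:R))) ^+ 2 <= 5^-1 / K.+1%:R * delta.
Proof.
set m := (48 + n)%N; pose x i := psi (grid i).
pose O := (\sum_(i < m) (x i.+1 - x i) ^+ 2) / 5^-1.
have gE i : grid i = grid 0 + i%:R * 5^-1 :> R by rewrite /grid; field.
have OB : x m ^+ 2 / outer_rec 5^-1 cellwidth m <= O + B.
 have := @outer_rec_le R 5^-1 cellwidth x (47 + n) _ cellwidth_gt0; rewrite invr_gt0 ltr0n => /(_ erefl).
 rewrite (_ : (47 + n).+1 = m)// => /le_trans; apply; rewrite -/O lerD2l.
 rewrite -lee_fin -XB.
 apply: (@le_trans _ _ (\int[leb]_(s in `]expR (- grid m), expR (- grid 0)]) (X s ^+ 2)%:E)%E).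
  apply: (@step_integral_ge R (fun s => X s ^+ 2) (fun i => expR (- grid i)) (fun i => x i ^+ 2) m) => //.
  - exact: measurable_funX.
  - by move=> s; exact: sqr_ge0.
  - by move=> i; rewrite ler_expR lerN2 /grid -natr1; lra.
  - by move=> i; exact: sqr_ge0.
  - move=> i s _ /andP[s1 s2]; rewrite lerXn2r ?nnegrE//; first exact: X0.
   exact: (Xle (lt_trans (expR_gt0 _) s1) s2).
 apply: ge0_subset_integral => //; try exact: mX2; try by move=> s _; rewrite lee_fin sqr_ge0.
 by move=> s /=; rewrite !in_itv/= andbT => /andP[h _]; apply: lt_trans h; exact: expR_gt0.
have chain K N : \sum_(i < N) (psi (grid m + i.+1%:R * (5^-1 / K.+1%:R)) -
   psi (grid m + i%:R * (5^-1 / K.+1%:R))) ^+ 2 <= 5^-1 / K.+1%:R * (E - O).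
 set h := 5^-1 / K.+1%:R; have h0 : 0 < h by rewrite divr_gt0// invr_gt0.
 pose f (j : nat) := psi (grid 0 + j%:R * h).
 have := @energy (grid 0) h (m * K.+1 + N) h0.
 rewrite big_split_ord/= mulrBr => H.
 (* On the outer cells the energy on the fine mesh dominates the coarse one, so of the total [h * E]
    at most [h * (E - O)] is left for the inner part. *)
 have H1 : h * O <= \sum_(j < m * K.+1) (f j.+1 - f j) ^+ 2.
  have := block_sum f K.+1 m; have hK : h * K.+1%:R = 5^-1 by rewrite /h mulfVK// pnatr_eq0.
  have -> : \sum_(i < m) (f (i.+1 * K.+1)%N - f (i * K.+1)%N) ^+ 2 = \sum_(i < m) (x i.+1 - x i) ^+ 2.
   apply: eq_bigr => i _; rewrite /f /x (gE i.+1) (gE i) !natrM -!mulrA !(mulrC K.+1%:R h) !hK//.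
  move=> /(ler_wpM2l (ltW h0)); rewrite mulrA hK => H1.
  rewrite /O; move: H1; set S := \sum_(i < m) _; set F := \sum_(j < _) _ => H1.
  by rewrite mulrA ler_pdivrMr ?invr_gt0// [leRHS]mulrC.
 rewrite lerBrDl; apply: le_trans H; apply: lerD.
  by apply: le_trans H1 _; apply: le_of_eq; apply: eq_bigr => j _.
 apply: le_of_eq; apply: eq_bigr => j _.
 have e k : grid m + k%:R * h = grid 0 + (m * K.+1 + k)%:R * h.
  rewrite (gE m) natrD natrM /h.
  by have := pnatr_eq0 R K.+1; move: (K.+1%:R) => c /negbT c0; field.
 by rewrite !e addnS.
have O0 : 0 <= O by rewrite divr_ge0 ?invr_ge0//; apply: sumr_ge0 => i _; exact: sqr_ge0.
have d0 : 0 <= E - O.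
 by have := chain 0%N 0%N; rewrite big_ord0 pmulr_rge0// divr_gt0// invr_gt0.
exists (E - O) => //; split => //.
- by rewrite gerBl.
- by have := EB; lra.
have w0 : 0 < outer_rec 5^-1 cellwidth m :> R.
 by apply: (@outer_rec_gt0 R _ _ (47 + n)); [rewrite invr_gt0|exact: cellwidth_gt0].
have := OB; rewrite ler_pdivrMr// => OB'.
apply: (le_trans OB'); have := @outer_rec_grid R n; rewrite -/m -/kappa => wk.
have le1 : O + B <= 1 - (E - O) by have := EB; lra.
have OB0 : 0 <= O + B by rewrite addr_ge0// admissible_B_ge0.
rewrite [leRHS]mulrC; apply: (ler_pM OB0 (ltW w0) le1 wk).
Qed.

End admissible_profiles.

(** * Domination near 0 or concentration *)

Section dichotomy_tools.
Context {R : realType}.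
Notation leb := (@lebesgue_measure R).
Implicit Types f g : R -> R.

Lemma le_integral_line (D : set R) f g : measurable D ->
 mfun R f -> mfun R g ->
 (forall x, D x -> 0 <= f x) -> (forall x, D x -> f x <= g x) ->
 (\int[leb]_(x in D) (f x)%:E <= \int[leb]_(x in D) (g x)%:E)%E.
Proof.
move=> mD mf mg f0 fg; apply: ge0_le_integral => //.
all: try by apply/measurable_EFinP/measurable_funTS.
all: by move=> x Dx; rewrite lee_fin ?f0 ?fg.
Qed.

Lemma integral_splitoy f a : 0 <= a -> mfun R f -> (forall x, 0 < x -> 0 <= f x) ->
 (\int[leb]_(x in `]0%R, +oo[) (f x)%:E =
  \int[leb]_(x in `]0%R, a]) (f x)%:E + \int[leb]_(x in `]a, +oo[) (f x)%:E)%E.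
Proof.
move=> a0 mf f0.
rewrite (_ : `]0%R, +oo[%classic = `]0%R, a]%classic `|` `]a, +oo[%classic); last first.
 by rewrite -itv_bndbnd_setU// bnd_simp.
rewrite ge0_integral_setU//.
- by apply/measurable_EFinP/measurable_funTS.
- move=> x [] /=; rewrite in_itv/= ?andbT lee_fin => h; apply: f0; first by case/andP: h.
 exact: le_lt_trans h.
- apply/disj_set2P/seteqP; split => x //= []; rewrite !in_itv/= andbT => /andP[_ h1] h2.
 by move: h2; rewrite ltNge h1.
Qed.

Lemma integral_splitoc f a b : 0 <= a -> a <= b -> mfun R f -> (forall x, 0 < x -> 0 <= f x) ->
 (\int[leb]_(x in `]0%R, b]) (f x)%:E =
  \int[leb]_(x in `]0%R, a]) (f x)%:E + \int[leb]_(x in `]a, b]) (f x)%:E)%E.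
Proof.
move=> a0 ab mf f0.
rewrite (_ : `]0%R, b]%classic = `]0%R, a]%classic `|` `]a, b]%classic); last first.
 by rewrite -itv_bndbnd_setU// bnd_simp.
rewrite ge0_integral_setU//.
- by apply/measurable_EFinP/measurable_funTS.
- move=> x [] /=; rewrite in_itv/= lee_fin => /andP[h _]; apply: f0 => //.
 exact: le_lt_trans h.
- apply/disj_set2P/seteqP; split => x //= []; rewrite !in_itv/= => /andP[_ h1] /andP[h2 _].
 by move: h2; rewrite ltNge h1.
Qed.

(** [x <= 1 + x^2], and a power of [(1 + x^2) / 4] is at most a factorial times its exponential. *)
Lemma powR_le_exp (p : R) : 0 <= p -> exists2 K : R, 0 <= K &
 forall x, 0 <= x -> x `^ p <= K * expR (x ^+ 2 / 4).
Proof.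
move=> p0; pose n := Num.truncn p; exists (4 ^+ n.+1 * n.+1`!%:R * expR (4^-1)).
 by rewrite !mulr_ge0 ?expR_ge0// exprn_ge0.
move=> x x0.
have x1 : x <= 1 + x ^+ 2 by have := sqr_ge0 (x - 2^-1); rewrite sqrrB; lra.
have y1 : 1 <= 1 + x ^+ 2 by rewrite lerDl sqr_ge0.
apply: (@le_trans _ _ ((1 + x ^+ 2) `^ p)).
 by apply: ge0_ler_powR => //; rewrite nnegrE//; lra.
apply: (@le_trans _ _ ((1 + x ^+ 2) `^ n.+1%:R)).
 by apply: ler_powR => //; apply/ltW/truncnS_gt.
rewrite powR_mulrn; last by lra.
have y0 : 0 <= (1 + x ^+ 2) / 4 by lra.
have := expR_ge1Dxn n y0 => h.
have -> : 4 ^+ n.+1 * n.+1`!%:R * expR 4^-1 * expR (x ^+ 2 / 4) =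
  4 ^+ n.+1 * (n.+1`!%:R * expR ((1 + x ^+ 2) / 4)).
 by rewrite mulrDl mul1r expRD; ring.
have -> : (1 + x ^+ 2) ^+ n.+1 = 4 ^+ n.+1 * ((1 + x ^+ 2) / 4) ^+ n.+1.
 by rewrite -exprMn; congr (_ ^+ _); field.
rewrite ler_wpM2l ?exprn_ge0// -ler_pdivrMl ?ltr0n ?fact_gt0// mulrC.
by apply: le_trans h; rewrite lerDr.
Qed.

Lemma grid_unbounded (c : R) : exists n, c <= grid (48 + n).
Proof.
exists (Num.truncn (5 * `|c|)).+1; rewrite /grid natrD.
have := truncnS_gt (5 * `|c|); have := ler_norm c; lra.
Qed.

Lemma grid_step i : grid i.+1 = grid i + 5^-1 :> R.
Proof. by rewrite /grid -natr1; lra. Qed.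

Lemma le_grid i j : (i <= j)%N -> grid i <= grid j :> R.
Proof. by rewrite -(@ler_nat R) /grid; lra. Qed.

Lemma grid_cell m (t : R) : 0 <= grid m :> R -> grid m <= t -> exists i, [/\ (m <= i)%N, grid i <= t & t < grid i.+1].
Proof.
move=> m0 mt; have t0 : 0 <= 5 * t by lra.
have /andP[h1 h2] := truncn_itv t0.
have e : grid (Num.truncn (5 * t) + 8)%N = (Num.truncn (5 * t))%:R / 5 :> R by rewrite /grid natrD; lra.
have h3 : grid (Num.truncn (5 * t) + 8)%N <= t by rewrite e; lra.
have h4 : t < grid (Num.truncn (5 * t) + 8).+1 by rewrite grid_step e; move: h2; rewrite -(natr1 (Num.truncn _)); lra.
exists (Num.truncn (5 * t) + 8)%N; split => //.
rewrite leqNgt; apply/negP => lt; have := le_grid lt; move: (_ + 8)%N h3 h4 lt => i; lra.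
Qed.

Lemma log_fun_exp (t : R) : 0 < t -> log_fun (expR (- t)) = expR (t - 2 * ln t).
Proof. by move=> t0; rewrite /log_fun expR_gt0 expR_lt1 oppr_lt0 t0 expRK !opprK. Qed.

Lemma exp_half_le (t : R) : 0 < t -> expR (t / 2) <= 8 * log_fun (expR (- t)).
Proof.
move=> t0; rewrite log_fun_exp//.
have h := @expR_ge1Dxn R (t / 2) 1; have t2 : 0 <= t / 2 by lra.
have {}h := h t2; have e2 : (2`!)%:R = 2 :> R by [].
have := expR_ge0 (t / 2); move=> E0.
have ln2 : expR (2 * ln t) = t ^+ 2 by rewrite -[2]/(2%:R) expRM_natl lnK// posrE.
have -> : expR (t - 2 * ln t) = expR (t / 2) * expR (t / 2) / t ^+ 2.
 by rewrite -ln2 -expRN -!expRD; congr expR; lra.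
have -> a : 8 * (a * a / t ^+ 2) = a * (8 * a / t ^+ 2) by ring.
rewrite ler_peMr// ler_pdivlMr ?exprn_gt0// mul1r.
by move: h; rewrite e2 expr_div_n; lra.
Qed.

(** [t - 2 ln t = t - 4 ln (sqrt t)], and [ln r <= r - 1]. *)
Lemma ln_le_sqrt (t : R) : 0 < t -> (Num.sqrt t - 2) ^+ 2 <= t - 2 * ln t.
Proof.
move=> t0; have r0 : 0 < Num.sqrt t by rewrite sqrtr_gt0.
have h : ln (Num.sqrt t) <= Num.sqrt t - 1.
 by rewrite -{1}(subrK 1 (Num.sqrt t)) addrC; apply: le_ln1Dx; lra.
have {2 3}-> : t = Num.sqrt t ^+ 2 by rewrite sqr_sqrtr// ltW.
rewrite lnXn// -mulr_natr; move: (Num.sqrt t) h => r h.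
rewrite sqrrB; lra.
Qed.

Lemma exp_sub1_le (x : R) : 0 <= x -> x <= 2^-1 -> expR x - 1 <= 2 * x.
Proof.
move=> x0 x2; have := expR_ge1Dx (- x); rewrite expRN => h.
have e0 := expR_gt0 x.
have h2 : (1 - x) * expR x <= 1.
 by rewrite -ler_pdivlMr// div1r.
have h1 : expR x <= 2.
 have : 2^-1 * expR x <= 1 by apply: le_trans h2; rewrite ler_wpM2r ?(ltW e0)//; lra.
 lra.
have : x * expR x <= x * 2 by rewrite ler_wpM2l.
lra.
Qed.

End dichotomy_tools.

Section dichotomy.
Context {R : realType}.
Notation leb := (@lebesgue_measure R).
Variables (X : R -> R) (E B : R).
Hypothesis adm : admissible X E B.

Let psi t := X (expR (- t)).
Let mX : mfun R X. Proof. by case: adm. Qed.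
Let X0 s : 0 <= X s. Proof. by case: adm. Qed.
Let Xle s1 s2 : 0 < s1 -> s1 <= s2 -> X s2 <= X s1. Proof. by case: adm => _ _ + _ _; apply. Qed.
Let E0 : 0 <= E. Proof. by case: adm => _ _ _ _ []. Qed.
Let EB : E + B <= 1. Proof. by case: adm => _ _ _ _ []. Qed.
Let B0 : 0 <= B. Proof. exact: admissible_B_ge0 adm. Qed.

(** For [grid i > 0] this says [expR (X s ^+ 2) < log_fun s] at [s = expR (- grid i)], and [log_fun]
    is integrable at 0. *)
Let quiet i : bool := psi (grid i) ^+ 2 < grid i - 2 * ln (grid i).

(** Monotonicity inside the cell; the factor 2 covers the growth [expR (1 / 5)] over one step. *)
Lemma quiet_le i t : 0 < t -> grid i <= t -> t <= grid i.+1 -> quiet i.+1 ->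
 expR (X (expR (- t)) ^+ 2) <= 2 * log_fun (expR (- t)).
Proof.
move=> t0 it ti q; rewrite log_fun_exp//.
have h1 : X (expR (- t)) ^+ 2 <= psi (grid i.+1) ^+ 2.
 by rewrite lerXn2r ?nnegrE ?X0//; exact: psi_mono adm _ _ ti.
have h2 : ln t <= ln (grid i.+1) by rewrite ler_ln ?posrE//; exact: lt_le_trans ti.
have h3 : expR (5^-1) <= 2 :> R.
 have /(_ _ _)/wrap[||] := @exp_sub1_le R 5^-1; lra.
apply: (@le_trans _ _ (expR (5^-1 + (t - 2 * ln t)))).
 by rewrite ler_expR; have gs := @grid_step R i; move: q; rewrite /quiet; lra.
by rewrite [leLHS]expRD ler_wpM2r ?expR_ge0.
Qed.

(** A large value at the grid point uses up the budget: [outer_bound] leaves at most a quarter of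
    the energy beyond it, so [X ^+ 2] grows at most like [t / 2] from there on. The constant depends
    on [L] only, not on the profile. *)
Lemma loud_le n L t : 2000 <= grid (48 + n) :> R -> ~~ quiet (48 + n) -> grid (48 + n) <= L -> L <= t ->
 expR (X (expR (- t)) ^+ 2) <= expR (2 * L + 1) * 8 * log_fun (expR (- t)).
Proof.
rewrite /quiet -leNgt => T2 loud TL Lt.
have [d [d0 dE dB aT] inn] := outer_bound adm n.
move: aT inn loud TL T2; set T := grid (48 + n) => /= aT inn loud TL T2.
have T0 : 0 < T by lra.
have lnT : 2 * ln T <= 4 * Num.sqrt T.
 have := ln_le_sqrt T0; rewrite sqrrB sqr_sqrtr ?(ltW T0)//; lra.
have r40 : 40 <= Num.sqrt T.
 by rewrite -(@ler_pXn2r _ 2)// ?nnegrE// sqr_sqrtr ?(ltW T0)//; lra.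
have r2 : Num.sqrt T ^+ 2 = T by rewrite sqr_sqrtr ?ltW.
(* If [d > 1 / 4], the deficit [(T - 1 - 1/100) * d] exceeds [2 ln T <= 4 sqrt T], the largest
   deficit that loudness allows, because [sqrt T >= 40]. *)
have d4 : d <= 4^-1.
 rewrite leNgt; apply/negP => d4.
 have h : (T - (1 + 100^-1)) * d <= 4 * Num.sqrt T.
  move: aT loud; rewrite /psi mulrBr mulr1; lra.
 have : (T - (1 + 100^-1)) * 4^-1 <= (T - (1 + 100^-1)) * d by rewrite ler_wpM2l ?ltW//; lra.
 have : 40 * Num.sqrt T <= Num.sqrt T ^+ 2 by rewrite expr2 ler_wpM2r.
 rewrite r2; lra.
have Tt : T <= t by lra.
pose N := (Num.truncn (5 * (t - T))).+1.
have tT0 : 0 <= 5 * (t - T) by lra.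
have /andP[N1 N2] := truncn_itv tT0.
have NE : N%:R = (Num.truncn (5 * (t - T)))%:R + 1 :> R by rewrite natr1.
have tN : t <= T + N%:R * 5^-1 by move: N2; rewrite -/N; lra.
have N3 : N%:R * 5^-1 <= t - T + 5^-1 by lra.
have h1 : (psi (T + N%:R * 5^-1) - psi T) ^+ 2 <= N%:R * 5^-1 * d.
 have := inn 0%N N; rewrite divr1 => hh.
 have -> : psi (T + N%:R * 5^-1) - psi T = \sum_(j < N) (psi (T + j.+1%:R * 5^-1) - psi (T + j%:R * 5^-1)).
  rewrite -(big_mkord xpredT (fun j => psi (T + j.+1%:R * 5^-1) - psi (T + j%:R * 5^-1))).
  by rewrite telescope_sumr// mul0r addr0.
 apply: le_trans (sqr_sum_le_sum (fun j => psi (T + j.+1%:R * 5^-1) - psi (T + j%:R * 5^-1)) N) _.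
 by rewrite -mulrA ler_wpM2l.
have h2 : psi T ^+ 2 <= T.
 have : (T - (1 + 100^-1)) * (1 - d) <= (T - (1 + 100^-1)) * 1 by rewrite ler_wpM2l//; lra.
 by rewrite /psi; lra.
have h3 : N%:R * 5^-1 * d <= (t - T + 5^-1) * 4^-1 by rewrite ler_pM// mulr_ge0.
have h4 : psi t ^+ 2 <= 2 * L + 1 + t / 2.
 have : psi t ^+ 2 <= psi (T + N%:R * 5^-1) ^+ 2.
  by rewrite lerXn2r ?nnegrE ?X0//; exact: psi_mono adm _ _ tN.
 (* This square expresses [p^2 <= 2 (p - q)^2 + 2 q^2]. *)
 have := sqr_ge0 (psi (T + N%:R * 5^-1) - 2 * psi T).
 move: h1 h2; move: (psi (T + _)) (psi T) (psi t) => a b c; rewrite !sqrrB; lra.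
have t0 : 0 < t by lra.
rewrite -mulrA; apply: (@le_trans _ _ (expR (2 * L + 1) * expR (t / 2))).
 by rewrite -expRD ler_expR.
by rewrite ler_wpM2l ?expR_ge0// exp_half_le.
Qed.

Section concentrating.
Variables (lam p K : R) (m n : nat).
Hypothesis p2 : 2 <= p.
Hypothesis K0 : 0 <= K.
Hypothesis K_bound : forall x, 0 <= x -> x `^ p <= K * expR (x ^+ 2 / 4).
Let M := grid (48 + m) : R.
Let T := grid (48 + n) : R.
Let r := Num.sqrt T.
(** [2000] makes the middle integral [2 / M] small, and [8000 |lam| K] does so for the power part
    below [expR (- M)]. In the next hypothesis [60000] makes [B] and the remaining energy
    negligible, [6000 |lam|] makes [|lam| B] small, and [24 expR M] forces [X ^+ 2 <= 1 / 2] beyond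
    [expR (- M)]. *)
Hypothesis M_large : 2000 + 8000 * (`|lam| * K) <= M.
Hypothesis r_large : 60 * 1000 + 6000 * `|lam| + 24 * expR M <= r.
Hypothesis quiet_between : forall i, (48 + m <= i)%N -> (i <= 48 + n)%N -> quiet i.
Hypothesis loud_next : ~~ quiet (48 + n).+1.

Let lamK0 : 0 <= `|lam| * K. Proof. by rewrite mulr_ge0. Qed.
Let M0 : 2000 <= M. Proof. by have := lamK0; have := M_large; lra. Qed.
Let r0 : 60 * 1000 <= r.
Proof. by have := expR_ge0 M; have := normr_ge0 lam; have := r_large; lra. Qed.
Let r2 : r ^+ 2 = T.
Proof.
have h : 0 < r by have := r0; lra.
by rewrite sqr_sqrtr// ltW//; move: h; rewrite sqrtr_gt0.
Qed.
Let MT : M <= T.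
Proof.
have h : 1 * r <= r * r by rewrite ler_wpM2r//; have := r0; lra.
have := r2; rewrite expr2 => <-; apply: le_trans h; rewrite mul1r.
have := expR_ge1Dx M; have := normr_ge0 lam; have := r_large; have := M0; lra.
Qed.

(** The next grid point is loud, which gives at least [r - 2] there; one step back costs at most 1
    by the Holder bound. *)
Let psiT : r - 3 <= psi T.
Proof.
have h1 : (r - 2) ^+ 2 <= psi (grid (48 + n).+1) ^+ 2.
 move: loud_next; rewrite -leNgt; apply: le_trans.
 have T0 : 0 < grid (48 + n).+1 :> R by rewrite grid_step -/T; have := M0; have := MT; lra.
 apply: le_trans (ln_le_sqrt T0); rewrite lerXn2r ?nnegrE//.
 - by have := r0; lra.
 - have : r <= Num.sqrt (grid (48 + n).+1 : R) by apply: ler_wsqrtr; rewrite grid_step -/T; lra.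
  by have := r0; lra.
 - by rewrite lerD2r; apply: ler_wsqrtr; rewrite grid_step -/T; lra.
have h2 : r - 2 <= psi (grid (48 + n).+1).
 move: h1; rewrite ler_pXn2r// nnegrE ?X0//; have := r0; lra.
have := @psi_holder _ _ _ _ adm T (grid (48 + n).+1).
rewrite grid_step -/T => /(_ _)/wrap[]; first by lra.
rewrite -(grid_step (48 + n)) -/(psi _) -/(psi _) => h3.
have h4 : (psi (grid (48 + n).+1) - psi T) ^+ 2 <= 1.
 apply: le_trans h3 _; rewrite grid_step -/T addrAC subrr add0r.
 have := admissible_E_le1 adm; lra.
have : psi (grid (48 + n).+1) - psi T <= 1.
 by apply: le_trans (ler_norm _) _; move: h4; rewrite -sqrtr_sqr; move=> /ler_wsqrtr; rewrite sqrtr1.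
lra.
Qed.

Let r6 : 1 - 6 / r <= (r - 3) ^+ 2 / r ^+ 2.
Proof.
have h : 0 < r by have := r0; lra.
have -> : (r - 3) ^+ 2 / r ^+ 2 = 1 - 6 / r + 9 / r ^+ 2 by field; rewrite gt_eqF.
by rewrite lerDl divr_ge0 ?exprn_ge0 ?ltW.
Qed.

(** Climbing from at most 1 at [t = 0] to [r - 3] at [t = r^2] takes energy at least
    [(r - 4)^2 / r^2], so at most [8 / r] is left for the mass. *)
Let B_small : B <= 8 / r.
Proof.
have h : 0 < r by have := r0; lra.
have T0 : 0 <= T by have := MT; have := M0; lra.
have h1 : psi 0 <= 1 by have := psi_le adm (lexx 0); rewrite /= sqrtr0 addr0.
have := psi_holder adm T0; rewrite subr0 -/(psi _) -/(psi _) => h2.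
suff : 1 - 8 / r <= E by have := EB; lra.
have h4 : (r - 4) ^+ 2 <= r ^+ 2 * E.
 by rewrite r2; apply: le_trans h2; rewrite lerXn2r ?nnegrE//; have := psiT; have := r0; lra.
have h5 : (r - 4) ^+ 2 / r ^+ 2 <= E by rewrite ler_pdivrMr ?exprn_gt0// mulrC.
apply: le_trans h5; have -> : (r - 4) ^+ 2 / r ^+ 2 = 1 - 8 / r + 16 / r ^+ 2 by field; rewrite gt_eqF.
by rewrite lerDl divr_ge0 ?exprn_ge0 ?ltW.
Qed.

Let mexp D : measurable_fun D (fun s => expR (X s ^+ 2)).
Proof. by apply: measurable_funTS; apply: measurableT_comp => //; exact: measurable_funX. Qed.

(** [outer_bound] and [psiT] give a remaining energy [d <= 6 / r], and [inner_bound] is then at most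
    [expR (- 1 / 100) / (1 - d)]. This is the only part of the integral that is not small. *)
Let A_inner : (\int[leb]_(s in `]0%R, expR (- T)]) (expR (X s ^+ 2) - 1)%:E <= (994 / 1000)%:E)%E.
Proof.
have [d [d0 dE dB aT] inn] := outer_bound adm n.
move: aT inn; rewrite -/T /= -/(psi T) => aT inn.
have rr : 0 < r by have := r0; lra.
have T0 : 0 < T - (1 + 100^-1) by have := MT; have := M0; lra.
have h1 : 1 - 6 / r <= 1 - d.
 apply: le_trans r6 _; rewrite ler_pdivrMr ?exprn_gt0//.
 apply: (@le_trans _ _ (psi T ^+ 2)).
  by rewrite lerXn2r ?nnegrE ?X0//; have := psiT; have := r0; lra.
 apply: le_trans aT _; rewrite mulrC ler_wpM2l//; last by rewrite r2; lra.
 by have := admissible_E_le1 adm; lra.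
have h2 : 6 / r <= 1000^-1 / 10 by rewrite ler_pdivrMr//; have := r0; lra.
have d1 : 0 <= d < 1 by rewrite d0/=; lra.
apply: (@le_trans _ _ (\int[leb]_(s in `]0%R, expR (- T)]) (expR (X s ^+ 2))%:E)%E).
 apply: le_integral_line => //.
 - by apply: measurable_funB => //; exact: mexp.
 - by move=> x _; rewrite subr_ge0 -[leLHS]expR0 ler_expR sqr_ge0.
 - by move=> x _; lra.
apply: le_trans (inner_bound adm d1 inn) _; rewrite lee_fin /= -/(psi T).
have dd : 0 < 1 - d by lra.
have h3 : psi T ^+ 2 / (1 - d) <= T - (1 + 100^-1) by rewrite ler_pdivrMr.
rewrite mulrA -expRD ler_pdivrMr//.
apply: (@le_trans _ _ (expR (- 100^-1))); first by rewrite ler_expR; lra.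
have := expR_ge1Dx (100^-1 : R); rewrite expRN => h4.
have h5 : (expR (100^-1))^-1 <= (1 + 100^-1)^-1 :> R.
 by rewrite lef_pV2 ?posrE ?expR_gt0//; lra.
apply: le_trans h5 _.
have -> : (1 + 100^-1)^-1 = 100 / 101 :> R by field.
lra.
Qed.

(** All cells between [M] and [T] are quiet, and the integral of [log_fun] up to [expR (- M)] is at
    most [1 / M]. *)
Let A_middle : (\int[leb]_(s in `]expR (- T), expR (- M)]) (expR (X s ^+ 2) - 1)%:E <= 1000^-1%:E)%E.
Proof.
have M0' := M0.
apply: (@le_trans _ _ (\int[leb]_(s in `]0%R, expR (- M)]) (2 * log_fun s)%:E)%E).
 apply: (@le_trans _ _ (\int[leb]_(s in `]expR (- T), expR (- M)]) (2 * log_fun s)%:E)%E).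
  apply: le_integral_line => //.
  - by apply: measurable_funB => //; exact: mexp.
  - by apply: measurable_funM => //; exact: measurable_log_fun.
  - by move=> x _; rewrite subr_ge0 -[leLHS]expR0 ler_expR sqr_ge0.
  move=> x /=; rewrite in_itv/= => /andP[Tx xM].
  have x0 : 0 < x by apply: lt_trans Tx; exact: expR_gt0.
  have xE : x = expR (- (- ln x)) by rewrite opprK lnK.
  have t1 : - ln x < T by rewrite ltrNl -ltr_expR lnK.
  have t2 : M <= - ln x by rewrite lerNr -ler_expR lnK.
  have [|i [mi it ti]] := @grid_cell R (48 + m) (- ln x) _ t2; first by rewrite -/M; lra.
  have i_n : (i.+1 <= 48 + n)%N.
   by rewrite ltnNge; apply/negP => /(@le_grid R); rewrite -/T; lra.
  rewrite xE; apply: (@le_trans _ _ (expR (X (expR (- - ln x)) ^+ 2))); first by lra.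
  apply: (quiet_le _ it (ltW ti)); first by lra.
  by apply: quiet_between => //; apply: leq_trans (leqnSn _).
 apply: ge0_subset_integral => //.
 - by apply/measurable_EFinP/measurable_funTS; apply: measurable_funM => //; exact: measurable_log_fun.
 - by move=> x _; rewrite lee_fin mulr_ge0// log_fun_ge0.
 - by move=> x /=; rewrite !in_itv/= => /andP[h ->]; rewrite (lt_trans _ h)// expR_gt0.
under eq_integral do rewrite EFinM.
rewrite ge0_integralZl//; last 2 first.
- by apply/measurable_EFinP/measurable_funTS; exact: measurable_log_fun.
- by move=> x _; rewrite lee_fin log_fun_ge0.
have := @integral_log_fun R (expR (- M)); rewrite expR_gt0 expR_lt1 oppr_lt0 expRK opprK.
move=> /(_ _)/wrap[]; first by lra.
move=> h; apply: (@le_trans _ _ (2%:E * (M^-1)%:E)%E); first by rewrite lee_wpmul2l// lee_fin.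
by rewrite -EFinM lee_fin ler_pdivrMr; lra.
Qed.

Let X_outer s : expR (- M) < s -> X s ^+ 2 <= 2^-1.
Proof.
move=> Ms; have rr : 0 < r by have := r0; lra.
apply: (@le_trans _ _ (X (expR (- M)) ^+ 2)).
 by rewrite lerXn2r ?nnegrE ?X0// Xle ?expR_gt0// ltW.
have := admissible_sqr_le adm (expR_gt0 (- M)); rewrite -ler_pdivlMr ?expR_gt0// => h.
apply: le_trans h _; rewrite -expRN opprK.
apply: (@le_trans _ _ (8 / r * expR M)); first by rewrite ler_wpM2r ?expR_ge0.
rewrite mulrAC ler_pdivrMr//; have := normr_ge0 lam; have := r_large; lra.
Qed.

Let mX2 : mfun R (fun s => X s ^+ 2).
Proof. exact: measurable_funX. Qed.

Let sqr_outer : (\int[leb]_(s in `]expR (- M), +oo[) (X s ^+ 2)%:E <= B%:E)%E.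
Proof.
case: adm => _ _ _ _ [_ <- _]; apply: ge0_subset_integral => //.
- by apply/measurable_EFinP/measurable_funTS.
- by move=> x _; rewrite lee_fin sqr_ge0.
- by move=> x /=; rewrite !in_itv/= !andbT; apply: lt_trans; exact: expR_gt0.
Qed.

Let A_outer : (\int[leb]_(s in `]expR (- M), +oo[) (expR (X s ^+ 2) - 1)%:E <= (3 / 1000 / 10)%:E)%E.
Proof.
have rr : 0 < r by have := r0; lra.
apply: (@le_trans _ _ (\int[leb]_(s in `]expR (- M), +oo[) (2 * X s ^+ 2)%:E)%E).
 apply: le_integral_line => //.
 - by apply: measurable_funB => //; exact: mexp.
 - by apply: measurable_funM.
 - by move=> x _; rewrite subr_ge0 -[leLHS]expR0 ler_expR sqr_ge0.
 - move=> x /=; rewrite in_itv/= andbT => Mx; apply: exp_sub1_le; [exact: sqr_ge0|exact: X_outer].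
under eq_integral do rewrite EFinM.
rewrite ge0_integralZl//; last 2 first.
- by apply/measurable_EFinP/measurable_funTS.
- by move=> x _; rewrite lee_fin sqr_ge0.
apply: (@le_trans _ _ (2%:E * B%:E)%E); first by rewrite lee_wpmul2l// lee_fin.
rewrite -EFinM lee_fin; have : 8 / r <= 15 / 100 / 1000 by rewrite ler_pdivrMr//; have := r0; lra.
have := B_small; lra.
Qed.

Lemma concentrating_A : (\int[leb]_(s in `]0%R, +oo[) (expR (X s ^+ 2) - 1)%:E <= (996 / 1000)%:E)%E.
Proof.
have f0 s : 0 < s -> 0 <= expR (X s ^+ 2) - 1.
 by move=> _; rewrite subr_ge0 -[leLHS]expR0 ler_expR sqr_ge0.
have mf : mfun R (fun s => expR (X s ^+ 2) - 1).
 by apply: measurable_funB => //; exact: mexp.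
have TM : expR (- T) <= expR (- M) by rewrite ler_expR lerN2 MT.
rewrite (integral_splitoy (expR_ge0 (- M)) mf f0) (integral_splitoc (expR_ge0 (- T)) TM mf f0).
have := leeD (leeD A_inner A_middle) A_outer; rewrite -!EFinD => /le_trans; apply.
by rewrite lee_fin; lra.
Qed.

(** Below [expR (- M)] the growth [X s ^+ 2 <= 2 - 2 ln s] bounds [X ^ p] by a multiple of
    [s ^ (- 1 / 2)]; beyond it [X <= 1], so [X ^ p <= X ^+ 2], whose integral is at most [B]. *)
Lemma concentrating_P : (`|lam|%:E * \int[leb]_(s in `]0%R, +oo[) (X s `^ p)%:E <= (3 / 1000)%:E)%E.
Proof.
have M0' := M0; have rr : 0 < r by have := r0; lra.
have mp : mfun R (fun s => X s `^ p).
 by apply: (@measurableT_comp _ _ _ _ _ _ (fun x => x `^ p)) => //; exact: measurable_powR.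
have M1 : expR (- M) < 1 by rewrite expR_lt1; lra.
have P1 : (\int[leb]_(s in `]0%R, expR (- M)]) (X s `^ p)%:E <= (8 * K / M)%:E)%E.
 apply: (@le_trans _ _ (\int[leb]_(s in `]0%R, expR (- M)]) (2 * K * power_fun 2^-1 s)%:E)%E).
  apply: le_integral_line => //.
  - by apply: measurable_funM => //; exact: measurable_power_fun.
  - by move=> x _; exact: powR_ge0.
  move=> x /=; rewrite in_itv/= => /andP[x0 xM].
  apply: (le_trans (K_bound (X0 x))); rewrite -mulrA mulrCA ler_wpM2l//.
  have t0 : 0 <= - ln x by rewrite oppr_ge0 ln_le0//; lra.
  have := psi_le adm t0; rewrite opprK lnK ?posrE// => h.
  have h2 : X x ^+ 2 <= 2 - 2 * ln x.
   have : X x ^+ 2 <= (1 + Num.sqrt (- ln x)) ^+ 2 by rewrite lerXn2r ?nnegrE ?X0 ?addr_ge0 ?sqrtr_ge0.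
   have := sqr_ge0 (1 - Num.sqrt (- ln x)); have := sqr_sqrtr t0.
   rewrite sqrrB sqrrD; lra.
  rewrite /power_fun x0.
  have h3 : expR (2^-1) <= 2 :> R.
   have /(_ _ _)/wrap[||] := @exp_sub1_le R 2^-1; lra.
  apply: (@le_trans _ _ (expR (2^-1 + (2^-1 - 1) * ln x))); first by rewrite ler_expR; lra.
  by rewrite expRD ler_wpM2r ?expR_ge0.
 under eq_integral do rewrite EFinM.
 rewrite ge0_integralZl//; last 3 first.
 - by apply/measurable_EFinP/measurable_funTS; exact: measurable_power_fun.
 - by move=> x _; rewrite lee_fin power_fun_ge0.
 - by rewrite lee_fin mulr_ge0.
 have h20 : 0 < 2^-1 :> R by [].
 have := integral_power0 h20 (expR_gt0 (- M)); rewrite expRK => h.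
 apply: (@le_trans _ _ ((2 * K)%:E * (expR (2^-1 * - M) / 2^-1)%:E)%E).
  by rewrite lee_wpmul2l// lee_fin mulr_ge0.
 rewrite -EFinM lee_fin mulrN expRN.
 have h4 : (expR (2^-1 * M))^-1 <= 2 / M.
  rewrite -[leRHS]invf_div lef_pV2 ?posrE ?expR_gt0 ?divr_gt0//; try lra.
  by have := expR_ge1Dx (2^-1 * M); lra.
 have : K * (expR (2^-1 * M))^-1 <= K * (2 / M) by rewrite ler_wpM2l.
 lra.
have P2 : (\int[leb]_(s in `]expR (- M), +oo[) (X s `^ p)%:E <= B%:E)%E.
 apply: le_trans sqr_outer; apply: le_integral_line => //; first by move=> x _; exact: powR_ge0.
 move=> x /=; rewrite in_itv/= andbT => Mx; have h := X_outer Mx.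
 have X1 : X x <= 1 by rewrite -(@ler_pXn2r _ 2)// ?nnegrE// expr1n; lra.
 have [->|Xn0] := eqVneq (X x) 0; first by rewrite powR0 ?sqr_ge0// gt_eqF//; have := p2; lra.
 have Xp : 0 < X x by rewrite lt0r Xn0/=.
 by rewrite -(powR_mulrn 2 (X0 x)); apply: ger_powR => //; rewrite Xp.
have -> : (\int[leb]_(s in `]0%R, +oo[) (X s `^ p)%:E = \int[leb]_(s in `]0%R, expR (- M)]) (X s `^ p)%:E + \int[leb]_(s in `]expR (- M), +oo[) (X s `^ p)%:E)%E.
 by apply: integral_splitoy => //; move=> x _; exact: powR_ge0.
apply: (@le_trans _ _ (`|lam|%:E * ((8 * K / M)%:E + B%:E))%E).
 by rewrite lee_wpmul2l ?lee_fin// leeD.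
rewrite -EFinD -EFinM lee_fin mulrDr.
have h1 : `|lam| * (8 * K / M) <= 1000^-1.
 by rewrite !mulrA ler_pdivrMr; [have := M_large; lra|lra].
have h2 : `|lam| * B <= 2 / 1000.
 apply: (@le_trans _ _ (`|lam| * (8 / r))); first by rewrite ler_wpM2l// B_small.
 rewrite mulrA ler_pdivrMr//; have := r_large; have := expR_ge0 M; lra.
lra.
Qed.

End concentrating.
End dichotomy.

(** The first loud index from [m] on decides. If there is none, or if it comes before a bound fixed
    by [lam] and [p], the profile is dominated near 0. If it comes later, all the earlier cells are
    quiet and the profile concentrates. *)
Lemma dichotomy {R : realType} (lam p : R) : 2 <= p -> exists C s0, [/\ 0 <= C, 0 < s0, s0 < 1 &
 forall X E B, admissible X E B ->
  (forall s, 0 < s -> s <= s0 -> expR (X s ^+ 2) <= C * log_fun s) \/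
  (\int[@lebesgue_measure R]_(s in `]0%R, +oo[) (expR (X s ^+ 2) - 1)%:E +
   `|lam|%:E * \int[@lebesgue_measure R]_(s in `]0%R, +oo[) (X s `^ p)%:E <= (999 / 1000)%:E)%E].
Proof.
move=> p2; have [|K K0 Kb] := @powR_le_exp R p; first by lra.
have [m Mm] := grid_unbounded (2000 + 8000 * (`|lam| * K)).
pose c := 60 * 1000 + 6000 * `|lam| + 24 * expR (grid (48 + m)).
have [n1 Mn] := grid_unbounded (c ^+ 2).
have lamK0 : 0 <= `|lam| * K by rewrite mulr_ge0.
have M0 : 2000 <= grid (48 + m) :> R by lra.
pose L : R := grid (48 + (m + n1).+1).
have ML : grid (48 + m) <= L by apply: le_grid; rewrite leq_add2l ltnW// ltnS leq_addr.
have CL := expR_ge0 (2 * L + 1).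
have M1 : 0 < grid (48 + m) :> R by apply: lt_le_trans M0; rewrite ltr0n.
have L1 := lt_le_trans M1 ML.
have sum_le : 996 / 1000 + 3 / 1000 <= 999 / 1000 :> R by lra.
exists (expR (2 * L + 1) * 8 + 2), (expR (- L)); split.
- by rewrite addr_ge0// mulr_ge0.
- exact: expR_gt0.
- by rewrite expR_lt1 oppr_lt0.
move=> X E B adm; pose quiet i : bool := X (expR (- grid i)) ^+ 2 < grid i - 2 * ln (grid i).
have tE s : 0 < s -> s <= expR (- L) -> L <= - ln s /\ s = expR (- (- ln s)).
 by move=> s0 sL; split; [rewrite lerNr -ler_expR lnK|rewrite opprK lnK].
have [H|H] := pselect (exists i, (m <= i)%N && ~~ quiet (48 + i)%N); last first.
 left => s s0 /(tE s s0)[Lt sE].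
 have Mt : grid (48 + m) <= - ln s by exact: le_trans Lt.
 have [|i [mi it ti]] := grid_cell _ Mt; first exact: ltW.
 apply: (@le_trans _ _ (2 * log_fun s)); last by rewrite ler_wpM2r ?log_fun_ge0// lerDr mulr_ge0.
 rewrite sE; apply: (quiet_le adm _ it (ltW ti)); first exact: (lt_le_trans L1 Lt).
 apply/negPn/negP => qi; apply: H; exists (i.+1 - 48)%N.
 have mi' : (48 + m <= i.+1)%N by exact: leq_trans (leqnSn _).
 have i48 : (48 <= i.+1)%N by apply: leq_trans mi'; exact: leq_addr.
 by rewrite subnKC// qi andbT leq_subRL.
case: (ex_minnP H) => k /andP[mk lk] kmin.
have [kn|nk] := leqP k (m + n1).+1.
 left => s s0 /(tE s s0)[Lt sE].
 apply: (@le_trans _ _ (expR (2 * L + 1) * 8 * log_fun s)); last first.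
  by rewrite ler_wpM2r ?log_fun_ge0// lerDl.
 rewrite sE; apply: (loud_le adm (n := k)) => //.
 - by apply: le_trans M0 _; apply: le_grid; rewrite leq_add2l.
 - by apply: le_grid; rewrite leq_add2l.
right; case: k nk mk lk kmin => // n; rewrite ltnS => nk mk lk kmin.
have rL : c <= Num.sqrt (grid (48 + n)).
 have c0 : 0 <= c by rewrite /c; have := expR_ge0 (grid (48 + m) : R); have := normr_ge0 lam; lra.
 rewrite -(ger0_norm c0) -sqrtr_sqr; apply: ler_wsqrtr; apply: le_trans Mn _.
 apply: le_grid; rewrite leq_add2l; apply: leq_trans (ltnW nk).
 exact: leq_addl.
have qb i : (48 + m <= i)%N -> (i <= 48 + n)%N -> quiet i.
 move=> mi in_; apply/negPn/negP => qi.
 have i48 : (48 <= i)%N by apply: leq_trans mi; exact: leq_addr.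
 have := kmin (i - 48)%N; rewrite subnKC// qi andbT leq_subRL// => /(_ mi).
 by rewrite leq_subRL// addnS ltnNge in_.
have ln : ~~ quiet (48 + n).+1 by rewrite -addnS.
apply: (@le_trans _ _ ((996 / 1000)%:E + (3 / 1000)%:E)%E); last by rewrite -EFinD lee_fin.
apply: leeD.
 exact: (concentrating_A adm K0 Mm rL qb ln).
exact: (concentrating_P adm p2 K0 Kb Mm rL ln).
Qed.

(** * Selection of a limit profile *)

Section limit_profile.
Context {R : realType}.
Notation leb := (@lebesgue_measure R).

Lemma ultra_limit (U : set_system nat) (x : nat -> R) (a b : R) : UltraFilter U ->
 (forall n, a <= x n <= b) -> exists l : R, x n @[n --> U] --> l.
Proof.
move=> UU xab.
have [|l [_ cl]] := @segment_compact R a b (x @ U) _.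
 have H : U (x @^-1` `[a, b]%classic) by apply: filterE => n; rewrite /= in_itv/= xab.
 exact: H.
exists l => V lV /=; have [//|H] := @in_ultra_setVsetC _ U (x @^-1` V) UU.
have H' : (x @ U) (~` V) by exact: H.
by have [y []] := cl _ _ H' lV.
Qed.

Lemma powR_cvg (p l : R) (u : nat -> R) : 2 <= p -> (forall n, 0 <= u n) ->
 u n @[n --> \oo] --> l -> u n `^ p @[n --> \oo] --> l `^ p.
Proof.
move=> p2 u0 ul; have l0 : 0 <= l by apply: (cvgr_to_ge ul); exact: nearW.
have [lz|ln] := eqVneq l 0.
 rewrite lz in ul *; rewrite powR0; last by rewrite gt_eqF//; lra.
 have sq : u n ^+ 2 @[n --> \oo] --> (0 : R).
  rewrite -[X in _ --> X](mulr0 (0 : R)); under eq_cvg do rewrite expr2.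
  exact: cvgM.
 apply: (@squeeze_cvgr _ _ _ _ (cst 0) (fun n => u n ^+ 2)) => //; last exact: cvg_cst.
 apply: filterS ((cvgrPdist_lt _ _).1 ul 1 ltr01) => n.
 rewrite sub0r normrN ger0_norm// => u1; rewrite powR_ge0/=.
 have [->|un] := eqVneq (u n) 0; first by rewrite powR0 ?expr0n// gt_eqF//; lra.
 by rewrite -(powR_mulrn 2 (u0 n)); apply: ger_powR => //; rewrite lt0r un u0/= ltW.
have lp : 0 < l by rewrite lt0r ln.
have E : \forall n \near \oo, expR (p * exp.ln (u n)) = u n `^ p.
 apply: filterS ((cvgrPdist_lt _ _).1 ul l lp) => n h.
 rewrite /powR gt_eqF//; move: h; have := ler_norm (l - u n); lra.
apply: (cvg_trans (near_eq_cvg E)).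
rewrite /powR (negbTE ln).
apply: (@cvg_comp _ _ _ (fun n => p * exp.ln (u n)) expR); last exact: continuous_expR.
apply: cvgMl_tmp; apply: (@cvg_comp _ _ _ u (@exp.ln R)); first exact: ul.
exact: continuous_ln.
Qed.

Variables (X : nat -> R -> R) (E B : nat -> R).
Hypothesis adm : forall n, admissible (X n) (E n) (B n).

Let X0 n s : 0 <= X n s. Proof. by case: (adm n). Qed.
Let B01 n : 0 <= B n <= 1.
Proof. by rewrite (admissible_B_ge0 (adm n)) (admissible_B_le1 (adm n)). Qed.
Let E01 n : 0 <= E n <= 1.
Proof. by rewrite (admissible_E_le1 (adm n)) andbT; case: (adm n) => _ _ _ _ []. Qed.

(** Helly's selection principle. An ultrafilter gives limits for all [s] at once; a sequence of
    indices is then picked that is close to them on finer and finer finite meshes, and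
    equicontinuity in [- ln s] extends the convergence to every [s]. Mass may be lost, and Fatou
    gives [B'' <= B']. *)
Lemma limit_profile : exists (k : nat -> nat) (X' : R -> R) (E' B' B'' : R), [/\
 (forall n : nat, (n <= k n)%N),
 (forall s, 0 < s -> X (k n) s @[n --> \oo] --> X' s),
 (B (k n) @[n --> \oo] --> B'), B'' <= B' /\ E' + B' <= 1 & admissible X' E' B''].
Proof.
have [U [UU oU]] := ultraFilterLemma (eventually_filter : ProperFilter \oo).
have XB n s : 0 < s -> 0 <= X n s <= Num.sqrt (s^-1).
 move=> s0; rewrite X0/= -(ger0_norm (X0 n s)) -sqrtr_sqr; apply: ler_wsqrtr.
 rewrite -[leRHS]mul1r ler_pdivlMr//; apply: le_trans (admissible_sqr_le (adm n) s0) _.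
 by case/andP: (B01 n).
have [f fP] : {f : R -> R & forall s, 0 < s -> X n s @[n --> U] --> f s}.
 apply: (@choice _ _ (fun s l => 0 < s -> X n s @[n --> U] --> l)) => s.
 have [s0|s0] := ltP 0 s; last by exists 0.
 by have [l ?] := ultra_limit UU (fun n => XB n s s0); exists l.
have [E' EP] := ultra_limit UU E01.
have [B' BP] := ultra_limit UU B01.
(* For [ln s], a mesh of step [1 / m] on [[- m, m]], hence [2 m^2 + 1] points. *)
pose pt (m i : nat) : R := expR ((i%:R - m%:R ^+ 2) / m%:R).
have near_k m : exists n, [/\ (m <= n)%N, `|E n - E'| < m.+1%:R^-1, `|B n - B'| < m.+1%:R^-1 &
  forall i : 'I_(2 * m ^ 2).+1, `|X n (pt m i) - f (pt m i)| < m.+1%:R^-1].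
 have e0 : 0 < m.+1%:R^-1 :> R by rewrite invr_gt0.
 have H1 : \forall n \near U, (m <= n)%N by apply: oU; exact: nbhs_infty_ge.
 have H2 := (cvgrPdistC_lt _ _).1 EP _ e0.
 have H3 := (cvgrPdistC_lt _ _).1 BP _ e0.
 have H4 : \forall n \near U, forall i : 'I_(2 * m ^ 2).+1, `|X n (pt m i) - f (pt m i)| < m.+1%:R^-1.
  apply: filter_forall => i.
  exact: ((cvgrPdistC_lt _ _).1 (fP _ (expR_gt0 _)) _ e0).
 have [n [[[h1 h2] h3] h4]] := filter_ex (filterI (filterI (filterI H1 (H2 _)) (H3 _)) H4).
 by exists n.
have [k kP] := choice near_k.
have hold t t' : t <= t' -> (f (expR (- t')) - f (expR (- t))) ^+ 2 <= t' - t.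
 move=> tt; have lim : (X n (expR (- t')) - X n (expR (- t))) ^+ 2 @[n --> U] --> (f (expR (- t')) - f (expR (- t))) ^+ 2.
  under eq_cvg do rewrite expr2; rewrite expr2.
  by apply: cvgM; apply: cvgB; apply: fP; exact: expR_gt0.
 apply: (cvgr_to_le lim); apply: nearW => n.
 apply: le_trans (psi_holder (adm n) tt) _.
 by rewrite ler_piMr ?subr_ge0//; case/andP: (E01 n).
have harm : m.+1%:R^-1 @[m --> \oo] --> (0 : R) by exact: cvg_harmonic.
have squ (g : nat -> R) l : (forall m, `|g m - l| < m.+1%:R^-1) -> g m @[m --> \oo] --> l.
 move=> h; apply/cvgrPdistC_lt => e e0; apply: filterS ((cvgrPdistC_lt _ _).1 harm _ e0) => m; rewrite subr0 ger0_norm// => h2; exact: lt_trans (h m) h2.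
have EL : E (k m) @[m --> \oo] --> E' by apply: squ => m; case: (kP m).
have BL : B (k m) @[m --> \oo] --> B' by apply: squ => m; case: (kP m).
have conv s : 0 < s -> X (k n) s @[n --> \oo] --> f s.
 move=> s0; have sE : s = expR (- - exp.ln s) by rewrite opprK lnK.
 move: (- exp.ln s) sE => t sE.
 have bound : \forall m \near \oo, `|X (k m) s - f s| <= m.+1%:R^-1 + 4 * Num.sqrt (m.+1%:R^-1).
  near=> m.
  have m1 : (0 < m)%N by near: m; exact: nbhs_infty_gt.
  have mt : `|t| <= m%:R - 1.
   rewrite lerBrDr; apply: le_trans (_ : (Num.truncn (`|t| + 1)).+1%:R <= _).
    exact/ltW/truncnS_gt.
   by rewrite ler_nat; near: m; exact: nbhs_infty_ge.
  have mp : 0 < m%:R :> R by rewrite ltr0n.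
  have [i [im it ti]] : exists i : nat, [/\ (i < (2 * m ^ 2).+1)%N, i%:R - m%:R ^+ 2 <= - t * m%:R & - t * m%:R <= i%:R - m%:R ^+ 2 + 1].
   have tm : `|t * m%:R| <= m%:R ^+ 2 by rewrite normrM (ger0_norm (ltW mp)) expr2 ler_wpM2r// ?ltW//; lra.
   have y0 : 0 <= m%:R ^+ 2 - t * m%:R by have := ler_norm (t * m%:R); lra.
   have /andP[h1 h2] := truncn_itv y0.
   exists (Num.truncn (m%:R ^+ 2 - t * m%:R)); split.
   - rewrite -(ltr_nat R); apply: le_lt_trans h1 _; rewrite -natr1 natrM natrX.
    have := ler_norm (- (t * m%:R)); rewrite normrN; lra.
   - lra.
   - by move: h2; rewrite -(natr1 (Num.truncn _)); lra.
  have [_ _ _ /(_ (Ordinal im)) /= cl] := kP m.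
  pose t' : R := (m%:R ^+ 2 - i%:R) / m%:R.
  have ptE : pt m i = expR (- t') by rewrite /pt /t'; congr expR; rewrite -[RHS]mulNr opprB.
  have tt' : t <= t' by rewrite /t' ler_pdivlMr//; lra.
  have t't : t' - t <= m%:R^-1.
   by rewrite lerBlDr /t' ler_pdivrMr// mulrDl mulVf ?gt_eqF//; lra.
  have mm : m%:R^-1 <= 4 * m.+1%:R^-1 :> R.
   rewrite -[leLHS]div1r ler_pdivrMr// mulrAC ler_pdivlMr// -natr1.
   have : 1 <= m%:R :> R by rewrite ler1n.
   lra.
  have sq (a b : R) : (b - a) ^+ 2 <= t' - t -> `|b - a| <= 2 * Num.sqrt (m.+1%:R^-1).
   move=> h; rewrite -sqrtr_sqr.
   have -> : 2 * Num.sqrt (m.+1%:R^-1) = Num.sqrt (4 * m.+1%:R^-1) :> R.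
    by rewrite sqrtrM// -[4](_ : 2 ^+ 2 = _) ?sqrtr_sqr ?ger0_norm// expr2 -natrM.
   by apply: ler_wsqrtr; exact: le_trans h (le_trans t't mm).
  have h1 := sq _ _ (hold _ _ tt').
  have h2 : `|X (k m) (expR (- t')) - X (k m) (expR (- t))| <= 2 * Num.sqrt (m.+1%:R^-1).
   apply: sq; apply: le_trans (psi_holder (adm (k m)) tt') _.
   by rewrite ler_piMr ?subr_ge0//; case/andP: (E01 (k m)).
  rewrite sE; move: cl h1 h2; rewrite ptE.
  set a := X _ _; set b := f _; set c := X _ _; set d := f _ => cl h1 h2.
  have -> : c - d = (a - b) + (b - d) - (a - c) by ring.
  apply: le_trans (ler_normB _ _) _; apply: le_trans (lerD (ler_normD _ _) (lexx _)) _.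
  move: cl h1 h2 => /ltW; move: (Num.sqrt (m.+1%:R^-1 : R)) => u; move: (m.+1%:R^-1 : R) => v; lra.
 apply/cvgrPdistC_le => e e0.
 have lim0 : m.+1%:R^-1 + 4 * Num.sqrt (m.+1%:R^-1) @[m --> \oo] --> (0 : R).
  have h : m.+1%:R^-1 + 4 * Num.sqrt (m.+1%:R^-1) @[m --> \oo] --> (0 + 4 * Num.sqrt 0 : R).
   apply: cvgD => //; apply: cvgMl_tmp.
   by apply: (@cvg_comp _ _ _ (fun m => m.+1%:R^-1) (@Num.sqrt R)); [exact: harm|exact: sqrt_continuous].
  by rewrite sqrtr0 mulr0 addr0 in h.
 apply: filterS2 bound ((cvgrPdistC_lt _ _).1 lim0 _ e0) => m h1; rewrite subr0 => h2.
 by apply: le_trans h1 _; apply: le_trans (ler_norm _) (ltW h2).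
pose X' s : R := if 0 < s then f s else 0.
have X'E s : 0 < s -> X' s = f s by rewrite /X' => ->.
have EB' : E' + B' <= 1.
 by apply: (cvgr_to_le (cvgD EL BL)); apply: nearW => n; case: (adm (k n)) => _ _ _ _ [].
have f0 s : 0 < s -> 0 <= f s by move=> s0; apply: (cvgr_to_ge (conv s s0)); exact: nearW.
have X'0 s : 0 <= X' s by rewrite /X'; case: ltP => // /f0.
have mX' : mfun R X'.
 apply: (@measurable_fun_cvg _ (mline R) R setT (fun n s => if 0 < s then X (k n) s else 0)).
  by move=> n; apply: measurable_if_pos; case: (adm (k n)).
 by move=> s _; rewrite /X'; case: ltP => [/conv//|_]; exact: cvg_cst.
have [B'' B''E B''le] : exists2 B'', (\int[leb]_(s in `]0%R, +oo[) (X' s ^+ 2)%:E = B''%:E)%E & B'' <= B'.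
 have : (\int[leb]_(s in `]0%R, +oo[) (X' s ^+ 2)%:E <= B'%:E)%E.
  have := @fatou _ (mline R) R leb `]0%R, +oo[%classic _ (fun n s => (X (k n) s ^+ 2)%:E).
  have -> : limn_einf (fun n => \int[leb]_(x in `]0%R, +oo[) (X (k n) x ^+ 2)%:E)%E = B'%:E.
   have -> : (fun n => \int[leb]_(x in `]0%R, +oo[) (X (k n) x ^+ 2)%:E)%E = (fun n => (B (k n))%:E).
    by apply/funext => n; case: (adm (k n)) => _ _ _ _ [].
   have lB : (fun n => (B (k n))%:E) n @[n --> \oo] --> B'%:E by apply: cvg_EFin => //; exact: nearW.
   exact: (cvg_limn_einf_sup lB).1.
  have -> : (\int[leb]_(x in `]0%R, +oo[) limn_einf (fun n => (X (k n) x ^+ 2)%:E) = \int[leb]_(s in `]0%R, +oo[) (X' s ^+ 2)%:E)%E.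
   apply: eq_integral => s /set_mem /=; rewrite in_itv/= andbT => s0.
   have lB : (X (k n) s ^+ 2)%:E @[n --> \oo] --> (X' s ^+ 2)%:E.
    apply: cvg_EFin; first exact: nearW.
    rewrite X'E// expr2; under eq_cvg do rewrite /= expr2.
    by apply: cvgM; exact: conv.
   exact: (cvg_limn_einf_sup lB).1.
  apply => //.
  - by move=> n; apply/measurable_EFinP/measurable_funTS/measurable_funX; case: (adm (k n)).
  - by move=> n x _; rewrite lee_fin sqr_ge0.
 have : (0 <= \int[leb]_(s in `]0%R, +oo[) (X' s ^+ 2)%:E)%E.
  by apply: integral_ge0 => s _; rewrite lee_fin sqr_ge0.
 by case: (\int[leb]_(s in _) _)%E => [r| |]//; rewrite !lee_fin => _ rB; exists r.
exists k, X', E', B', B''; split => //.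
- by move=> n; case: (kP n).
- by move=> s s0; rewrite X'E//; exact: conv.
split => //.
- move=> s1 s2 s10 s12; have s20 : 0 < s2 by exact: lt_le_trans s12.
 rewrite !X'E// -subr_ge0; apply: (cvgr_to_ge (cvgB (conv _ s10) (conv _ s20))).
 by apply: nearW => n; rewrite subr_ge0; case: (adm (k n)) => _ _ + _ _; apply.
- move=> t D N D0; under eq_bigr do rewrite !X'E ?expR_gt0//.
 have lim : \sum_(i < N) (X (k n) (expR (- (t + i.+1%:R * D))) - X (k n) (expR (- (t + i%:R * D)))) ^+ 2
    - D * E (k n) @[n --> \oo] --> \sum_(i < N) (f (expR (- (t + i.+1%:R * D))) - f (expR (- (t + i%:R * D)))) ^+ 2 - D * E'.
  apply: cvgB; last exact: cvgMl_tmp.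
  apply: cvg_big => [|i _]; first exact: add_continuous.
  under eq_cvg do rewrite expr2; rewrite expr2.
  by apply: cvgM; apply: cvgB; apply: conv; exact: expR_gt0.
 rewrite -subr_le0; apply: (cvgr_to_le lim); apply: nearW => n; rewrite subr_le0.
 by case: (adm (k n)) => _ _ _ + _; apply.
- split => //; last by lra.
 by apply: (cvgr_to_ge EL); apply: nearW => n; case/andP: (E01 (k n)).
Unshelve. all: by end_near.
Qed.

End limit_profile.

(** * Change of variables *)

Section change_of_variables.
Context {R : realType}.
Notation leb := (@lebesgue_measure R).
Notation DD := (`]0%R, +oo[%classic : set (mline R)).

(** Uniqueness of Lebesgue measure concerns the whole line, so the image measure divided by [c] on
    the positive axis is completed by Lebesgue measure on the rest. *)
Lemma pushforward_scaled d (T : measurableType d) (mu : {measure set T -> \bar R})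
  (phi : T -> mline R) (c : R) : 0 < c -> mfun T phi ->
 (forall a, 0 <= a -> mu (phi @^-1` `]0%R, a]%classic) = (c * a)%:E) ->
 forall f : R -> R, mfun R f -> (forall x, 0 < x -> 0 <= f x) ->
 (\int[mu]_(x in phi @^-1` DD) (f (phi x))%:E = c%:E * \int[leb]_(x in DD) (f x)%:E)%E.
Proof.
move=> c0 mphi mua f mf f0.
have ci0 : 0 <= c^-1 by rewrite invr_ge0 ltW.
have mD : measurable DD by exact: measurable_itv.
have mN : measurable (`]-oo, 0%R]%classic : set (mline R)) by exact: measurable_itv.
have [nu nuE] : {nu : {measure set (mline R) -> \bar R} | forall A, nu A = mu (phi @^-1` A)}.
 by unshelve eexists (pushforward mu phi).
pose m1 := mscale (NngNum ci0) (mrestr nu mD).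
pose m2 := mrestr leb mN.
have m1E A : m1 A = ((c^-1)%:E * mu (phi @^-1` (A `&` DD)))%E by rewrite -nuE.
have m2E A : m2 A = leb (A `&` `]-oo, 0%R]%classic) by [].
have itv p q : 0 <= p -> p <= q -> mu (phi @^-1` `]p, q]%classic) = (c * (q - p))%:E.
 move=> p0 pq; have q0 := le_trans p0 pq.
 have mI (a b : R) : measurable (phi @^-1` `]a, b]%classic).
  by rewrite -[X in measurable X]setTI; apply: mphi => //; exact: measurable_itv.
 have : mu (phi @^-1` `]0%R, q]%classic) = (mu (phi @^-1` `]0%R, p]%classic) + mu (phi @^-1` `]p, q]%classic))%E.
  rewrite -measureU//.
   congr (mu _); apply/seteqP; split => x /=; rewrite !in_itv/=.
    by move=> /andP[-> ->]; case: (leP (phi x) p) => h; [left|right].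
   by move=> [/andP[-> h]|/andP[h ->]]; [rewrite (le_trans h)|rewrite (le_lt_trans p0)].
  apply/seteqP; split => x //= []; rewrite !in_itv/= => /andP[_ h1] /andP[h2 _].
  by move: h2; rewrite ltNge h1.
 rewrite !mua//; case: (mu (phi @^-1` `]p, q]%classic)) => [z| |]// [h].
 by congr (_%:E); rewrite mulrBr h addrAC subrr add0r.
have lebE' A : measurable A -> leb A = measure_add m1 m2 A.
 move=> mA; apply: lebesgue_measure_unique => // _ [[a b]] _ <-.
 rewrite [RHS](_ : _ = m1 `]a, b]%classic + m2 `]a, b]%classic)%E; last exact: measure_addE.
 rewrite m1E m2E /=.
 have [ab|ba] := leP a b; last first.
  have -> : `]a, b]%classic = set0 by apply: set_itv_ge; rewrite bnd_simp -leNgt ltW.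
  by rewrite !set0I preimage_set0 !measure0 mule0 adde0.
 have -> : phi @^-1` (`]a, b] `&` `]0%R, +oo[)%classic = phi @^-1` `](Num.max a 0), (Num.max b 0)]%classic.
  apply/seteqP; split => x /=; rewrite !in_itv/= andbT.
   by move=> [/andP[h1 h2] h3]; rewrite gt_max h1 h3 le_max h2.
  rewrite gt_max => /andP[/andP[h1 h2]]; rewrite le_max leNgt => /orP[h3|]; last by rewrite leNgt h2.
  by split => //; rewrite h1.
 have -> : (`]a, b] `&` `]-oo, 0%R])%classic = `](Num.min a 0), (Num.min b 0)]%classic.
  apply/seteqP; split => x /=; rewrite !in_itv/=.
   by move=> [/andP[h1 h2] h3]; rewrite gt_min h1 le_min h2.
  rewrite le_min => /andP[+ /andP[h2 h3]]; rewrite gt_min => /orP[h1|]; last by rewrite ltNge h3.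
  by split => //; rewrite h1.
 have h1 : Num.max a 0 <= Num.max b 0 by rewrite ge_max !le_max ab lexx orbT.
 have h2 : Num.min a 0 <= Num.min b 0 by rewrite le_min !ge_min ab lexx orbT.
 have h0 : 0 <= Num.max a 0 by rewrite le_max lexx orbT.
 have -> : leb `](Num.min a 0), (Num.min b 0)]%classic = (Num.min b 0 - Num.min a 0)%:E by exact: leb_itvoc h2.
 rewrite (itv _ _ h0 h1) [LHS](leb_itvoc ab) -EFinM -EFinD.
 congr (_%:E); rewrite mulrA mulVf ?gt_eqF// mul1r.
 by case: (leP a 0) (leP b 0) => ha [] hb; lra.
have lebE A : measurable A -> A `<=` DD -> leb A = mscale (NngNum ci0) nu A.
 move=> mA AD; rewrite lebE'// [LHS](_ : _ = m1 A + m2 A)%E; last exact: measure_addE.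
 rewrite m1E m2E (setIidl AD) (_ : mscale _ _ _ = (c^-1)%:E * nu A)%E// nuE (_ : A `&` _ = set0) ?measure0 ?adde0//.
 apply/seteqP; split => x //= [/AD]; rewrite /= !in_itv/= andbT => h.
 by rewrite leNgt h.
have -> : (\int[leb]_(x in DD) (f x)%:E = \int[mscale (NngNum ci0) nu]_(x in DD) (f x)%:E)%E.
 by apply: eq_measure_integral => A mA AD; exact: lebE.
have mfD : measurable_fun DD (fun x => (f x)%:E) by apply/measurable_EFinP/measurable_funTS.
have fD : {in DD, forall x, (0 <= (f x)%:E)%E}.
 by move=> x /set_mem /=; rewrite in_itv/= andbT lee_fin => /f0.
rewrite ge0_integral_mscale//; last by move=> x Dx; apply: fD; exact/mem_set.
rewrite muleA -EFinM divff ?gt_eqF// mul1e.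
have := @ge0_integral_pushforward _ _ T (mline R) R phi mphi mu DD (fun x => (f x)%:E) mD mfD fD.
move=> <-; apply: eq_measure_integral => A mA _.
by rewrite nuE.
Qed.

Lemma integral_scale (r : R) (f : R -> R) : 0 < r -> mfun R f ->
 (forall x, 0 < x -> 0 <= f x) ->
 (\int[leb]_(x in DD) (f (x / r))%:E = r%:E * \int[leb]_(x in DD) (f x)%:E)%E.
Proof.
move=> r0 mf f0.
have mphi : mfun (mline R) (fun x : mline R => x / r : mline R).
 by apply: measurable_funM.
have := @pushforward_scaled _ (mline R) leb _ r r0 mphi _ f mf f0.
have -> : (fun x : mline R => x / r : mline R) @^-1` DD = DD.
 by apply/seteqP; split => x /=; rewrite !in_itv/= !andbT pmulr_lgt0// invr_gt0.
apply => a a0.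
have -> : (fun x : mline R => x / r : mline R) @^-1` `]0%R, a]%classic = `]0%R, (r * a)]%classic.
 by apply/seteqP; split => x /=; rewrite !in_itv/= pmulr_lgt0 ?invr_gt0// ler_pdivrMr// mulrC.
have ra : 0 <= r * a by rewrite mulr_ge0// ltW.
by rewrite [LHS](leb_itvoc ra) subr0.
Qed.

End change_of_variables.

(** * Functionals on profiles and compactness of maximising sequences *)

Section functionals.
Context {R : realType}.
Notation leb := (@lebesgue_measure R).
Implicit Types (X : R -> R) (E B C p lam : R).

Lemma dct_line (fn : nat -> R -> R) (f h : R -> R) :
 (forall n, mfun R (fn n)) -> mfun R f -> mfun R h ->
 (forall n s, 0 < s -> 0 <= fn n s <= h s) -> (forall s, 0 < s -> fn n s @[n --> \oo] --> f s) ->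
 (\int[leb]_(s in `]0%R, +oo[) (h s)%:E < +oo)%E ->
 (\int[leb]_(s in `]0%R, +oo[) (f s)%:E < +oo)%E /\
 fine (\int[leb]_(s in `]0%R, +oo[) (fn n s)%:E) @[n --> \oo] --> fine (\int[leb]_(s in `]0%R, +oo[) (f s)%:E).
Proof.
move=> mfn mf mh fnh fnf hoo.
have mD : measurable (`]0%R, +oo[%classic : set (mline R)) by exact: measurable_itv.
have toD (g : R -> R) : mfun R g ->
  measurable_fun (`]0%R, +oo[%classic : set (mline R)) (fun x => (g x)%:E).
 by move=> mg; apply/measurable_EFinP/measurable_funTS.
have Dpos x : (`]0%R, +oo[%classic : set (mline R)) x -> 0 < x by rewrite /= in_itv/= andbT.
have f0 s : 0 < s -> 0 <= f s.
 by move=> s0; apply: (cvgr_to_ge (fnf s s0)); apply: nearW => n; case/andP: (fnh n s s0).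
have h0 s : 0 < s -> 0 <= h s.
 by move=> s0; case/andP: (fnh 0%N s s0) => a b; exact: le_trans b.
have ih : leb.-integrable (`]0%R, +oo[%classic : set (mline R)) (fun x => (h x)%:E).
 apply/integrableP; split; first exact: toD.
 apply: le_lt_trans hoo; apply: le_of_eq.
 by apply: eq_integral => x /set_mem/Dpos x0; rewrite gee0_abs// lee_fin h0.
have cv : {ae leb, forall x, (`]0%R, +oo[%classic : set (mline R)) x -> (fn n x)%:E @[n --> \oo] --> (f x)%:E}.
 apply: aeW => x /Dpos x0; apply: cvg_EFin; [exact: nearW|exact: fnf].
have bd : {ae leb, forall x, forall n, (`]0%R, +oo[%classic : set (mline R)) x -> (`|(fn n x)%:E| <= (h x)%:E)%E}.
 by apply: aeW => x n /Dpos x0; rewrite gee0_abs ?lee_fin; case/andP: (fnh n x x0).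
have [i _ L] := @dominated_convergence _ (mline R) R leb _ mD
 (fun n x => (fn n x)%:E) (fun x => (f x)%:E) (fun x => (h x)%:E)
 (fun n => toD _ (mfn n)) (toD _ mf) cv ih bd.
have foo : (\int[leb]_(s in `]0%R, +oo[) (f s)%:E < +oo)%E.
 move: (integrableP _ _ _ i) => [_]; apply: le_lt_trans; apply: le_of_eq.
 by apply: eq_integral => x /set_mem/Dpos x0; rewrite gee0_abs// lee_fin f0.
split => //; apply: (@fine_cvg _ _ \oo).
rewrite fineK; first exact: L.
by rewrite ge0_fin_numE// integral_ge0// => x /Dpos x0; rewrite lee_fin f0.
Qed.

(** The part of the integrand that passes to the limit by domination. The subtracted [y ^+ 2] is not
    dominated at infinity and is accounted for by the mass [B]. *)
Definition exp_remainder (y : R) := expR (y ^+ 2) - 1 - y ^+ 2.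

Lemma exp_remainder_ge0 y : 0 <= exp_remainder y.
Proof. by rewrite /exp_remainder; have := expR_ge1Dx (y ^+ 2); lra. Qed.

(** [expR x - 1 <= x * expR x], used twice. *)
Lemma exp_remainder_le y : exp_remainder y <= (y ^+ 2) ^+ 2 * expR (y ^+ 2).
Proof.
rewrite /exp_remainder; move: (y ^+ 2) (sqr_ge0 y) => x x0.
have h : expR x - 1 <= x * expR x.
 have := expR_ge1Dx (- x); rewrite expRN => h; have e0 := expR_gt0 x.
 have : (1 - x) * expR x <= 1 by rewrite -ler_pdivlMr// div1r.
 lra.
have : x * (expR x - 1) <= x * (x * expR x) by rewrite ler_wpM2l.
rewrite expr2; lra.
Qed.

(** Beyond [s0] only [X s ^+ 2 <= 1 / s] is available. It bounds the remainder by a multiple of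
    [s ^ (- 2)] and [X ^ p] by [s ^ (- p / 2)], integrable at infinity because [p > 2]; as
    [power_fun] they have the indices [- 1] and [- (p / 2 - 1)]. *)
Lemma tail_dominated C (s0 : R) p : 2 < p -> 0 <= C -> 0 < s0 -> s0 < 1 ->
 exists h : R -> R, [/\ mfun R h,
  (\int[leb]_(s in `]0%R, +oo[) (h s)%:E < +oo)%E &
  forall X E B, admissible X E B ->
   (forall s, 0 < s -> s <= s0 -> expR (X s ^+ 2) <= C * log_fun s) ->
   forall s, 0 < s -> exp_remainder (X s) <= h s /\ X s `^ p <= h s].
Proof.
move=> p2 C0 s00 s01; have [|K K0 Kb] := @powR_le_exp R p; first by lra.
pose c := p / 2 - 1; have c0 : 0 < c by rewrite /c; lra.
pose e := expR (s0^-1).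
have e0 : 0 <= e by exact: expR_ge0.
pose h1 s : R := (1 + K) * C * log_fun s.
pose h2 s : R := e * power_fun (- 1) s + power_fun (- c) s.
have mh1 : mfun R h1 by apply: measurable_funM => //; exact: measurable_log_fun.
have mh2 : mfun R h2.
 by apply: measurable_funD; [apply: measurable_funM => //|]; exact: measurable_power_fun.
have h10 s : 0 <= h1 s by rewrite /h1 !mulr_ge0 ?addr_ge0 ?log_fun_ge0.
have h20 s : 0 <= h2 s by rewrite addr_ge0 ?mulr_ge0 ?power_fun_ge0.
pose h s : R := if s <= s0 then h1 s else h2 s.
have mh : mfun R h.
 by apply: measurable_fun_ifT => //; apply: measurable_fun_ler.
exists h; split => //.
 have h0 x : 0 < x -> 0 <= h x by rewrite /h; case: ifP.
 rewrite (integral_splitoy (ltW s00) mh h0); apply: lte_add_pinfty.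
  apply: (@le_lt_trans _ _ (\int[leb]_(x in `]0%R, s0]) (h1 x)%:E)%E).
   by apply: le_integral_line => // x; rewrite /= in_itv/= /h => /andP[_ ->].
  under eq_integral do rewrite EFinM.
  rewrite ge0_integralZl//; last 3 first.
  - by apply/measurable_EFinP/measurable_funTS; exact: measurable_log_fun.
  - by move=> x _; rewrite lee_fin log_fun_ge0.
  - by rewrite lee_fin mulr_ge0// addr_ge0.
  apply: (@le_lt_trans _ _ (((1 + K) * C)%:E * ((- ln s0)^-1)%:E)%E); last by rewrite -EFinM ltry.
  by rewrite lee_wpmul2l ?lee_fin ?mulr_ge0 ?addr_ge0// integral_log_fun// s00.
 apply: (@le_lt_trans _ _ (\int[leb]_(x in `[s0, +oo[) (h2 x)%:E)%E).
  apply: (@le_trans _ _ (\int[leb]_(x in `]s0, +oo[) (h2 x)%:E)%E).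
   by apply: le_integral_line => // x; rewrite /= in_itv/= andbT /h; case: leP.
  apply: ge0_subset_integral => //.
  - by apply/measurable_EFinP/measurable_funTS.
  - by move=> x _; rewrite lee_fin.
  - by move=> x /=; rewrite !in_itv/= !andbT => /ltW.
 have mpw c' : measurable_fun (`[s0, +oo[%classic : set (mline R)) (fun x => (power_fun c' x)%:E).
  by apply/measurable_EFinP/measurable_funTS; exact: measurable_power_fun.
 have -> : (\int[leb]_(x in `[s0, +oo[) (h2 x)%:E = e%:E * \int[leb]_(x in `[s0, +oo[) (power_fun (- 1) x)%:E +
   \int[leb]_(x in `[s0, +oo[) (power_fun (- c) x)%:E)%E.
  have p0 (c' x : R) : (0 <= (power_fun c' x)%:E)%E by rewrite lee_fin power_fun_ge0.
  rewrite -ge0_integralZl//; try exact: mpw; try by move=> x _.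
  rewrite -ge0_integralD//; try exact: mpw; try by apply: measurable_funeM; exact: mpw.
  by move=> x _; rewrite mule_ge0// lee_fin.
 apply: lte_add_pinfty.
  apply: (@le_lt_trans _ _ (e%:E * (expR (- 1 * ln s0) / 1)%:E)%E); last by rewrite -EFinM ltry.
  by rewrite lee_wpmul2l ?lee_fin// integral_powery.
 by apply: (le_lt_trans (integral_powery c0 s00)); rewrite ltry.
move=> X E B adm tl s sp; have X0 : 0 <= X s by case: adm.
have Xs : X s ^+ 2 <= s^-1.
 rewrite -[leRHS]mul1r ler_pdivlMr//; apply: le_trans (admissible_sqr_le adm sp) _.
 exact: admissible_B_le1 adm.
rewrite /h; case: (leP s s0) => ss.
 have t := tl s sp ss; have lf := log_fun_ge0 s.
 have e1 : 1 <= expR (X s ^+ 2) by rewrite -[leLHS]expR0 ler_expR sqr_ge0.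
 have CK : K * expR (X s ^+ 2) <= K * (C * log_fun s) by rewrite ler_wpM2l.
 have Cl : 0 <= C * log_fun s by rewrite mulr_ge0.
 have KCl : 0 <= K * (C * log_fun s) by rewrite mulr_ge0.
 split; first by rewrite /h1 /exp_remainder; have := sqr_ge0 (X s); lra.
 apply: le_trans (Kb _ X0) _; apply: (@le_trans _ _ (K * expR (X s ^+ 2))).
  by rewrite ler_wpM2l// ler_expR; have := sqr_ge0 (X s); lra.
 by rewrite /h1; lra.
have p1 : power_fun (- 1) s = (s^-1) ^+ 2.
 rewrite /power_fun sp -[X in X ^+ 2]lnK ?posrE ?invr_gt0// -expRM_natl lnV ?posrE//.
 by congr expR; lra.
have pc : X s `^ p <= power_fun (- c) s.
 have [->|Xn] := eqVneq (X s) 0; first by rewrite powR0 ?power_fun_ge0// gt_eqF//; lra.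
 have Xp : 0 < X s by rewrite lt0r Xn.
 rewrite /powR (negbTE Xn) /power_fun sp ler_expR.
 have : ln (X s ^+ 2) <= ln (s^-1) by rewrite ler_ln ?posrE ?exprn_gt0 ?invr_gt0.
 rewrite lnXn// lnV ?posrE// -mulr_natr => hl.
 have : p / 2 * (ln (X s) * 2) <= p / 2 * - ln s by rewrite ler_wpM2l//; lra.
 by rewrite /c; lra.
have hc := power_fun_ge0 (- c) s; split; last first.
 by apply: le_trans pc _; rewrite /h2 lerDr mulr_ge0// power_fun_ge0.
apply: le_trans (exp_remainder_le _) _; rewrite /h2 p1.
have s1 : s^-1 <= s0^-1 by rewrite lef_pV2// ltW.
have : (X s ^+ 2) ^+ 2 * expR (X s ^+ 2) <= (s^-1) ^+ 2 * e.
 apply: ler_pM; rewrite ?expR_ge0 ?sqr_ge0//.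
  by rewrite lerXn2r ?nnegrE ?sqr_ge0// invr_ge0 ltW.
 by rewrite ler_expR; lra.
lra.
Qed.

End functionals.

Section compactness.
Context {R : realType}.
Notation leb := (@lebesgue_measure R).
Implicit Types (X : R -> R) (E B lam p : R).

Definition exp_part X : \bar R := (\int[leb]_(s in `]0%R, +oo[) (expR (X s ^+ 2) - 1)%:E)%E.

Definition power_part p X : \bar R := (\int[leb]_(s in `]0%R, +oo[) (X s `^ p)%:E)%E.

Definition profile_value lam p X : R := fine (exp_part X) - lam * fine (power_part p X).

Lemma measurable_exp_sqr X : mfun R X -> mfun R (fun s => expR (X s ^+ 2)).
Proof. by move=> mX; apply: measurableT_comp => //; exact: measurable_funX. Qed.

Lemma measurable_pow X p : mfun R X -> mfun R (fun s => X s `^ p).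
Proof.
by move=> mX; apply: (@measurableT_comp _ _ _ _ _ _ (fun x => x `^ p)) => //; exact: measurable_powR.
Qed.

Lemma measurable_remainder X : mfun R X -> mfun R (fun s => exp_remainder (X s)).
Proof.
move=> mX; apply: measurable_funB; last exact: measurable_funX.
by apply: measurable_funB => //; exact: measurable_exp_sqr.
Qed.

Lemma exp_part_ge0 X : (0 <= exp_part X)%E.
Proof.
by apply: integral_ge0 => x _; rewrite lee_fin subr_ge0 -[leLHS]expR0 ler_expR sqr_ge0.
Qed.

Lemma power_part_ge0 p X : (0 <= power_part p X)%E.
Proof. by apply: integral_ge0 => x _; rewrite lee_fin powR_ge0. Qed.

Lemma exp_part_split X E B : admissible X E B ->
 exp_part X = (B%:E + \int[leb]_(s in `]0%R, +oo[) (exp_remainder (X s))%:E)%E.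
Proof.
case=> mX X0 _ _ [_ <- _]; rewrite /exp_part -ge0_integralD//.
- by apply: eq_integral => x _; rewrite -EFinD; congr (_%:E); rewrite /exp_remainder; ring.
- by move=> x _; rewrite lee_fin sqr_ge0.
- by apply/measurable_EFinP/measurable_funTS/measurable_funX.
- by move=> x _; rewrite lee_fin exp_remainder_ge0.
- by apply/measurable_EFinP/measurable_funTS; exact: measurable_remainder.
Qed.

Lemma admissible_finite X E B p : 2 < p -> admissible X E B ->
 (exp_part X < +oo)%E /\ (power_part p X < +oo)%E.
Proof.
move=> p2 adm; have [|C [s0 [C0 s00 s01 /(_ X E B adm)[tl|small]]]] := @dichotomy R 1 p; first by lra.
 have [h [mh hoo /(_ X E B adm tl) hX]] := tail_dominated p2 C0 s00 s01.
 have mX : mfun R X by case: adm.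
 have le (g : R -> R) : mfun R g -> (forall x, 0 <= g x) -> (forall s, 0 < s -> g s <= h s) ->
   (\int[leb]_(s in `]0%R, +oo[) (g s)%:E < +oo)%E.
  move=> mg g0 gh; apply: le_lt_trans hoo; apply: le_integral_line => //.
  by move=> x /=; rewrite in_itv/= andbT => /gh.
 split.
  rewrite (exp_part_split adm); apply: lte_add_pinfty; first exact: ltry.
  apply: le; [exact: measurable_remainder|by move=> x; exact: exp_remainder_ge0|by move=> s /hX[]].
 by apply: le; [exact: measurable_pow|by move=> x; exact: powR_ge0|by move=> s /hX[]].
rewrite normr1 mul1e in small; split; apply: le_lt_trans (ltry (999 / 1000)); apply: le_trans small.
 by rewrite leeDl// power_part_ge0.
by rewrite leeDr// exp_part_ge0.
Qed.

Lemma admissible_fine X E B p : 2 < p -> admissible X E B ->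
 exp_part X = (fine (exp_part X))%:E /\ power_part p X = (fine (power_part p X))%:E.
Proof.
move=> p2 adm; have [a b] := admissible_finite p2 adm.
by rewrite !fineK// ge0_fin_numE ?exp_part_ge0 ?power_part_ge0.
Qed.

(** A dilation of [s] is a translation of [t = - ln s], which leaves the energy unchanged. *)
Lemma scale_admissible X E B r : 0 < r -> E + r * B <= 1 -> admissible X E B ->
 admissible (fun s => X (s / r)) E (r * B).
Proof.
move=> r0 EB [mX X0 Xle en [E0 XB _]]; split => //.
- by apply: measurableT_comp => //; exact: measurable_funM.
- move=> s1 s2 s10 s12; apply: Xle; first by rewrite divr_gt0.
 by rewrite ler_wpM2r// invr_ge0 ltW.
- move=> t D N D0; apply: le_trans (en (t + ln r) D N D0).
 have e (i : nat) : expR (- (t + i%:R * D)) / r = expR (- (t + ln r + i%:R * D)).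
  by rewrite -[r in LHS]lnK ?posrE// -expRN -expRD; congr expR; lra.
 by apply: le_of_eq; apply: eq_bigr => i _; rewrite !e.
- split => //; rewrite EFinM -XB.
 apply: (@integral_scale R r (fun s => X s ^+ 2)) => //; first exact: measurable_funX.
 by move=> x _; exact: sqr_ge0.
Qed.

Lemma profile_value_scale X E B lam p r : 2 < p -> 0 < r -> admissible X E B ->
 profile_value lam p (fun s => X (s / r)) = r * profile_value lam p X.
Proof.
move=> p2 r0 adm; have mX : mfun R X by case: adm.
have [a b] := admissible_fine p2 adm.
have -> : profile_value lam p (fun s => X (s / r)) =
  fine (r%:E * exp_part X)%E - lam * fine (r%:E * power_part p X)%E.
 congr (fine _ - lam * fine _).
  apply: (@integral_scale R r (fun s => expR (X s ^+ 2) - 1)) => //.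
   by apply: measurable_funB => //; exact: measurable_exp_sqr.
  by move=> x _; rewrite subr_ge0 -[leLHS]expR0 ler_expR sqr_ge0.
 apply: (@integral_scale R r (fun s => X s `^ p)) => //; first exact: measurable_pow.
 by move=> x _; exact: powR_ge0.
by rewrite /profile_value a b -!EFinM /=; ring.
Qed.

Lemma profile_value_small X E B lam p c : 2 < p -> admissible X E B ->
 (exp_part X + `|lam|%:E * power_part p X <= c%:E)%E -> profile_value lam p X <= c.
Proof.
move=> p2 adm; have [a b] := admissible_fine p2 adm.
rewrite /profile_value a b -EFinM -EFinD lee_fin /=.
have P0 : 0 <= fine (power_part p X) by rewrite fine_ge0// power_part_ge0.
have : - lam * fine (power_part p X) <= `|lam| * fine (power_part p X).
 by rewrite ler_wpM2r// -normrN ler_norm.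
lra.
Qed.

(** [S > 1] excludes concentration, so the remainder and the power part converge by domination and
    only mass can be lost, [B''] being left of [B']. A dilation by [B' / B''] restores it and
    multiplies the value. *)
Theorem profile_compactness (lam p S : R) (X : nat -> R -> R) (E B : nat -> R) :
 2 < p -> 1 < S -> (forall n, admissible (X n) (E n) (B n)) ->
 profile_value lam p (X n) @[n --> \oo] --> S ->
 exists X' E' B', admissible X' E' B' /\ S <= profile_value lam p X'.
Proof.
move=> p2 S1 adm JS.
have [|C [s0 [C0 s00 s01 dich]]] := @dichotomy R lam p; first by lra.
have [N _ NP] : \forall n \near \oo, 999 / 1000 < profile_value lam p (X n).
 by apply: (cvgr_gt S) => //; lra.
have tl n : (N <= n)%N -> forall s, 0 < s -> s <= s0 -> expR (X n s ^+ 2) <= C * log_fun s.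
 move=> Nn; have [//|small] := dich _ _ _ (adm n).
 have := profile_value_small p2 (adm n) small; have := NP n Nn; lra.
have [h [mh hoo hX]] := tail_dominated p2 C0 s00 s01.
have [k [X' [E' [B' [B'' [kn XX' BB' [B''B' EB'] adm']]]]]] := limit_profile (fun n => adm (N + n)%N).
have hk n := hX _ _ _ (adm (N + k n)%N) (tl _ (leq_addr _ _)).
have mX n : mfun R (X n) by case: (adm n).
have mX' : mfun R X' by case: adm'.
have X0 n s : 0 <= X n s by case: (adm n).
have crem : continuous (exp_remainder : R -> R).
 move=> y; apply: cvgB; last exact: exprn_continuous.
 apply: cvgB; last exact: cvg_cst.
 by apply: (@cvg_comp _ _ _ (fun y : R => y ^+ 2) expR); [exact: exprn_continuous|exact: continuous_expR].
have rem_cvg s (sp : 0 < s) : exp_remainder (X (N + k n)%N s) @[n --> \oo] --> exp_remainder (X' s).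
 by apply: (@cvg_comp _ _ _ (fun n => X (N + k n)%N s) exp_remainder); [exact: XX'|exact: crem].
have [Gfin Glim] := @dct_line R (fun n s => exp_remainder (X (N + k n)%N s)) (fun s => exp_remainder (X' s)) h
 (fun n => measurable_remainder (mX _)) (measurable_remainder mX') mh
 (fun n s sp => introT andP (conj (exp_remainder_ge0 _) (hk n s sp).1))
 rem_cvg hoo.
have [Pfin Plim] := @dct_line R (fun n s => X (N + k n)%N s `^ p) (fun s => X' s `^ p) h
 (fun n => measurable_pow p (mX _)) (measurable_pow p mX') mh
 (fun n s sp => introT andP (conj (powR_ge0 _ _) (hk n s sp).2))
 (fun s sp => powR_cvg (ltW p2) (fun n => X0 _ _) (XX' s sp)) hoo.
set G := fine _ in Glim; set P := fine _ in Plim.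
have JE Y EY BY : admissible Y EY BY -> profile_value lam p Y =
  BY + fine (\int[leb]_(s in `]0%R, +oo[) (exp_remainder (Y s))%:E) - lam * fine (power_part p Y).
 move=> aY; have [a _] := admissible_finite p2 aY; have sp := exp_part_split aY.
 have G0 : (0 <= \int[leb]_(s in `]0%R, +oo[) (exp_remainder (Y s))%:E)%E.
  by apply: integral_ge0 => s _; rewrite lee_fin exp_remainder_ge0.
 rewrite /profile_value sp fineD// ge0_fin_numE//.
 by apply: le_lt_trans a; rewrite sp leeDr// lee_fin (admissible_B_ge0 aY).
have lim : profile_value lam p (X (N + k n)%N) @[n --> \oo] --> B' + G - lam * P.
 under eq_cvg do rewrite (JE _ _ _ (adm _)).
 by apply: cvgB; [exact: cvgD|exact: cvgMl_tmp].
have limS : profile_value lam p (X (N + k n)%N) @[n --> \oo] --> S.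
 apply/cvgrPdist_lt => e e0; have [M _ MP] := (cvgrPdist_lt _ _).1 JS e e0.
 exists M; first exact: I.
 move=> n Mn; apply: MP; apply: (leq_trans Mn); apply: (leq_trans (kn n)); exact: leq_addl.
have SE : S = B' + G - lam * P by apply: (cvg_unique (@Rhausdorff R) limS); exact: lim.
have J' := JE _ _ _ adm'; rewrite -/G -/P in J'.
clearbody G P; clear -p2 S1 J' SE B''B' EB' adm'.
have E'0 : 0 <= E' by case: adm' => _ _ _ _ [].
have B''0 := admissible_B_ge0 adm'.
(* [B'' = 0] would make the limit zero and leave [S = B' <= 1]. *)
have [B0|Bn] := eqVneq B'' 0.
 have X'0 s : 0 < s -> X' s = 0.
  move=> sp; have := admissible_sqr_le adm' sp; rewrite B0 pmulr_lle0// => h0.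
  by apply/eqP; rewrite -sqrf_eq0 eq_le h0 sqr_ge0.
 have : profile_value lam p X' = 0.
  rewrite /profile_value /exp_part /power_part !integral0_eq ?mulr0 ?subrr// => s /=;
   rewrite in_itv/= andbT => sp; rewrite (X'0 _ sp).
  - by rewrite powR0// gt_eqF//; lra.
  - by rewrite expr0n expR0 subrr.
 lra.
have Bp : 0 < B'' by rewrite lt0r Bn.
have rp : 0 < B' / B'' by rewrite divr_gt0//; lra.
exists (fun s => X' (s / (B' / B''))), E', (B' / B'' * B''); split.
 by apply: scale_admissible => //; rewrite mulfVK.
rewrite (profile_value_scale lam p2 rp adm').
(* A limit value below [B''] would give [S < B' <= 1]. Otherwise the dilation gains at least the
   lost mass [B' - B'']. *)
have [JB|JB] := leP B'' (profile_value lam p X'); last by lra.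
have -> : S = profile_value lam p X' + (B' - B'') by lra.
rewrite -subr_ge0.
have -> : B' / B'' * profile_value lam p X' - (profile_value lam p X' + (B' - B'')) =
  (B' - B'') * (profile_value lam p X' - B'') / B'' by field.
by rewrite divr_ge0// mulr_ge0//; lra.
Qed.

End compactness.

(** * Measurability and polar coordinates in the plane *)

Section plane_measurability.
Context {R : realType}.
Notation P := (mplane R).

(** An open set is the union of the boxes it contains with rational centre and half-side
    [1 / (k + 1)], a countable family. *)
Lemma open_plane_measurable (S : set (R * R)) : open S -> measurable (S : set P).
Proof.
move=> oS.
pose Bx (a b : rat) (k : nat) : set P := [set x | `|x.1 - ratr a| < k.+1%:R^-1] `&` [set x | `|x.2 - ratr b| < k.+1%:R^-1].
have mB a b k : measurable (Bx a b k).
 have m (c : R) : measurable ([set t : mline R | `|t - c| < k.+1%:R^-1]).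
  rewrite [X in measurable X](_ : _ = `](c - k.+1%:R^-1), (c + k.+1%:R^-1)[%classic); first exact: measurable_itv.
  by apply/seteqP; split => t /=; rewrite in_itv/= ltr_distl.
 apply: measurableI; rewrite -[X in measurable X]setTI.
  exact: (@measurable_fst _ _ _ _ measurableT _ (m (ratr a))).
 exact: (@measurable_snd _ _ _ _ measurableT _ (m (ratr b))).
have -> : S = \bigcup_a \bigcup_b \bigcup_k (if `[< Bx a b k `<=` S >] then Bx a b k else set0).
 apply/seteqP; split => x; last first.
  by move=> [a _ [b _ [k _]]]; case: asboolP => // sub; exact: sub.
 move=> Sx; have /nbhs_ballP[e /= e0 eS] : nbhs x S by exact: open_nbhs_nbhs.
 have [k ke] : exists k : nat, k.+1%:R^-1 + k.+1%:R^-1 <= e.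
  exists (Num.truncn (2 / e)); have h := truncnS_gt (2 / e).
  move: h; rewrite ltr_pdivrMr// => h.
  have -> : forall y : R, y^-1 + y^-1 = 2 / y by move=> y; rewrite mulrDl mul1r.
  by rewrite ler_pdivrMr// mulrC ltW.
 have k0 : 0 < k.+1%:R^-1 :> R by rewrite invr_gt0.
 have rt (t : R) : exists q : rat, `|t - ratr q| < k.+1%:R^-1.
  have [|q] := @rat_in_itvoo R (t - k.+1%:R^-1) (t + k.+1%:R^-1); first by move: (k.+1%:R^-1 : R) k0 => y; lra.
  by rewrite in_itv/= => /andP[h1 h2]; exists q; rewrite ltr_distlC h1.
 have [a xa] := rt x.1; have [b xb] := rt x.2.
 exists a => //; exists b => //; exists k => //.
 case: asboolP => [_|[]]; first by split.
 move=> y [/= ya yb]; apply: eS; split; rewrite /ball/=; apply: lt_le_trans ke.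
  rewrite (_ : x.1 - y.1 = (x.1 - ratr a) - (y.1 - ratr a)); last by ring.
  by apply: le_lt_trans (ler_normB _ _) _; exact: ltrD.
 rewrite (_ : x.2 - y.2 = (x.2 - ratr b) - (y.2 - ratr b)); last by ring.
 by apply: le_lt_trans (ler_normB _ _) _; exact: ltrD.
apply: bigcupT_measurable_rat => a; apply: bigcupT_measurable_rat => b.
by apply: bigcupT_measurable => k; case: ifP.
Qed.

Lemma continuous_plane_measurable (f : R * R -> R) : continuous f -> mfun P f.
Proof.
move=> cf; apply: (@measurability _ _ P (mline R) setT f _ (RGenOInfty.measurableE R)) => _ [_ [c ->] <-].
rewrite setTI; apply: open_plane_measurable.
by apply: open_comp => [x _|]; [exact: cf|exact: interval_open].
Qed.

End plane_measurability.

Section polar.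
Context {R : realType}.
Notation leb := (@lebesgue_measure R).
Notation P := (mplane R).

(* [rho x] is the area of the disc of radius [|x|], divided by [4 pi]. *)
Definition rho (x : R * R) : R := (x.1 ^+ 2 + x.2 ^+ 2) / 4.

Lemma measurable_rho : mfun P (rho : P -> R).
Proof. by apply: measurable_funM => //; apply: measurable_funD; apply: measurable_funX. Qed.

(** Vertical slices have length [2 sqrt (4 a - t^2)]; symmetry and the dilation by [r = 2 sqrt a]
    reduce their integral to the quarter disc. *)
Lemma disc_area (a : R) : 0 <= a -> leb2 R [set x | rho x <= a] = (4 * pi * a)%:E.
Proof.
move=> a0; pose f t : R := 2 * Num.sqrt (4 * a - t ^+ 2); pose quarter (t : R) := Num.sqrt (1 - t ^+ 2).
have f0 t : 0 <= f t by rewrite mulr_ge0.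
have cf : continuous f.
 move=> t; apply: cvgMl_tmp.
 apply: (@cvg_comp _ _ _ (fun t : R => 4 * a - t ^+ 2) (@Num.sqrt R)); last exact: sqrt_continuous.
 by apply: cvgB; [exact: cvg_cst|exact: exprn_continuous].
have slice t : leb (xsection [set x : P | rho x <= a] t) = (f t)%:E.
 have [ta|ta] := leP (t ^+ 2) (4 * a).
  have ta' : 0 <= 4 * a - t ^+ 2 by lra.
  have -> : xsection [set x : P | rho x <= a] t = `[- Num.sqrt (4 * a - t ^+ 2), Num.sqrt (4 * a - t ^+ 2)]%classic.
   apply/seteqP; split => y; rewrite /xsection/= inE/= in_itv/= -ler_norml /rho/= => h.
    by rewrite -sqrtr_sqr; apply: ler_wsqrtr; lra.
   have : `|y| ^+ 2 <= Num.sqrt (4 * a - t ^+ 2) ^+ 2 by rewrite lerXn2r ?nnegrE.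
   by rewrite sqr_sqrtr// real_normK ?num_real//; lra.
  have h : - Num.sqrt (4 * a - t ^+ 2) <= Num.sqrt (4 * a - t ^+ 2) by have := sqrtr_ge0 (4 * a - t ^+ 2); lra.
  by rewrite [LHS](leb_itvcc h) /f; congr (_%:E); ring.
 have -> : xsection [set x : P | rho x <= a] t = set0.
  by apply/seteqP; split => y //; rewrite /xsection/= inE/= /rho/=; have := sqr_ge0 y; lra.
 by rewrite measure0 /f ler0_sqrtr ?mulr0//; lra.
have -> : leb2 R [set x | rho x <= a] = (\int[leb]_t (f t)%:E)%E.
 by apply: eq_integral => t _; exact: slice.
rewrite (ge0_symfun_integralT f0 cf); last by move=> t; rewrite /= /f sqrrN.
rewrite -set_itvcy.
have [a_0|an] := eqVneq a 0.
 rewrite integral0_eq ?mule0 ?a_0 ?mulr0// => t _.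
 by rewrite /f a_0 mulr0 sub0r ler0_sqrtr ?mulr0// oppr_le0 sqr_ge0.
have ap : 0 < a by rewrite lt0r an.
pose r := 2 * Num.sqrt a; have r0 : 0 < r by rewrite mulr_gt0// sqrtr_gt0.
have r2 : r ^+ 2 = 4 * a by rewrite exprMn sqr_sqrtr//; ring.
have mf : mfun R f by exact: continuous_measurable_fun.
have mq : mfun R quarter by apply: continuous_measurable_fun; exact: continuous_quarter.
have -> : (\int[leb]_(t in `[0%R, +oo[) (f t)%:E = \int[leb]_(t in `]0%R, +oo[) (f t)%:E)%E.
 by rewrite integral_itv_obnd_cbnd//; apply/measurable_EFinP/measurable_funTS.
have fE t : f t = 2 * r * quarter (t / r).
 have rn : Num.sqrt (r ^+ 2) = r by rewrite sqrtr_sqr ger0_norm// ltW.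
 rewrite /f /quarter -mulrA -[X in _ = 2 * (X * _)]rn -sqrtrM ?sqr_ge0//.
 by congr (2 * Num.sqrt _); rewrite -r2; field; rewrite gt_eqF.
under eq_integral do rewrite fE EFinM.
have q0 x : 0 <= quarter x by exact: sqrtr_ge0.
rewrite ge0_integralZl//; last 3 first.
- apply/measurable_EFinP/measurable_funTS; apply: measurableT_comp => //; exact: measurable_funM.
- by move=> x _; rewrite lee_fin.
- by rewrite lee_fin mulr_ge0// ltW.
have -> : (\int[leb]_(x in `]0%R, +oo[) (quarter (x / r))%:E = r%:E * \int[leb]_(x in `]0%R, +oo[) (quarter x)%:E)%E.
 by apply: integral_scale => // x _.
have -> : (\int[leb]_(x in `]0%R, +oo[) (quarter x)%:E = (pi / 4)%:E)%E.
 rewrite (integral_splitoy ler01 mq (fun x _ => q0 x)) (_ : \int[leb]_(x in `]1%R, +oo[) _ = 0)%E.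
  rewrite adde0 integral_itv_obnd_cbnd; last by apply/measurable_EFinP/measurable_funTS.
  exact: integral_quarter.
 apply: integral0_eq => x /=; rewrite in_itv/= andbT => x1; rewrite /quarter ler0_sqrtr// subr_le0.
 exact: exprn_ege1 (ltW x1).
rewrite -!EFinM; congr (_%:E); have -> : 2 * (2 * r * (r * (pi / 4))) = r ^+ 2 * pi by field.
by rewrite r2; ring.
Qed.

(** By [disc_area] the image of planar measure under [rho] is [4 pi] times Lebesgue measure on the
    positive half-line. *)
Lemma polar (f : R -> R) : mfun R f -> (forall x, 0 < x -> 0 <= f x) ->
 (forall x, x <= 0 -> f x = 0) ->
 (\int[leb2 R]_x (f (rho x))%:E = (4 * pi)%:E * \int[leb]_(x in `]0%R, +oo[) (f x)%:E)%E.
Proof.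
move=> mf f0 fz; have pi4 : 0 < 4 * pi :> R by rewrite mulr_gt0// pi_gt0.
have mle (a : R) : measurable ([set x | rho x <= a] : set P).
 rewrite [X in measurable X](_ : _ = (rho : P -> mline R) @^-1` `]-oo, a]%classic).
  by rewrite -[X in measurable X]setTI; apply: measurable_rho => //; exact: measurable_itv.
 by apply/seteqP; split => x; rewrite /= in_itv.
have disc a : 0 <= a -> (leb2 R) ((rho : P -> mline R) @^-1` `]0%R, a]%classic) = (4 * pi * a)%:E.
 move=> a0; have d : (leb2 R) ([set x | (rho x <= a)%R] : set P) = ((leb2 R) ([set x | (rho x <= 0)%R] : set P) + (leb2 R) ((rho : P -> mline R) @^-1` `]0%R, a]%classic))%E.
  rewrite -(@measureU _ R P (@area R)).
  - congr (leb2 R _); apply/seteqP; split => x /=; rewrite in_itv/=.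
    by move=> xa; case: (leP (rho x) 0) => h; [left|right].
   by move=> [h|/andP[_ h]] //; exact: le_trans a0.
  - exact: mle.
  - by rewrite -[X in measurable X]setTI; apply: measurable_rho => //; exact: measurable_itv.
  - by apply/seteqP; split => x //= []; rewrite in_itv/= => h1 /andP[h2 _]; move: h2; rewrite ltNge h1.
 by move: d; rewrite !disc_area// mulr0 add0e.
have := @pushforward_scaled R _ P (@area R) (rho : P -> mline R) (4 * pi) pi4 measurable_rho disc f mf f0.
move=> <-; rewrite [RHS]integral_mkcond; apply: eq_integral => x _; rewrite patchE.
case: ifPn => // /negP h; rewrite fz//; rewrite leNgt; apply/negP => h'; apply: h.
by rewrite inE/= in_itv/= h'.
Qed.

End polar.

(** * Weak derivatives from slices *)

Section slices.
Context {R : realType}.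
Notation leb := (@lebesgue_measure R).
Notation P := (mplane R).

Lemma pair_left_continuous (z : R) : continuous (fun s : R => (s, z)).
Proof.
move=> s; apply/cvgrPdist_lt => e e0.
have ids : t @[t --> s] --> s by exact: cvg_id.
apply: filterS ((cvgrPdist_lt _ _).1 ids e e0) => t h.
by rewrite (_ : `|_| = Num.max `|s - t| `|z - z|)// subrr normr0 gt_max h.
Qed.

Lemma pair_right_continuous (z : R) : continuous (fun s : R => (z, s)).
Proof.
move=> s; apply/cvgrPdist_lt => e e0.
have ids : t @[t --> s] --> s by exact: cvg_id.
apply: filterS ((cvgrPdist_lt _ _).1 ids e e0) => t h.
by rewrite (_ : `|_| = Num.max `|z - z| `|s - t|)// subrr normr0 gt_max h andbT.
Qed.

Lemma test_function_support (phi : P -> R) : test_function phi -> exists K : set (R * R),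
 [/\ compact K, closed K & forall x, ~ K x -> \forall y \near (x : R * R), phi y = 0].
Proof.
move=> [_ cK]; exists (closure [set x : R * R | phi x != 0]); split => //; first exact: closed_closure.
move=> x nKx; have oK : open (~` closure [set x : R * R | phi x != 0]) by apply: closed_openC; exact: closed_closure.
have := open_nbhs_nbhs (conj oK nKx); apply: filterS => y nKy.
by apply/eqP/negPn/negP => py; apply: nKy; exact: subset_closure.
Qed.

Lemma bounded_off_compact (K : set (R * R)) (f : R * R -> R) : compact K -> continuous f ->
 (forall x, ~ K x -> f x = 0) -> exists2 M, 0 <= M & forall x, `|f x| <= M.
Proof.
move=> cK cf f0.
have : compact (f @` K) by apply: continuous_compact => //; exact: continuous_subspaceT.
move=> /compact_bounded [M [_ MP]]; exists (`|M| + 1); first by rewrite addr_ge0.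
move=> x; have [Kx|nKx] := pselect (K x); last by rewrite f0// normr0 addr_ge0.
by apply: MP; [by have := ler_norm M; lra|exists x].
Qed.

Lemma slice_integral_zero (v dv p dp : R -> R) (L : R) : 0 < L ->
 (forall s : R, is_derive s 1 v (dv s)) -> continuous dv ->
 (forall s : R, is_derive s 1 p (dp s)) -> continuous dp ->
 (forall s, L <= `|s| -> p s = 0) -> (forall s, L <= `|s| -> dp s = 0) ->
 (\int[leb]_s (v s * dp s + dv s * p s)%:E = 0)%E.
Proof.
move=> L0 dv_ cdv dp_ cdp p0 dp0.
have cv : continuous v by move=> s; exact: is_derive_continuous (dv_ s).
have cp : continuous p by move=> s; exact: is_derive_continuous (dp_ s).
have LL : - L <= L by lra.
have d (s : R) : is_derive s 1 (v * p) (v s * dp s + dv s * p s).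
 have -> : v s * dp s + dv s * p s = v s *: dp s + p s *: dv s by rewrite /GRing.scale/= [p s * _]mulrC.
 exact: is_deriveM.
have -> : (\int[leb]_s (v s * dp s + dv s * p s)%:E = \int[leb]_(s in `[(- L)%R, L]) (v s * dp s + dv s * p s)%:E)%E.
 rewrite [RHS]integral_mkcond; apply: eq_integral => s _; rewrite patchE; case: ifPn => // /negP sL.
 have Ls : L <= `|s|.
  rewrite leNgt; apply/negP => h; apply: sL; rewrite inE/= in_itv/= -ler_norml; exact: ltW.
 by rewrite p0// dp0// !mulr0 addr0.
have H := @FTC2_is_derive R (fun s => v s * dp s + dv s * p s) (v * p) (- L) L LL (fun s _ => d s).
rewrite H; first by rewrite /= !(mulrfctE) !p0 ?normrN ?gtr0_norm// !mulr0 subrr.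
by move=> s _; apply: cvgD; apply: cvgM; [exact: cv|exact: cdp|exact: cdv|exact: cp].
Qed.

Lemma integral_zero_off0 (G : R -> \bar R) : mfun R G ->
 (forall z, z != 0 -> G z = 0%E) -> (\int[leb]_z G z = 0)%E.
Proof.
move=> mG G0; rewrite -[RHS](integral0 leb [set: mline R]).
apply: (@ae_eq_integral _ (mline R) R leb setT (cst 0%E) G) => //.
exists [set (0 : R)]; split; [exact: measurable_set1|exact: lebesgue_measure_set1|].
move=> z /= h; apply/eqP/negPn/negP => zn; apply: h => _; exact: G0.
Qed.

Section direction.
Variables (u w : P -> R) (phi : P -> R).
Hypotheses (uL : u \in Lfun (leb2 R) 2%:E) (wL : w \in Lfun (leb2 R) 2%:E).
Hypothesis tphi : test_function phi.

Let cphi : continuous (phi : R * R -> R). Proof. by case: tphi => /(_ 0%N). Qed.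
Let Ck1 : Ck 1 phi. Proof. by case: tphi => /(_ 1%N). Qed.

Lemma test_function_bounds (v : R * R) : continuous ('D_v phi : R * R -> R) ->
 exists L M, [/\ 0 < L, forall x, L <= `|x.1| \/ L <= `|x.2| -> phi x = 0 /\ 'D_v phi x = 0,
  forall x, `|phi x| <= M * \1_(box (- L) L (- L) L) x &
  forall x, `|'D_v phi x| <= M * \1_(box (- L) L (- L) L) x].
Proof.
move=> cD; have [K [cK clK K0]] := test_function_support tphi.
have phi0 x : ~ K x -> phi x = 0 by move=> /K0 h; exact: (nbhs_singleton h).
have D0 x : ~ K x -> 'D_v phi x = 0.
 by move=> /K0 h0; rewrite (@near_eq_derive _ _ _ _ (cst 0))// derive_cst.
have [M1 M10 B1] := bounded_off_compact cK cphi phi0.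
have [M2 M20 B2] := bounded_off_compact cK cD D0.
have [N [_ NP]] := compact_bounded cK.
pose L := `|N| + 2; have L0 : 0 < L by rewrite /L; have := normr_ge0 N; lra.
have KL x : L <= `|x.1| \/ L <= `|x.2| -> ~ K x.
 have N1 : N < `|N| + 1 by have := ler_norm N; lra.
 move=> h Kx; have := NP _ N1 x Kx; rewrite /= /L => h2.
 have : `|x.1| <= `|x| /\ `|x.2| <= `|x| by rewrite (_ : `|x| = Num.max `|x.1| `|x.2|)// !le_max !lexx orbT.
 by case: h => h [h3 h4]; move: h h2 h3 h4; rewrite /L; lra.
exists L, (M1 + M2); split => //.
- by move=> x /KL nK; rewrite phi0// D0.
- move=> x; rewrite indicE; case: (boolP (x \in _)) => [_|/negP nb]; first by rewrite mulr1; have := B1 x; lra.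
 rewrite phi0 ?normr0 ?mulr0//; apply: KL; rewrite !leNgt.
 apply/orP; rewrite -negb_and; apply/negP => /andP[a b]; apply: nb.
 by apply/mem_set; split => /=; rewrite in_itv/= -ltr_norml.
- move=> x; rewrite indicE; case: (boolP (x \in _)) => [_|/negP nb]; first by rewrite mulr1; have := B2 x; lra.
 rewrite D0 ?normr0 ?mulr0//; apply: KL; rewrite !leNgt.
 apply/orP; rewrite -negb_and; apply/negP => /andP[a b]; apply: nb.
 by apply/mem_set; split => /=; rewrite in_itv/= -ltr_norml.
Qed.

Let box_fin L : 0 < L -> (leb2 R (box (- L) L (- L) L) < +oo)%E.
Proof. by move=> L0; rewrite leb2_box ?ltry//; lra. Qed.

Let conclude v L M : 0 < L -> continuous ('D_v phi : R * R -> R) ->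
 (forall x, `|phi x| <= M * \1_(box (- L) L (- L) L) x) ->
 (forall x, `|'D_v phi x| <= M * \1_(box (- L) L (- L) L) x) ->
 ((leb2 R).-integrable [set: P] (fun x => (u x * 'D_v phi x + w x * phi x)%:E)) /\
 ((\int[leb2 R]_x (u x * 'D_v phi x + w x * phi x)%:E = 0)%E ->
  (\int[leb2 R]_x (u x * 'D_v phi x)%:E = - \int[leb2 R]_x (w x * phi x)%:E)%E).
Proof.
move=> L0 cD b1 b2.
have mb := @measurable_box R (- L) L (- L) L.
have i1 := Lfun2_integrable_bounded uL (continuous_plane_measurable cD) mb (box_fin L0) b2.
have i2 := Lfun2_integrable_bounded wL (continuous_plane_measurable cphi) mb (box_fin L0) b1.
have E : (fun x => (u x * 'D_v phi x + w x * phi x)%:E) = (fun x => (u x * 'D_v phi x)%:E) \+ (fun x => (w x * phi x)%:E).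
 by apply/funext => x; rewrite EFinD.
split; first by rewrite E; exact: integrableD.
rewrite E (@integralD _ _ _ (leb2 R) _ measurableT _ _ i1 i2).
have := integrable_fin_num measurableT i1; have := integrable_fin_num measurableT i2.
case: (\int[leb2 R]_x (u x * 'D_v phi x)%:E)%E => [a| |]//.
case: (\int[leb2 R]_x (w x * phi x)%:E)%E => [b| |]// _ _ [ab].
by rewrite -EFinN; congr (_%:E); lra.
Qed.

(** Fubini along horizontal lines: on each of them the integrand is the derivative of a product with
    compact support. The line through the origin, where a radial function may be singular, is
    negligible. *)
Lemma weak_partial_fst_slices :
 (forall z : R, z != 0 -> forall s : R, is_derive s 1 (fun s => u (s, z)) (w (s, z))) ->
 (forall z : R, z != 0 -> continuous (fun s => w (s, z))) ->
 (\int[leb2 R]_x (u x * 'D_(1, 0) phi x)%:E = - \int[leb2 R]_x (w x * phi x)%:E)%E.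
Proof.
move=> du ch; case: (Ck1) => d1 _ cD _.
have [L [M [L0 z0 b1 b2]]] := test_function_bounds cD.
have [i C] := conclude L0 cD b1 b2; apply: C.
rewrite -(@integral21_prod_meas1 _ _ (mline R) (mline R) R leb leb _ i).
apply: integral_zero_off0; first exact: (@measurable_fubini_G _ _ (mline R) (mline R) R leb leb _ i).
move=> z zn; rewrite /fubini_G/=.
have dphi (s : R) : is_derive s 1 (fun s => phi (s, z)) ('D_(1, 0) phi (s, z)).
 by rewrite derive_fst; apply: DeriveDef => //; exact: (derivable_fst phi (s, z)).1 (d1 _).
have cpair : continuous (fun s : R => (s, z)).
 exact: pair_left_continuous.
apply: (slice_integral_zero L0 (du z zn) (ch z zn) dphi).
- by move=> s; apply: (@continuous_comp _ _ _ (fun s : R => (s, z)) ('D_(1, 0) phi)); [exact: cpair|exact: cD].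
- by move=> s Ls; exact: (z0 (s, z) (or_introl Ls)).1.
- by move=> s Ls; exact: (z0 (s, z) (or_introl Ls)).2.
Qed.

Lemma weak_partial_snd_slices :
 (forall z : R, z != 0 -> forall s : R, is_derive s 1 (fun s => u (z, s)) (w (z, s))) ->
 (forall z : R, z != 0 -> continuous (fun s => w (z, s))) ->
 (\int[leb2 R]_x (u x * 'D_(0, 1) phi x)%:E = - \int[leb2 R]_x (w x * phi x)%:E)%E.
Proof.
move=> du ch; case: (Ck1) => _ d1 _ cD.
have [L [M [L0 z0 b1 b2]]] := test_function_bounds cD.
have [i C] := conclude L0 cD b1 b2; apply: C.
rewrite -(@integral12_prod_meas1 _ _ (mline R) (mline R) R leb leb _ i).
apply: integral_zero_off0; first exact: (@measurable_fubini_F _ _ (mline R) (mline R) R leb leb _ i).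
move=> z zn; rewrite /fubini_F/=.
have dphi (s : R) : is_derive s 1 (fun s => phi (z, s)) ('D_(0, 1) phi (z, s)).
 by rewrite derive_snd; apply: DeriveDef => //; exact: (derivable_snd phi (z, s)).1 (d1 _).
have cpair : continuous (fun s : R => (z, s)).
 exact: pair_right_continuous.
apply: (slice_integral_zero L0 (du z zn) (ch z zn) dphi).
- by move=> s; apply: (@continuous_comp _ _ _ (fun s : R => (z, s)) ('D_(0, 1) phi)); [exact: cpair|exact: cD].
- by move=> s Ls; exact: (z0 (z, s) (or_intror Ls)).1.
- by move=> s Ls; exact: (z0 (z, s) (or_intror Ls)).2.
Qed.

End direction.
End slices.

(** * Radial functions in H^1 *)

Section radial.
Context {R : realType}.
Notation leb := (@lebesgue_measure R).
Notation P := (mplane R).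

Definition radial (Y : R -> R) (x : P) : R := Y (rho x).

(** [q] stands for minus the derivative of the profile, and [rho] has gradient [x / 2]. *)
Definition radial_gradient (q : R -> R) (x : P) : plane R := (- q (rho x) * (x.1 / 2), - q (rho x) * (x.2 / 2)).

Lemma radial_gradient_sqr q x :
 (radial_gradient q x).1 ^+ 2 + (radial_gradient q x).2 ^+ 2 = rho x * q (rho x) ^+ 2.
Proof. by rewrite /radial_gradient /rho /=; field. Qed.

Lemma measurable_radial (Y : R -> R) : mfun R Y -> mfun P (radial Y).
Proof. by move=> mY; apply: measurableT_comp => //; exact: measurable_rho. Qed.

Lemma Lfun2_of_sqr (f : P -> R) : mfun P f ->
 (\int[leb2 R]_x (f x ^+ 2)%:E < +oo)%E -> f \in Lfun (leb2 R) 2%:E.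
Proof.
move=> mf foo; rewrite inE; apply/andP; split; rewrite inE//=.
rewrite /finite_norm unlock; apply: poweR_lty; apply: le_lt_trans foo; apply: le_of_eq.
by apply: eq_integral => x _; rewrite /= powR_mulrn// real_normK ?num_real.
Qed.

Section radial_H1.
Variables Y q : R -> R.
Hypotheses (mY : mfun R Y) (mq : mfun R q).
Hypotheses (Y0 : forall s, s <= 0 -> Y s = 0) (q0 : forall s, s <= 0 -> q s = 0).

Lemma integral_radial_sqr :
 (\int[leb2 R]_x (radial Y x ^+ 2)%:E = (4 * pi)%:E * \int[leb]_(s in `]0%R, +oo[) (Y s ^+ 2)%:E)%E.
Proof.
apply: (@polar R (fun s => Y s ^+ 2)).
- exact: measurable_funX.
- by move=> s _; exact: sqr_ge0.
- by move=> s /Y0 ->; rewrite expr0n.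
Qed.

Lemma integral_radial_gradient :
 (\int[leb2 R]_x ((radial_gradient q x).1 ^+ 2 + (radial_gradient q x).2 ^+ 2)%:E =
  (4 * pi)%:E * \int[leb]_(s in `]0%R, +oo[) (s * q s ^+ 2)%:E)%E.
Proof.
under eq_integral do rewrite radial_gradient_sqr.
apply: (@polar R (fun s => s * q s ^+ 2)).
- by apply: measurable_funM => //; exact: measurable_funX.
- by move=> s s0; rewrite mulr_ge0 ?sqr_ge0// ltW.
- by move=> s /q0 ->; rewrite expr0n mulr0.
Qed.

Hypothesis Yfin : (\int[leb]_(s in `]0%R, +oo[) (Y s ^+ 2)%:E < +oo)%E.
Hypothesis qfin : (\int[leb]_(s in `]0%R, +oo[) (s * q s ^+ 2)%:E < +oo)%E.

Let mg1 : mfun P (fst \o radial_gradient q).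
Proof.
rewrite (_ : fst \o _ = fun x : P => - q (rho x) * (x.1 / 2))//.
apply: measurable_funM; last exact: measurable_funM.
by apply: measurableT_comp => //; apply: measurableT_comp => //; exact: measurable_rho.
Qed.

Let mg2 : mfun P (snd \o radial_gradient q).
Proof.
rewrite (_ : snd \o _ = fun x : P => - q (rho x) * (x.2 / 2))//.
apply: measurable_funM; last exact: measurable_funM.
by apply: measurableT_comp => //; apply: measurableT_comp => //; exact: measurable_rho.
Qed.

Lemma radial_Lfun2 : radial Y \in Lfun (leb2 R) 2%:E.
Proof.
apply: Lfun2_of_sqr; first exact: measurable_radial.
by rewrite integral_radial_sqr lte_mul_pinfty// lee_fin mulr_ge0// pi_ge0.
Qed.

Lemma radial_gradient_Lfun2 : (fst \o radial_gradient q) \in Lfun (leb2 R) 2%:E /\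
 (snd \o radial_gradient q) \in Lfun (leb2 R) 2%:E.
Proof.
have fin : (\int[leb2 R]_x ((radial_gradient q x).1 ^+ 2 + (radial_gradient q x).2 ^+ 2)%:E < +oo)%E.
 by rewrite integral_radial_gradient lte_mul_pinfty// lee_fin mulr_ge0// pi_ge0.
have mS : mfun P (fun x => ((radial_gradient q x).1 ^+ 2 + (radial_gradient q x).2 ^+ 2)%:E).
 by apply/measurable_EFinP; apply: measurable_funD; exact: measurable_funX.
split; apply: Lfun2_of_sqr => //; apply: le_lt_trans fin; apply: ge0_le_integral => //;
 try (by apply/measurable_EFinP; exact: measurable_funX);
 by move=> x _; rewrite lee_fin ?addr_ge0 ?sqr_ge0//= ?lerDl ?lerDr sqr_ge0.
Qed.

Hypothesis dY : forall s : R, 0 < s -> is_derive s 1 Y (- q s).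
Hypothesis cq : forall s : R, 0 < s -> {for s, continuous q}.

Let rho_pos (s z : R) : z != 0 -> 0 < (s ^+ 2 + z ^+ 2) / 4.
Proof.
by move=> z0; rewrite divr_gt0// ltr_wpDl ?sqr_ge0// lt0r sqr_ge0 sqrf_eq0 z0.
Qed.

Let slice_derive (s z : R) : z != 0 ->
 is_derive s 1 (fun s => Y ((s ^+ 2 + z ^+ 2) / 4)) (- q ((s ^+ 2 + z ^+ 2) / 4) * (s / 2)).
Proof.
move=> z0; have dr : is_derive s 1 (fun s : R => (s ^+ 2 + z ^+ 2) / 4) (s / 2).
 by apply: is_derive_eq; rewrite /GRing.scale/=; field.
have := @is_derive1_comp R Y (fun s : R => (s ^+ 2 + z ^+ 2) / 4) s _ _ (dY (rho_pos s z0)) dr.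
by rewrite mulrC.
Qed.

Let slice_continuous (z : R) : z != 0 -> continuous (fun s : R => - q ((s ^+ 2 + z ^+ 2) / 4) * (s / 2)).
Proof.
move=> z0 s; apply: cvgM; last by apply: cvgMr_tmp.
apply: cvgN; apply: (@continuous_comp _ _ _ (fun s : R => (s ^+ 2 + z ^+ 2) / 4) q); last exact/cq/rho_pos.
by apply: cvgMr_tmp; apply: cvgD; [exact: exprn_continuous|exact: cvg_cst].
Qed.

Lemma radial_H1 : H1_grad (radial Y) (radial_gradient q).
Proof.
have [g1 g2] := radial_gradient_Lfun2; have uL := radial_Lfun2.
split => // phi tphi.
 apply: (@weak_partial_fst_slices R (radial Y) (fst \o radial_gradient q) phi uL g1 tphi) => z z0.
  by move=> s; exact: slice_derive.
 exact: slice_continuous.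
apply: (@weak_partial_snd_slices R (radial Y) (snd \o radial_gradient q) phi uL g2 tphi) => z z0.
 move=> s; have := slice_derive s z0; rewrite /radial/= /radial_gradient /rho/= [z ^+ 2 + _]addrC.
 by under [X in is_derive _ _ X _ -> _]eq_fun do rewrite addrC.
have := slice_continuous z0; rewrite /radial_gradient /rho/=.
by under [X in continuous X -> _]eq_fun do rewrite addrC.
Qed.

End radial_H1.
End radial.

(** * Smoothing of profiles *)

Section antiderivative.
Context {R : realType}.
Notation leb := (@lebesgue_measure R).

(** The integrals from [- n], normalised to vanish at 0, agree for all large [n] and glue to one
    primitive; [n0 x] is a sufficient [n] at [x]. *)
Lemma continuous_antiderivative (f : R -> R) : continuous f ->
 exists F : R -> R, forall t : R, is_derive t 1 F (f t).
Proof.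
move=> cf.
have int (a b : R) : leb.-integrable `[a, b] (EFin \o f).
 by apply: continuous_compact_integrable; [exact: segment_compact|exact: continuous_subspaceT].
pose G (n : nat) (x : R) : R := \int[leb]_(t in `[(- n%:R)%R, x]) f t.
have shift (n m : nat) (x y : R) : (n <= m)%N -> - n%:R <= x -> - n%:R <= y -> G m x - G m y = G n x - G n y.
 move=> nm nx ny.
 have split z : - n%:R <= z -> G m z = \int[leb]_(t in `[(- m%:R)%R, (- n%:R)%R[) f t + G n z.
  move=> nz; rewrite /G -Rintegral_setU//=.
  - congr (Rintegral _ _ _); rewrite -itv_bndbnd_setU// bnd_simp ?lerN2 ?ler_nat//.
  - rewrite -itv_bndbnd_setU// ?bnd_simp ?lerN2 ?ler_nat//; exact: int.
  - apply/disj_set2P/seteqP; split => t //= []; rewrite !in_itv/= => /andP[_ h1] /andP[h2 _].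
   by move: h1; rewrite ltNge h2.
 by rewrite (split x)// (split y)//; ring.
pose n0 (x : R) := (Num.truncn `|x|).+1.
have n0P (x : R) (m : nat) : (n0 x <= m)%N -> - m%:R <= x.
 move=> h; have := truncnS_gt `|x|; have : (n0 x)%:R <= m%:R :> R by rewrite ler_nat.
 by rewrite /n0; have := ler_norm (- x); rewrite normrN; lra.
exists (fun x => G (n0 x) x - G (n0 x) 0) => t.
have [m mE] : exists m, m = (n0 t).+2 by exists (n0 t).+2.
have tm : - m%:R < t.
 by have := n0P t (n0 t) (leqnn _); rewrite mE -natr1 -natr1; lra.
have cm : {for t, continuous f} by exact: cf.
have tt1 : t < t + 1 by lra.
have := @continuous_FTC1_closed R f (- m%:R) t (t + 1) tt1 (int _ _) tm cm.
move=> /= [dG eG].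
have dGm : is_derive t 1 (G m) (f t) by apply: (DeriveDef (f := G m) dG); rewrite -derive1E.
have dGm' : is_derive t 1 (fun x => G m x - G m 0) (f t).
 have := is_deriveB dGm (is_derive_cst (G m 0) t 1); by rewrite subr0.
apply: near_eq_is_derive dGm'.
have b1 : 0 < 1 :> R by [].
apply: filterS ((cvgrPdist_lt _ _).1 (@cvg_id _ (nbhs t)) 1 b1) => x tx.
have xm : (n0 x <= m)%N.
 have h1 : (n0 x <= (Num.truncn (`|t| + 1)).+1)%N.
  by apply: le_truncn; have := ler_distD t x 0; rewrite !subr0 distrC; lra.
 have h2 : (Num.truncn (`|t| + 1) < (Num.truncn `|t|).+2)%N.
  rewrite -(@ltr_nat R); apply: le_lt_trans (_ : `|t| + 1 < _); first by rewrite truncn_le addr_ge0.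
  by have := truncnS_gt `|t|; rewrite -[ltRHS]natr1; lra.
 by rewrite mE; apply: leq_trans h1 (leq_trans h2 (leqnSn _)).
by apply: shift => //; exact: n0P.
Qed.

End antiderivative.

Section averaging.
Context {R : realType}.
Variables (X : R -> R) (E B : R).
Hypothesis adm : admissible X E B.

Let psi t := X (expR (- t)).
Let mX : mfun R X. Proof. by case: adm. Qed.
Let X0 s : 0 <= X s. Proof. by case: adm. Qed.
Let Xle s1 s2 : 0 < s1 -> s1 <= s2 -> X s2 <= X s1. Proof. by case: adm => _ _ + _ _; apply. Qed.
Let E0 : 0 <= E. Proof. by case: adm => _ _ _ _ []. Qed.

Lemma psi_continuous : continuous (fun t : R => X (expR (- t))).
Proof.
move=> t; apply/cvgrPdist_lt => e e0.
have e2 : 0 < e ^+ 2 by rewrite exprn_gt0.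
have idt : y @[y --> t] --> t by exact: cvg_id.
apply: filterS ((cvgrPdist_lt _ _).1 idt _ e2) => y ty.
rewrite -(@ltr_pXn2r _ 2)// ?nnegrE ?ltW// real_normK ?num_real//.
apply: le_lt_trans ty.
have E1 := admissible_E_le1 adm.
case: (leP t y) => [le|/ltW le].
 rewrite -sqrrN opprB; apply: le_trans (psi_holder adm le) _.
 by rewrite distrC ger0_norm ?subr_ge0// ler_piMr// subr_ge0.
apply: le_trans (psi_holder adm le) _.
by rewrite ger0_norm ?subr_ge0// ler_piMr// subr_ge0.
Qed.

Lemma profile_continuous (s : R) : 0 < s -> {for s, continuous X}.
Proof.
move=> s0; have H : {for s, continuous (fun s => psi (- ln s))}.
 apply: (@continuous_comp _ _ _ (fun s : R => - ln s) psi); last exact: psi_continuous.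
 by apply: cvgN; exact: continuous_ln.
rewrite /prop_for/continuous_at in H *.
have eq s' : 0 < s' -> psi (- ln s') = X s' by move=> h; rewrite /psi opprK lnK.
rewrite -(eq s s0); apply: cvg_trans H; apply: near_eq_cvg.
have ids : y @[y --> s] --> s by exact: cvg_id.
by apply: filterS (cvgr_gt s ids 0 s0) => y y0; rewrite eq.
Qed.

Variable D : R.
Hypothesis D0 : 0 < D.
Let r := expR (- D).
Let r0 : 0 < r. Proof. exact: expR_gt0. Qed.

(** Minus the derivative in [s] of the mean of [X] over a step [D] in [t = - ln s]: a difference
    quotient in [t] divided by [s]. *)
Definition slope s : R := (X (r * s) - X s) / D * power_fun 0 s.

Lemma power_fun0 (s : R) : 0 < s -> power_fun 0 s = s^-1.
Proof. by move=> s0; rewrite /power_fun s0 sub0r mulN1r expRN lnK. Qed.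

Lemma measurable_slope : mfun R slope.
Proof.
apply: measurable_funM; last exact: measurable_power_fun.
apply: measurable_funM => //; apply: measurable_funB => //.
by apply: measurableT_comp => //; exact: measurable_funM.
Qed.

Lemma slope_neg (s : R) : s <= 0 -> slope s = 0.
Proof. by move=> s0; rewrite /slope /power_fun ltNge s0 mulr0. Qed.

Lemma slope_continuous (s : R) : 0 < s -> {for s, continuous slope}.
Proof.
move=> s0.
have c1 : {for s, continuous (fun s => X (r * s))}.
 apply: (@continuous_comp _ _ _ (fun s : R => r * s) X); first by apply: cvgMl_tmp; exact: cvg_id.
 by apply: profile_continuous; rewrite mulr_gt0.
have H : {for s, continuous (fun s => (X (r * s) - X s) / D * s^-1)}.
 apply: cvgM; last by apply: cvgV; [rewrite gt_eqF|exact: cvg_id].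
 by apply: cvgMr_tmp; apply: cvgB; [exact: c1|exact: profile_continuous].
rewrite /prop_for/continuous_at in H *.
rewrite {2}/slope power_fun0//; apply: cvg_trans H; apply: near_eq_cvg.
have ids : y @[y --> s] --> s by exact: cvg_id.
by apply: filterS (cvgr_gt s ids 0 s0) => y y0; rewrite /slope power_fun0.
Qed.

(** [Y] is the mean of [psi] over [[t, t + D]]. Monotonicity encloses it between the two end values,
    which will control its distance to [X]. *)
Lemma average : exists Y : R -> R, [/\ mfun R Y,
 forall s, s <= 0 -> Y s = 0, forall s : R, 0 < s -> is_derive s 1 Y (- slope s) &
 forall s, 0 < s -> X s <= Y s <= X (r * s)].
Proof.
have [Phi dPhi] := continuous_antiderivative psi_continuous.
have cPhi : continuous Phi by move=> t; exact: is_derive_continuous (dPhi t).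
pose A t := (Phi (t + D) - Phi t) / D.
pose Y s : R := if 0 < s then A (- ln s) else 0.
have rs s : 0 < s -> expR (- (- ln s + D)) = r * s.
 by move=> s0; rewrite opprD opprK expRD lnK// mulrC.
have cA : continuous A.
 move=> t; apply: cvgMr_tmp; apply: cvgB; last exact: cPhi.
 apply: (@continuous_comp _ _ _ (fun t : R => t + D) Phi); last exact: cPhi.
 by apply: cvgD; [exact: cvg_id|exact: cvg_cst].
exists Y; split.
- apply: measurable_if_pos; apply: (@measurableT_comp _ _ _ _ _ _ A).
  exact: continuous_measurable_fun.
 by apply: measurableT_comp => //; exact: measurable_ln.
- by move=> s s0; rewrite /Y ltNge s0.
- move=> s s0.
 have dA (t : R) : is_derive t 1 A ((psi (t + D) - psi t) / D).
  have d1 : is_derive t 1 (fun t => Phi (t + D)) (psi (t + D)).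
   have dr : is_derive t 1 (fun t : R => t + D) 1.
    by have := is_deriveD (@is_derive_id R R t 1) (is_derive_cst D t 1); rewrite addr0.
   by have := @is_derive1_comp R Phi (fun t : R => t + D) t _ _ (dPhi (t + D)) dr; rewrite mulr1.
  have := is_deriveZ D^-1 (is_deriveB d1 (dPhi t)).
  rewrite /A /GRing.scale/= [D^-1 * _]mulrC.
  have -> // : (fun t0 => (Phi (t0 + D) - Phi t0) / D) = D^-1 \*: ((fun t0 => Phi (t0 + D)) - Phi).
  by apply/funext => y; rewrite /= mulrC.
 have dl : is_derive s 1 (fun s : R => - ln s) (- s^-1).
  by have := is_deriveN (is_derive1_ln s0).
 have := @is_derive1_comp R A (fun s : R => - ln s) s _ _ (dA (- ln s)) dl.
 have -> : (psi (- ln s + D) - psi (- ln s)) / D * - s^-1 = - slope s.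
  by rewrite /slope power_fun0// /psi rs// opprK lnK// mulrN.
 apply: near_eq_is_derive; have ids : y @[y --> s] --> s by exact: cvg_id.
 by apply: filterS (cvgr_gt s ids 0 s0) => y y0; rewrite /Y y0.
- move=> s s0; rewrite /Y s0 /A; set t := - ln s.
 have tD : t < t + D by rewrite ltrDl.
 have [c] := @MVT R Phi psi t (t + D) tD (fun x _ => dPhi x) (continuous_subspaceT cPhi).
 rewrite in_itv/= => /andP[tc cD] ->; rewrite addrAC subrr add0r mulfK ?gt_eqF//.
 have -> : X s = psi t by rewrite /psi /t opprK lnK.
 have -> : X (r * s) = psi (t + D) by rewrite /psi rs.
 by apply/andP; split; apply: (psi_mono adm); exact: ltW.
Qed.

End averaging.

Section slope_energy.
Context {R : realType}.
Notation leb := (@lebesgue_measure R).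

Lemma integral_subset_indic (A : set R) (f : R -> R) : A `<=` `]0%R, +oo[%classic ->
 (\int[leb]_(x in A) (f x)%:E = \int[leb]_(x in `]0%R, +oo[) (f x * \1_A x)%:E)%E.
Proof.
move=> AD; rewrite integral_mkcond [RHS]integral_mkcond; apply: eq_integral => x _.
rewrite !patchE indicE; case: (boolP (x \in A)) => xA; last by rewrite mulr0; case: ifP.
by rewrite mulr1 ifT//; apply/mem_set/AD/set_mem.
Qed.

Lemma improper_integral0y (f : R -> R) (C : R) : mfun R f -> (forall x, 0 <= f x) ->
 (forall b : R, (0 < b)%R -> \int[leb]_(x in `]0%R, b]) (f x)%:E <= C%:E)%E ->
 (\int[leb]_(x in `]0%R, +oo[) (f x)%:E <= C%:E)%E.
Proof.
move=> mf f0 fC; have mfD D : measurable_fun D (fun x => (f x)%:E).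
 by exact/measurable_EFinP/measurable_funTS.
have nd : {homo (fun n : nat => `]0, n.+1%:R]%classic : set R) : n m / (n <= m)%N >-> (n <= m)%O}.
 move=> m n mn; apply/subsetPset => x /=; rewrite !in_itv/= => /andP[-> h].
 by rewrite (le_trans h)// ler_nat ltnS.
have U : \bigcup_n (`]0, n.+1%:R]%classic : set R) = `]0%R, +oo[%classic.
 apply/seteqP; split => x /=.
  by move=> [n _] /=; rewrite !in_itv/= => /andP[-> _].
 rewrite in_itv/= andbT => x0; exists (Num.truncn x) => //=; rewrite in_itv/= x0.
 exact/ltW/truncnS_gt.
have := @ge0_nondecreasing_set_cvg_integral _ (mline R) R (fun n => `]0, n.+1%:R]%classic) (fun x => (f x)%:E) leb nd.
rewrite U => H; apply: (cvge_to_le (H _ _ _)) => //.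
- by move=> n; exact: mfD.
- by move=> n x _; rewrite lee_fin.
- by apply: nearW => n; exact: fC.
Qed.

Lemma integral_inv_le (a b : R) : 0 < a -> a <= b ->
 (\int[leb]_(x in `]a, b]) (power_fun 0 x)%:E <= (ln b - ln a)%:E)%E.
Proof.
move=> a0 ab.
have pos (x : R) : a <= x <= b -> 0 < x by move=> /andP[ax _]; exact: lt_le_trans ax.
have mpf D : measurable_fun D (fun x : mline R => (power_fun 0 x)%:E).
 by apply/measurable_EFinP/measurable_funTS; exact: measurable_power_fun.
apply: (@le_trans _ _ (\int[leb]_(x in `[a, b]) (power_fun 0 x)%:E)%E).
 apply: ge0_subset_integral => //; first by move=> x _; rewrite lee_fin power_fun_ge0.
 by move=> x /=; rewrite !in_itv/= => /andP[/ltW -> ->].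
have -> : (\int[leb]_(x in `[a, b]) (power_fun 0 x)%:E = \int[leb]_(x in `[a, b]) (x^-1)%:E)%E.
 by apply: eq_integral => x /set_mem/=; rewrite in_itv/= => /pos x0; rewrite power_fun0.
have H := @FTC2_is_derive R (fun x => x^-1) (@ln R) a b ab (fun x h => is_derive1_ln (pos x h)).
rewrite H// => x /pos x0; apply: cvgV; [by rewrite gt_eqF|exact: cvg_id].
Qed.

Variables (X : R -> R) (E B : R).
Hypothesis adm : admissible X E B.
Let mX : mfun R X. Proof. by case: adm. Qed.
Let X0 s : 0 <= X s. Proof. by case: adm. Qed.

Section fixed_step.
Variable D : R.
Hypothesis D0 : 0 < D.
Let r := expR (- D).
Let r0 : 0 < r. Proof. exact: expR_gt0. Qed.
Let r1 : r < 1. Proof. by rewrite expR_lt1 oppr_lt0. Qed.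

Let g s := (X (r * s) - X s) ^+ 2 * power_fun 0 s.
Let d (i : nat) x := (X (r ^+ i.+1 * x) - X (r ^+ i * x)) ^+ 2 * power_fun 0 x.

Let mscaled (c : R) : mfun R (fun s => X (c * s)).
Proof. by apply: measurableT_comp => //; exact: measurable_funM. Qed.

Let mg : mfun R g.
Proof.
apply: measurable_funM; last exact: measurable_power_fun.
by apply: measurable_funX; apply: measurable_funB => //; exact: mscaled.
Qed.

Let md i : mfun R (d i).
Proof.
apply: measurable_funM; last exact: measurable_power_fun.
by apply: measurable_funX; apply: measurable_funB; exact: mscaled.
Qed.

Let g0 s : 0 <= g s. Proof. by rewrite mulr_ge0 ?sqr_ge0 ?power_fun_ge0. Qed.
Let d0 i s : 0 <= d i s. Proof. by rewrite mulr_ge0 ?sqr_ge0 ?power_fun_ge0. Qed.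

Let cell_integral b i : 0 < b ->
 (\int[leb]_(x in `](b * r ^+ i.+1)%R, (b * r ^+ i)%R]) (g x)%:E = \int[leb]_(x in `](b * r)%R, b]) (d i x)%:E)%E.
Proof.
move=> b0; have ri : 0 < r ^+ i by rewrite exprn_gt0.
have sub (x y : R) : 0 < x -> `]x, y]%classic `<=` `]0%R, +oo[%classic.
 by move=> x0 t /=; rewrite !in_itv/= andbT => /andP[h _]; exact: lt_trans h.
have s1 : `](b * r ^+ i.+1)%R, (b * r ^+ i)%R]%classic `<=` `]0%R, +oo[%classic.
 by apply: sub; rewrite mulr_gt0// exprn_gt0.
have s2 : `](b * r)%R, b]%classic `<=` `]0%R, +oo[%classic by apply: sub; rewrite mulr_gt0.
rewrite (integral_subset_indic g s1) (integral_subset_indic (d i) s2).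
have -> : (\int[leb]_(x in `]0%R, +oo[) (g x * \1_(`]b * r ^+ i.+1, b * r ^+ i]%classic) x)%:E =
  \int[leb]_(x in `]0%R, +oo[) (g (r ^+ i * (x / r ^+ i)) * \1_(`]b * r, b]%classic) (x / r ^+ i))%:E)%E.
 apply: eq_integral => x _; congr (_%:E); rewrite mulrCA divff ?gt_eqF// mulr1; congr (_ * _).
 rewrite !indicE; have -> // : (x \in `]b * r ^+ i.+1, b * r ^+ i]%classic) = (x / r ^+ i \in `]b * r, b]%classic).
 apply/idP/idP => /set_mem/= h; apply/mem_set; move: h; rewrite /= !in_itv/=.
  by rewrite ltr_pdivlMr// ler_pdivrMr// exprS mulrA.
 by rewrite ltr_pdivlMr// ler_pdivrMr// exprS mulrA.
rewrite (@integral_scale R (r ^+ i) (fun x => g (r ^+ i * x) * \1_(`]b * r, b]%classic) x))//.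
- rewrite -ge0_integralZl//.
 + apply: eq_integral => x /set_mem/=; rewrite in_itv/= andbT => x0.
  rewrite -EFinM; congr (_%:E); rewrite /g /d !power_fun0 ?mulr_gt0//.
  have -> : r * (r ^+ i * x) = r ^+ i.+1 * x by rewrite exprS mulrA.
  by field; rewrite !gt_eqF.
 + apply/measurable_EFinP/measurable_funTS; apply: measurable_funM => //.
  by apply: (@measurableT_comp _ _ _ _ _ _ g) => //; exact: measurable_funM.
 + by move=> x _; rewrite lee_fin mulr_ge0.
 + by rewrite lee_fin ltW.
- apply: measurable_funM => //; apply: (@measurableT_comp _ _ _ _ _ _ g) => //; exact: measurable_funM.
- by move=> x _; rewrite mulr_ge0.
Qed.

Let cells_integral b N : 0 < b ->
 (\int[leb]_(x in `](b * r ^+ N)%R, b]) (g x)%:E = \int[leb]_(x in `](b * r)%R, b]) (\sum_(i < N) d i x)%:E)%E.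
Proof.
move=> b0; have mgD S : measurable_fun S (fun x => (g x)%:E) by apply/measurable_EFinP/measurable_funTS.
have sle n : b * r ^+ n <= b by rewrite ler_piMr ?(ltW b0)//; apply: exprn_ile1; exact: ltW.
elim: N => [|N IH].
 rewrite expr0 mulr1 set_itv_ge ?integral_set0; last by rewrite bnd_simp ltxx.
 by rewrite integral0_eq// => x _; rewrite big_ord0.
rewrite (_ : `](b * r ^+ N.+1)%R, b]%classic = `](b * r ^+ N.+1)%R, (b * r ^+ N)%R]%classic `|` `](b * r ^+ N)%R, b]%classic); last first.
 rewrite -itv_bndbnd_setU// bnd_simp//.
 by rewrite ler_wpM2l ?(ltW b0)// exprS ler_piMl ?exprn_ge0 ?ltW.
rewrite ge0_integral_setU//; last 3 first.
- exact: mgD.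
- by move=> x _; rewrite lee_fin.
- apply/disj_set2P/seteqP; split => x //= []; rewrite !in_itv/= => /andP[_ h1] /andP[h2 _].
 by move: h2; rewrite ltNge h1.
rewrite IH cell_integral// -ge0_integralD//.
- by apply: eq_integral => x _; rewrite -EFinD big_ord_recr/= addrC.
- by move=> x _; rewrite lee_fin.
- by apply/measurable_EFinP/measurable_funTS; exact: md.
- by move=> x _; rewrite lee_fin sumr_ge0.
- by apply/measurable_EFinP/measurable_funTS; apply: measurable_sum => i; exact: md.
Qed.

(** Fold the half-line onto one multiplicative period []b r, b]]. For each [x] there, the sum of
    squared increments along the points [r ^+ i * x] is at most [D * E], and the period has length
    [D] for the measure [ds / s]; the factor [D ^ (- 2)] of the squared quotient cancels both. *)
Lemma slope_energy : (\int[leb]_(s in `]0%R, +oo[) (s * slope X D s ^+ 2)%:E <= E%:E)%E.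
Proof.
have E0 : 0 <= E by case: adm => _ _ _ _ [].
have main : (\int[leb]_(s in `]0%R, +oo[) (g s)%:E <= (D * E * D)%:E)%E.
 apply: improper_integral0y => // b b0.
 apply: (@improper_integral0 R g (fun n => b * r ^+ n)) => //.
 - by move=> n; rewrite mulr_ge0 ?exprn_ge0 ?ltW.
 - by move=> n; rewrite ler_wpM2l ?(ltW b0)// exprS ler_piMl ?exprn_ge0 ?ltW.
 - move=> x x0; have xb : 0 < x / b by rewrite divr_gt0.
  have rn : `|r| < 1 by rewrite gtr0_norm.
  have [N _ NP] := (cvgrPdist_lt _ _).1 (cvg_expr rn) _ xb.
  exists N; have := NP N (leqnn N); rewrite /= sub0r normrN ger0_norm ?exprn_ge0 ?ltW//.
  by rewrite ltr_pdivlMr// mulrC.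
 move=> N; rewrite cells_integral//.
 apply: (@le_trans _ _ (\int[leb]_(x in `](b * r)%R, b]) (D * E * power_fun 0 x)%:E)%E).
  apply: le_integral_line => //.
  + by apply: measurable_sum => i; exact: md.
  + by apply: measurable_funM => //; exact: measurable_power_fun.
  + by move=> x _; rewrite sumr_ge0.
  move=> x /=; rewrite in_itv/= => /andP[bx _].
  have x0 : 0 < x by apply: lt_trans bx; rewrite mulr_gt0.
  rewrite -mulr_suml ler_wpM2r ?power_fun_ge0//.
  case: adm => _ _ _ en _; apply: le_trans (en (- ln x) D N D0).
  have e (i : nat) : r ^+ i * x = expR (- (- ln x + i%:R * D)).
   by rewrite /r -expRM_natl opprD opprK expRD lnK// mulrC; congr (_ * expR _); ring.
  by apply: le_of_eq; apply: eq_bigr => i _; rewrite !e.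
 have DE0 : 0 <= D * E by rewrite mulr_ge0// ltW.
 under eq_integral do rewrite EFinM.
 rewrite ge0_integralZl//; last 2 first.
 - by apply/measurable_EFinP/measurable_funTS; exact: measurable_power_fun.
 - by move=> x _; rewrite lee_fin power_fun_ge0.
 rewrite [leRHS]EFinM lee_wpmul2l ?lee_fin//.
 have br : 0 < b * r by rewrite mulr_gt0.
 have bb : b * r <= b by rewrite ler_piMr// ltW.
 apply: le_trans (integral_inv_le br bb) _; rewrite lee_fin lnM ?posrE// /r expRK; lra.
have DD : 0 < D ^+ 2 by rewrite exprn_gt0.
have -> : (\int[leb]_(s in `]0%R, +oo[) (s * slope X D s ^+ 2)%:E = ((D ^+ 2)^-1)%:E * \int[leb]_(s in `]0%R, +oo[) (g s)%:E)%E.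
 rewrite -ge0_integralZl//.
 - apply: eq_integral => x /set_mem/=; rewrite in_itv/= andbT => x0.
  rewrite -EFinM; congr (_%:E); rewrite /slope /g !power_fun0// -/r; field.
  by rewrite !gt_eqF.
 - by apply/measurable_EFinP/measurable_funTS.
 - by move=> x _; rewrite lee_fin.
 - by rewrite lee_fin invr_ge0 ltW.
apply: (@le_trans _ _ (((D ^+ 2)^-1)%:E * (D * E * D)%:E)%E).
 by rewrite lee_wpmul2l// lee_fin invr_ge0 ltW.
rewrite -EFinM lee_fin; apply: le_of_eq; field; by rewrite gt_eqF.
Qed.

End fixed_step.

(** The domination by [X (s / 2) ^+ 2] asks for a ratio at least [1 / 2]; this is why the steps are
    [1 / (n + 2)]. *)
Lemma translate_L2_cvg :
 fine (\int[leb]_(s in `]0%R, +oo[) ((X (expR (- n.+2%:R^-1) * s) - X s) ^+ 2)%:E) @[n --> \oo] --> (0 : R).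
Proof.
case: (adm) => _ _ Xle _ [E0 XB _].
have E1 := admissible_E_le1 adm.
have rn (n : nat) : 2^-1 <= expR (- n.+2%:R^-1) :> R /\ expR (- n.+2%:R^-1) <= 1 :> R.
 have h : 0 < n.+2%:R^-1 :> R by rewrite invr_gt0.
 have h2 : n.+2%:R^-1 <= 2^-1 :> R by rewrite lef_pV2 ?posrE// ler_nat.
 split; last by rewrite -[leRHS]expR0 ler_expR; move: (n.+2%:R^-1 : R) h => y; lra.
 by have := expR_ge1Dx (- n.+2%:R^-1 : R); move: h h2; move: (n.+2%:R^-1 : R) => y; lra.
have mh : mfun R (fun s => X (s / 2) ^+ 2).
 by apply: measurable_funX; apply: measurableT_comp => //; exact: measurable_funM.
pose fn (n : nat) s := (X (expR (- n.+2%:R^-1) * s) - X s) ^+ 2.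
have c1 n : mfun R (fn n).
 apply: measurable_funX; apply: measurable_funB => //.
 by apply: measurableT_comp => //; exact: measurable_funM.
have c2 : mfun R (cst 0 : R -> R) by exact: measurable_cst.
have c3 n s : 0 < s -> 0 <= fn n s <= X (s / 2) ^+ 2.
 move=> s0; have [a b] := rn n; rewrite sqr_ge0/= /fn lerXn2r ?nnegrE//.
  by rewrite subr_ge0 Xle ?mulr_gt0 ?expR_gt0// ler_piMl// ltW.
 apply: (@le_trans _ _ (X (expR (- n.+2%:R^-1) * s))); first by rewrite gerBl.
 by apply: Xle; [rewrite divr_gt0|rewrite mulrC ler_wpM2r// ltW].
have c4 s : 0 < s -> fn n s @[n --> \oo] --> cst 0 s.
 move=> s0.
 apply: (@squeeze_cvgr _ _ _ _ (cst 0) (fun n : nat => n.+2%:R^-1)); [|exact: cvg_cst|].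
  apply: nearW => n; rewrite sqr_ge0/=.
  have t0 : - ln s <= - ln s + n.+2%:R^-1 by rewrite lerDl invr_ge0.
  have := psi_holder adm t0; rewrite /= opprK lnK// opprD opprK expRD lnK// [s * _]mulrC => h.
  have e : - ln s + n.+2%:R^-1 + ln s = n.+2%:R^-1 by ring.
  by apply: le_trans h _; rewrite e ler_piMr// invr_ge0.
 have := @cvg_harmonic R; rewrite -(cvg_shiftS (fun n => n.+1%:R^-1 : R)); exact.
have c5 : (\int[leb]_(s in `]0%R, +oo[) (X (s / 2) ^+ 2)%:E < +oo)%E.
 have -> : (\int[leb]_(s in `]0%R, +oo[) (X (s / 2) ^+ 2)%:E = 2%:E * B%:E)%E.
  rewrite -XB; apply: (@integral_scale R 2 (fun s => X s ^+ 2)) => //; first exact: measurable_funX.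
  by move=> x _; exact: sqr_ge0.
 by rewrite -EFinM ltry.
have [_] := dct_line c1 c2 mh c3 c4 c5.
by rewrite [X in _ --> fine X -> _]integral0_eq.
Qed.

End slope_energy.

(** * Approximants of nearly least energy and their limit *)

Section approximants.
Context {R : realType}.
Notation leb := (@lebesgue_measure R).
Implicit Types (X Y q : R -> R).

Definition line_energy q : \bar R := (\int[leb]_(s in `]0%R, +oo[) (s * q s ^+ 2)%:E)%E.

Definition approximant X (eps : R) Y q : Prop :=
 [/\ mfun R Y /\ mfun R q,
   forall s, s <= 0 -> Y s = 0 /\ q s = 0,
   forall s : R, 0 < s -> is_derive s 1 Y (- q s) /\ {for s, continuous q} &
   (\int[leb]_(s in `]0%R, +oo[) ((Y s - X s) ^+ 2)%:E <= eps%:E)%E].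

Lemma line_energy_ge0 q : (0 <= line_energy q)%E.
Proof.
by apply: integral_ge0 => s /=; rewrite in_itv/= andbT lee_fin => s0; rewrite mulr_ge0 ?sqr_ge0// ltW.
Qed.

Lemma measurable_energy q : mfun R q -> mfun R (fun s => s * q s ^+ 2).
Proof. by move=> mq; apply: measurable_funM => //; exact: measurable_funX. Qed.

Lemma approximant_exists X E B (eps : R) : admissible X E B -> 0 < eps ->
 exists Y q, approximant X eps Y q /\ (line_energy q <= E%:E)%E.
Proof.
move=> adm e0; have [N _ NP] := (cvgrPdistC_lt _ _).1 (translate_L2_cvg adm) _ e0.
have mX : mfun R X by case: adm.
have D0 : 0 < N.+2%:R^-1 :> R by rewrite invr_gt0.
have [Y [mY Y0 dY YX]] := average adm D0.
exists Y, (slope X N.+2%:R^-1); split; last by rewrite /line_energy; exact: (slope_energy adm D0).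
split.
- by split => //; first [exact: (measurable_slope adm _)|exact: (measurable_slope _ adm)|exact: measurable_slope].
- by move=> s s0; split; [exact: Y0|exact: slope_neg].
- by move=> s s0; split; [exact: dY|exact: slope_continuous adm _ _ s0].
set r := expR _ in YX.
have mr : mfun R (fun s => (X (r * s) - X s) ^+ 2).
 apply: measurable_funX; apply: measurable_funB => //.
 by apply: measurableT_comp => //; exact: measurable_funM.
apply: (@le_trans _ _ (\int[leb]_(s in `]0%R, +oo[) ((X (r * s) - X s) ^+ 2)%:E)%E).
 apply: le_integral_line => //.
 - by apply: measurable_funX; apply: measurable_funB.
 - by move=> s _; exact: sqr_ge0.
 move=> s /=; rewrite in_itv/= andbT => s0; have /andP[h1 h2] := YX s s0.
 by rewrite lerXn2r ?nnegrE ?lerD2r// subr_ge0//; exact: le_trans h2.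
have := NP N (leqnn N); rewrite /= subr0 -/r.
have I0 : (0 <= \int[leb]_(s in `]0%R, +oo[) ((X (r * s) - X s) ^+ 2)%:E)%E.
 by apply: integral_ge0 => s _; rewrite lee_fin sqr_ge0.
have Ioo : (\int[leb]_(s in `]0%R, +oo[) ((X (r * s) - X s) ^+ 2)%:E < +oo)%E.
 case: (adm) => _ X0 Xle _ [_ XB _].
 have r0 : 0 < r by exact: expR_gt0.
 have r1 : r <= 1 by rewrite /r -[leRHS]expR0 ler_expR oppr_le0 ltW.
 apply: (@le_lt_trans _ _ (\int[leb]_(s in `]0%R, +oo[) (X (s / r^-1) ^+ 2)%:E)%E).
  apply: le_integral_line => //.
  - by apply: measurable_funX; apply: measurableT_comp => //; exact: measurable_funM.
  - by move=> s _; exact: sqr_ge0.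
  move=> s /=; rewrite in_itv/= andbT => s0; rewrite invrK [s * r]mulrC.
  have h : X s <= X (r * s) by apply: Xle; [rewrite mulr_gt0|rewrite ler_piMl// ltW].
  by rewrite lerXn2r ?nnegrE ?subr_ge0// gerBl.
 rewrite (@integral_scale R r^-1 (fun s => X s ^+ 2)) ?invr_gt0//.
 - by rewrite XB -EFinM ltry.
 - exact: measurable_funX.
 - by move=> s _; exact: sqr_ge0.
move: I0 Ioo; case: (\int[leb]_(s in _) _)%E => [z| |]//=.
by rewrite lee_fin => z0 _; rewrite ger0_norm// lee_fin => /ltW.
Qed.

(** The parallelogram identity for [q1] and [q2]. *)
Lemma line_energyB q1 q2 (c d : R) : mfun R q1 -> mfun R q2 ->
 (line_energy q1 <= c%:E)%E -> (line_energy q2 <= c%:E)%E ->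
 (d%:E <= line_energy (fun s => (q1 s + q2 s) / 2)%R)%E ->
 (line_energy (fun s => q1 s - q2 s)%R <= (4 * (c - d))%:E)%E.
Proof.
move=> m1 m2 h1 h2 hm.
have mB : mfun R (fun s => q1 s - q2 s) by exact: measurable_funB.
have mM : mfun R (fun s => (q1 s + q2 s) / 2).
 by apply: measurable_funM => //; exact: measurable_funD.
have mE q : mfun R q ->
  measurable_fun (`]0%R, +oo[%classic : set (mline R)) (fun s => (s * q s ^+ 2)%:E).
 by move=> mq; apply/measurable_EFinP/measurable_funTS; exact: measurable_energy.
have p0 (q : R -> R) (s : R) : (`]0%R, +oo[%classic : set (mline R)) s -> (0 <= (s * q s ^+ 2)%:E)%E.
 by rewrite /= in_itv/= andbT lee_fin => s0; rewrite mulr_ge0 ?sqr_ge0// ltW.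
have lin q (k : R) : 0 <= k -> mfun R q ->
  (k%:E * line_energy q = \int[leb]_(s in `]0%R, +oo[) (k%:E * (s * q s ^+ 2)%:E))%E.
 move=> k0 mq; rewrite ge0_integralZl//; [exact: mE|exact: p0].
have key : (line_energy (fun s => q1 s - q2 s)%R + 4%:E * line_energy (fun s => (q1 s + q2 s) / 2)%R =
  2%:E * line_energy q1 + 2%:E * line_energy q2)%E.
 rewrite !lin// /line_energy -!ge0_integralD//; try exact: mE; try exact: p0;
  try (by apply: measurable_funeM; exact: mE); try (by move=> s s0; rewrite mule_ge0 ?lee_fin// mulr_ge0 ?sqr_ge0//; move: s0; rewrite /= in_itv/= andbT => /ltW).
 by apply: eq_integral => s _; rewrite -!EFinM -!EFinD; congr (_%:E); field.
have e1 := line_energy_ge0 q1; have e2 := line_energy_ge0 q2.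
have eB := line_energy_ge0 (fun s => q1 s - q2 s).
move: key h1 h2 hm e1 e2 eB.
case: (line_energy q1) => [a1| |]//; case: (line_energy q2) => [a2| |]//.
case: (line_energy (fun s => q1 s - q2 s)) => [b| |]; case: (line_energy (fun s => (q1 s + q2 s) / 2)%R) => [m| |]//.
 by rewrite -!EFinM -!EFinD => -[key]; rewrite !lee_fin; lra.
all: have m4 : (4%:E * +oo = +oo :> \bar R)%E by rewrite gt0_muley// lte_fin.
all: by rewrite ?m4 -?EFinM -?EFinD /=.
Qed.

Lemma approximant_mid X (eps : R) Y1 q1 Y2 q2 : mfun R X ->
 approximant X eps Y1 q1 -> approximant X eps Y2 q2 ->
 approximant X eps (fun s => (Y1 s + Y2 s) / 2) (fun s => (q1 s + q2 s) / 2).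
Proof.
move=> mX [[mY1 mq1] z1 d1 i1] [[mY2 mq2] z2 d2 i2]; split.
- by split; apply: measurable_funM => //; exact: measurable_funD.
- by move=> s s0; have [-> ->] := z1 s s0; have [-> ->] := z2 s s0; rewrite addr0 mul0r.
- move=> s s0; have [dY1 cq1] := d1 s s0; have [dY2 cq2] := d2 s s0; split.
  have := is_deriveZ 2^-1 (is_deriveD dY1 dY2).
  have -> : 2^-1 \*: (Y1 + Y2) = (fun s => (Y1 s + Y2 s) / 2) by apply/funext => y; rewrite /= mulrC.
  by rewrite /GRing.scale/= mulrC -opprD mulNr.
 by apply: cvgMr_tmp; apply: cvgD.
have m2 Y : mfun R Y -> mfun R (fun s => 2^-1 * (Y s - X s) ^+ 2).
 by move=> mY; apply: measurable_funM => //; apply: measurable_funX; exact: measurable_funB.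
have mD Y : mfun R Y ->
  measurable_fun (`]0%R, +oo[%classic : set (mline R)) (fun s => (2^-1 * (Y s - X s) ^+ 2)%:E).
 by move=> mY; apply/measurable_EFinP/measurable_funTS; exact: m2.
have half Y : mfun R Y -> (\int[leb]_(s in `]0%R, +oo[) ((Y s - X s) ^+ 2)%:E <= eps%:E)%E ->
  (\int[leb]_(s in `]0%R, +oo[) (2^-1 * (Y s - X s) ^+ 2)%:E <= (2^-1 * eps)%:E)%E.
 move=> mY h; under eq_integral do rewrite EFinM.
 rewrite ge0_integralZl//.
 - by rewrite EFinM lee_wpmul2l// lee_fin.
 - by apply/measurable_EFinP/measurable_funTS; apply: measurable_funX; exact: measurable_funB.
 - by move=> s _; rewrite lee_fin sqr_ge0.
have -> : eps = 2^-1 * eps + 2^-1 * eps by field.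
rewrite EFinD; apply: le_trans (leeD (half _ mY1 i1) (half _ mY2 i2)).
rewrite -ge0_integralD//; try exact: mD; try by move=> s _; rewrite lee_fin mulr_ge0 ?sqr_ge0.
apply: le_integral_line => //.
- apply: measurable_funX; apply: measurable_funB => //; apply: measurable_funM => //; exact: measurable_funD.
- by apply: measurable_funD; exact: m2.
- by move=> s _; exact: sqr_ge0.
- move=> s _; have := sqr_ge0 (Y1 s - Y2 s); move: (Y1 s) (Y2 s) (X s) => a b c; rewrite !sqrrB.
 have -> : ((a + b) / 2) ^+ 2 - (a + b) / 2 * c *+ 2 + c ^+ 2 =
  4^-1 * (a ^+ 2 + 2 * (a * b) + b ^+ 2) - (a * c + b * c) + c ^+ 2 by field.
 by rewrite !mulr2n; move: (a ^+ 2) (b ^+ 2) (c ^+ 2) (a * b) (a * c) (b * c) => aa bb cc ab ac bc h; rewrite -subr_ge0; apply: (le_trans (_ : 0 <= (aa - (ab + ab) + bb) / 4)); [by rewrite divr_ge0|apply: le_of_eq; by field].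
Qed.

Lemma approximant_mono X (e1 e2 : R) Y q : e1 <= e2 -> approximant X e1 Y q -> approximant X e2 Y q.
Proof. by move=> e12 [? ? ? h]; split => //; apply: le_trans h _; rewrite lee_fin. Qed.

(** Strong convergence of the derivatives without weak compactness: among the approximants within a
    given L^2 error, take one of nearly least energy. Midpoints are again approximants, so the
    parallelogram identity forces the derivatives to be close. *)
Lemma minimizing_approximants X E B : admissible X E B ->
 exists (Y q : nat -> R -> R), forall j,
  [/\ approximant X (4^-1 ^+ j) (Y j) (q j), (line_energy (q j) <= (E + 16^-1 ^+ j)%:E)%E &
   (line_energy (fun s => q j.+1 s - q j s)%R <= (8 * 16^-1 ^+ j)%:E)%E].
Proof.
move=> adm; have mX : mfun R X by case: adm.
pose S (e : R) : set R := [set r | exists Y q, approximant X e Y q /\ line_energy q = r%:E].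
have Sinf e : 0 < e -> has_inf (S e) /\ inf (S e) <= E.
 move=> e0; have [Y [q [a le]]] := approximant_exists adm e0.
 have : exists r, line_energy q = r%:E /\ r <= E.
  move: le (line_energy_ge0 q); case: (line_energy q) => [r| |]// le _; exists r.
  by move: le; rewrite lee_fin.
 move=> [r [qr rE]]; have Sr : S e r by exists Y, q.
 have lb : has_lbound (S e).
  by exists 0 => x [Y' [q' [_ h]]]; rewrite -lee_fin -h line_energy_ge0.
 split; first by split => //; exists r.
 by apply: le_trans rE; exact: ge_inf.
(* The least energies [inf (S e)] increase as [e] decreases and stay below [E]. The error at stage
   [j] is taken so small that they are within [16 ^ (- j)] of their supremum. *)
pose T : set R := [set inf (S e) | e in [set e | 0 < e]].
have Tsup : has_sup T.
 split; first by exists (inf (S 1)), 1 => //=.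
 by exists E => _ [e /= e0 <-]; case: (Sinf e e0).
have dE : sup T <= E by apply: ge_sup; [case: Tsup|move=> _ [e /= e0 <-]; case: (Sinf e e0)].
have stage (j : nat) : exists Yqe : (R -> R) * (R -> R) * R,
  [/\ 0 < Yqe.2 <= 4^-1 ^+ j, approximant X Yqe.2 Yqe.1.1 Yqe.1.2,
   (line_energy Yqe.1.2 <= (sup T + 16^-1 ^+ j)%:E)%E & sup T - 16^-1 ^+ j <= inf (S Yqe.2)].
 have dj : 0 < 16^-1 ^+ j :> R by rewrite exprn_gt0.
 have [_ [e /= e0 <-] he] := sup_adherent dj Tsup.
 pose e' := Num.min e (4^-1 ^+ j).
 have e'0 : 0 < e' by rewrite lt_min e0 exprn_gt0.
 have [Sh _] := Sinf e' e'0.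
 have [r [Y [q [a qr]]] hr] := inf_adherent dj Sh.
 exists (Y, q, e'); split => /=.
 - by rewrite e'0 ge_min lexx orbT.
 - exact: a.
 - rewrite qr lee_fin; apply/ltW/(lt_le_trans hr); rewrite lerD2r.
  by apply: ub_le_sup; [case: Tsup|exists e'].
 - apply: (le_trans (ltW he)); apply: lb_le_inf; first by case: Sh.
  move=> x [Y' [q' [a' h']]]; apply: ge_inf; first by case: (Sinf e e0) => [[]].
  by exists Y', q'; split => //; apply: approximant_mono a'; rewrite ge_min lexx.
have [f fP] := choice stage.
exists (fun j => (f j).1.1), (fun j => (f j).1.2) => j.
have [/andP[e0 e4] a en lo] := fP j; have [/andP[e0' e4'] a' en' lo'] := fP j.+1.
have d16 : 16^-1 ^+ j.+1 <= 16^-1 ^+ j :> R.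
 by rewrite exprS ler_piMl ?exprn_ge0//; lra.
split.
- exact: approximant_mono a.
- by apply: le_trans en _; rewrite lee_fin lerD2r.
have -> : 8 * 16^-1 ^+ j = 4 * ((sup T + 16^-1 ^+ j) - (sup T - 16^-1 ^+ j)) :> R by ring.
have [mq _] : mfun R (f j).1.2 /\ True by case: a => [[]].
have [mq' _] : mfun R (f j.+1).1.2 /\ True by case: a' => [[]].
apply: line_energyB => //.
 by apply: le_trans en' _; rewrite lee_fin lerD2l.
pose m := Num.max (f j).2 (f j.+1).2.
have am := approximant_mid mX (approximant_mono (_ : (f j.+1).2 <= m) a') (approximant_mono (_ : (f j).2 <= m) a).
have m1 : (f j.+1).2 <= m by rewrite /m le_max lexx orbT.
have m2 : (f j).2 <= m by rewrite /m le_max lexx.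
have {}am := am m1 m2.
have lom : sup T - 16^-1 ^+ j <= inf (S m).
 rewrite /m; case: (leP (f j).2 (f j.+1).2) => _ //.
 by apply: le_trans lo'; rewrite lerD2l lerN2.
have m0 : 0 < m by rewrite /m lt_max e0.
move: (line_energy_ge0 (fun s => ((f j.+1).1.2 s + (f j).1.2 s) / 2)).
case E1 : (line_energy (fun s => ((f j.+1).1.2 s + (f j).1.2 s) / 2)) => [z| |]// _.
 rewrite lee_fin; apply: le_trans lom _; apply: ge_inf; first by case: (Sinf m m0) => [[]].
 by eexists; eexists; split; [exact: am|exact: E1].
by rewrite leey.
Qed.

End approximants.

Lemma le_geometric {R : realType} (x y K : R) : (forall m, x <= y + K * 2^-1 ^+ m) -> x <= y.
Proof.
move=> h; rewrite leNgt; apply/negP => yx.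
have d0 : 0 < x - y by rewrite subr_gt0.
have c : geometric K 2^-1 @ \oo --> (0 : R) by apply: cvg_geometric; rewrite ger0_norm ?invr_ge0// invf_lt1 ?ltr1n.
have [N _ NP] := (cvgrPdist_lt _ _).1 c _ d0.
have := NP N (leqnn N); rewrite /geometric/= sub0r normrN => hN.
have := h N; have := ler_norm (K * 2^-1 ^+ N); lra.
Qed.

Lemma geometric_cvg {R : realType} (a : nat -> R) (K : R) : (forall j, `|a j.+1 - a j| <= K * 2^-1 ^+ j) ->
 exists l : R, a @ \oo --> l /\ forall m, `|l - a m| <= 2 * K * 2^-1 ^+ m.
Proof.
move=> h; pose r k := a k + 2 * K * 2^-1 ^+ k; pose w k := a k - 2 * K * 2^-1 ^+ k.
have half k : 2 * K * 2^-1 ^+ k.+1 = K * 2^-1 ^+ k :> R by rewrite exprS; field.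
have rS k : r k.+1 <= r k.
 by have := h k; rewrite /r half ler_norml => /andP[_]; rewrite -mulrA; move: (K * _) => z; lra.
have wS k : w k <= w k.+1.
 by have := h k; rewrite /w half ler_norml => /andP[+ _]; rewrite -mulrA; move: (K * _) => z; lra.
have r_mono : {homo r : n m / (n <= m)%N >-> m <= n}.
 by apply/nonincreasing_seqP.
have w_mono : {homo w : n m / (n <= m)%N >-> n <= m}.
 by apply/nondecreasing_seqP.
have K0 : 0 <= K by have := h 0%N; rewrite expr0 mulr1; apply: le_trans; exact: normr_ge0.
have wr k : w k <= r k.
 rewrite /w /r lerD2l; apply: (@le_trans _ _ 0); first rewrite oppr_le0; by rewrite !mulr_ge0 ?exprn_ge0 ?invr_ge0.
have wr' j k : w j <= r k.
 apply: (@le_trans _ _ (w (maxn j k))); first by apply: w_mono; exact: leq_maxl.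
 by apply: le_trans (wr _) _; apply: r_mono; exact: leq_maxr.
have rc : cvgn r by apply: nonincreasing_is_cvgn => //; exists (w 0%N) => _ [k _ <-].
have g : geometric (2 * K) 2^-1 @ \oo --> (0 : R) by apply: cvg_geometric; rewrite ger0_norm ?invr_ge0// invf_lt1 ?ltr1n.
exists (limn r); split.
 rewrite -[limn r]subr0; have -> : a = (fun n => r n - geometric (2 * K) 2^-1 n).
  by apply/funext => n; rewrite /r /geometric/= addrK.
 exact: cvgB.
move=> m; rewrite ler_norml; apply/andP; split.
 have : w m <= limn r by apply: limr_ge => //; near=> k; exact: wr'.
 by rewrite /w; move: (2 * K * _) => z; lra.
have : limn r <= r m by apply: nonincreasing_cvgn_ge.
by rewrite /r; move: (2 * K * _) => z; lra.
Unshelve. all: end_near.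
Qed.

Section energy_limit.
Context {R : realType}.
Notation leb := (@lebesgue_measure R).
Variables (q : nat -> R -> R).
Hypotheses (mq : forall j, mfun R (q j)) (q0 : forall j s, s <= 0 -> q j s = 0).
Hypothesis qE : forall j, (line_energy (fun s => q j.+1 s - q j s)%R <= (8 * 16^-1 ^+ j)%:E)%E.

Let w j (s : R) : \bar R := (4 ^+ j * (s * (q j.+1 s - q j s) ^+ 2))%:E.
Let W (s : R) : \bar R := (\sum_(0 <= j <oo) w j s)%E.

Let w0 j s : (0 <= w j s)%E.
Proof.
rewrite lee_fin; apply: mulr_ge0; first exact: exprn_ge0.
have [s0|s0] := leP s 0; first by rewrite !q0// subrr expr0n/= mulr0.
by rewrite mulr_ge0 ?sqr_ge0// ltW.
Qed.

Let mB j k : mfun R (fun s => q j s - q k s).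
Proof. exact: measurable_funB. Qed.

Let mw j : mfun R (w j).
Proof.
by apply/measurable_EFinP; apply: measurable_funM => //; exact: measurable_energy.
Qed.

Let mW : mfun R W.
Proof. by apply: ge0_emeasurable_sum. Qed.

Let DD : set (mline R) := `]0%R, +oo[%classic.
Let mDD : measurable DD. Proof. exact: measurable_itv. Qed.

Let intW : (\int[leb]_(s in DD) W s <= 16%:E)%E.
Proof.
rewrite (integral_nneseries leb mDD); [|by move=> n; apply: measurable_funTS; exact: mw|by move=> n s _; exact: w0].
apply: lime_le; first by apply: is_cvg_nneseries => n _ _; apply: integral_ge0 => s _; exact: w0.
have sumE n : \sum_(0 <= j < n) 8 * 4^-1 ^+ j = 32 / 3 * (1 - 4^-1 ^+ n) :> R.
 elim: n => [|n IH] //=; first by rewrite big_geq// expr0 subrr mulr0.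
 by rewrite big_nat_recr//= IH exprS; move: (4^-1 ^+ n) => z; field.
near=> n.
apply: (@le_trans _ _ (\sum_(0 <= j < n) (8 * 4^-1 ^+ j)%:E)%E).
 apply: lee_sum => j _; rewrite /w; under eq_integral do rewrite EFinM.
 rewrite ge0_integralZl//.
 - apply: (@le_trans _ _ ((4 ^+ j)%:E * (8 * 16^-1 ^+ j)%:E)%E).
   by apply: lee_wpmul2l; [rewrite lee_fin exprn_ge0|exact: qE].
  rewrite -EFinM lee_fin mulrCA -exprMn.
  by have -> : 4 * 16^-1 = 4^-1 :> R by field.
 - by apply/measurable_EFinP/measurable_funTS; exact: measurable_energy.
 - by move=> s; rewrite /DD/= in_itv/= andbT => s0; rewrite lee_fin mulr_ge0 ?sqr_ge0// ltW.
rewrite sumEFin lee_fin.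
rewrite sumE; have : 0 <= 4^-1 ^+ n :> R by rewrite exprn_ge0// invr_ge0.
by move: (_ ^+ n) => z; lra.
Unshelve. all: end_near.
Qed.

(** Completeness of a weighted L^2 space. With the weights [4 ^+ j] the function [W] is still
    integrable, and where it is finite the increments of [q j] decay like [2 ^ (- j)]; elsewhere the
    limit is set to 0. *)
Lemma energy_limit : exists (l : R -> R), [/\ mfun R l, forall s, s <= 0 -> l s = 0 &
 forall m, (line_energy (fun s => l s - q m s)%R <= (64 * 4^-1 ^+ m)%:E)%E].
Proof.
have pt (s : R) : exists z : R, [/\ s <= 0 -> z = 0,
  (fun j => if (W s < +oo)%E then q j s else 0) @ \oo --> z &
  forall m, ((s * (z - q m s) ^+ 2)%:E <= (4 * 4^-1 ^+ m)%:E * W s)%E].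
 have [s0|s0] := leP s 0.
  exists 0; split => //.
  - by under eq_fun do rewrite q0// if_same; exact: cvg_cst.
  - by move=> m; rewrite q0// subrr expr0n/= mulr0 mule_ge0// ?lee_fin ?mulr_ge0 ?exprn_ge0 ?invr_ge0// nneseries_ge0.
 have W0 : (0 <= W s)%E by apply: nneseries_ge0.
 case Woo : (W s < +oo)%E; last first.
  move: Woo => /negbT; rewrite -leNgt leye_eq => /eqP Wy; exists 0; split => //; first exact: cvg_cst.
  by move=> m; rewrite Wy gt0_muley ?leey// lte_fin mulr_gt0// exprn_gt0// invr_gt0.
 have [v Wv] : exists v, W s = v%:E by move: W0 Woo; case: (W s) => // v; exists v.
 have v0 : 0 <= v by rewrite -lee_fin -Wv.
 have dj j : `|q j.+1 s - q j s| <= Num.sqrt (v / s) * 2^-1 ^+ j.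
  have le : (w j s <= v%:E)%E.
   rewrite -Wv; apply: le_trans (nneseries_lim_ge j.+1 _) => //.
   by rewrite big_nat_recr//=; apply: leeDr; exact: sume_ge0.
  rewrite -ler_sqr ?nnegrE ?mulr_ge0 ?exprn_ge0 ?invr_ge0 ?sqrtr_ge0//.
  rewrite real_normK ?num_real// exprMn sqr_sqrtr ?divr_ge0 ?(ltW s0)//.
  rewrite exprAC; have -> : 2^-1 ^+ 2 = 4^-1 :> R by field.
  rewrite mulrAC ler_pdivlMr// exprVn ler_pdivlMr ?exprn_gt0//.
  by move: le; rewrite lee_fin; apply: le_trans; apply: le_of_eq; ring.
 have [z [cz bz]] := geometric_cvg dj; exists z; split => //.
 move=> m; rewrite Wv -EFinM lee_fin.
  have : `|z - q m s| ^+ 2 <= (2 * Num.sqrt (v / s) * 2^-1 ^+ m) ^+ 2.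
   by rewrite lerXn2r ?nnegrE ?normr_ge0 ?mulr_ge0 ?exprn_ge0 ?invr_ge0 ?sqrtr_ge0//; exact: bz.
  rewrite real_normK ?num_real// !exprMn sqr_sqrtr ?divr_ge0 ?(ltW s0)// exprAC.
  have -> : 2^-1 ^+ 2 = 4^-1 :> R by field.
  move=> h; apply: (le_trans (ler_wpM2l (ltW s0) h)).
  by apply: le_of_eq; field; rewrite gt_eqF.
have [l lP] := choice pt.
have mb : mfun R (fun s => (W s < +oo)%E).
 exact: (@measurable_fun_lte _ (mline R) R setT W (fun=> +oo%E) mW (measurable_cst _)).
have ml : mfun R l.
 apply: (@measurable_fun_cvg _ (mline R) R setT (fun j s => if (W s < +oo)%E then q j s else 0)).
  by move=> j; exact: (@measurable_fun_ifT _ _ (mline R) (mline R) (q j) (fun=> 0) _ mb (mq j) (measurable_cst _)).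
 by move=> s _; case: (lP s).
exists l; split => //.
- by move=> s; case: (lP s).
- move=> m; apply: (@le_trans _ _ (\int[leb]_(s in DD) ((4 * 4^-1 ^+ m)%:E * W s))%E).
  apply: (ge0_le_integral leb mDD) => /=.
  - by move=> s; rewrite /DD/= in_itv/= andbT => s0; rewrite lee_fin mulr_ge0 ?sqr_ge0// ltW.
  - by apply/measurable_EFinP/measurable_funTS; apply: measurable_energy; exact: measurable_funB.
  - by apply: measurable_funTS; apply: measurable_funeM.
  - by move=> s _; case: (lP s).
 rewrite (ge0_integralZl leb mDD).
 - apply: (@le_trans _ _ ((4 * 4^-1 ^+ m)%:E * 16%:E)%E).
   by apply: lee_wpmul2l; [rewrite lee_fin mulr_ge0// exprn_ge0// invr_ge0|exact: intW].
  by rewrite -EFinM lee_fin mulrAC; lra.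
 - by apply: measurable_funTS; exact: mW.
 - by move=> s _; apply: nneseries_ge0 => n _ _; exact: w0.
 - by rewrite lee_fin mulr_ge0// exprn_ge0// invr_ge0.
Qed.

(** [a^2 <= (1 + t) b^2 + (1 + 1 / t) (a - b)^2] with [t = 2 ^ (- m)]: the squared error [4 ^ (- m)]
    survives the division by [t]. *)
Lemma line_energy_limit (l : R -> R) (E C : R) : 0 <= E -> 0 <= C -> mfun R l ->
 (forall m, (line_energy (q m) <= (E + 16^-1 ^+ m)%:E)%E) ->
 (forall m, (line_energy (fun s => l s - q m s)%R <= (C * 4^-1 ^+ m)%:E)%E) ->
 (line_energy l <= E%:E)%E.
Proof.
move=> E0 C0 ml hE hC.
have bd m : (line_energy l <= (E + (E + 2 + 2 * C) * 2^-1 ^+ m)%:E)%E.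
 have t0 : 0 < 2^-1 ^+ m :> R by rewrite exprn_gt0// invr_gt0.
 set t : R := 2^-1 ^+ m in t0 *.
 have t1 : t <= 1 by rewrite exprn_ile1 ?invr_ge0// invf_le1// ler1n.
 have mE (u : R -> R) : mfun R u -> measurable_fun DD (fun s => (s * u s ^+ 2)%:E).
  by move=> mu; apply/measurable_EFinP/measurable_funTS; exact: measurable_energy.
 have p0 (u : R -> R) (s : R) : DD s -> (0 <= (s * u s ^+ 2)%:E)%E.
  by rewrite /DD/= in_itv/= andbT lee_fin => s0; rewrite mulr_ge0 ?sqr_ge0// ltW.
 have mB' : mfun R (fun s => l s - q m s) by exact: measurable_funB.
 apply: (@le_trans _ _ ((1 + t)%:E * line_energy (q m) + (1 + t^-1)%:E * line_energy (fun s => l s - q m s)%R)%E).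
  have k1 : 0 <= 1 + t by rewrite addr_ge0// ltW.
  have k2 : 0 <= 1 + t^-1 by rewrite addr_ge0// invr_ge0 ltW.
  rewrite /line_energy -!ge0_integralZl//; try exact: mE; try exact: p0;
   try by move=> s Ds; rewrite (p0 (fun s => l s - q m s) s Ds).
  rewrite -ge0_integralD//; try (by apply: measurable_funeM; exact: mE);
   try (by move=> s Ds; rewrite mule_ge0//; rewrite ?(p0 (q m) s Ds) ?(p0 (fun s => l s - q m s) s Ds)).
  apply: ge0_le_integral => //; try exact: mE; try exact: p0.
  - by apply: emeasurable_funD; apply: measurable_funeM; exact: mE.
  move=> s; rewrite /DD/= in_itv/= andbT => s0; rewrite -!EFinM -EFinD lee_fin.
  move: (l s) (q m s) => a b.
  have -> : (1 + t) * (s * b ^+ 2) + (1 + t^-1) * (s * (a - b) ^+ 2) = s * ((1 + t) * b ^+ 2 + (1 + t^-1) * (a - b) ^+ 2) by ring.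
  rewrite ler_pM2l//.
  have -> : (1 + t) * b ^+ 2 + (1 + t^-1) * (a - b) ^+ 2 = a ^+ 2 + t^-1 * (t * b - (a - b)) ^+ 2.
   by field; rewrite gt_eqF.
  by rewrite lerDl mulr_ge0 ?sqr_ge0// invr_ge0 ltW.
 apply: (@le_trans _ _ ((1 + t)%:E * (E + 16^-1 ^+ m)%:E + (1 + t^-1)%:E * (C * 4^-1 ^+ m)%:E)%E).
  apply: leeD; apply: lee_wpmul2l => //; rewrite lee_fin addr_ge0 ?invr_ge0// ltW//.
 have -> : 4^-1 ^+ m = t * t :> R by rewrite /t -exprMn; congr (_ ^+ _); field.
 have -> : 16^-1 ^+ m = t * (t * (t * t)) :> R by rewrite /t -!exprMn; congr (_ ^+ _); field.
 rewrite -!EFinM -EFinD lee_fin.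
 have tt : t * t <= t by rewrite ler_piMl// ltW.
 have t4 : t * (t * (t * t)) <= t.
  by rewrite ler_piMr ?(ltW t0)// (le_trans _ t1)// ler_piMr ?(ltW t0)// (le_trans tt).
 have Ctt : C * (t * t) <= C * t by rewrite ler_wpM2l.
 have -> : (1 + t^-1) * (C * (t * t)) = C * (t * t) + C * t by field; rewrite gt_eqF.
 have h1 : (1 + t) * (t * (t * (t * t))) <= 2 * t.
  by apply: ler_pM => //; [rewrite addr_ge0// ltW|rewrite !mulr_ge0// ltW|lra].
 by move: h1 Ctt; rewrite mulrDr; move: (_ * (t * (t * _))) (C * (t * t)) => a b; lra.
have le1 := bd 0%N; have ge0 := line_energy_ge0 l.
move: bd le1 ge0; case: (line_energy l) => [z| |]// bd _ _.
rewrite lee_fin; apply: (@le_geometric _ _ _ (E + 2 + 2 * C)) => m.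
by have := bd m; rewrite lee_fin.
Qed.

End energy_limit.

(** * Weak derivatives of L^2 limits *)

Section weak_limit.
Context {R : realType}.
Notation P := (mplane R).

(** Young's inequality with weight [2 ^ (- n)], which balances the squared distance [4 ^ (- n)]. *)
Lemma pairing_close (f fn psi : P -> R) (C M A : R) (n : nat) (Q : set P) :
 f \in Lfun (leb2 R) 2%:E -> fn \in Lfun (leb2 R) 2%:E -> mfun P psi ->
 measurable Q -> leb2 R Q = A%:E -> (forall x, `|psi x| <= M * \1_Q x) ->
 (\int[leb2 R]_x ((f x - fn x) ^+ 2)%:E <= (C * 4^-1 ^+ n)%:E)%E ->
 `|fine (\int[leb2 R]_x (f x * psi x)%:E)%E - fine (\int[leb2 R]_x (fn x * psi x)%:E)%E| <= (C + M ^+ 2 * A) * 2^-1 ^+ n.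
Proof.
move=> fL fnL mpsi mQ QA bpsi fC.
have Qoo : (leb2 R Q < +oo)%E by rewrite QA ltry.
have i1 := Lfun2_integrable_bounded fL mpsi mQ Qoo bpsi.
have i2 := Lfun2_integrable_bounded fnL mpsi mQ Qoo bpsi.
have mf := Lfun2_measurable fL; have mfn := Lfun2_measurable fnL.
have mD : mfun P (fun x => f x - fn x) by exact: measurable_funB.
rewrite -fineB ?integrable_fin_num// -integralB//.
apply: (@le_trans _ _ (fine (\int[leb2 R]_x `|((f x * psi x)%:E - (fn x * psi x)%:E)%E|)%E)).
 have iB := integrableB measurableT i1 i2.
 rewrite -fine_abse ?integrable_fin_num//; apply: fine_le => //.
 - by rewrite abse_fin_num integrable_fin_num.
 - by apply: integrable_fin_num => //; exact: integrable_abse.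
 - by apply: le_abse_integral => //; case/integrableP: iB.
set t : R := 2^-1 ^+ n.
have t0 : 0 < t by rewrite exprn_gt0// invr_gt0.
have tt : 4^-1 ^+ n = t * t by rewrite /t -exprMn; congr (_ ^+ _); field.
suff : (\int[leb2 R]_x `|((f x * psi x)%:E - (fn x * psi x)%:E)%E| <= ((C + M ^+ 2 * A) * t)%:E)%E.
 have : (0 <= \int[leb2 R]_x `|((f x * psi x)%:E - (fn x * psi x)%:E)%E|)%E by exact: integral_ge0.
 by case: (\int[leb2 R]_x _)%E => [z| |]//= _; rewrite lee_fin.
apply: (@le_trans _ _ (\int[leb2 R]_x ((t^-1)%:E * ((f x - fn x) ^+ 2)%:E + (t * M ^+ 2)%:E * (\1_Q x)%:E))%E).
 apply: ge0_le_integral => //=.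
 - apply/measurable_EFinP; apply: measurableT_comp => //; apply: measurable_funB; exact: measurable_funM.
 - by apply: emeasurable_funD; apply: measurable_funeM; apply/measurable_EFinP; [exact: measurable_funX|exact: measurable_indic].
 move=> x _; rewrite -mulrBl -!EFinM -EFinD lee_fin.
 have h := bpsi x; have p0 := normr_ge0 (psi x); have d0 := normr_ge0 (f x - fn x).
 rewrite normrM -[(f x - fn x) ^+ 2]real_normK ?num_real//.
 move: (`|f x - fn x|) (`|psi x|) d0 p0 h => a b a0 b0.
 have tV : 0 < t^-1 by rewrite invr_gt0.
 rewrite indicE; case: (x \in Q) => /=; rewrite ?mulr1 ?mulr0.
  move=> bM; apply: (@le_trans _ _ (a * M)); first by rewrite ler_wpM2l.
  have : 0 <= t^-1 * (a - t * M) ^+ 2 by rewrite mulr_ge0 ?sqr_ge0// ltW.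
  have -> : t^-1 * (a - t * M) ^+ 2 = t^-1 * a ^+ 2 - 2 * (a * M) + t * M ^+ 2 by field; rewrite gt_eqF.
  have : 0 <= a * M by rewrite mulr_ge0// (le_trans b0).
  move: (a * M) (t^-1 * a ^+ 2) (t * M ^+ 2) => x1 x2 x3; lra.
 move=> b0'; have -> : b = 0 by apply/eqP; rewrite eq_le b0' b0.
 by rewrite mulr0 addr0 mulr_ge0 ?sqr_ge0// ltW.
rewrite ge0_integralD//; last 4 first.
- by move=> x _; rewrite -EFinM lee_fin mulr_ge0 ?sqr_ge0// invr_ge0 ltW.
- by apply: measurable_funeM; apply/measurable_EFinP; exact: measurable_funX.
- by move=> x _; rewrite -EFinM lee_fin mulr_ge0 ?indicE// mulr_ge0 ?sqr_ge0// ltW.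
- by apply: measurable_funeM; apply/measurable_EFinP; exact: measurable_indic.
rewrite !ge0_integralZl//; try (by rewrite lee_fin ?mulr_ge0 ?sqr_ge0 ?invr_ge0// ltW);
 try (by move=> x _; rewrite lee_fin ?sqr_ge0); try (by move=> x _; rewrite lee_fin indicE); try (by apply/measurable_EFinP; first [exact: measurable_funX|exact: measurable_indic]).
rewrite integral_indic// setIT [X in (_ + _ * X)%E]QA -EFinM.
apply: (@le_trans _ _ ((t^-1)%:E * (C * 4^-1 ^+ n)%:E + (t * M ^+ 2 * A)%:E)%E).
 by rewrite leeD2r// lee_wpmul2l// lee_fin invr_ge0 ltW.
rewrite -EFinM -EFinD lee_fin tt; apply: le_of_eq; field; rewrite gt_eqF//.
by rewrite lee_fin mulr_ge0 ?sqr_ge0// ltW.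
Qed.

Lemma weak_partial_L2_limit (v : plane R) (u h : P -> R) (un hn : nat -> P -> R) (C : R) :
 (forall phi : P -> R, test_function phi -> continuous ('D_v phi : R * R -> R)) ->
 u \in Lfun (leb2 R) 2%:E -> h \in Lfun (leb2 R) 2%:E ->
 (forall n, un n \in Lfun (leb2 R) 2%:E /\ hn n \in Lfun (leb2 R) 2%:E) ->
 (forall n, (\int[leb2 R]_x ((u x - un n x) ^+ 2)%:E <= (C * 4^-1 ^+ n)%:E)%E) ->
 (forall n, (\int[leb2 R]_x ((h x - hn n x) ^+ 2)%:E <= (C * 4^-1 ^+ n)%:E)%E) ->
 (forall n, weak_partial v (un n) (hn n)) -> weak_partial v u h.
Proof.
move=> cD uL hL nL uC hC wn phi tphi; have cDphi := cD phi tphi.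
have cphi : continuous (phi : R * R -> R) by case: (tphi) => /(_ 0%N).
have [L [M [L0 _ bphi bD]]] := test_function_bounds tphi cDphi.
have mQ := measurable_box (- L) L (- L) L.
have LL : - L <= L by lra.
have QA := leb2_box LL LL.
have mphi := continuous_plane_measurable cphi; have mDphi := continuous_plane_measurable cDphi.
have Qoo : (leb2 R (box (- L) L (- L) L) < +oo)%E by rewrite QA ltry.
have iu := Lfun2_integrable_bounded uL mDphi mQ Qoo bD.
have ih := Lfun2_integrable_bounded hL mphi mQ Qoo bphi.
set K := C + M ^+ 2 * ((L - - L) * (L - - L)).
have close n : `|fine (\int[leb2 R]_x (u x * 'D_v phi x)%:E)%E + fine (\int[leb2 R]_x (h x * phi x)%:E)%E| <= 0 + 2 * K * 2^-1 ^+ n.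
 have [unL hnL] := nL n.
 have c1 := pairing_close uL unL mDphi mQ QA bD (uC n).
 have c2 := pairing_close hL hnL mphi mQ QA bphi (hC n).
 have := wn n phi tphi => e; move: c1; rewrite e fineN opprK => c1.
 rewrite add0r -mulrA mulr_natl mulr2n; move: c1 c2; rewrite -/K.
 move: (fine _) (fine _) (fine _) => a b c c1 c2.
 have -> : c + a = (c + b) + (a - b) by ring.
 by apply: (le_trans (ler_normD _ _)); exact: lerD.
have := le_geometric close; rewrite normr_le0 addr_eq0 => /eqP e.
rewrite -[LHS]fineK ?integrable_fin_num// e EFinN fineK// integrable_fin_num//.
Qed.

End weak_limit.

(** * Realisation of profiles by radial functions *)

Section attained.
Context {R : realType}.
Notation leb := (@lebesgue_measure R).
Notation P := (mplane R).
Variables (X : R -> R) (E B : R).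
Hypotheses (adm : admissible X E B) (X0 : forall s, s <= 0 -> X s = 0).

(** As [c ^+ 2 * (4 * pi) = 1], the norms of the radial function agree with those of the profile. *)
Let c : R := (Num.sqrt (4 * pi))^-1.
Let c2 : c ^+ 2 * (4 * pi) = 1.
Proof. by rewrite /c exprVn sqr_sqrtr ?mulVf// ?mulr_ge0 ?pi_ge0// mulf_neq0// gt_eqF// pi_gt0. Qed.

Let mX : mfun R X. Proof. by case: adm. Qed.

Lemma integral_radial_sqr_normal (f : R -> R) : mfun R f -> (forall s, s <= 0 -> f s = 0) ->
 (\int[leb2 R]_x (radial (fun s => c * f s) x ^+ 2)%:E = \int[leb]_(s in `]0%R, +oo[) (f s ^+ 2)%:E)%E.
Proof.
move=> mf f0; rewrite integral_radial_sqr; last 2 first.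
- exact: measurable_funM.
- by move=> s s0; rewrite f0// mulr0.
under eq_integral do rewrite exprMn EFinM.
rewrite ge0_integralZl//.
- by rewrite muleA -EFinM mulrC c2 mul1e.
- by apply/measurable_EFinP/measurable_funTS; exact: measurable_funX.
- by move=> s _; rewrite lee_fin sqr_ge0.
- by rewrite lee_fin sqr_ge0.
Qed.

Lemma integral_radial_gradient_normal (f : R -> R) : mfun R f -> (forall s, s <= 0 -> f s = 0) ->
 (\int[leb2 R]_x ((radial_gradient (fun s => c * f s) x).1 ^+ 2 + (radial_gradient (fun s => c * f s) x).2 ^+ 2)%:E =
  line_energy f)%E.
Proof.
move=> mf f0; rewrite integral_radial_gradient; last 2 first.
- exact: measurable_funM.
- by move=> s s0; rewrite f0// mulr0.
have e (s : R) : s * (c * f s) ^+ 2 = c ^+ 2 * (s * f s ^+ 2) by ring.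
under eq_integral do rewrite e EFinM.
rewrite ge0_integralZl//.
- by rewrite muleA -EFinM mulrC c2 mul1e.
- by apply/measurable_EFinP/measurable_funTS; exact: measurable_energy.
- by move=> s; rewrite /= in_itv/= andbT => s0; rewrite lee_fin mulr_ge0 ?sqr_ge0// ltW.
- by rewrite lee_fin sqr_ge0.
Qed.

Lemma scaled_energy (f : R -> R) : mfun R f ->
 line_energy (fun s => c * f s) = ((c ^+ 2)%:E * line_energy f)%E.
Proof.
move=> mf; rewrite /line_energy -ge0_integralZl//.
- by apply: eq_integral => s _; rewrite -EFinM; congr (_%:E); ring.
- by apply/measurable_EFinP/measurable_funTS; exact: measurable_energy.
- by move=> s; rewrite /= in_itv/= andbT => s0; rewrite lee_fin mulr_ge0 ?sqr_ge0// ltW.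
- by rewrite lee_fin sqr_ge0.
Qed.

(** The approximants are differentiable on the positive axis, so their radial functions are in H^1.
    Values and gradients converge in L^2, and the weak derivatives pass to the limit. *)
Lemma radial_realization : exists q : R -> R,
 [/\ mfun R q, forall s, s <= 0 -> q s = 0, (line_energy q <= E%:E)%E &
 H1_grad (radial (fun s => c * X s)) (radial_gradient (fun s => c * q s))].
Proof.
have [Y [qn yq]] := minimizing_approximants adm.
have mY j : mfun R (Y j) by case: (yq j) => [[[]]].
have mq j : mfun R (qn j) by case: (yq j) => [[[]]].
have Y0 j s : s <= 0 -> Y j s = 0 by case: (yq j) => [[_ h _ _] _ _] /h [].
have q0 j s : s <= 0 -> qn j s = 0 by case: (yq j) => [[_ h _ _] _ _] /h [].
have [q [mq' q'0 qlim]] := energy_limit mq q0 (fun j => let: And3 _ _ h := yq j in h).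
have [_ _ _ _ [E0 XB _]] := adm.
have qE : (line_energy q <= E%:E)%E.
 apply: (@line_energy_limit _ qn mq q E 64) => //; by move=> m; case: (yq m).
exists q; split => //.
have mc (f : R -> R) : mfun R f -> mfun R (fun s => c * f s) by move=> mf; exact: measurable_funM.
have z0 (f : R -> R) : (forall s, s <= 0 -> f s = 0) -> forall s, s <= 0 -> c * f s = 0 by move=> h s s0; rewrite h// mulr0.
have sub0 (f g : R -> R) : (forall s, s <= 0 -> f s = 0) -> (forall s, s <= 0 -> g s = 0) -> forall s, s <= 0 -> f s - g s = 0.
 by move=> h1 h2 s s0; rewrite h1// h2// subrr.
have enfin (f : R -> R) (K : R) : mfun R f -> (line_energy f <= K%:E)%E ->
  (line_energy (fun s => c * f s)%R < +oo)%E.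
 move=> mf h; rewrite scaled_energy//; apply: (@le_lt_trans _ _ ((c ^+ 2)%:E * K%:E)%E); last by rewrite -EFinM ltry.
 by apply: lee_wpmul2l => //; rewrite lee_fin sqr_ge0.
have uL : radial (fun s => c * X s) \in Lfun (leb2 R) 2%:E.
 apply: Lfun2_of_sqr; first by apply: measurable_radial; exact: mc.
 by rewrite integral_radial_sqr_normal// XB ltry.
have [g1L g2L] := radial_gradient_Lfun2 (mc _ mq') (z0 _ q'0) (enfin _ _ mq' qE).
have XY j : (\int[leb]_(s in `]0%R, +oo[) ((X s - Y j s) ^+ 2)%:E <= (4^-1 ^+ j)%:E)%E.
 case: (yq j) => [[_ _ _ h] _ _]; apply: le_trans h; apply: le_of_eq.
 by apply: eq_integral => s _; rewrite -sqrrN opprB.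
have Yfin j : (\int[leb]_(s in `]0%R, +oo[) ((c * Y j s) ^+ 2)%:E < +oo)%E.
 have mB : mfun R (fun s => X s - Y j s) by exact: measurable_funB.
 have mK (f : R -> R) : mfun R f ->
  measurable_fun (`]0%R, +oo[%classic : set (mline R)) (fun s => (f s ^+ 2)%:E).
  by move=> mf; apply/measurable_EFinP/measurable_funTS; exact: measurable_funX.
 apply: (@le_lt_trans _ _ (\int[leb]_(s in `]0%R, +oo[) ((2 * c ^+ 2)%:E * (X s ^+ 2)%:E + (2 * c ^+ 2)%:E * ((X s - Y j s) ^+ 2)%:E))%E).
  apply: ge0_le_integral => //=.
  - by move=> s _; rewrite lee_fin sqr_ge0.
  - by apply: mK; exact: mc.
  - by apply: emeasurable_funD; apply: measurable_funeM; exact: mK.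
  - move=> s _; rewrite -!EFinM -EFinD lee_fin exprMn; move: (X s) (Y j s) => a b.
   have -> : 2 * c ^+ 2 * a ^+ 2 + 2 * c ^+ 2 * (a - b) ^+ 2 = c ^+ 2 * (2 * (a ^+ 2 + (a - b) ^+ 2)) by ring.
   rewrite ler_wpM2l ?sqr_ge0// -subr_ge0.
   have -> : 2 * (a ^+ 2 + (a - b) ^+ 2) - b ^+ 2 = (2 * a - b) ^+ 2 by ring.
   exact: sqr_ge0.
 have k0 : 0 <= 2 * c ^+ 2 by rewrite mulr_ge0 ?sqr_ge0.
 rewrite ge0_integralD//; try (by apply: measurable_funeM; exact: mK);
  try (by move=> s _; rewrite -EFinM lee_fin mulr_ge0 ?sqr_ge0).
 rewrite !ge0_integralZl//; try exact: mK; try (by move=> s _; rewrite lee_fin sqr_ge0).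
 rewrite XB -EFinM; apply: lte_add_pinfty; first by rewrite ltry.
 apply: (@le_lt_trans _ _ ((2 * c ^+ 2)%:E * (4^-1 ^+ j)%:E)%E); last by rewrite -EFinM ltry.
 by apply: lee_wpmul2l => //; rewrite lee_fin.
have hn j : H1_grad (radial (fun s => c * Y j s)) (radial_gradient (fun s => c * qn j s)).
 case: (yq j) => [[_ _ dY _] hE _].
 apply: radial_H1; try exact: mc; try exact: (z0 _ (Y0 j)); try exact: (z0 _ (q0 j)); try exact: Yfin.
 - exact: (enfin _ _ (mq j) hE).
 - move=> s s0; have [d _] := dY s s0; have := is_deriveZ c d.
  have -> : c \*: Y j = (fun s => c * Y j s) by apply/funext.
  by rewrite /GRing.scale/= mulrN.
 - by move=> s s0; have [_ d] := dY s s0; first [apply: cvgMl_tmp; exact: d|apply: cvgM; [exact: cvg_cst|exact: d]].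
have cu j : (\int[leb2 R]_x ((radial (fun s => c * X s) x - radial (fun s => c * Y j s) x) ^+ 2)%:E <= (64 * 4^-1 ^+ j)%:E)%E.
 apply: (@le_trans _ _ (4^-1 ^+ j)%:E); last by rewrite lee_fin ler_peMl ?ler1n// exprn_ge0// invr_ge0.
 apply: le_trans (XY j); rewrite -integral_radial_sqr_normal; [|exact: measurable_funB|by apply: sub0 => //; exact: Y0].
 by apply: le_of_eq; apply: eq_integral => x _; rewrite /radial mulrBr.
have cg j : (\int[leb2 R]_x (((radial_gradient (fun s => c * q s) x).1 - (radial_gradient (fun s => c * qn j s) x).1) ^+ 2 +
  ((radial_gradient (fun s => c * q s) x).2 - (radial_gradient (fun s => c * qn j s) x).2) ^+ 2)%:E <= (64 * 4^-1 ^+ j)%:E)%E.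
 apply: le_trans (qlim j); rewrite -integral_radial_gradient_normal; [|exact: measurable_funB|by apply: sub0 => //; exact: q0].
 apply: le_of_eq; apply: eq_integral => x _; congr (_%:E).
 by rewrite /radial_gradient/=; ring.
have mg (f : R -> R) : mfun R f ->
  mfun P (fst \o radial_gradient f) /\ mfun P (snd \o radial_gradient f).
 have mr (f' : R -> R) : mfun R f' -> mfun P (fun x => - f' (rho x)).
  by move=> mf; apply: measurable_funN; exact: measurable_radial.
 move=> mf; split; apply: measurable_funM; try exact: mr.
 - by apply: measurable_funM => //; exact: measurable_fst.
 - by apply: measurable_funM => //; exact: measurable_snd.
have gL j := let: And5 a b c d e := hn j in (conj (conj a b) (conj (conj c d) e)).
have [mg1 mg2] := mg _ (mc _ mq').
have mgn j := mg _ (mc _ (mq j)).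
split => //.
- apply: (@weak_partial_L2_limit R (1, 0) _ _ (fun j => radial (fun s => c * Y j s)) (fun j => fst \o radial_gradient (fun s => c * qn j s)) 64) => //.
 + by move=> phi [ck _]; have [_ _ h _] := ck 1%N; exact: h.
 + by move=> n; case: (gL n) => [[? ?] _].
 + move=> n; apply: le_trans (cg n); apply: ge0_le_integral => //=.
  * by move=> x _; rewrite lee_fin sqr_ge0.
  * apply/measurable_EFinP; apply: measurable_funX; apply: measurable_funB => //; by case: (mgn n).
  * by apply/measurable_EFinP; apply: measurable_funD; apply: measurable_funX; apply: measurable_funB => //; case: (mgn n).
  * by move=> x _; rewrite lee_fin lerDl sqr_ge0.
 + by move=> n; case: (gL n) => [_ [[_ ?] _]].
- apply: (@weak_partial_L2_limit R (0, 1) _ _ (fun j => radial (fun s => c * Y j s)) (fun j => snd \o radial_gradient (fun s => c * qn j s)) 64) => //.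
 + by move=> phi [ck _]; have [_ _ _ h] := ck 1%N; exact: h.
 + by move=> n; case: (gL n) => [[? _] [[? _] _]].
 + move=> n; apply: le_trans (cg n); apply: ge0_le_integral => //=.
  * by move=> x _; rewrite lee_fin sqr_ge0.
  * apply/measurable_EFinP; apply: measurable_funX; apply: measurable_funB => //; by case: (mgn n).
  * by apply/measurable_EFinP; apply: measurable_funD; apply: measurable_funX; apply: measurable_funB => //; case: (mgn n).
  * by move=> x _; rewrite lee_fin lerDr sqr_ge0.
 + by move=> n; case: (gL n) => [_ [_ ?]].
Qed.

End attained.

(** * Correspondence between functions on the plane and profiles *)

Section plane_profile.
Context {R : realType}.
Notation leb := (@lebesgue_measure R).
Notation P := (mplane R).

Let pi4 : 0 < 4 * pi :> R. Proof. by rewrite mulr_gt0// pi_gt0. Qed.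
Let r4 : 0 < Num.sqrt (4 * pi) :> R. Proof. by rewrite sqrtr_gt0. Qed.

(** Profiles carry a factor [sqrt (4 pi)], so the parameter [lam] on the plane becomes
    [lam / power_scale p] on the half-line. *)
Definition power_scale (p : R) : R := Num.sqrt (4 * pi) `^ p.

Lemma power_scale_gt0 p : 0 < power_scale p. Proof. exact: powR_gt0. Qed.

Lemma integral_sub_scaled (f1 f2 : P -> R) (mu a b : R) :
 mfun P f1 -> mfun P f2 -> (forall x, 0 <= f1 x) -> (forall x, 0 <= f2 x) ->
 (\int[leb2 R]_x (f1 x)%:E = a%:E)%E -> (\int[leb2 R]_x (f2 x)%:E = b%:E)%E ->
 (\int[leb2 R]_x (f1 x - mu * f2 x)%:E = (a - mu * b)%:E)%E.
Proof.
move=> m1 m2 p1 p2 h1 h2.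
have i (f : P -> R) (z : R) : mfun P f -> (forall x, 0 <= f x) ->
  (\int[leb2 R]_x (f x)%:E = z%:E)%E -> (leb2 R).-integrable [set: P] (EFin \o f).
 move=> mf f0 fz; apply/integrableP; split; first exact/measurable_EFinP.
 rewrite (eq_integral (fun x => (f x)%:E)); last by move=> x _; rewrite /= ger0_norm.
 by rewrite fz ltry.
have i1 := i f1 a m1 p1 h1; have i2 := i f2 b m2 p2 h2.
under eq_integral do rewrite EFinB EFinM.
rewrite integralB//; last exact: integrableZl.
by rewrite integralZl// h1 h2.
Qed.

Lemma measurable_exp_sqr_sub1 : mfun R (fun y : R => expR (y ^+ 2) - 1).
Proof. by apply: measurable_funB => //; apply: measurableT_comp => //; exact: measurable_funX. Qed.

Lemma TM_functional_value (u : P -> R) (lam p a b : R) : 2 < p -> mfun P u ->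
 (\int[leb2 R]_x (expR ((Num.sqrt (4 * pi) * `|u x|) ^+ 2) - 1)%:E = (4 * pi * a)%:E)%E ->
 (\int[leb2 R]_x ((Num.sqrt (4 * pi) * `|u x|) `^ p)%:E = (4 * pi * b)%:E)%E ->
 TM_functional lam p u = (4 * pi * (a - lam / power_scale p * b))%:E.
Proof.
move=> p2 mu h1 h2; have mau : mfun P (fun x => Num.sqrt (4 * pi) * `|u x|).
 by apply: measurable_funM => //; exact: measurableT_comp.
rewrite /TM_functional.
have e x : expR (4 * pi * u x ^+ 2) - 1 - lam * `|u x| `^ p =
  (expR ((Num.sqrt (4 * pi) * `|u x|) ^+ 2) - 1) - lam / power_scale p * (Num.sqrt (4 * pi) * `|u x|) `^ p.
 rewrite exprMn sqr_sqrtr ?(ltW pi4)// real_normK ?num_real// powRM ?(ltW r4)// -/(power_scale p).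
 by rewrite mulrA mulfVK// gt_eqF// power_scale_gt0.
under eq_integral do rewrite e.
rewrite (integral_sub_scaled (lam / power_scale p) _ _ _ _ h1 h2).
- by congr (_%:E); ring.
- exact: (measurableT_comp measurable_exp_sqr_sub1 mau).
- exact: (measurableT_comp (@measurable_powR R p) mau).
- by move=> x; rewrite subr_ge0 -[leLHS]expR0 ler_expR sqr_ge0.
- by move=> x; exact: powR_ge0.
Qed.

Lemma profile_of_H1 (u : plane R -> R) p : 2 < p -> H1_norm_le1 u ->
 exists X E B, admissible X E B /\
  forall lam, TM_functional lam p u = (4 * pi * profile_value (lam / power_scale p) p X)%:E.
Proof.
move=> p2 [g ug le1]; have uL := ug; case: uL => uL g1L g2L _ _.
have mu := Lfun2_measurable uL; have mg1 := Lfun2_measurable g1L; have mg2 := Lfun2_measurable g2L.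
have m1 : mfun P (fun x => (g x).1 ^+ 2 + (g x).2 ^+ 2).
 by apply: measurable_funD; apply: measurable_funX.
have m2 : mfun P (fun x => u x ^+ 2) by exact: measurable_funX.
have p1 (x : P) : (0 <= ((g x).1 ^+ 2 + (g x).2 ^+ 2)%:E)%E by rewrite lee_fin addr_ge0 ?sqr_ge0.
have p0 (x : P) : (0 <= (u x ^+ 2)%:E)%E by rewrite lee_fin sqr_ge0.
move: le1; under eq_integral do rewrite EFinD.
rewrite ge0_integralD//; [|exact/measurable_EFinP|exact/measurable_EFinP].
have I1 : (0 <= \int[leb2 R]_x ((g x).1 ^+ 2 + (g x).2 ^+ 2)%:E)%E by exact: integral_ge0.
have I2 : (0 <= \int[leb2 R]_x (u x ^+ 2)%:E)%E by exact: integral_ge0.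
case gE : (\int[leb2 R]_x ((g x).1 ^+ 2 + (g x).2 ^+ 2)%:E)%E I1 => [E| |]// E0;
 case uB : (\int[leb2 R]_x (u x ^+ 2)%:E)%E I2 => [B| |]// B0.
rewrite -EFinD lee_fin => EB; rewrite !lee_fin in E0 B0.
have uM : (\int[leb2 R]_x (u x ^+ 2)%:E <= B%:E)%E by rewrite uB.
have gM : (\int[leb2 R]_x ((g x).1 ^+ 2 + (g x).2 ^+ 2)%:E <= E%:E)%E by rewrite gE.
pose X := profile u.
have XB : (\int[leb]_(s in `]0%R, +oo[) (X s ^+ 2)%:E = B%:E)%E.
 have sq : (\int[leb2 R]_x ((Num.sqrt (4 * pi) * `|u x|) ^+ 2)%:E = (4 * pi)%:E * \int[leb]_(s in `]0%R, +oo[) (X s ^+ 2)%:E)%E.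
  apply: (equimeasurable mu uM (F := fun y => y ^+ 2)).
  - exact: measurable_funX.
  - by rewrite expr0n.
  - by move=> y _; exact: sqr_ge0.
  move=> c c0; exists (Num.sqrt c); first exact: sqrtr_ge0.
  by move=> y y0; rewrite -[c in LHS]sqr_sqrtr// ltr_sqr ?nnegrE ?sqrtr_ge0.
 move: sq; under eq_integral do rewrite exprMn sqr_sqrtr ?(ltW pi4)// real_normK ?num_real// EFinM.
 rewrite ge0_integralZl//; [|exact/measurable_EFinP|by rewrite lee_fin ltW].
 rewrite uB; case: (\int[leb]_(s in _) _)%E => [z| |].
 - by rewrite -!EFinM => -[/(mulfI (lt0r_neq0 pi4)) ->].
 - by rewrite gt0_muley// lte_fin.
 - by rewrite gt0_muleNy// lte_fin.
have adm : admissible X E B.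
 split.
 - exact: (measurable_profile mu uM).
 - exact: (profile_ge0 mu uM).
 - by move=> s1 s2; exact: (profile_le mu uM).
 - by move=> t D N D0; exact: (profile_energy mu uM t N ug gM D0).
 - by split.
have [f1 f2] := admissible_fine p2 adm.
exists X, E, B; split => // lam; rewrite /profile_value.
apply: TM_functional_value => //.
- rewrite EFinM -f1 /exp_part; apply: (equimeasurable mu uM measurable_exp_sqr_sub1).
 + by rewrite expr0n expR0 subrr.
 + by move=> y _; rewrite subr_ge0 -[leLHS]expR0 ler_expR sqr_ge0.
 + move=> c c0; exists (Num.sqrt (ln (1 + c))); first exact: sqrtr_ge0.
  have c1 : 0 < 1 + c by rewrite ltr_pwDl.
  have l0 : 0 <= ln (1 + c) by rewrite ln_ge0// lerDl.
  move=> y y0; rewrite ltrBrDl -[in LHS](lnK (c1 : 1 + c \is Num.pos)) ltr_expR.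
  by rewrite -[ln _ in LHS]sqr_sqrtr// ltr_sqr ?nnegrE ?sqrtr_ge0.
- rewrite EFinM -f2 /power_part; apply: (equimeasurable mu uM (@measurable_powR R p)).
 + by rewrite powR0// gt_eqF// (lt_trans _ p2).
 + by move=> y _; exact: powR_ge0.
 + have p00 : 0 < p by rewrite (lt_trans _ p2).
  move=> c c0; exists (c `^ p^-1); first exact: powR_ge0.
  move=> y y0; have e : c = (c `^ p^-1) `^ p by rewrite -powRrM mulVf ?powRr1// gt_eqF.
  rewrite [in LHS]e; apply/idP/idP.
   by apply: contraTT; rewrite -!leNgt => h; apply: ge0_ler_powR; rewrite ?nnegrE ?powR_ge0// ltW.
  by move=> h; apply: gt0_ltr_powR; rewrite ?nnegrE ?powR_ge0.
Qed.

Lemma restrict_admissible (X : R -> R) E B : admissible X E B ->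
 admissible (fun s => if 0 < s then X s else 0) E B.
Proof.
move=> [mX X0 Xle Xen [E0 XB EB]]; split.
- exact: measurable_if_pos.
- by move=> s; case: ifP.
- by move=> s1 s2 s10 s12; rewrite s10 (lt_le_trans s10 s12); exact: Xle.
- by move=> t D N D0; under eq_bigr do rewrite !expR_gt0; exact: Xen.
- split => //; rewrite -XB; apply: eq_integral => s; rewrite inE/= in_itv/= andbT => s0.
 by rewrite s0.
Qed.

Lemma H1_of_profile (X : R -> R) E B p : 2 < p -> admissible X E B ->
 exists u, [/\ H1 u, H1_norm_le1 u &
  forall lam, TM_functional lam p u = (4 * pi * profile_value (lam / power_scale p) p X)%:E].
Proof.
move=> p2 adm; have := restrict_admissible adm; set Z := fun s => _ => admZ.
have Z0 s : s <= 0 -> Z s = 0 by move=> s0; rewrite /Z ltNge s0.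
have [q [mq q0 qE uH]] := radial_realization admZ Z0.
have [mZ Zge _ _ [E0 ZB EB]] := admZ.
set c := (Num.sqrt (4 * pi))^-1 in uH.
have mcZ : mfun R (fun s => c * Z s) by exact: measurable_funM.
have [uL g1L g2L _ _] := uH.
have mu := Lfun2_measurable uL; have mg1 := Lfun2_measurable g1L; have mg2 := Lfun2_measurable g2L.
exists (radial (fun s => c * Z s)); split.
- by exists (radial_gradient (fun s => c * q s)).
- exists (radial_gradient (fun s => c * q s)) => //.
 under eq_integral do rewrite EFinD.
 rewrite ge0_integralD//; last 4 first.
 + by move=> x _; rewrite lee_fin addr_ge0 ?sqr_ge0.
 + by apply/measurable_EFinP; apply: measurable_funD; apply: measurable_funX.
 + by move=> x _; rewrite lee_fin sqr_ge0.
 + by apply/measurable_EFinP; exact: measurable_funX.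
 rewrite integral_radial_gradient_normal// integral_radial_sqr_normal// ZB.
 by apply: (le_trans (leeD2r _ qE)); rewrite -EFinD lee_fin.
have [f1 f2] := admissible_fine p2 adm.
have cZ (x : P) : Num.sqrt (4 * pi) * `|radial (fun s => c * Z s) x| = Z (rho x).
 by rewrite /radial ger0_norm ?mulr_ge0 ?invr_ge0 ?(ltW r4)// mulrA mulfV ?mul1r// gt_eqF.
move=> lam; rewrite /profile_value; apply: TM_functional_value => //.
- under eq_integral do rewrite cZ.
 rewrite (polar (f := fun s => expR (Z s ^+ 2) - 1)).
 + rewrite [RHS]EFinM -f1; congr (_ * _)%E; apply: eq_integral => s; rewrite inE/= in_itv/= andbT => s0.
  by rewrite /Z s0.
 + exact: (measurableT_comp measurable_exp_sqr_sub1 mZ).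
 + by move=> s _; rewrite subr_ge0 -[leLHS]expR0 ler_expR sqr_ge0.
 + by move=> s s0; rewrite Z0// expr0n expR0 subrr.
- under eq_integral do rewrite cZ.
 rewrite (polar (f := fun s => Z s `^ p)).
 + rewrite [RHS]EFinM -f2; congr (_ * _)%E; apply: eq_integral => s; rewrite inE/= in_itv/= andbT => s0.
  by rewrite /Z s0.
 + exact: measurable_pow.
 + by move=> s _; exact: powR_ge0.
 + by move=> s s0; rewrite Z0// powR0// gt_eqF// (lt_trans _ p2).
Qed.

End plane_profile.

(** * Bounds for the one-dimensional problem *)

Section one_dimensional.
Context {R : realType}.
Notation leb := (@lebesgue_measure R).
Implicit Types (X : R -> R) (E B p lam : R).
Let DD : set (mline R) := `]0%R, +oo[%classic.
Let mDD : measurable DD. Proof. exact: measurable_itv. Qed.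

Lemma exp_part_fine X E B p : 2 < p -> admissible X E B ->
 fine (exp_part X) = B + fine (\int[leb]_(s in DD) (exp_remainder (X s))%:E)%E /\
 (\int[leb]_(s in DD) (exp_remainder (X s))%:E < +oo)%E.
Proof.
move=> p2 adm; have [a _] := admissible_finite p2 adm; have sp := exp_part_split adm.
have G0 : (0 <= \int[leb]_(s in DD) (exp_remainder (X s))%:E)%E.
 by apply: integral_ge0 => s _; rewrite lee_fin exp_remainder_ge0.
have G1 : (\int[leb]_(s in DD) (exp_remainder (X s))%:E < +oo)%E.
 by apply: le_lt_trans a; rewrite sp leeDr// lee_fin (admissible_B_ge0 adm).
by split => //; rewrite sp fineD// ge0_fin_numE.
Qed.

Lemma power_part_pointwise X E B p s : 2 < p -> admissible X E B -> 0 < s ->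
 X s `^ p * s <= fine (power_part p X).
Proof.
move=> p2 adm s0; have [_ f2] := admissible_fine p2 adm; have [mX X0 Xle _ _] := adm.
rewrite -lee_fin -f2 /power_part (integral_splitoy (ltW s0)); last 2 first.
- exact: measurable_pow.
- by move=> x _; exact: powR_ge0.
apply: (@le_trans _ _ (\int[leb]_(x in `]0%R, s]) (X s `^ p)%:E)%E).
 by rewrite integral_cst// [X in (_ * X)%E](leb_itvoc (ltW s0)) subr0 EFinM.
apply: (@le_trans _ _ (\int[leb]_(x in `]0%R, s]) (X x `^ p)%:E)%E).
 apply: le_integral_line => //; first exact: measurable_pow.
 - by move=> x _; exact: powR_ge0.
 - move=> x /=; rewrite in_itv/= => /andP[x0 xs]; apply: ge0_ler_powR; rewrite ?nnegrE//; first by lra.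
  exact: Xle.
by rewrite leeDl// integral_ge0// => x _; rewrite lee_fin powR_ge0.
Qed.

(** Each alternative of the dichotomy gives a bound independent of the profile: through the integral
    of the dominating function, or [999 / 1000]. *)
Lemma uniform_bound p : 2 < p -> exists K, forall X E B, admissible X E B ->
 fine (exp_part X) <= K /\ fine (power_part p X) <= K.
Proof.
move=> p2; have [C [s0 [C0 s00 s01 dic]]] := dichotomy 1 (ltW p2).
have [h [mh hoo hP]] := tail_dominated p2 C0 s00 s01.
pose M := fine (\int[leb]_(s in DD) (h s)%:E).
have hM X E B (f : R -> R) : admissible X E B -> mfun R f ->
  (forall s, 0 < s -> 0 <= f s) -> (forall s, 0 < s -> f s <= h s) ->
  0 <= M /\ fine (\int[leb]_(s in DD) (f s)%:E)%E <= M.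
 move=> adm mf f0 fh.
 have I0 : (0 <= \int[leb]_(s in DD) (f s)%:E)%E.
  by apply: integral_ge0 => s; rewrite /DD/= in_itv/= andbT lee_fin => /f0.
 have le : (\int[leb]_(s in DD) (f s)%:E <= \int[leb]_(s in DD) (h s)%:E)%E.
  by apply: (le_integral_line mDD) => // s; rewrite /DD/= in_itv/= andbT => s1; [exact: f0|exact: fh].
 have foo := le_lt_trans le hoo.
 have I1 := le_trans I0 le.
 split; first by rewrite /M fine_ge0.
 by apply: fine_le => //; rewrite ge0_fin_numE.
clearbody M; exists (`|M| + 1) => X E B adm; have [mX _ _ _ _] := adm.
have [f1 f2] := admissible_fine p2 adm.
have e0 : 0 <= fine (exp_part X) by rewrite fine_ge0// exp_part_ge0.
have q0 : 0 <= fine (power_part p X) by rewrite fine_ge0// power_part_ge0.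
have M0 := normr_ge0 M; have MM := ler_norm M.
have [tail|] := dic X E B adm; clear dic; last first.
 by rewrite normr1 mul1e -/(exp_part X) -/(power_part p X) f1 f2 -EFinD lee_fin => h1; split; lra.
have tP := hP _ _ _ adm tail.
have [r1 r2] := exp_part_fine p2 adm; have B1 := admissible_B_le1 adm.
have [_ h1] := hM _ _ _ (fun s => exp_remainder (X s)) adm (measurable_remainder mX) (fun s _ => exp_remainder_ge0 _) (fun s s0 => (tP s s0).1).
have [_ h2] := hM _ _ _ (fun s => X s `^ p) adm (measurable_pow p mX) (fun s _ => powR_ge0 _ _) (fun s s0 => (tP s s0).2).
by split; [rewrite r1; lra|rewrite /power_part -/DD; lra].
Qed.

(** Here [p <= 4] enters: [x ^ 4 <= x ^ p] on [[0, 1]]. *)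
Lemma remainder_le_power p (x : R) : 2 < p -> p <= 4 -> 0 <= x -> x <= 1 ->
 exp_remainder x <= expR 1 * x `^ p.
Proof.
move=> p2 p4 x0 x1; apply: le_trans (exp_remainder_le x) _.
have [->|xn] := eqVneq x 0.
 by rewrite expr0n/= expr0n/= mul0r mulr_ge0 ?expR_ge0 ?powR_ge0.
have xp : 0 < x by rewrite lt0r xn.
rewrite mulrC; apply: ler_pM; rewrite ?expR_ge0 ?exprn_ge0//.
 by rewrite ler_expR expr_le1.
rewrite -exprM -powR_mulrn//; apply: ger_powR => //.
by rewrite xp.
Qed.

(* The set where [X > 1] lies in ]0, 2 s] for some [s] with [X s > 1], so that
  [inner_bound] controls the remainder there by [s] and hence by the power part. *)
Lemma remainder_le_power_part X E B p : 2 < p -> p <= 4 -> admissible X E B -> E <= 2^-1 ->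
 fine (\int[leb]_(s in DD) (exp_remainder (X s))%:E)%E <= (4 * expR 3 + expR 1) * fine (power_part p X).
Proof.
move=> p2 p4 adm E2; have [mX X0 Xle Xen [E0 XB EB]] := adm.
have [f1 f2] := admissible_fine p2 adm.
have [_ Roo] := exp_part_fine p2 adm.
have R0 : (0 <= \int[leb]_(s in DD) (exp_remainder (X s))%:E)%E.
 by apply: integral_ge0 => s _; rewrite lee_fin exp_remainder_ge0.
have Q0 : 0 <= fine (power_part p X) by rewrite fine_ge0// power_part_ge0.
suff : (\int[leb]_(s in DD) (exp_remainder (X s))%:E <= ((4 * expR 3 + expR 1) * fine (power_part p X))%:E)%E.
 by move: R0 Roo; case: (\int[leb]_(s in DD) _)%E => [z| |]//=; rewrite lee_fin.
have mP : mfun R (fun s => expR 1 * X s `^ p).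
 by apply: measurable_funM => //; exact: measurable_pow.
have Pint (A : set (mline R)) : measurable A ->
  (\int[leb]_(s in A) (expR 1 * X s `^ p)%:E = (expR 1)%:E * \int[leb]_(s in A) (X s `^ p)%:E)%E.
 move=> mA; under eq_integral do rewrite EFinM.
 rewrite (ge0_integralZl leb mA)//.
 - by apply/measurable_EFinP/measurable_funTS; exact: measurable_pow.
 - by move=> s _; rewrite lee_fin powR_ge0.
have far s1 : 0 <= s1 -> (forall s, s1 < s -> X s <= 1) ->
  (\int[leb]_(s in `]s1, +oo[) (exp_remainder (X s))%:E <= (expR 1)%:E * (fine (power_part p X))%:E)%E.
 move=> s10 h; rewrite -f2.
 apply: (@le_trans _ _ (\int[leb]_(s in `]s1, +oo[) (expR 1 * X s `^ p)%:E)%E).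
  apply: le_integral_line => //; first exact: measurable_remainder.
  - by move=> s _; exact: exp_remainder_ge0.
  - by move=> s /=; rewrite in_itv/= andbT => s1s; apply: remainder_le_power => //; exact: h.
 rewrite Pint//; apply: lee_wpmul2l; first by rewrite lee_fin expR_ge0.
 rewrite /power_part (integral_splitoy s10); last 2 first.
 - exact: measurable_pow.
 - by move=> x _; exact: powR_ge0.
 by rewrite leeDr// integral_ge0// => s _; rewrite lee_fin powR_ge0.
have [[n Xn]|none] := pselect (exists n : nat, 1 < X (2^-1 ^+ n)); last first.
 have le1 s : 0 < s -> X s <= 1.
  move=> s0; rewrite leNgt; apply/negP => Xs; apply: none.
  have c : geometric 1 2^-1 @ \oo --> (0 : R) by apply: cvg_geometric; rewrite ger0_norm ?invr_ge0// invf_lt1 ?ltr1n.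
  have [N _ NP] := (cvgrPdist_lt _ _).1 c _ s0.
  have := NP N (leqnn N); rewrite /geometric/= sub0r normrN mul1r ger0_norm ?exprn_ge0 ?invr_ge0// => hN.
  exists N; apply: (lt_le_trans Xs); apply: Xle; [by rewrite exprn_gt0// invr_gt0|exact: ltW].
 have := far 0 (lexx 0) le1; move/le_trans; apply.
 by rewrite -EFinM lee_fin ler_wpM2r// lerDr mulr_ge0// expR_ge0.
(* The least [m] gives the largest dyadic [s] with [X s > 1]; then [X (2 s) <= 1], and [s] is at
   most the power part. *)
have [m Xm mmin] := ex_minnP (ex_intro (fun n => 1 < X (2^-1 ^+ n)) n Xn).
have m0 : (0 < m)%N.
 rewrite lt0n; apply/eqP => e; move: Xm; rewrite e expr0 ltNge => /negP; apply.
 have := admissible_sqr_le adm ltr01; have := admissible_B_le1 adm; rewrite mulr1 => B1 h.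
 by rewrite -(@expr_le1 _ 2)//; exact: le_trans B1.
pose s := 2^-1 ^+ m : R.
have s0 : 0 < s by rewrite exprn_gt0// invr_gt0.
have s2 : 2 * s = 2^-1 ^+ m.-1 by rewrite /s -(prednK m0) exprS/= mulrA mulfV ?mul1r.
have X2 : X (2 * s) <= 1.
 rewrite s2 leNgt; apply/negP => h; have := mmin _ h.
 by rewrite leqNgt ltn_predL m0.
have sP : s <= fine (power_part p X).
 apply: le_trans (power_part_pointwise p2 adm s0); rewrite ler_peMl ?(ltW s0)//.
 apply: (@le_trans _ _ (1 `^ p)); first by rewrite powR1.
 apply: ge0_ler_powR; rewrite ?nnegrE//; [lra|exact: ltW].
pose T := - ln (2 * s).
have eT : expR (- T) = 2 * s by rewrite opprK lnK// posrE mulr_gt0.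
(* [inner_bound] with [delta = E <= 1 / 2] and a starting value at most 1: the constant is at most
   [2 s * expR (1 + 2) / (1 / 2)]. *)
have near_ : (\int[leb]_(x in `]0%R, (2 * s)%R]) (expR (X x ^+ 2))%:E <= (4 * expR 3 * s)%:E)%E.
 have E01 : 0 <= E < 1 by rewrite E0; lra.
 have := @inner_bound R X E B adm T E E01; rewrite eT => /(_ _)/le_trans; apply.
  by move=> K N; apply: Xen; rewrite divr_gt0 ?invr_gt0.
 have -> : 4 * expR 3 * s = 2 * s * (expR 3 / 2^-1) :> R by field.
 have i1 : 0 < 1 - E by lra.
 have i2 : 2^-1 <= 1 - E by lra.
 rewrite lee_fin ler_pM2l ?mulr_gt0//; apply: ler_pM; rewrite ?expR_ge0 ?invr_ge0 ?(ltW i1)//; last by rewrite lef_pV2 ?posrE ?invr_gt0.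
 rewrite ler_expR; have q : X (2 * s) ^+ 2 <= 1 by rewrite expr_le1.
 have : X (2 * s) ^+ 2 / (1 - E) <= 2 by rewrite ler_pdivrMr//; lra.
 lra.
rewrite (@integral_splitoy R (fun x => exp_remainder (X x)) (2 * s)); last 3 first.
- by rewrite mulr_ge0// ltW.
- exact: measurable_remainder.
- by move=> x _; exact: exp_remainder_ge0.
rewrite [((_ + expR 1) * _)%R]mulrDl EFinD; apply: leeD; last first.
 rewrite EFinM; apply: far; first by rewrite mulr_ge0// ltW.
 by move=> x sx; apply: le_trans X2; apply: Xle; [rewrite mulr_gt0|exact: ltW].
apply: le_trans (_ : (4 * expR 3 * s)%:E <= _)%E; last by rewrite lee_fin ler_wpM2l// mulr_ge0// expR_ge0.
apply: le_trans near_; apply: le_integral_line => //.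
- exact: measurable_remainder.
- exact: measurable_exp_sqr.
- by move=> x _; exact: exp_remainder_ge0.
- by move=> x _; rewrite /exp_remainder -addrA gerDl -opprD oppr_le0 addr_ge0// sqr_ge0.
Qed.

(** By contradiction, take profiles of value above 1 for parameters tending to infinity. Their
    energy exceeds [1 / 2], since otherwise the power part pays for the remainder. The power part
    tends to 0, hence so do [X] pointwise and the remainder, and the value falls below
    [B + 1 / 4 < 1]. *)
Lemma large_lambda p : 2 < p -> p <= 4 -> exists L, forall lam X E B, L <= lam -> admissible X E B ->
 profile_value lam p X <= 1.
Proof.
move=> p2 p4; apply: contrapT => /forallNP no.
(* The offset is the constant of [remainder_le_power_part]. *)
pose L0 n : R := 4 * expR 3 + expR 1 + n.+1%:R.
have stage (n : nat) : exists XEB : (R -> R) * R * R,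
  [/\ admissible XEB.1.1 XEB.1.2 XEB.2 & 1 < fine (exp_part XEB.1.1) - L0 n * fine (power_part p XEB.1.1)].
 apply: contrapT => /forallNP h; apply: (no (L0 n)) => lam X E B lamL adm.
 rewrite leNgt; apply/negP => J1; apply: (h (X, E, B)); split => //=.
 apply: lt_le_trans J1 _; rewrite /profile_value lerD2l lerN2 ler_wpM2r ?fine_ge0 ?power_part_ge0//.
have [f fP] := choice stage.
pose X n := (f n).1.1; pose E n := (f n).1.2; pose B n := (f n).2.
have adm n : admissible (X n) (E n) (B n) by case: (fP n).
have P0 n : 0 <= fine (power_part p (X n)) by rewrite fine_ge0// power_part_ge0.
have big n : 1 < fine (exp_part (X n)) - L0 n * fine (power_part p (X n)) by case: (fP n).
have e0 : 0 < expR 3 :> R by exact: expR_gt0.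
have e1 : 0 < expR 1 :> R by exact: expR_gt0.
have En n : 2^-1 < E n.
 rewrite ltNge; apply/negP => E2.
 have := remainder_le_power_part p2 p4 (adm n) E2; have [r1 _] := exp_part_fine p2 (adm n).
 have B1 := admissible_B_le1 (adm n); have := big n; rewrite r1 /L0 mulrDl.
 have : 0 <= n.+1%:R * fine (power_part p (X n)) by rewrite mulr_ge0.
 by move: (n.+1%:R * _) ((4 * _ + _) * _) => a b; lra.
have [C [s0 [C0 s00 s01 dic]]] := dichotomy 0 (ltW p2).
have [h [mh hoo hP]] := tail_dominated p2 C0 s00 s01.
have tail n s : 0 < s -> exp_remainder (X n s) <= h s /\ X n s `^ p <= h s.
 move=> sp; have [t|] := dic _ _ _ (adm n); first exact: (hP _ _ _ (adm n) t s sp).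
 rewrite normr0 mul0e adde0 -/(exp_part (X n)); have [-> _] := admissible_fine p2 (adm n).
 rewrite lee_fin => small; have := big n.
 have : 0 <= L0 n * fine (power_part p (X n)) by rewrite mulr_ge0// /L0 addr_ge0// addr_ge0 ?mulr_ge0// ltW.
 by move: (L0 n * _) => a; lra.
clear dic; have [K KP] := uniform_bound p2.
have Pn n : fine (power_part p (X n)) <= K / n.+1%:R.
 rewrite ler_pdivlMr//; have [k1 _] := KP _ _ _ (adm n); have := big n; rewrite /L0 mulrDl.
 have : 0 <= (4 * expR 3 + expR 1) * fine (power_part p (X n)) by rewrite mulr_ge0// addr_ge0 ?mulr_ge0 ?ltW.
 by rewrite [fine _ * _]mulrC; move: (n.+1%:R * _) ((4 * _ + _) * _) => a b; lra.
have K0 : 0 <= K by have [_] := KP _ _ _ (adm 0%N); exact: le_trans.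
have cX s : 0 < s -> X n s @[n --> \oo] --> (0 : R).
 move=> sp; apply/cvgrPdist_lt => e ee.
 have ep : 0 < e `^ p * s by rewrite mulr_gt0// powR_gt0.
 have cK : K * n.+1%:R^-1 @[n --> \oo] --> K * 0 by apply: cvgMl_tmp; exact: cvg_harmonic.
 rewrite mulr0 in cK.
 apply: filterS ((cvgrPdist_lt _ _).1 cK _ ep) => n; rewrite sub0r normrN => hn.
 have Xge : 0 <= X n s by case: (adm n).
 rewrite sub0r normrN ger0_norm// ltNge; apply/negP => eX.
 have := power_part_pointwise p2 (adm n) sp; apply/negP; rewrite -ltNge.
 apply: (le_lt_trans (Pn n)); apply: (le_lt_trans (ler_norm _)); apply: (lt_le_trans hn).
 rewrite ler_pM2r//; apply: ge0_ler_powR; rewrite ?nnegrE ?(ltW ee)//; lra.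
have cR : fine (\int[leb]_(s in DD) (exp_remainder (X n s))%:E)%E @[n --> \oo] --> fine (\int[leb]_(s in DD) (0 : R)%:E)%E.
 apply: (@dct_line R (fun n s => exp_remainder (X n s)) (fun=> 0) h _ _ mh _ _ hoo).2.
 - by move=> n; apply: measurable_remainder; case: (adm n).
 - exact: measurable_cst.
 - by move=> n s sp; rewrite exp_remainder_ge0; case: (tail n s sp).
 - move=> s sp; have -> : 0 = expR (0 ^+ 2) - 1 - 0 ^+ 2 :> R by rewrite expr0n/= expR0 !subrr ?subr0.
  have c2 : X n s ^+ 2 @[n --> \oo] --> (0 ^+ 2 : R) by rewrite expr2; apply: cvgM; exact: cX.
  apply: cvgB => //; apply: cvgB; last exact: cvg_cst.
  by apply: (cvg_comp _ _ c2); exact: continuous_expR.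
rewrite integral0 /= in cR.
have q0 : 0 < 4^-1 :> R by rewrite invr_gt0.
have [N _ NP] := (cvgrPdist_lt _ _).1 cR _ q0.
have := NP N (leqnn N); rewrite /= sub0r normrN => /(le_lt_trans (ler_norm _)) r4.
have [r1 _] := exp_part_fine p2 (adm N); have := big N; rewrite r1.
have : 0 <= L0 N * fine (power_part p (X N)) by rewrite mulr_ge0// /L0 addr_ge0// addr_ge0 ?mulr_ge0// ltW.
have := En N; have [_ _ _ _ [_ _ EB]] := adm N; move: r4.
by move: (fine (\int[leb]_(s in DD) _)%E) (L0 N * _) => a b; lra.
Qed.

End one_dimensional.

(** * Explicit test profiles *)

Section test_profile.
Context {R : realType}.
Notation leb := (@lebesgue_measure R).

(* Apply the mean value theorem to [G - 2 c f + c^2 id] with [c] the slope of the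
  chord of [f]; its derivative is [(f' - c)^2]. *)
Lemma chord_energy (f df G : R -> R) (t D : R) : 0 < D ->
 (forall s : R, is_derive s 1 f (df s)) -> (forall s : R, is_derive s 1 G (df s ^+ 2)) ->
 (f (t + D) - f t) ^+ 2 <= D * (G (t + D) - G t).
Proof.
move=> D0 fD GD; pose c := (f (t + D) - f t) / D.
pose K s := G s + (- 2 * c) * f s + c ^+ 2 * s.
have KD (s : R) : is_derive s 1 K ((df s - c) ^+ 2).
 have h1 := is_deriveZ (- 2 * c) (fD s); have h2 := is_deriveZ (c ^+ 2) (is_derive_id s (1 : R)).
 have := is_deriveD (is_deriveD (GD s) h1) h2.
 have -> : G + (- 2 * c) \*: f + c ^+ 2 \*: id = K by apply/funext.
 by rewrite /GRing.scale/= mulr1; congr (is_derive _ _ _ _); ring.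
have tD : t < t + D by rewrite ltrDl.
have [|x _ e] := @MVT R K (fun s => (df s - c) ^+ 2) t (t + D) tD (fun s _ => KD s).
 apply: continuous_subspaceT => s; apply: differentiable_continuous.
 by apply/derivable1_diffP; case: (KD s).
have {e} : 0 <= K (t + D) - K t by rewrite e mulr_ge0 ?sqr_ge0// subr_ge0 ltW.
have -> : K (t + D) - K t = (G (t + D) - G t) - (f (t + D) - f t) ^+ 2 / D.
 by rewrite /K /c; field; rewrite gt_eqF.
by rewrite subr_ge0 ler_pdivrMr// mulrC.
Qed.

Variables (a b : R).
Hypotheses (a0 : 0 < a) (b0 : 0 < b).

(** In [t = - ln s] this is the logistic function, [w' = w (1 - w)], so the energy and the integrals
    of powers are explicit. *)
Definition bump (s : R) : R := if 0 < s then (1 + b * s)^-1 else 0.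
Definition test_profile (s : R) : R := a * bump s ^+ 2.

Lemma bump_bound s : 0 <= bump s <= 1.
Proof.
rewrite /bump; case: ifP => s0; last by rewrite lexx ler01.
have p : 0 < 1 + b * s by rewrite ltr_pwDl// mulr_ge0// ltW.
by rewrite invr_ge0 (ltW p) invf_le1// lerDl mulr_ge0// ltW.
Qed.

Lemma measurable_bump : mfun R bump.
Proof.
have -> : bump = (fun s => if 0 < s then expR (- ln (1 + b * s)) else 0).
 apply/funext => s; rewrite /bump; case: ifP => // s0.
 have p : 0 < 1 + b * s by rewrite ltr_pwDl// mulr_ge0// ltW.
 by rewrite expRN lnK.
apply: measurable_if_pos; apply: measurableT_comp => //; apply: measurable_funN.
apply: measurableT_comp; first exact: measurable_ln.
by apply: measurable_funD => //; exact: measurable_funM.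
Qed.

Lemma measurable_test_profile : mfun R test_profile.
Proof. by apply: measurable_funM => //; apply: measurable_funX; exact: measurable_bump. Qed.

Let w t := bump (expR (- t)).

Let wD (t : R) : is_derive t 1 w (w t * (1 - w t)).
Proof.
have p0 (s : R) : 0 < 1 + b * expR (- s) by rewrite ltr_pwDl// mulr_ge0 ?expR_ge0// ltW.
have we : w = (fun s => (1 + b * expR (- s))^-1) by apply/funext => s; rewrite /w /bump expR_gt0.
have dN : is_derive t 1 (fun s : R => - s) (- 1).
 exact: (is_deriveN (is_derive_id t (1 : R))).
have dE : is_derive t 1 (fun s : R => expR (- s)) (- expR (- t)).
 have := is_derive1_comp (is_derive_expR (- t)) dN.
 by rewrite mulrN1.
have dA : is_derive t 1 (fun s : R => 1 + b * expR (- s)) (- (b * expR (- t))).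
 have := is_deriveD (is_derive_cst (1 : R) t (1 : R)) (is_deriveZ b dE).
 have -> : cst 1 + b \*: (fun s : R => expR (- s)) = (fun s => 1 + b * expR (- s)) by apply/funext.
 by rewrite add0r /GRing.scale/= mulrN.
rewrite we; have := @is_deriveV R (fun s => 1 + b * expR (- s)) t _ 1 (lt0r_neq0 (p0 t)) dA.
congr (is_derive _ _ _ _); rewrite /GRing.scale/= -exprVn.
by have := p0 t; move: (expR (- t)) => y y0; field; rewrite gt_eqF.
Qed.

(** Times [a ^+ 2], this polynomial in [w] is a primitive of the squared derivative of the test
    profile; its increase is at most [1 / 5], whence the energy [a ^+ 2 / 5]. *)
Let energy_poly_bound (x : R) : 0 <= x <= 1 -> 0 <= x ^+ 4 - 4 / 5 * x ^+ 5 <= 5^-1.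
Proof.
move=> /andP[x0 x1]; apply/andP; split.
 have -> : x ^+ 4 - 4 / 5 * x ^+ 5 = x ^+ 4 * (1 - 4 / 5 * x) by ring.
 by rewrite mulr_ge0 ?exprn_ge0// subr_ge0; lra.
rewrite -subr_ge0.
have -> : 5^-1 - (x ^+ 4 - 4 / 5 * x ^+ 5) = 5^-1 * (1 - x) ^+ 2 * (1 + 2 * x + 3 * x ^+ 2 + 4 * x ^+ 3) by field.
apply: mulr_ge0; first by rewrite mulr_ge0 ?sqr_ge0// invr_ge0.
by rewrite !addr_ge0 ?mulr_ge0 ?exprn_ge0.
Qed.

Lemma test_profile_energy t D N : 0 < D -> \sum_(i < N)
 (test_profile (expR (- (t + i.+1%:R * D))) - test_profile (expR (- (t + i%:R * D)))) ^+ 2 <= D * (a ^+ 2 / 5).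
Proof.
move=> D0; pose G s := a ^+ 2 * (w s ^+ 4 - 4 / 5 * w s ^+ 5).
pose f s := a * w s ^+ 2; pose df s := 2 * a * w s ^+ 2 * (1 - w s).
have fD (s : R) : is_derive s 1 f (df s).
 have := is_deriveZ a (is_deriveX 2 (wD s)).
 have -> : a \*: (w ^+ 2) = f by apply/funext.
 by congr (is_derive _ _ _ _); rewrite /df /GRing.scale/= -mulr_natl; ring.
have GD (s : R) : is_derive s 1 G (df s ^+ 2).
 have := is_deriveZ (a ^+ 2) (is_deriveB (is_deriveX 4 (wD s)) (is_deriveZ (4 / 5) (is_deriveX 5 (wD s)))).
 have -> : a ^+ 2 \*: (w ^+ 4 - (4 / 5) \*: (w ^+ 5)) = G by apply/funext.
 have scaleE (x y : R) : x *: y = x * y by [].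
 by congr (is_derive _ _ _ _); rewrite /df !scaleE/=; move: (w s) => x; field.
apply: (@le_trans _ _ (D * (G (t + N%:R * D) - G t))).
 elim: N => [|n IH]; first by rewrite big_ord0 mul0r addr0 subrr mulr0.
 rewrite big_ord_recr/=; have := chord_energy (t + n%:R * D) D0 fD GD.
 have -> : t + n%:R * D + D = t + n.+1%:R * D by rewrite -natr1; ring.
 move=> h; apply: (le_trans (lerD IH h)).
 by rewrite -mulrDr; move: (G _) (G _) (G _) => x y z; rewrite ler_pM2l//; lra.
have [/andP[g0 _] /andP[_ g1]] := (energy_poly_bound (bump_bound (expR (- t))), energy_poly_bound (bump_bound (expR (- (t + N%:R * D))))).
rewrite ler_pM2l// /G -mulrBr ler_wpM2l ?sqr_ge0//.
move: g0 g1; rewrite -/(w t) -/(w (t + N%:R * D)); move: (w _ ^+ 4 - _) (w _ ^+ 4 - _) => x y; lra.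
Qed.

Lemma bump_integral n : (\int[leb]_(s in `]0%R, +oo[) (bump s ^+ n.+2)%:E = ((n.+1%:R * b)^-1)%:E)%E.
Proof.
have p0 (s : R) : 0 <= s -> 0 < 1 + b * s by move=> s0; rewrite ltr_pwDl// mulr_ge0// ltW.
pose v (s : R) := (1 + b * s)^-1.
pose c := - (n.+1%:R * b)^-1.
have nb : 0 < n.+1%:R * b by rewrite mulr_gt0.
have vD (s : R) : 0 <= s -> is_derive s 1 v (- b * v s ^+ 2).
 move=> s0; have dA : is_derive s 1 (fun s : R => 1 + b * s) b.
  have := is_deriveD (is_derive_cst (1 : R) s (1 : R)) (is_deriveZ b (is_derive_id s (1 : R))).
  have -> : cst 1 + b \*: id = (fun s : R => 1 + b * s) by apply/funext.
  by rewrite add0r /GRing.scale/= mulr1.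
 have := @is_deriveV R (fun s => 1 + b * s) s _ 1 (lt0r_neq0 (p0 s s0)) dA.
 by congr (is_derive _ _ _ _); rewrite /GRing.scale/= /v exprVn !mulNr mulrC.
pose F (s : R) : R := c * v s ^+ n.+1.
have scaleE (x y : R) : x *: y = x * y by [].
have FD (s : R) : 0 <= s -> is_derive s 1 F (v s ^+ n.+2).
 move=> s0; have := is_deriveZ c (is_deriveX n.+1 (vD s s0)).
 have -> : c \*: (v ^+ n.+1) = F by rewrite exprfctE.
 congr (is_derive _ _ _ _); rewrite !scaleE/= /c.
 have -> : v s ^+ n.+2 = v s ^+ 2 * v s ^+ n by rewrite -exprD.
 have := ltr0Sn R n; move: (v s ^+ n) (v s) (n.+1%:R) => x y k k0.
 by field; rewrite !gt_eqF.
have cv (s : R) : 0 <= s -> {for s, continuous v}.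
 by move=> s0; apply: differentiable_continuous; apply/derivable1_diffP; case: (vD s s0).
have cvX m (s : R) : 0 <= s -> v x ^+ m @[x --> s] --> v s ^+ m.
 by move=> s0; apply: (cvg_comp v (fun y => y ^+ m) (cv s s0)); exact: exprn_continuous.
have cF (s : R) : 0 <= s -> {for s, continuous F}.
 by move=> s0; apply: differentiable_continuous; apply/derivable1_diffP; case: (FD s s0).
have H := @ge0_continuous_FTC2y R (fun s => v s ^+ n.+2) F 0 0 _ _ _ _ _ _.
have {}H : (\int[leb]_(x in `[0%R, +oo[) (v x ^+ n.+2)%:E = 0%:E - (F 0)%:E)%E.
 apply: H.
 - by move=> s s0; rewrite exprn_ge0// invr_ge0 ltW// p0.
 - apply/continuous_within_itvcyP; split.
   by move=> s; rewrite in_itv/= andbT => s0; apply: cvX; exact: ltW.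
  by apply: cvg_at_right_filter; exact: cvX.
 - have <- : c * 0 ^+ n.+1 = 0 by rewrite expr0n mulr0.
  apply: cvgMl_tmp; apply: (@cvg_comp _ _ _ v (fun y => y ^+ n.+1) _ (nbhs (0 : R))); last exact: exprn_continuous.
  apply/cvgrPdist_lt => e e0; exists (e^-1 / b); split; first by rewrite num_real.
  move=> s es; rewrite sub0r normrN.
  have s0 : 0 < s by apply: lt_trans es; rewrite divr_gt0 ?invr_gt0.
  rewrite ger0_norm ?invr_ge0 ?(ltW (p0 _ (ltW s0)))//.
  rewrite invf_plt ?posrE ?p0 ?(ltW s0)//; move: es; rewrite ltr_pdivrMr// mulrC; lra.
 - by move=> s s0; case: (FD s (ltW s0)).
 - by apply: cvg_at_right_filter; exact: (cF 0 (lexx 0)).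
 - move=> s; rewrite in_itv/= andbT => s0; rewrite derive1E; by case: (FD s (ltW s0)) => _ ->.
transitivity (\int[leb]_(x in `]0%R, +oo[) (v x ^+ n.+2)%:E)%E.
 by apply: eq_integral => s; rewrite inE/= in_itv/= andbT => s0; rewrite /bump s0.
rewrite integral_itv_obnd_cbnd ?H; last first.
 apply: (@eq_measurable_fun _ _ (mline R) _ _ (fun s => (bump s ^+ n.+2)%:E)).
  by move=> s; rewrite inE/= in_itv/= andbT => s0; rewrite /bump s0.
 by apply/measurable_EFinP/measurable_funTS; apply: measurable_funX; exact: measurable_bump.
rewrite /F /v mulr0 addr0 invr1 expr1n mulr1 /c -EFinB sub0r opprK//.
Qed.

Lemma test_profile_sqr : (\int[leb]_(s in `]0%R, +oo[) (test_profile s ^+ 2)%:E = (a ^+ 2 / (3 * b))%:E)%E.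
Proof.
have e s : test_profile s ^+ 2 = a ^+ 2 * bump s ^+ 4 by rewrite /test_profile exprMn -exprM.
under eq_integral do rewrite e EFinM.
rewrite ge0_integralZl//.
- by rewrite bump_integral -EFinM.
- by apply/measurable_EFinP/measurable_funTS; apply: measurable_funX; exact: measurable_bump.
- by move=> s _; rewrite lee_fin exprn_ge0//; case/andP: (bump_bound s).
- by rewrite lee_fin sqr_ge0.
Qed.

Lemma test_profile_four : (\int[leb]_(s in `]0%R, +oo[) (test_profile s ^+ 4)%:E = (a ^+ 4 / (7 * b))%:E)%E.
Proof.
have e s : test_profile s ^+ 4 = a ^+ 4 * bump s ^+ 8 by rewrite /test_profile exprMn -exprM.
under eq_integral do rewrite e EFinM.
rewrite ge0_integralZl//.
- by rewrite bump_integral -EFinM.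
- by apply/measurable_EFinP/measurable_funTS; apply: measurable_funX; exact: measurable_bump.
- by move=> s _; rewrite lee_fin exprn_ge0//; case/andP: (bump_bound s).
- by rewrite lee_fin exprn_ge0// ltW.
Qed.

Lemma test_profile_admissible : a ^+ 2 / 5 + a ^+ 2 / (3 * b) <= 1 ->
 admissible test_profile (a ^+ 2 / 5) (a ^+ 2 / (3 * b)).
Proof.
move=> EB; split.
- exact: measurable_test_profile.
- by move=> s; rewrite mulr_ge0 ?sqr_ge0// ltW.
- move=> s1 s2 s10 s12; rewrite ler_pM2l// lerXn2r ?nnegrE//; first by case/andP: (bump_bound s2).
  by case/andP: (bump_bound s1).
 rewrite /bump s10 (lt_le_trans s10 s12) lef_pV2 ?posrE ?ltr_pwDl ?mulr_ge0 ?(ltW b0) ?(ltW s10)//; last by lra.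
 by rewrite lerD2l ler_pM2l.
- by move=> t D N D0; exact: test_profile_energy.
- by split => //; [rewrite divr_ge0// sqr_ge0|exact: test_profile_sqr].
Qed.

End test_profile.

(** * Values above 1 and the threshold *)

Section threshold.
Context {R : realType}.
Notation leb := (@lebesgue_measure R).
Implicit Types (X : R -> R) (E B p lam mu : R).
Let DD : set (mline R) := `]0%R, +oo[%classic.
Let mDD : measurable DD. Proof. exact: measurable_itv. Qed.

Lemma exp_quadratic (y : R) : 0 <= y -> 1 + y + y ^+ 2 / 2 <= expR y.
Proof.
move=> y0; have -> : 1 + y + y ^+ 2 / 2 = series (exp_coeff y) 3.
 by rewrite /series/= !big_nat_recr//= big_geq// /exp_coeff/= !factS fact0 expr0 expr1; field.
apply: nondecreasing_cvgn_le; last exact: is_cvg_series_exp_coeff.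
by apply: nondecreasing_series => n _ _; exact: exp_coeff_ge0.
Qed.

(** The width [b] makes [E + B = 1]. The remainder is at least half the integral of [X ^+ 4], which
    gives [3 / 14 * a ^+ 2 * B], and [X ^ p <= a ^ (p - 2) * X ^+ 2]. *)
Lemma test_value lam p (a : R) : 2 < p -> 0 < a -> a <= 1 -> exists X E B, admissible X E B /\
 (1 - a ^+ 2 / 5) * (1 + 3 / 14 * a ^+ 2 - `|lam| * a `^ (p - 2)) <= profile_value lam p X.
Proof.
move=> p2 a0 a1; have aa0 : 0 < a ^+ 2 by rewrite exprn_gt0.
have aa1 : a ^+ 2 <= 1 by rewrite expr_le1// ltW.
set x := a ^+ 2 / 5; have x0 : 0 <= x by rewrite divr_ge0// ltW.
have x1 : 0 < 1 - x by rewrite /x; lra.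
pose b := a ^+ 2 / (3 * (1 - x)).
have b0 : 0 < b by rewrite divr_gt0// mulr_gt0.
have B1 : a ^+ 2 / (3 * b) = 1 - x by rewrite /b; field; rewrite !gt_eqF.
have B2 : a ^+ 4 / (7 * b) = 3 / 7 * a ^+ 2 * (1 - x).
 by rewrite /b; field; rewrite !gt_eqF.
have adm : admissible (test_profile a b) x (1 - x).
 by rewrite -B1; apply: test_profile_admissible => //; rewrite B1 /x; lra.
exists (test_profile a b), x, (1 - x); split => //.
have [mX X0 _ _ [_ XB _]] := adm.
have [e1 Roo] := exp_part_fine p2 adm; have [f1 f2] := admissible_fine p2 adm.
have rem : 3 / 14 * a ^+ 2 * (1 - x) <= fine (\int[leb]_(s in DD) (exp_remainder (test_profile a b s))%:E)%E.
 have R0 : (0 <= \int[leb]_(s in DD) (exp_remainder (test_profile a b s))%:E)%E.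
  by apply: integral_ge0 => s _; rewrite lee_fin exp_remainder_ge0.
 suff : ((3 / 14 * a ^+ 2 * (1 - x))%:E <= \int[leb]_(s in DD) (exp_remainder (test_profile a b s))%:E)%E.
  by move: R0 Roo; case: (\int[leb]_(s in DD) _)%E => [z| |]//=; rewrite lee_fin.
 have -> : ((3 / 14 * a ^+ 2 * (1 - x))%:E = (2^-1)%:E * (a ^+ 4 / (7 * b))%:E)%E.
  by rewrite B2 -EFinM; congr (_%:E); field.
 rewrite -test_profile_four// -ge0_integralZl//; last 2 first.
 - by apply/measurable_EFinP/measurable_funTS; exact: measurable_funX.
 - by move=> s _; rewrite lee_fin exprn_ge0.
 under eq_integral do rewrite -EFinM.
 apply: (le_integral_line mDD).
 - by apply: measurable_funM => //; exact: measurable_funX.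
 - exact: measurable_remainder.
 - by move=> s _; rewrite mulr_ge0 ?exprn_ge0.
 - move=> s _; have := exp_quadratic (sqr_ge0 (test_profile a b s)).
  rewrite /exp_remainder (_ : test_profile a b s ^+ 4 = (test_profile a b s ^+ 2) ^+ 2); last by rewrite -exprM.
  by move: (test_profile a b s ^+ 2) => z; move: (z ^+ 2) (expR z) => u1 u2; lra.
have Xa s : test_profile a b s <= a.
 have /andP[h0 h1] := bump_bound b0 s; rewrite /test_profile ler_piMr ?(ltW a0)//.
 by rewrite expr_le1.
have pow : fine (power_part p (test_profile a b)) <= a `^ (p - 2) * (1 - x).
 rewrite -lee_fin -f2 /power_part EFinM -XB -ge0_integralZl//; last 3 first.
 - by apply/measurable_EFinP/measurable_funTS; exact: measurable_funX.
 - by move=> s _; rewrite lee_fin sqr_ge0.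
 - by rewrite lee_fin powR_ge0.
 under [leRHS]eq_integral do rewrite -EFinM.
 apply: (le_integral_line mDD).
 - exact: measurable_pow.
 - by apply: measurable_funM => //; exact: measurable_funX.
 - by move=> s _; exact: powR_ge0.
 - move=> s _; have Xs := X0 s; have [->|Xn] := eqVneq (test_profile a b s) 0.
   by rewrite powR0 ?gt_eqF ?expr0n ?mulr0//; lra.
  have -> : test_profile a b s `^ p = test_profile a b s `^ (p - 2) * test_profile a b s ^+ 2.
   by rewrite -powR_mulrn// -powRD ?subrK//; apply/implyP => _.
  by rewrite ler_wpM2r ?sqr_ge0//; apply: ge0_ler_powR; rewrite ?nnegrE ?(ltW a0)//; lra.
rewrite /profile_value e1.
have P0 : 0 <= fine (power_part p (test_profile a b)) by rewrite fine_ge0// power_part_ge0.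
have lP : lam * fine (power_part p (test_profile a b)) <= `|lam| * (a `^ (p - 2) * (1 - x)).
 apply: (le_trans (ler_wpM2r P0 (ler_norm lam))); by rewrite ler_wpM2l.
rewrite mulrC mulrBl mulrDl mul1r; move: lP rem; rewrite mulrA.
by move: (lam * _) (_ * _ * (1 - x)) (fine (\int[leb]_(s in DD) _)%E) (3 / 14 * _ * _) => u1 u2 u3 u4; lra.
Qed.

Lemma small_power (K q e : R) : 0 <= K -> 0 < q -> 0 < e ->
 exists a : R, [/\ 0 < a, a <= 4^-1, a ^+ 2 <= e & K * a `^ q <= e].
Proof.
move=> K0 q0 e0; pose z := e / (K + 1).
have K1 : 0 < K + 1 by rewrite ltr_wpDl.
have z0 : 0 < z by rewrite divr_gt0.
pose a := Num.min 4^-1 (Num.min e (z `^ q^-1)).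
have a0 : 0 < a by rewrite !lt_min invr_gt0 e0 powR_gt0// ltr0n.
have a4 : a <= 4^-1 by rewrite ge_min lexx.
have ae : a <= e by rewrite !ge_min lexx orbT.
have az : a <= z `^ q^-1 by rewrite !ge_min lexx !orbT.
exists a; split => //.
 by apply: le_trans ae; rewrite expr2 ler_piMl ?(ltW a0)//; lra.
have : a `^ q <= z.
 have -> : z = (z `^ q^-1) `^ q by rewrite -powRrM mulVf ?powRr1 ?gt_eqF// ltW.
 by apply: ge0_ler_powR; rewrite ?nnegrE ?powR_ge0// ltW.
move=> h; apply: (le_trans (ler_wpM2l K0 h)).
rewrite /z mulrA ler_pdivrMr// [leRHS]mulrC ler_wpM2r ?(ltW e0)//; lra.
Qed.

(** To first order in [a ^+ 2] the gain [3 / 14] exceeds the energy cost [1 / 5] by [1 / 70]; a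
    power term of [1 / 100] still leaves [3 / 700], and [a <= 1 / 4] controls the second order. *)
Lemma value_gt1 lam p (a : R) : 2 < p -> 0 < a -> a <= 4^-1 -> `|lam| * a `^ (p - 2) <= a ^+ 2 / 100 ->
 exists X E B, admissible X E B /\ 1 < profile_value lam p X.
Proof.
move=> p2 a0 a4 h; have a1 : a <= 1 by lra.
have [X [E [B [adm le]]]] := test_value lam p2 a0 a1.
exists X, E, B; split => //; apply: lt_le_trans le.
have aa : a ^+ 2 <= 16^-1.
 have -> : 16^-1 = 4^-1 ^+ 2 :> R by field.
 by rewrite lerXn2r ?nnegrE ?(ltW a0)// invr_ge0.
have aa0 : 0 < a ^+ 2 by rewrite exprn_gt0.
move: h aa aa0; move: (`|lam| * _) (a ^+ 2) => t x h x16 x0.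
apply: (@lt_le_trans _ _ ((1 - x / 5) * (1 + 3 / 14 * x - x / 100))); last first.
 by rewrite ler_wpM2l//; lra.
rewrite -subr_gt0.
have -> : (1 - x / 5) * (1 + 3 / 14 * x - x / 100) - 1 = x * (3 / 700 - x * (143 / 3500)) by field.
apply: mulr_gt0; first exact: x0.
by lra.
Qed.

Lemma value_near1 lam p (e : R) : 2 < p -> 0 < e ->
 exists X E B, admissible X E B /\ 1 - e < profile_value lam p X.
Proof.
move=> p2 e0; have q0 : 0 < p - 2 by lra.
have e4 : 0 < e / 4 by rewrite divr_gt0.
have [a [a0 a4 ae h]] := small_power (normr_ge0 lam) q0 e4.
have a1 : a <= 1 by lra.
have [X [E [B [adm le]]]] := test_value lam p2 a0 a1.
exists X, E, B; split => //; apply: lt_le_trans le.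
have t0 : 0 <= `|lam| * a `^ (p - 2) by rewrite mulr_ge0// powR_ge0.
have aa0 : 0 < a ^+ 2 by rewrite exprn_gt0.
have aa1 : a ^+ 2 <= 1 by rewrite expr_le1// ltW.
move: h t0 ae aa0 aa1; move: (`|lam| * _) (a ^+ 2) => t x ht t0 hx x0 x1.
apply: (@lt_le_trans _ _ ((1 - x / 5) * (1 - t))); last by rewrite ler_wpM2l//; lra.
have -> : (1 - x / 5) * (1 - t) = 1 - x / 5 - t + x / 5 * t by ring.
have : 0 <= x / 5 * t by rewrite mulr_ge0// divr_ge0// ltW.
by move: (x / 5 * t) => y; lra.
Qed.

Lemma TM_sup_value lam p S : 2 < p ->
 (forall X E B, admissible X E B -> profile_value (lam / power_scale p) p X <= S) ->
 (forall e : R, 0 < e -> exists X E B, admissible X E B /\ S - e < profile_value (lam / power_scale p) p X) ->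
 TM_sup lam p = (4 * pi * S)%:E.
Proof.
move=> p2 ub near1; have pi4 : 0 < 4 * pi :> R by rewrite mulr_gt0// pi_gt0.
apply/eqP; rewrite eq_le; apply/andP; split.
 apply: ge_ereal_sup => _ [u [_ u1] <-].
 have [X [E [B [adm ->]]]] := profile_of_H1 p2 u1.
 by rewrite lee_fin ler_pM2l//; exact: ub adm.
apply/lee_addgt0Pr => e e0.
have [X [E [B [adm J]]]] := near1 (e / (4 * pi)) (divr_gt0 e0 pi4).
have [u [uH u1 uJ]] := H1_of_profile p2 adm.
apply: (@le_trans _ _ (TM_functional lam p u + e%:E)%E); last first.
 by apply: leeD2r; apply: ereal_sup_ubound; exists u.
rewrite uJ -EFinD lee_fin.
have : 4 * pi * (S - e / (4 * pi)) <= 4 * pi * profile_value (lam / power_scale p) p X by rewrite ler_pM2l// ltW.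
have -> : 4 * pi * (S - e / (4 * pi)) = 4 * pi * S - e by rewrite mulrBr [X in _ - X]mulrC mulfVK ?gt_eqF.
by rewrite lerBlDr.
Qed.

Lemma attained_of_value_gt1 lam p : 2 < p ->
 (exists X E B, admissible X E B /\ 1 < profile_value (lam / power_scale p) p X) -> TM_attained lam p.
Proof.
move=> p2 [X0 [E0 [B0 [adm0 J0]]]]; set mu := lam / power_scale p in J0 *.
pose V : set R := [set r | exists X E B, admissible X E B /\ r = profile_value mu p X].
have [K KP] := uniform_bound p2.
have Vub : has_ubound V.
 exists (K + `|mu| * K) => _ [X [E [B [adm ->]]]]; have [k1 k2] := KP _ _ _ adm.
 have P0 : 0 <= fine (power_part p X) by rewrite fine_ge0// power_part_ge0.
 rewrite /profile_value lerD// -mulNr; apply: (@le_trans _ _ (`|mu| * fine (power_part p X))).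
  by rewrite ler_wpM2r// -normrN ler_norm.
 by rewrite ler_wpM2l.
have Vsup : has_sup V by split => //; exists (profile_value mu p X0), X0, E0, B0.
have S1 : 1 < sup V.
 by apply: (lt_le_trans J0); apply: ub_le_sup => //; exists X0, E0, B0.
have ub X E B : admissible X E B -> profile_value mu p X <= sup V.
 by move=> adm; apply: ub_le_sup => //; exists X, E, B.
have near1 (e : R) : 0 < e -> exists X E B, admissible X E B /\ sup V - e < profile_value mu p X.
 by move=> e0; have [_ [X [E [B [adm ->]]]] h] := sup_adherent e0 Vsup; exists X, E, B.
have stage (n : nat) : exists XEB : (R -> R) * R * R,
  admissible XEB.1.1 XEB.1.2 XEB.2 /\ sup V - n.+1%:R^-1 < profile_value mu p XEB.1.1.
 have n0 : 0 < n.+1%:R^-1 :> R by rewrite invr_gt0.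
 by have [X [E [B [adm h]]]] := near1 _ n0; exists (X, E, B).
have [f fP] := choice stage.
have lim : profile_value mu p (f n).1.1 @[n --> \oo] --> sup V.
 apply: (@squeeze_cvgr _ _ _ _ (fun n => sup V - n.+1%:R^-1) (fun=> sup V)).
 - by apply: nearW => n; have [adm h] := fP n; rewrite (ltW h) (ub _ _ _ adm).
 - rewrite -[X in _ --> X]subr0; apply: cvgB; first exact: cvg_cst.
  exact: cvg_harmonic.
 - exact: cvg_cst.
have [X [E [B [adm h]]]] := profile_compactness p2 S1 (fun n => (fP n).1) lim.
have [u [uH u1 uJ]] := H1_of_profile p2 adm.
exists u; split => //; rewrite uJ (TM_sup_value p2 ub near1); congr (_ * _)%:E.
by apply/eqP; rewrite eq_le h (ub _ _ _ adm).
Qed.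

Lemma value_le1_TM_sup lam p : 2 < p ->
 (forall X E B, admissible X E B -> profile_value (lam / power_scale p) p X <= 1) ->
 TM_sup lam p = (4 * pi)%:E.
Proof.
move=> p2 ub; rewrite (TM_sup_value p2 ub) ?mulr1// => e e0; exact: value_near1.
Qed.

Lemma value_le1_not_attained lam mu p : 2 < p -> mu < lam / power_scale p ->
 (forall X E B, admissible X E B -> profile_value mu p X <= 1) -> ~ TM_attained lam p.
Proof.
move=> p2 lt_mu ub; set nu := lam / power_scale p in lt_mu.
have diff X : profile_value mu p X = profile_value nu p X + (nu - mu) * fine (power_part p X).
 by rewrite /profile_value; ring.
have P0 X : 0 <= fine (power_part p X) by rewrite fine_ge0// power_part_ge0.
have ub' X E B : admissible X E B -> profile_value nu p X <= 1.
 move=> adm; have := ub _ _ _ adm; rewrite diff; apply: le_trans.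
 by rewrite lerDl mulr_ge0// subr_ge0 ltW.
have pi4 : 0 < 4 * pi :> R by rewrite mulr_gt0// pi_gt0.
move=> [u [_ u1]]; rewrite (value_le1_TM_sup p2 ub').
have [X [E [B [adm ->]]]] := profile_of_H1 p2 u1.
rewrite -/nu => -[]; rewrite -[RHS]mulr1 => /(mulfI (lt0r_neq0 pi4)) J1.
have := ub _ _ _ adm; rewrite diff J1 gerDl pmulr_rle0 ?subr_gt0// => P1.
have X0 s : 0 < s -> X s = 0.
 move=> s0; have := le_trans (power_part_pointwise p2 adm s0) P1.
 rewrite pmulr_lle0// => h; have : X s `^ p == 0 by rewrite eq_le h powR_ge0.
 by rewrite powR_eq0 => /andP[/eqP].
move: J1; rewrite /profile_value.
have -> : exp_part X = 0%E.
 by apply: integral0_eq => s; rewrite /= in_itv/= andbT => s0; rewrite X0// expr0n expR0 subrr.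
have -> : power_part p X = 0%E.
 apply: integral0_eq => s; rewrite /= in_itv/= andbT => s0; rewrite X0// powR0//.
 by rewrite gt_eqF// (lt_trans _ p2).
by rewrite /= mulr0 subrr => /eqP; rewrite eq_sym oner_eq0.
Qed.

End threshold.

Theorem theorem1p1 (R : realType) :
 (forall p : R, 2 < p -> p <= 4 ->
   exists lambda_star : R,
    [/\ 0 < lambda_star,
      forall lambda : R, lambda < lambda_star -> TM_attained lambda p,
      forall lambda : R, lambda_star < lambda -> ~ TM_attained lambda p
     & forall lambda : R, lambda_star < lambda ->
       TM_sup lambda p = (4 * pi)%:E]) /\
 (forall p : R, 4 < p -> forall lambda : R, TM_attained lambda p).
Proof.
split => [p p2 p4|p p4 lam].
 (* The value does not increase with [mu], so the parameters with some value above 1 form a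
    half-line; its end is the threshold. *)
 pose T : set R := [set mu | exists X E B, admissible X E B /\ 1 < profile_value mu p X].
 have k0 := power_scale_gt0 p.
 have [mu0 [mu00 Tmu0]] : exists mu0 : R, 0 < mu0 /\ T mu0.
  have a0 : 0 < 4^-1 :> R by rewrite invr_gt0.
  have q0 : 0 < (4^-1 : R) `^ (p - 2) by rewrite powR_gt0.
  have m0 : 0 < (4^-1 ^+ 2 / 100) / (4^-1 : R) `^ (p - 2) by rewrite !divr_gt0// exprn_gt0.
  (* [value_gt1] with [a = 1 / 4], at the largest parameter that its hypothesis admits. *)
  exists ((4^-1 ^+ 2 / 100) / (4^-1 : R) `^ (p - 2)); split => //.
  by apply: (value_gt1 p2 a0) => //; rewrite ger0_norm ?(ltW m0)// mulfVK// gt_eqF.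
 have [L LP] := large_lambda p2 p4.
 have Tub : has_ubound T.
  exists L => mu [X [E [B [adm J]]]]; rewrite leNgt; apply/negP => /ltW Lmu.
  by have := LP _ _ _ _ Lmu adm; rewrite leNgt J.
 have Tsup : has_sup T by split => //; exists mu0.
 have T0 : 0 < sup T by apply: (lt_le_trans mu00); exact: ub_le_sup.
 have above mu : sup T < mu -> forall X E B, admissible X E B -> profile_value mu p X <= 1.
  move=> Tmu X E B adm; rewrite leNgt; apply/negP => J.
  by move: Tmu; rewrite ltNge => /negP; apply; apply: ub_le_sup => //; exists X, E, B.
 exists (sup T * power_scale p); split.
 - by rewrite mulr_gt0.
 - move=> lam; rewrite -ltr_pdivrMr// => lt_sup; apply: attained_of_value_gt1 => //.
  have e0 : 0 < sup T - lam / power_scale p by rewrite subr_gt0.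
  have [mu [X [E [B [adm J]]]]] := sup_adherent e0 Tsup; rewrite subKr => lt_mu.
  exists X, E, B; split => //; apply: (lt_le_trans J).
  rewrite /profile_value lerD2l lerN2 ler_wpM2r ?(ltW lt_mu)//.
  by rewrite fine_ge0// power_part_ge0.
 - move=> lam; rewrite -ltr_pdivlMr// => lt_lam.
  (* The midpoint is a parameter below the given one that is still strictly above [sup T], so all
     its values are at most 1. *)
  apply: (@value_le1_not_attained R lam ((sup T + lam / power_scale p) / 2)) => //.
   by move: lt_lam; move: (lam / _) (sup T) => x y; lra.
  by apply: above; move: lt_lam; move: (lam / _) (sup T) => x y; lra.
 - move=> lam; rewrite -ltr_pdivlMr// => lt_lam.
  by apply: value_le1_TM_sup => //; exact: above.
have p2 : 2 < p by apply: lt_trans p4; rewrite ltr_nat.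
apply: attained_of_value_gt1 => //.
have q0 : 0 < p - 4 by rewrite subr_gt0.
have e0 : 0 < 100^-1 :> R by rewrite invr_gt0.
have [a [a0 a4 _ h]] := small_power (normr_ge0 (lam / power_scale p)) q0 e0.
apply: (value_gt1 p2 a0 a4).
(* The factor [a ^+ 2] is split off, and the remaining [a ^ (p - 4)] is small for small [a] because
   [p > 4]. *)
have -> : p - 2 = (p - 4) + 2%:R by ring.
rewrite powRD; last by apply/implyP => _; rewrite gt_eqF.
rewrite powR_mulrn ?(ltW a0)// mulrA [leRHS]mulrC ler_wpM2r ?sqr_ge0//.
Qed.
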